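(* For any $m\in\mathbb{N}$, there exist $C^\infty$-diffeomorphisms $\varphi$ of the two-torus $\mathbb{T}^2$ with the following properties. (a) $\varphi$ is a skew product over some irrational rotation $R_\alpha:\mathbb{T}^1\to\mathbb{T}^1$, $x\mapsto x+\alpha\bmod 1$. (b) $\varphi$ is totally strictly ergodic and a measure-theoretic $m$ to $1$ extension of the irrational rotation $R_\alpha$, which is the maximal equicontinuous factor of the system. (c) The unique $\varphi$-invariant measure $\mu$ is the projection of the Lebesgue measure $\lambda$ on $\mathbb{T}^1$ onto some $m$-valued measurable graph, that is, it is of the form $\mu=\frac1m\sum_{j=1}^m(\mathrm{Id}_{\mathbb{T}^1}\times\gamma_j)_*\lambda$, where $\gamma_j:\mathbb{T}^1\to\mathbb{T}^1$ are measurable functions for $j=1,\ldots,m$ and $\gamma_i(x)\neq\gamma_j(x)$ $\lambda$-almost surely for all $i\neq j$. (d) The dynamical spectrum of $\varphi$ is given by the (discrete) dynamical spectrum of $R_\alpha$ and a singular continuous component.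
   Context: $\mathbb{T}^d=\mathbb{R}^d/\mathbb{Z}^d$, and $\lambda$ is the normalized Lebesgue measure on $\mathbb{T}^1$. $\mathrm{Id}_{\mathbb{T}^1}\times\gamma$ denotes the map $\mathbb{T}^1\to\mathbb{T}^2$, $x\mapsto(x,\gamma(x))$. A skew product over $R_\alpha$ is a map of the form $\varphi(x,y)=(x+\alpha,\varphi_x(y))$ on $\mathbb{T}^2$; the projection to the first coordinate $\pi(x,y)=x$ is then a factor map onto $(\mathbb{T}^1,R_\alpha)$. A topological dynamical system (tds) is a pair $(X,\varphi)$ with $X$ a compact metric space (metric $d_X$) and $\varphi$ a homeomorphism of $X$. It is minimal if every orbit $\{\varphi^n(x)\mid n\in\mathbb{Z}\}$ is dense, uniquely ergodic if there is exactly one $\varphi$-invariant Borel probability measure, strictly ergodic if it is both, and totally strictly ergodic if all iterates $\varphi^n$, $n\geq 1$, are strictly ergodic. It is equicontinuous if for all $\varepsilon>0$ there is $\delta>0$ such that $d_X(x,y)<\delta$ implies $d_X(\varphi^n(x),\varphi^n(y))<\varepsilon$ for all $n\in\mathbb{N}$. A factor of $(X,\varphi)$ is a triple $(Y,\psi,\pi)$ with $(Y,\psi)$ a tds and $\pi:X\to Y$ continuous and onto with $\pi\circ\varphi=\psi\circ\pi$; $\pi$ is called the factor map. $(Y,\psi,\pi)$ is a maximal equicontinuous factor (MEF) of $(X,\varphi)$ if $(Y,\psi)$ is equicontinuous and for every other factor $(Z,\rho,p)$ with $(Z,\rho)$ equicontinuous there is a unique factor map $q$ from $(Y,\psi)$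 to $(Z,\rho)$ with $p=q\circ\pi$. A uniquely ergodic tds $(X,\varphi)$ with invariant measure $\mu$ is a measure-theoretic $m$ to $1$ extension of its factor $(Y,\psi,\pi)$, with invariant measure $\nu$, if there are measurable sets $A\subseteq X$ and $B\subseteq Y$ with $\mu(A)=\nu(B)=1$ such that $\pi^{-1}(y)\cap A$ has exactly $m$ elements for every $y\in B$. Systems as in (b) and (c) are called $m$:$1$-topomorphic extensions (of the MEF). The dynamical spectrum of $\varphi$ is the spectrum of its Koopman operator, taken with respect to its unique invariant measure $\mu$; the Koopman operator is the unitary operator $U_\varphi:L^2_\mu(X)\to L^2_\mu(X)$, $f\mapsto f\circ\varphi$. For $g\in L^2_\mu(X)$, the spectral measure $\mu_g$ is the Borel measure on the spectrum $\sigma(U_\varphi)\subseteq\mathbb{S}^1$ (the unit circle in $\mathbb{C}$) with $\langle f(U_\varphi)g,g\rangle=\int f\,d\mu_g$ for all continuous $f:\sigma(U_\varphi)\to\mathbb{C}$. There is an orthogonal decomposition $L^2_\mu(X)=L^2_\mu(X)_{\mathrm{pp}}\oplus L^2_\mu(X)_{\mathrm{sc}}\oplus L^2_\mu(X)_{\mathrm{ac}}$ into the sets of those $g$ for which $\mu_g$ is pure point, singular continuous, respectively absolutely continuous (with respect to Lebesgue measure on the circle). The discrete (pure point), singular continuous and absolutely continuous components of the dynamical spectrum are the spectra of the restrictions of $U_\varphi$ to these subspaces.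
   Formalization: In (d), a nontrivial singular continuous component is asserted only for m > 1: for m = 1, (c) makes the system measure-theoretically isomorphic to the rotation, so its spectrum is purely discrete. *)

(* Defs.v *)
From HB Require Import structures.
From mathcomp Require Import all_boot all_order all_algebra.
From mathcomp Require Import all_classical all_reals all_analysis.
From mathcomp Require Import complex lra zify.
Set Implicit Arguments. Unset Strict Implicit. Unset Printing Implicit Defensive.
Import Order.TTheory GRing.Theory Num.Theory.
Import numFieldNormedType.Exports.
Local Open Scope classical_set_scope.
Local Open Scope ring_scope.
Local Open Scope quotient_scope.
Local Open Scope card_scope.

Notation borel X := (g_sigma_algebraType (@open X)).

#[short(type="pmetricType")]
HB.structure Definition PointedMetric (K : numDomainType) :=
  {M of Metric K M & Pointed M}.

Section prod_metric.
Context {R : realType} {M N : metricType R}.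

Let pdist (p q : M * N) : R := Num.max (mdist p.1 q.1) (mdist p.2 q.2).

Let pdist_ge0 p q : 0 <= pdist p q.
Proof. by rewrite le_max mdist_ge0. Qed.

Let pdist_positivity p q : pdist p q = 0 -> p = q.
Proof.
case: p q => [a b] [c d] pq0.
have [h1 h2] : mdist a c <= 0 /\ mdist b d <= 0.
  by apply/andP; rewrite -ge_max -[X in X <= _]/(pdist (a, b) (c, d)) pq0.
by congr pair; apply: mdist_positivity; apply/eqP;
  rewrite eq_le mdist_ge0 ?h1 ?h2.
Qed.

Let ball_pdist p (d : R) : ball p d = [set q | pdist p q < d].
Proof.
rewrite /pdist; apply/seteqP; split => q /=; rewrite gt_max.
  by move=> [/=]; rewrite !ballEmdist/= => -> ->.
by move=> /andP[? ?]; split; rewrite /= ballEmdist.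
Qed.

HB.instance Definition _ := PseudoMetric_isMetric.Build R (M * N)%type
  pdist_ge0 pdist_positivity ball_pdist.

End prod_metric.

HB.instance Definition _ (R : realType) (M N : pmetricType R) :=
  Pointed.on (M * N)%type.

Lemma continuous_nonexpansive (R : realType) (M N : metricType R) (f : M -> N) :
  (forall x y, mdist (f x) (f y) <= mdist x y) -> continuous f.
Proof.
move=> fle x; apply/cvg_ballP => e e0.
apply: filterS (nbhsx_ballx x _ e0) => y; rewrite !ballEmdist/=.
exact: le_lt_trans.
Qed.

(* R/Z, as a quotient of additive groups. *)
Definition torus1 (R : realType) : Type :=
  Quotient.quot (GRing.ZmodClosed.clone R (@Num.int_num_subdef R) _).

HB.instance Definition _ (R : realType) := Choice.on (torus1 R).
HB.instance Definition _ (R : realType) := GRing.Zmodule.on (torus1 R).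
HB.instance Definition _ (R : realType) := isPointed.Build (torus1 R) 0.

Section torus1.
Context {R : realType}.
Implicit Types (x y : R) (s t u : torus1 R).

Definition toT (x : R) : torus1 R :=
  \pi_(Quotient.quot (GRing.ZmodClosed.clone R (@Num.int_num_subdef R) _)) x.

Lemma toTD x y : toT (x + y) = toT x + toT y.
Proof. by rewrite /toT raddfD. Qed.

Lemma toTN x : toT (- x) = - toT x.
Proof. by rewrite /toT raddfN. Qed.

Lemma toTB x y : toT (x - y) = toT x - toT y.
Proof. by rewrite toTD toTN. Qed.

Lemma toT_eq x y : (toT x == toT y) = (x - y \is a Num.int).
Proof. by rewrite /toT -Quotient.idealrBE. Qed.

Lemma toT0 : toT 0 = 0.
Proof. by rewrite /toT raddf0. Qed.

Lemma toT_surj t : exists x, toT x = t.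
Proof. by exists (repr t); rewrite /toT reprK. Qed.

(* The quotient metric on R/Z : the distance to the nearest integer. *)
Definition torus1_norm t : R := inf [set `|x| | x in toT @^-1` [set t]].
Definition torus1_dist s t : R := torus1_norm (s - t).

Let norms_lb t : has_lbound [set `|x| | x in toT @^-1` [set t]].
Proof. by exists 0 => _ [x _ <-]. Qed.

Let norms_inf t : has_inf [set `|x| | x in toT @^-1` [set t]].
Proof.
by split => //; have [x xt] := toT_surj t; exists `|x|; exists x.
Qed.

Lemma torus1_norm_le x : torus1_norm (toT x) <= `|x|.
Proof. by apply: ge_inf => //; exists x. Qed.

Let torus1_norm_ge0 t : 0 <= torus1_norm t.
Proof. by apply: lb_le_inf; [case: (norms_inf t)|move=> _ [x _ <-]]. Qed.

Let torus1_norm_lt t (e : R) : torus1_norm t < e ->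
  exists2 x, toT x = t & `|x| < e.
Proof. by move=> /(inf_lt (norms_inf t).1)[_ [x xt <-] xe]; exists x. Qed.

Let torus1_norm0_eq t : torus1_norm t = 0 -> t = 0.
Proof.
move=> t0.
have [x xt xh] : exists2 x, toT x = t & `|x| < 2^-1.
  by apply: torus1_norm_lt; rewrite t0.
have [x0|x0] := eqVneq x 0; first by rewrite -xt x0 toT0.
have [y yt yx] : exists2 y, toT y = t & `|y| < `|x|.
  by apply: torus1_norm_lt; rewrite t0 normr_gt0.
have : x - y \is a Num.int by rewrite -toT_eq xt yt.
move=> /intrP[n xyn].
have : `|x - y| < 1.
  by rewrite (le_lt_trans (ler_normB _ _))// [1]splitr -[1]/1 div1r ltrD// (lt_trans yx).
rewrite xyn -intr_norm ltrz1 => n1.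
have n0 : n = 0 by lia.
by move: xyn yx; rewrite n0 => /eqP; rewrite subr_eq0 => /eqP ->; rewrite ltxx.
Qed.

Let torus1_distxx t : torus1_dist t t = 0.
Proof.
apply/eqP; rewrite eq_le torus1_norm_ge0 andbT.
by rewrite /torus1_dist subrr -toT0 (le_trans (torus1_norm_le 0)) ?normr0.
Qed.

Let torus1_dist_pos s t : torus1_dist s t = 0 -> s = t.
Proof. by move=> /torus1_norm0_eq/eqP; rewrite subr_eq0 => /eqP. Qed.

Let torus1_normN t : torus1_norm (- t) <= torus1_norm t.
Proof.
apply: lb_le_inf; first by case: (norms_inf t).
by move=> _ [x /= <- <-]; rewrite -toTN -normrN torus1_norm_le.
Qed.

Let torus1_dist_sym s t : torus1_dist s t = torus1_dist t s.
Proof.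
have le_dist a b : torus1_dist a b <= torus1_dist b a.
  by rewrite /torus1_dist -opprB torus1_normN.
by apply/eqP; rewrite eq_le !le_dist.
Qed.

Let torus1_dist_triangle t s u :
  torus1_dist s u <= torus1_dist s t + torus1_dist t u.
Proof.
apply/ler_addgt0Pl => e e0.
have [x xst xe] : exists2 x, toT x = s - t & `|x| < torus1_dist s t + e / 2.
  by apply: torus1_norm_lt; rewrite ltrDl divr_gt0.
have [y ytu ye] : exists2 y, toT y = t - u & `|y| < torus1_dist t u + e / 2.
  by apply: torus1_norm_lt; rewrite ltrDl divr_gt0.
have -> : torus1_dist s u = torus1_norm (toT (x + y)).
  by rewrite toTD xst ytu addrA subrK.
rewrite (le_trans (torus1_norm_le _))// (le_trans (ler_normD _ _))//.
by move: xe ye; lra.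
Qed.

HB.instance Definition _ := isMetric.Build R (torus1 R)
  torus1_distxx torus1_dist_pos torus1_dist_sym torus1_dist_triangle.

End torus1.

Section torus1_lebesgue.
Context {R : realType}.
Implicit Types (x y : R) (s t u : torus1 R).

Lemma mdist_torus1E s t : mdist s t = torus1_norm (s - t).
Proof. by []. Qed.

Lemma continuous_toT : continuous (toT : R -> torus1 R).
Proof.
move=> x; apply/cvg_ballP => e e0.
near=> y; rewrite ballEmdist/= mdist_torus1E -toTB.
rewrite (le_lt_trans (torus1_norm_le _))//.
Unshelve. all: by end_near. Qed.

Lemma compact_torus1 : compact [set: torus1 R].
Proof.
have -> : [set: torus1 R] = toT @` `[0, 1].
  apply/seteqP; split => // t _; have [x <-] := toT_surj t.
  exists (x - (Num.floor x)%:~R).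
    have := floor_itv x; rewrite intrD1 /= in_itv/= => /andP[]; lra.
  by apply/eqP; rewrite toT_eq addrAC subrr add0r rpredN intr_int.
apply: continuous_compact; last exact: segment_compact.
by apply: continuous_subspaceT; exact: continuous_toT.
Qed.

Lemma continuous_torus1_addr t : continuous (+%R^~ t : torus1 R -> torus1 R).
Proof.
apply: continuous_nonexpansive => s u.
by rewrite !mdist_torus1E opprD addrACA subrr addr0.
Qed.

(* The normalized Lebesgue measure on R/Z : push-forward of the Lebesgue
   measure on the fundamental domain [0, 1[. *)
Definition torus1_lebesgue (A : set (borel (torus1 R))) : \bar R :=
  lebesgue_measure ((`[0, 1[ : set R) `&` toT @^-1` A).

Let measurable_toT (A : set (borel (torus1 R))) : measurable A ->
  measurable (toT @^-1` A : set R).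
Proof.
have mtoT : measurable_fun [set: R] (toT : R -> borel (torus1 R)).
  apply: (measurability (@open (torus1 R) : set (set (borel (torus1 R))))) => //.
  move=> _ [B oB <-]; rewrite setTI.
  by apply: measurable_realfun.open_measurable; apply: open_comp => // x _; exact: continuous_toT.
by move=> mA; rewrite -[X in measurable X]setTI; exact: mtoT.
Qed.

Let torus1_lebesgue0 : torus1_lebesgue set0 = 0%E.
Proof. by rewrite /torus1_lebesgue preimage_set0 setI0 measure0. Qed.

Let torus1_lebesgue_ge0 A : (0 <= torus1_lebesgue A)%E.
Proof. exact: measure_ge0. Qed.

Let torus1_lebesgue_sigma : semi_sigma_additive torus1_lebesgue.
Proof.
move=> F mF tF mUF; rewrite /torus1_lebesgue preimage_bigcup setI_bigcupr.
apply: measure_semi_sigma_additive.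
- by move=> n; apply: measurableI => //; exact: measurable_toT.
- apply/trivIsetP => i j _ _ ij.
  have FF : F i `&` F j = set0 by move/trivIsetP : tF; exact.
  by rewrite setIACA -[X in _ `&` X]preimage_setI FF preimage_set0 setI0.
- rewrite -setI_bigcupr -preimage_bigcup; apply: measurableI => //.
  exact: measurable_toT.
Qed.

HB.instance Definition _ := isMeasure.Build _ _ _ torus1_lebesgue
  torus1_lebesgue0 torus1_lebesgue_ge0 torus1_lebesgue_sigma.

Let torus1_lebesgueT : torus1_lebesgue setT = 1%E.
Proof.
rewrite /torus1_lebesgue preimage_setT setIT lebesgue_measure_itv/= lte_fin.
by rewrite ltr01 sube0.
Qed.

HB.instance Definition _ := Measure_isProbability.Build _ _ _ torus1_lebesgue
  torus1_lebesgueT.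

End torus1_lebesgue.

Record tds (R : realType) (X : metricType R) := Tds {
  tds_map :> X -> X ;
  tds_inv : X -> X ;
  tds_compact : compact [set: X] ;
  tds_continuous : continuous tds_map ;
  tds_inv_continuous : continuous tds_inv ;
  tds_mapK : cancel tds_map tds_inv ;
  tds_invK : cancel tds_inv tds_map }.

Section iterates.
Context {R : realType} {X : metricType R}.
Implicit Types (phi : tds X).

Definition iterz phi (n : int) : X -> X :=
  match n with
  | Posz k => iter k phi
  | Negz k => iter k.+1 (tds_inv phi)
  end.

Let iter_cont (f : X -> X) n : continuous f -> continuous (iter n f).
Proof.
move=> cf; elim: n => [|n IH] x; first exact: cvg_id.
by rewrite /=; apply: (@continuous_comp _ _ _ (iter n f) f); [exact: IH|exact: cf].
Qed.

Let iter_can (f g : X -> X) n : cancel f g -> cancel (iter n f) (iter n g).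
Proof. by move=> fg; elim: n => // n IH x; rewrite iterSr /= fg IH. Qed.

Definition tds_iter phi (n : nat) : tds X :=
  Tds (tds_compact phi) (@iter_cont _ n (@tds_continuous _ _ phi))
    (@iter_cont _ n (@tds_inv_continuous _ _ phi))
    (@iter_can _ _ n (@tds_mapK _ _ phi)) (@iter_can _ _ n (@tds_invK _ _ phi)).

Definition minimal phi := forall x : X, dense (range (fun n : int => iterz phi n x)).

Definition equicontinuous phi := forall e : R, 0 < e ->
  exists2 d : R, 0 < d & forall x y : X, mdist x y < d ->
    forall n : nat, mdist (iter n phi x) (iter n phi y) < e.

End iterates.

Section ergodicity.
Context {R : realType} {X : pmetricType R}.
Implicit Types (phi : tds X) (mu nu : probability (borel X) R).

Definition invariant_measure phi mu := forall A : set (borel X),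
  measurable A -> mu (phi @^-1` A) = mu A.

Definition unique_invariant_measure phi mu := invariant_measure phi mu /\
  forall nu, invariant_measure phi nu ->
    forall A : set (borel X), measurable A -> nu A = mu A.

Definition uniquely_ergodic phi := exists mu, unique_invariant_measure phi mu.

Definition strictly_ergodic phi := minimal phi /\ uniquely_ergodic phi.

Definition totally_strictly_ergodic phi :=
  forall n : nat, (0 < n)%N -> strictly_ergodic (tds_iter phi n).

End ergodicity.

Definition is_factor (R : realType) (X Y : metricType R)
    (phi : tds X) (psi : tds Y) (p : X -> Y) :=
  [/\ continuous p, set_surj setT setT p & p \o phi = psi \o p].

Definition is_MEF (R : realType) (X Y : metricType R)
    (phi : tds X) (psi : tds Y) (p : X -> Y) :=
  [/\ is_factor phi psi p, equicontinuous psi &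
    forall (Z : metricType R) (rho : tds Z) (r : X -> Z),
      is_factor phi rho r -> equicontinuous rho ->
      exists! q : Y -> Z, is_factor psi rho q /\ r = q \o p].

Definition m_to_one_extension (R : realType) (X Y : pmetricType R)
    (phi : tds X) (psi : tds Y) (p : X -> Y) (m : nat) :=
  is_factor phi psi p /\
  exists (mu : probability (borel X) R) (nu : probability (borel Y) R),
    [/\ unique_invariant_measure phi mu, unique_invariant_measure psi nu &
    exists (A : set (borel X)) (B : set (borel Y)),
      [/\ measurable A, measurable B, mu A = 1%E, nu B = 1%E &
      forall y, B y -> p @^-1` [set y] `&` A #= `I_m]].

(* Elements of L^2 are represented by functions rather than by classes:
   identities between them are stated almost everywhere (eqL2). *)

Section spectrum.
Context {R : realType} {X : pmetricType R}.
Variables (phi : tds X) (mu : probability (borel X) R).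
Local Notation C := (R[i]).
Implicit Types (f g h : X -> C) (V : set (X -> C)) (z : C).

Definition csqnorm z : R := complex.Re z ^+ 2 + complex.Im z ^+ 2.

Definition cintegral d (T : measurableType d)
    (nu : {measure set T -> \bar R}) (D : set T) (f : T -> C) : C :=
  Complex (\int[nu]_(x in D) complex.Re (f x))
          (\int[nu]_(x in D) complex.Im (f x)).

Definition L2 : set (X -> C) := [set f |
  [/\ measurable_fun setT (fun x : borel X => complex.Re (f x)),
      measurable_fun setT (fun x : borel X => complex.Im (f x)) &
      (\int[mu]_x (csqnorm (f x))%:E < +oo)%E]].

Definition L2norm f : R := Num.sqrt (\int[mu]_x csqnorm (f x)).

Definition L2inner f g : C := cintegral mu setT (fun x => f x * (g x)^*%C).

Definition eqL2 f g := {ae mu, forall x, f x = g x}.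

Definition koopman g : X -> C := g \o phi.

Definition bounded_linear_on V (S : (X -> C) -> (X -> C)) :=
  [/\ forall f, V f -> V (S f),
      forall (a : C) f g, V f -> V g ->
        eqL2 (S (fun x => a * f x + g x)) (fun x => a * S f x + S g x) &
      exists c : R, forall f, V f -> L2norm (S f) <= c * L2norm f].

(* The spectrum of the restriction to V of an operator U that leaves V
   invariant: z is in the resolvent set iff U - z has a bounded inverse on V. *)
Definition spectrum_on V (U : (X -> C) -> (X -> C)) : set C := [set z |
  ~ exists S, bounded_linear_on V S /\ forall f, V f ->
      eqL2 (S (fun x => U f x - z * f x)) f /\
      eqL2 (fun x => U (S f) x - z * S f x) f].

Definition dynamical_spectrum : set C := spectrum_on L2 koopman.

Definition dynamical_eigenvalues : set C := [set z | exists f,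
  [/\ L2 f, ~ eqL2 f (fun=> 0) & eqL2 (koopman f) (fun x => z * f x)]].

(* The Laurent polynomial z^-N p(z), evaluated at z and at the Koopman
   operator. *)
Definition laurent (N : nat) (p : {poly C}) z : C := p.[z] / z ^+ N.

Definition laurent_koopman (N : nat) (p : {poly C}) g : X -> C := fun x =>
  \sum_(k < size p) p`_k * g (iterz phi (k%:Z - N%:Z) x).

(* Continuous functional calculus of the unitary Koopman operator U: T = f(U)
   iff T is the limit in operator norm of Laurent polynomials in U that
   approximate f uniformly on the spectrum. *)
Definition is_functional_calculus (f : C -> C) (T : (X -> C) -> (X -> C)) :=
  (forall g, L2 g -> L2 (T g)) /\
  forall e : R, 0 < e -> exists N p,
    (forall z, dynamical_spectrum z -> `|f z - laurent N p z| <= e%:C%C) /\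
    forall g, L2 g ->
      L2norm (fun x => T g x - laurent_koopman N p g x) <= e * L2norm g.

Definition is_spectral_measure g
    (nu : {finite_measure set (borel (C^o)) -> \bar R}) :=
  nu.-negligible (~` dynamical_spectrum) /\
  forall f : C^o -> C^o, {within (dynamical_spectrum : set C^o), continuous f} ->
    exists T, is_functional_calculus f T /\
      L2inner (T g) g = cintegral nu dynamical_spectrum f.

(* Lebesgue measure on the unit circle, as the push-forward of the Lebesgue
   measure on [0, 1[ under t |-> exp(2 i pi t). *)
Definition circle_lebesgue (A : set C) : \bar R :=
  lebesgue_measure ((`[0, 1[ : set R) `&`
    [set t | A (Complex (cos (2 * pi * t)) (sin (2 * pi * t)))]).

(* nu ranges over measures carried by the unit circle; the zero measure has all
   three types, so that 0 belongs to the three subspaces below. *)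
Definition pure_point (nu : {finite_measure set (borel (C^o)) -> \bar R}) :=
  exists2 D : set C, countable D & nu.-negligible (~` D).

Definition singular_continuous
    (nu : {finite_measure set (borel (C^o)) -> \bar R}) :=
  (forall z, nu [set z] = 0%E) /\
  exists A : set (borel (C^o)),
    [/\ measurable A, circle_lebesgue A = 0%E & nu.-negligible (~` A)].

Definition absolutely_continuous
    (nu : {finite_measure set (borel (C^o)) -> \bar R}) :=
  forall A : set (borel (C^o)), measurable A ->
    circle_lebesgue A = 0%E -> nu A = 0%E.

Definition L2pp : set (X -> C) :=
  [set g | L2 g /\ exists nu, is_spectral_measure g nu /\ pure_point nu].
Definition L2sc : set (X -> C) :=
  [set g | L2 g /\ exists nu, is_spectral_measure g nu /\ singular_continuous nu].
Definition L2ac : set (X -> C) :=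
  [set g | L2 g /\ exists nu, is_spectral_measure g nu /\ absolutely_continuous nu].

Definition spectrum_pp : set C := spectrum_on L2pp koopman.
Definition spectrum_sc : set C := spectrum_on L2sc koopman.
Definition spectrum_ac : set C := spectrum_on L2ac koopman.

End spectrum.

Notation torus2 R := (torus1 R * torus1 R)%type.

Section rotation.
Context {R : realType}.
Variable alpha : torus1 R.

Let addrBK_ : cancel (+%R^~ alpha) (+%R^~ (- alpha)).
Proof. by move=> x; rewrite addrK. Qed.

Let subrDK_ : cancel (+%R^~ (- alpha)) (+%R^~ alpha).
Proof. by move=> x; rewrite subrK. Qed.

Definition rotation : tds (torus1 R) :=
  Tds (@compact_torus1 R) (@continuous_torus1_addr R alpha)
    (@continuous_torus1_addr R (- alpha)) addrBK_ subrDK_.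

End rotation.

Fixpoint Ck (R : realType) (k : nat) (f : R * R -> R) : Prop :=
  match k with
  | 0 => continuous f
  | k'.+1 => (forall x v : R * R, derivable f x v) /\
             forall v : R * R, Ck k' (fun x => 'D_v f x)
  end.

Definition Cinfty (R : realType) (f : R * R -> R) := forall k, Ck k f.

(* A map of the two-torus is smooth iff it has a smooth lift to R^2 (a
   continuous map of the torus always lifts, R^2 being simply connected). *)
Definition smooth_torus_map (R : realType) (f : torus2 R -> torus2 R) :=
  exists F1 F2 : R * R -> R, [/\ Cinfty F1, Cinfty F2 &
    forall x : R * R, f (toT x.1, toT x.2) = (toT (F1 x), toT (F2 x))].

Definition smooth_diffeo (R : realType) (phi : tds (torus2 R)) :=
  smooth_torus_map phi /\ smooth_torus_map (tds_inv phi).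

Definition is_skew_product (R : realType) (phi : tds (torus2 R))
    (alpha : torus1 R) :=
  exists fib : torus1 R -> torus1 R -> torus1 R,
    forall x y, phi (x, y) = (x + alpha, fib x y).

(* Main.v *)
(* The diffeomorphism is a limit of conjugates (Anosov-Katok) of rational rotations of the first
   coordinate. All conjugacies are lifts of projective actions of matrices with unit determinant,
   so that the limit cocycle is smooth. The n-th conjugacy stretches the fibres near m equidistant
   points, which makes m graphs attract almost all of a circle that is transported along the
   orbits: their limit is the multigraph carrying the invariant measure. The times q_n are
   rigidity times, which excludes absolutely continuous spectrum. Along the times t_n about half
   of the fibres is moved by - 1 / m and the rest is fixed, so that the Koopman operators converge
   weakly to (1 + U_tau) / 2, with tau the translation of the fibres by - 1 / m. Hence
   eigenfunctions are tau-invariant and come from the base, while a function f with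
   f o tau = b f, b <> 1, has a spectral measure without atoms. *)
Require Import Defs.
From HB Require Import structures.
From mathcomp Require Import all_boot all_order all_algebra.
From mathcomp Require Import all_classical all_reals all_analysis.
From mathcomp Require Import complex ring lra zify measurable_realfun.
Set Implicit Arguments.
Unset Strict Implicit.
Unset Printing Implicit Defensive.
Import Order.TTheory GRing.Theory Num.Theory.
Import numFieldNormedType.Exports.
Local Open Scope classical_set_scope.
Local Open Scope ring_scope.

Local Notation re := complex.Re.
Local Notation im := complex.Im.

(** The obstacle is that the conjugacies [kap n] have exploding derivatives while the cocycle has to
    converge together with all of its derivatives. Matrices settle this: one step multiplies the
    cocycle matrix by [Cm n], a conjugate of a rotation by an angle proportional to [eps n]. Its
    distance to the identity is [eps n] times a fixed power of [Gn n], and each derivative costs one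
    more factor [Gn n]. As [eps n] is about [1 / ell n] and [ell n] is a power of [Gn n] with an
    exponent that grows with [n], all derivatives of order at most [n] are under control at step
    [n]. The base angle is the final [alpha] at every stage, so nothing has to converge in the base.
    The shear [y - q n * x] inside [kap n.+1] trades a displacement in the fibre for a base
    displacement below [1 / q n]; hence all transported circles look alike, and this yields strict
    ergodicity of every power at once. The spectral notions refer to a functional calculus on the
    spectrum. Since the eigenvalues of the base rotation are dense in the circle, this spectrum is
    the whole circle, and functional calculus, Riesz representation and spectral measures are
    developed only there. *)

Lemma lipschitz_derive (R : realType) (f df : R -> R) (K : R) :
  (forall x : R, is_derive x 1 f (df x)) -> (forall x, `|df x| <= K) ->
  forall x y, `|f x - f y| <= K * `|x - y|.
Proof.
move=> fdf dfK.
have main x y : x <= y -> `|f y - f x| <= K * `|y - x|.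
  move=> xy.
  have [|z _ ->] := @MVT_segment R f df x y xy (fun z _ => fdf z).
    apply: continuous_subspaceT => z.
    by apply: differentiable_continuous; apply/derivable1_diffP; have [] := fdf z.
  by rewrite normrM ler_wpM2r.
move=> x y; have [|/ltW] := leP x y; last exact: main.
by rewrite distrC (distrC x); exact: main.
Qed.

(** The double angle formula provides two factors [cos (pi / 4)]: one bounds [cos (x / 2)] from
    below, the other the slope of [sin] on [[0, x / 2]], and twice the square of [cos (pi / 4)] is
    1. *)
Lemma sin_ge_half (R : realType) (x : R) : 0 <= x <= pi / 2 -> x / 2 <= sin x.
Proof.
move=> /andP[x0 xpi].
have [->|xn0] := eqVneq x 0; first by rewrite mul0r sin0.
have {}x0 : 0 < x by rewrite lt_def xn0.
have pi4 : pi / 4%:R < pi / 2 :> R by have := @pi_gt0 R; lra.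
have c4 : 0 < cos (pi / 4%:R) :> R.
  by apply: cos_gt0_pihalf; have := @pi_gt0 R; lra.
have c42 : cos (pi / 4%:R) ^+ 2 *+ 2 = 1 :> R.
  have := cos_mulr2n (pi / 4%:R : R).
  have -> : (pi / 4%:R) *+ 2 = pi / 2 :> R by rewrite -mulr_natl; field.
  rewrite cos_pihalf; lra.
have cle (u : R) : 0 <= u <= pi / 4%:R -> cos (pi / 4%:R) <= cos u.
  move=> /andP[u0 u4]; have [<-//|ne] := eqVneq u (pi / 4%:R).
  apply/ltW; rewrite ltr_cos ?lt_def 1?eq_sym ?ne // in_itv /=; have := @pi_gt0 R; lra.
have h : sin (x / 2) >= x / 2 * cos (pi / 4%:R).
  have [||z] := @MVT R sin cos 0 (x / 2); first by rewrite divr_gt0.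
    by apply: continuous_subspaceT; exact: continuous_sin.
  rewrite in_itv /= => /andP[z0 zx]; rewrite sin0 !subr0 => ->.
  by rewrite mulrC ler_wpM2r ?divr_ge0 ?(ltW x0)// cle//; lra.
have hc : cos (pi / 4%:R) <= cos (x / 2) by apply: cle; lra.
have -> : x = x / 2 *+ 2 by rewrite -mulr_natl; field.
rewrite sin_mulr2n.
have -> : x / 2 *+ 2 / 2 = (x / 2 * cos (pi / 4%:R)) * cos (pi / 4%:R) *+ 2.
  have -> : x / 2 * cos (pi / 4) * cos (pi / 4) *+ 2 = x/2 * (cos (pi / 4) ^+ 2 *+ 2) by ring.
  by rewrite c42; field.
rewrite lerMn2r/= [leRHS]mulrC ler_pM//.
- by apply: mulr_ge0; lra.
- exact: ltW.
Qed.

(** * Lifts of projective maps to the m-fold cover of the projective line *)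

Section lifts.
Context (R : realType) (m : nat) (m0 : (0 < m)%N).
Implicit Types (x y t : R) (f g : R -> R).

Record mat2 := Mat2 { m11 : R; m12 : R; m21 : R; m22 : R }.

Definition mul2 (A B : mat2) := Mat2
  (m11 A * m11 B + m12 A * m21 B) (m11 A * m12 B + m12 A * m22 B)
  (m21 A * m11 B + m22 A * m21 B) (m21 A * m12 B + m22 A * m22 B).
Definition one2 := Mat2 1 0 0 1.
Definition adj2 (A : mat2) := Mat2 (m22 A) (- m12 A) (- m21 A) (m11 A).
Definition det2 (A : mat2) := m11 A * m22 A - m12 A * m21 A.
Definition diag2 (S : R) := Mat2 S 0 0 S^-1.
Definition rot2 (t : R) := Mat2 (cos t) (- sin t) (sin t) (cos t).

Lemma det2M A B : det2 (mul2 A B) = det2 A * det2 B.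
Proof. by rewrite /det2 /=; ring. Qed.
Lemma adj2_mul A : det2 A = 1 -> mul2 (adj2 A) A = one2.
Proof.
case: A => a b c d; rewrite /det2 /= => h; rewrite /mul2 /=.
by congr Mat2; rewrite -?h; ring.
Qed.
Lemma det_adj2 A : det2 (adj2 A) = det2 A.
Proof. by rewrite /det2 /=; ring. Qed.
Lemma det_diag2 S : S != 0 -> det2 (diag2 S) = 1.
Proof. by move=> S0; rewrite /det2 /= mulr0 subr0 divff. Qed.
Lemma det_rot2 t : det2 (rot2 t) = 1.
Proof. by rewrite /det2/= -(cos2Dsin2 t); ring. Qed.

(** A fibre coordinate [y] stands for the direction of angle [pi m y]. Thus [y] and [y + 1 / m] span
    the same line, and the circle of all [y] covers the projective line [m] times. *)
Definition wfreq : R := pi * m%:R.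

Lemma mR_ge1 : 1 <= m%:R :> R. Proof. by rewrite ler1n. Qed.
Lemma mR_gt0 : 0 < m%:R :> R. Proof. by rewrite ltr0n. Qed.

Lemma wfreq_ge2 : 2 <= wfreq.
Proof.
by rewrite -[2]mulr1 ler_pM// ?pi_ge2 ?ler1n.
Qed.

Lemma wfreq_gt0 : 0 < wfreq. Proof. exact: lt_le_trans wfreq_ge2. Qed.
Lemma wfreq_neq0 : wfreq != 0. Proof. by rewrite gt_eqF ?wfreq_gt0. Qed.

(** With [v = (cos t, sin t)], this is the scalar product of [v] and [A v], and [cross2 A t] is
    their determinant. The quotient is the tangent of the angle from [v] to [A v]. *)
Definition dot2 (A : mat2) (t : R) :=
  m11 A * cos t ^+ 2 + (m12 A + m21 A) * (cos t * sin t) + m22 A * sin t ^+ 2.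
Definition cross2 (A : mat2) (t : R) :=
  m21 A * cos t ^+ 2 + (m22 A - m11 A) * (cos t * sin t) - m12 A * sin t ^+ 2.

Definition pos2 A := forall t, 0 < dot2 A t.

(* The lift of the (m-fold covered) projective action of A which moves each
   line by less than a right angle; meaningful when pos2 A. *)
Definition plift (A : mat2) (y : R) : R :=
  y + atan (cross2 A (wfreq * y) / dot2 A (wfreq * y)) / wfreq.

(** Because [r] is positive, [g] follows directions and not only lines; the ambiguity of a lift is
    therefore a multiple of [2 / m] rather than of [1 / m]. *)
Definition lifts (A : mat2) (g : R -> R) := forall y, exists2 r : R, 0 < r &
  m11 A * cos (wfreq * y) + m12 A * sin (wfreq * y) = r * cos (wfreq * g y) /\
  m21 A * cos (wfreq * y) + m22 A * sin (wfreq * y) = r * sin (wfreq * g y).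

Lemma lifts_comp A B f g : lifts A f -> lifts B g -> lifts (mul2 A B) (f \o g).
Proof.
move=> Af Bg y; have [r r0 [r1 r2]] := Bg y; have [s s0 [s1 s2]] := Af (g y).
exists (r * s); first exact: mulr_gt0.
split => /=; rewrite -mulrA.
  rewrite -s1; transitivity (m11 A * (r * cos (wfreq * g y)) + m12 A * (r * sin (wfreq * g y))).
    by rewrite -r1 -r2; ring.
  by ring.
rewrite -s2; transitivity (m21 A * (r * cos (wfreq * g y)) + m22 A * (r * sin (wfreq * g y))).
  by rewrite -r1 -r2; ring.
by ring.
Qed.
Lemma lifts1 : lifts one2 id.
Proof. by move=> y; exists 1 => //=; split; ring. Qed.

Lemma lifts_rot t : lifts (rot2 (wfreq * t)) (fun y => y + t).
Proof.
by move=> y; exists 1 => //=; rewrite !mul1r mulrDr cosD sinD; split; ring.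
Qed.

Lemma cos1_small (u : R) : cos u = 1 -> `|u| < 2 * pi -> u = 0.
Proof.
move=> cu up.
have : sin (u / 2) = 0.
  have := cos_mulr2n (u / 2).
  have -> : (u / 2) *+ 2 = u by rewrite -mulr_natl; field.
  rewrite cu cos2sin2 => h.
  by apply/eqP; rewrite -sqrf_eq0; apply/eqP; lra.
have [u0|u0|//] := ltrgtP u 0; last first.
  have: 0 < sin (u / 2) by apply: sin_gt0_pi; move: up; rewrite gtr0_norm//; lra.
  by lra.
have: 0 < sin (- u / 2) by apply: sin_gt0_pi; move: up; rewrite ltr0_norm//; lra.
by rewrite mulNr sinN; lra.
Qed.

(** Both lifts describe the same vector, so the lengths [r] agree and the angles agree modulo
    [2 pi], which is [2 / m] in the fibre coordinate. *)
Lemma lifts_unique A g g' y : lifts A g -> lifts A g' ->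
  `|g y - g' y| < 2 / m%:R -> g y = g' y.
Proof.
move=> Ag Ag' gg'; have [r r0 [r1 r2]] := Ag y; have [s s0 [s1 s2]] := Ag' y.
have c1 := cos2Dsin2 (wfreq * g y); have c2 := cos2Dsin2 (wfreq * g' y).
have rs : r = s.
  have : r ^+ 2 = s ^+ 2.
    rewrite -[LHS]mulr1 -[RHS]mulr1 -{1}c1 -c2 !mulrDr -!exprMn.
    by rewrite -r1 -r2 -s1 -s2.
  by move=> /eqP; rewrite eqrXn2 ?ltW// => /eqP.
have rn0 : r != 0 by rewrite gt_eqF.
have ec : cos (wfreq * g y) = cos (wfreq * g' y).
  by apply: (mulfI rn0); rewrite -r1 rs.
have es : sin (wfreq * g y) = sin (wfreq * g' y).
  by apply: (mulfI rn0); rewrite -r2 rs.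
have : wfreq * g y - wfreq * g' y = 0.
  apply: cos1_small; first by rewrite cosB ec es -!expr2.
  rewrite -mulrBr normrM gtr0_norm ?wfreq_gt0//.
  apply: (@lt_le_trans _ _ (wfreq * (2 / m%:R))); first by rewrite ltr_pM2l// wfreq_gt0.
  rewrite /wfreq.
  have -> : pi * m%:R * (2 / m%:R) = 2 * pi :> R by field; rewrite gt_eqF// mR_gt0.
  by [].
rewrite -mulrBr => /eqP; rewrite mulf_eq0 (negbTE wfreq_neq0) /= subr_eq0.
by move=> /eqP.
Qed.

(** In the frame formed by [v] and its quarter turn, the vector [A v] has the coordinates [dot2] and
    [cross2]; this is the content of [key1] and [key2]. *)
Lemma lifts_plift A : pos2 A -> lifts A (plift A).
Proof.
move=> pA y; rewrite /plift; set t := wfreq * y.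
have D0 := pA t; set D := dot2 A t in D0 *; set N := cross2 A t.
set th := atan (N / D).
have cth : 0 < cos th by apply: cos_gt0_pihalf; rewrite atan_gtNpi2 atan_ltpi2.
have sth : sin th * D = N * cos th.
  have : sin th / cos th = N / D by rewrite -/(tan th) atanK.
  move=> /(congr1 (fun u => u * (cos th * D))).
  have -> : sin th / cos th * (cos th * D) = sin th * D by field; rewrite gt_eqF.
  by move=> ->; field; rewrite gt_eqF.
have -> : wfreq * (y + th / wfreq) = t + th.
  by rewrite /t; field; exact: wfreq_neq0.
exists (D / cos th); first exact: divr_gt0.
have cn0 : cos th != 0 by rewrite gt_eqF.
have csn := cos2Dsin2 t.
have key1 : m11 A * cos t + m12 A * sin t = D * cos t - N * sin t.
  rewrite /D /N /dot2 /cross2 -[LHS]mulr1 -csn; ring.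
have key2 : m21 A * cos t + m22 A * sin t = D * sin t + N * cos t.
  rewrite /D /N /dot2 /cross2 -[LHS]mulr1 -csn; ring.
have Dn0 : D != 0 by rewrite gt_eqF.
have sE : sin th = N / D * cos th by apply: (mulIf Dn0); rewrite sth; field.
rewrite key1 key2 cosD sinD sE; split; field; by rewrite cn0 Dn0.
Qed.

Lemma plift_dist A y : `|plift A y - y| < 1 / (2 * m%:R).
Proof.
rewrite /plift addrAC subrr add0r normrM normfV (gtr0_norm wfreq_gt0).
rewrite ltr_pdivrMr ?wfreq_gt0//.
have -> : 1 / (2 * m%:R) * wfreq = pi / 2.
  by rewrite /wfreq; field; rewrite gt_eqF// mR_gt0.
by rewrite ltr_norml atan_gtNpi2 atan_ltpi2.
Qed.

(** A displacement below [1 / m] for [g] and one below [1 / (2 m)] for [plift] add up to less than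
    the ambiguity [2 / m]. *)
Lemma lifts_eq_plift A g y : pos2 A -> lifts A g -> `|g y - y| < 1 / m%:R ->
  g y = plift A y.
Proof.
move=> pA Ag gy; apply: (@lifts_unique A) => //; first exact: lifts_plift.
have := plift_dist A y.
have m1 : 1 / m%:R > 0 :> R by rewrite divr_gt0// mR_gt0.
have -> : 1 / (2 * m%:R) = (1 / m%:R) / 2 :> R by field; rewrite gt_eqF// mR_gt0.
have -> : 2 / m%:R = (1 / m%:R) * 2 :> R by field; rewrite gt_eqF// mR_gt0.
have -> : g y - plift A y = (g y - y) - (plift A y - y) by ring.
have := ler_normB (g y - y) (plift A y - y); lra.
Qed.

End lifts.

Lemma periodic_int (R : realType) (g : R -> R) (c : R) :
  (forall y, g (y + c) = g y + c) ->
  forall (y : R) (z : int), g (y + z%:~R * c) = g y + z%:~R * c.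
Proof.
move=> gc y.
have nat_case (n : nat) (u : R) : g (u + n%:R * c) = g u + n%:R * c.
  elim: n => [|n IH]; first by rewrite mul0r !addr0.
  by rewrite -natr1 mulrDl mul1r !addrA gc IH.
case=> n; first exact: nat_case.
rewrite NegzE intrN mulNr; apply/eqP; rewrite eq_sym subr_eq -nat_case.
by rewrite subrK.
Qed.

(** * Derivatives of projective lifts, and the fibre contraction *)

Section plift.
Context (R : realType) (m : nat) (m0 : (0 < m)%N).
Implicit Types (x y t u S K : R) (A : mat2 R).
Local Notation w := (wfreq R m).
Local Notation pl := (@plift R m).

Lemma dot2_pi (A : mat2 R) t : dot2 A (t + pi) = dot2 A t.
Proof. by rewrite /dot2 cosDpi sinDpi; ring. Qed.
Lemma cross2_pi (A : mat2 R) t : cross2 A (t + pi) = cross2 A t.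
Proof. by rewrite /cross2 cosDpi sinDpi; ring. Qed.

Lemma plift_shift1 A y : pl A (y + m%:R^-1) = pl A y + m%:R^-1.
Proof.
rewrite /plift.
have -> : w * (y + m%:R^-1) = w * y + pi.
  by rewrite mulrDr {2}/wfreq mulfK// gt_eqF// mR_gt0.
by rewrite dot2_pi cross2_pi addrAC.
Qed.
Lemma plift_shift A y (z : int) :
  pl A (y + z%:~R / m%:R) = pl A y + z%:~R / m%:R.
Proof. exact: (periodic_int (plift_shift1 A)). Qed.

Lemma sqr_dot2_cross2 (A : mat2 R) t : dot2 A t ^+ 2 + cross2 A t ^+ 2 =
  (m11 A * cos t + m12 A * sin t) ^+ 2 + (m21 A * cos t + m22 A * sin t) ^+ 2.
Proof.
transitivity ((cos t ^+ 2 + sin t ^+ 2) * ((m11 A * cos t + m12 A * sin t) ^+ 2 +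
  (m21 A * cos t + m22 A * sin t) ^+ 2)).
  by rewrite /dot2 /cross2; ring.
by rewrite cos2Dsin2 mul1r.
Qed.

(** The direction of [A v] turns at the speed [det A / |A v|^2], where [|A v|^2] is the sum of
    squares in the denominator; the term [- 1] is the speed of [v] itself. *)
Lemma is_derive_atan_ratio (A : mat2 R) t : 0 < dot2 A t ->
  is_derive t 1 (fun t => atan (cross2 A t / dot2 A t))
    (det2 A / (dot2 A t ^+ 2 + cross2 A t ^+ 2) - 1).
Proof.
move=> d0; have dn0 : dot2 A t != 0 by rewrite gt_eqF.
have dD : is_derive t 1 (dot2 A) (- 2 * m11 A * (cos t * sin t) +
    (m12 A + m21 A) * (cos t ^+ 2 - sin t ^+ 2) + 2 * m22 A * (cos t * sin t)).
  by apply: is_derive_eq; rewrite /GRing.scale /=; ring.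
have dN : is_derive t 1 (cross2 A) (- 2 * m21 A * (cos t * sin t) +
    (m22 A - m11 A) * (cos t ^+ 2 - sin t ^+ 2) - 2 * m12 A * (cos t * sin t)).
  by apply: is_derive_eq; rewrite /GRing.scale /=; ring.
have dV := is_deriveV dn0 dD.
have dR := is_deriveM dN dV.
apply: (is_derive_eq (is_derive1_comp (is_derive1_atan _) dR)).
have csn := cos2Dsin2 t.
have hN : 0 < dot2 A t ^+ 2 + cross2 A t ^+ 2.
  by rewrite ltr_pwDl ?exprn_gt0// sqr_ge0.
have key : dot2 A t ^+ 2 + cross2 A t ^+ 2 +  ((- 2 * m21 A * (cos t * sin t) +
    (m22 A - m11 A) * (cos t ^+ 2 - sin t ^+ 2) - 2 * m12 A * (cos t * sin t)) * dot2 A t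
   - cross2 A t * (- 2 * m11 A * (cos t * sin t) +
    (m12 A + m21 A) * (cos t ^+ 2 - sin t ^+ 2) + 2 * m22 A * (cos t * sin t))) = det2 A.
  transitivity ((cos t ^+ 2 + sin t ^+ 2) ^+ 2 * det2 A).
    by rewrite /dot2 /cross2 /det2; ring.
  by rewrite csn expr1n mul1r.
rewrite -key /GRing.scale /=.
set D := dot2 A t in dn0 hN *; set N := cross2 A t in hN *.
have h2 : 1 + (N * D^-1) ^+ 2 = (D ^+ 2 + N ^+ 2) / D ^+ 2 by field.
rewrite h2; field; rewrite dn0 /=.
by rewrite gt_eqF.
Qed.

Lemma is_derive_plift A y : 0 < dot2 A (w * y) ->
  is_derive y 1 (pl A) (det2 A / (dot2 A (w * y) ^+ 2 + cross2 A (w * y) ^+ 2)).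
Proof.
move=> d0.
have dlin : is_derive y 1 (fun y : R => w * y) w.
  by apply: is_derive_eq; rewrite /GRing.scale /= mulr1 ?mul0r ?addr0.
have d1 := is_derive1_comp (is_derive_atan_ratio d0) dlin.
have d2 := is_deriveZ (w^-1) d1.
have d3 := is_deriveD (is_derive_id y 1) d2.
rewrite (_ : pl A = id + w^-1 *: ((fun t => atan (cross2 A t / dot2 A t)) \o *%R w)).
  apply: (is_derive_eq d3); rewrite /GRing.scale /=; field.
  by rewrite wfreq_neq0//= gt_eqF// ltr_pwDl ?exprn_gt0// sqr_ge0.
by apply/funext => u; rewrite /plift mulrC.
Qed.

Lemma plift_lip A K : pos2 A -> det2 A = 1 -> 0 <= K ->
  (forall t, 1 <= K * (dot2 A t ^+ 2 + cross2 A t ^+ 2)) ->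
  forall x y, `|pl A x - pl A y| <= K * `|x - y|.
Proof.
move=> pA dA K0 AK; apply: (@lipschitz_derive _ _ (fun x =>
  det2 A / (dot2 A (w * x) ^+ 2 + cross2 A (w * x) ^+ 2))) => x; first exact: is_derive_plift.
have h : 0 < dot2 A (w * x) ^+ 2 + cross2 A (w * x) ^+ 2.
  by rewrite ltr_pwDl ?exprn_gt0// sqr_ge0.
by rewrite dA ger0_norm ?divr_ge0 ?(ltW h)// ler_pdivrMr.
Qed.

Lemma pos2_diag S : 0 < S -> pos2 (diag2 S).
Proof.
move=> S0 t; rewrite /dot2 /= addr0 mul0r addr0.
have csn := cos2Dsin2 t.
have [c0|c0] := eqVneq (cos t) 0.
  rewrite c0 expr0n mulr0 add0r mulr_gt0 ?invr_gt0//.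
  by move: csn; rewrite c0 expr0n /= add0r => ->.
have h1 : 0 < S * cos t ^+ 2 by rewrite mulr_gt0// exprn_even_gt0.
have h2 : 0 <= S^-1 * sin t ^+ 2 by rewrite mulr_ge0 ?sqr_ge0// invr_ge0 ltW.
exact: ltr_pwDl.
Qed.

(** For [S > 1] the diagonal matrix pulls directions towards the horizontal axis: the multiples of
    [1 / m] attract, and the points halfway between them repel. *)
Definition contr (S : R) : R -> R := pl (diag2 S).

(** The composition lifts the identity matrix and moves every point by less than [1 / m], so it is
    the identity. *)
Lemma contrK S : 0 < S -> cancel (contr S) (contr S^-1).
Proof.
move=> S0 y.
have p1 := pos2_diag S0; have p2 : pos2 (diag2 S^-1) by apply: pos2_diag; rewrite invr_gt0.
have h := lifts_comp (lifts_plift m0 p2) (lifts_plift m0 p1).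
have E : mul2 (diag2 S^-1) (diag2 S) = one2 R.
  by rewrite /mul2 /= !mulr0 !mul0r !addr0 add0r invrK mulVf ?divff// gt_eqF.
rewrite E in h.
apply: (lifts_unique m0 h (@lifts1 R m)) => /=.
have := plift_dist m0 (diag2 S) y; have := plift_dist m0 (diag2 S^-1) (contr S y).
rewrite /contr; set a := pl _ _; set b := pl _ _.
have mm := mR_gt0 R m0.
have -> : 2 / m%:R = 4 * (1 / (2 * m%:R)) :> R by field; rewrite gt_eqF.
have -> : a - y = (a - b) + (b - y) by ring.
have := ler_normD (a - b) (b - y).
have : 0 < 1 / (2 * m%:R) :> R by rewrite divr_gt0// mulr_gt0.
lra.
Qed.

(** The derivative is [1 / |A v|^2], and neither diagonal matrix shortens a unit vector below the
    length [1 / S]. *)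
Lemma contr_lip S : 1 <= S ->
  (forall x y, `|contr S x - contr S y| <= S ^+ 2 * `|x - y|) /\
  (forall x y, `|contr S^-1 x - contr S^-1 y| <= S ^+ 2 * `|x - y|).
Proof.
move=> S1; have S0 : 0 < S by exact: lt_le_trans S1.
have Sn0 : S != 0 by rewrite gt_eqF.
have S4 : 1 <= S ^+ 4 by rewrite exprn_ege1.
split; apply: plift_lip.
- exact: pos2_diag.
- exact: det_diag2.
- exact: sqr_ge0.
- move=> t; rewrite sqr_dot2_cross2 /= !mul0r addr0 add0r !exprMn exprVn.
  have -> : S ^+ 2 * (S ^+ 2 * cos t ^+ 2 + S ^- 2 * sin t ^+ 2) =
      S ^+ 4 * cos t ^+ 2 + sin t ^+ 2 by field.
  by rewrite -[leLHS](cos2Dsin2 t) lerD2r ler_peMl ?sqr_ge0.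
- by apply: pos2_diag; rewrite invr_gt0.
- by apply: det_diag2; rewrite invr_eq0.
- exact: sqr_ge0.
- move=> t; rewrite sqr_dot2_cross2 /= !mul0r addr0 add0r !exprMn invrK exprVn.
  have -> : S ^+ 2 * (S ^- 2 * cos t ^+ 2 + S ^+ 2 * sin t ^+ 2) =
      cos t ^+ 2 + S ^+ 4 * sin t ^+ 2 by field.
  by rewrite -[leLHS](cos2Dsin2 t) lerD2l ler_peMl ?sqr_ge0.
Qed.

(** At distance at least [1 / S] from the repelling points the horizontal component is at least
    [1 / S]. After stretching, the vector has length at least 1 while its vertical component is at
    most [1 / S]. The bound [2 <= wfreq] makes up for the factor 2 lost in each of the two uses of
    [sin_ge_half]. *)
Lemma contr_flat0 S u : 1 <= S -> `|u| <= 1 / (2 * m%:R) - 1 / S ->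
  `|contr S u| <= 1 / S.
Proof.
move=> S1 uS; have S0 : 0 < S by exact: lt_le_trans S1.
have w2 := wfreq_ge2 R m0; have w0 := wfreq_gt0 R m0; have mm := mR_gt0 R m0.
have wm : w * (1 / (2 * m%:R)) = pi / 2.
  by rewrite /wfreq; field; rewrite gt_eqF.
have Sw : 0 < w / S by rewrite divr_gt0.
have cosn : cos `|w * u| = cos (w * u) by rewrite cos_norm.
have nw : `|w * u| = w * `|u| by rewrite normrM gtr0_norm.
have wu : w * `|u| <= pi / 2 - w / S.
  have E : w / S = w * (1 / S) by rewrite mul1r.
  by rewrite -wm E -mulrBr ler_pM2l.
have wu0 : 0 <= w * `|u| by rewrite mulr_ge0// ltW.
have c1 : 1 / S <= cos (w * u).
  rewrite -cosn nw -[w * `|u|]opprK cosN -[- _](addrK (pi / 2)) cosBpihalf.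
  apply: le_trans (sin_ge_half _); last by apply/andP; split; lra.
  rewrite ler_pdivlMr//; apply: (@le_trans _ _ (w / S)); last by lra.
  by rewrite mulrC mulrA mulr1 ler_pM2r ?invr_gt0.
have c0 : 0 < cos (w * u) by apply: lt_le_trans c1; rewrite divr_gt0.
have [r r0 [/=]] := lifts_plift m0 (pos2_diag S0) u; rewrite !mul0r addr0 add0r.
rewrite -/(contr S u).
move=> r1 r2.
have C0 : 0 < cos (w * contr S u) by rewrite -(pmulr_rgt0 _ r0) -r1 mulr_gt0.
have sb : `|sin (w * contr S u)| <= 1 / S.
  have rE : r * `|sin (w * contr S u)| = `|sin (w * u)| / S.
    by rewrite -(gtr0_norm r0) -normrM -r2 normrM normfV (gtr0_norm S0) mulrC.
  have r1' : 1 <= r.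
    have : S * cos (w * u) <= r.
      by rewrite r1 ler_piMr ?cos_le1 ?ltW.
    by apply: le_trans; rewrite -ler_pdivrMl// mulrC.
  apply: (@le_trans _ _ (r * `|sin (w * contr S u)|)); first by rewrite ler_peMl.
  by rewrite rE ler_pM2r ?invr_gt0// sin_max.
have dist := plift_dist m0 (diag2 S) u; rewrite -/(contr S u) in dist.
have wM : `|w * contr S u| < pi.
  rewrite normrM gtr0_norm//.
  have : w * `|contr S u - u| < pi / 2 by rewrite -wm ltr_pM2l.
  move=> h1.
  have h2 : `|contr S u| <= `|contr S u - u| + `|u|.
    by rewrite -{1}(subrK u (contr S u)) ler_normD.
  have h3 : w * `|contr S u| <= w * `|contr S u - u| + w * `|u|.
    by rewrite -mulrDr ler_pM2l.
  lra.
(* The bound on the sine would also allow angles near [pi]; positivity of the cosine excludes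
   them. *)
have wM2 : `|w * contr S u| <= pi / 2.
  rewrite leNgt; apply/negP => gt.
  have : cos `|w * contr S u| < 0.
    rewrite -(subrK (pi / 2) `|_|) cosDpihalf oppr_lt0 sin_gt0_pihalf//.
    by apply/andP; split; lra.
  by rewrite cos_norm; lra.
have hs : `|w * contr S u| / 2 <= `|sin (w * contr S u)|.
  have [ge|lt] := leP 0 (w * contr S u).
    rewrite ger0_norm// in wM2 *; apply: (le_trans (sin_ge_half _)); rewrite ?ge ?wM2//.
    exact: ler_norm.
  rewrite ltr0_norm// in wM2 *; apply: (le_trans (sin_ge_half _)); rewrite ?wM2 ?andbT.
    by rewrite oppr_ge0 ltW.
  by rewrite sinN -normrN ler_norm.
rewrite normrM gtr0_norm// in hs.
have : `|contr S u| * 2 <= w * `|contr S u| by rewrite mulrC ler_wpM2r.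
lra.
Qed.
Lemma contr_shift S y (z : int) : contr S (y + z%:~R / m%:R) = contr S y + z%:~R / m%:R.
Proof. exact: plift_shift. Qed.

Lemma contr_flat S u (z : int) : 1 <= S ->
  `|u - z%:~R / m%:R| <= 1 / (2 * m%:R) - 1 / S -> `|contr S u - z%:~R / m%:R| <= 1 / S.
Proof.
move=> S1 h; have := contr_flat0 S1 h.
by rewrite -mulNr -intrN contr_shift intrN mulNr.
Qed.

End plift.

(** * Derivative bounds, geometric convergence and smooth limits *)

Section derivative_bounds.
Context (R : realType).
Implicit Types (f g : R -> R) (c d : R) (k : nat).

(* The first k derivatives of f satisfy |f^(j)| <= c * d ^ j; this class is
   stable under products, the c's being multiplied and the d's being added. *)
Fixpoint BN k c d f : Prop := (forall x, `|f x| <= c) /\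
  if k is k'.+1 then exists f', (forall x : R, is_derive x 1 f (f' x)) /\
    BN k' (c * d) d f' else True.

Lemma BN_le k c d c' d' f : 0 <= d -> c <= c' -> d <= d' ->
  BN k c d f -> BN k c' d' f.
Proof.
move=> d0 + dd'; elim: k c c' f => [|k IH] c c' f cc' [h1 h2].
  by split => // x; exact: le_trans cc'.
split; first by move=> x; exact: le_trans cc'.
have [f' [df' bf']] := h2; exists f'; split => //; apply: (IH _ _ _ _ bf').
by apply: ler_pM => //; apply: le_trans (h1 0).
Qed.

Lemma BN_pred k c d f : BN k.+1 c d f -> BN k c d f.
Proof.
elim: k c f => [|k IH] c f [h1 [f' [df bf]]]; first by split.
by split=> //; exists f'; split => //; exact: IH.
Qed.

Lemma BN_cst k c d a : `|a| <= c -> 0 <= d -> BN k c d (cst a).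
Proof.
move=> ac d0; elim: k c a ac => [|k IH] c a ac; first by split.
split=> //; exists (cst 0); split; first by move=> x; exact: is_derive_cst.
by apply: IH; rewrite normr0 mulr_ge0// (le_trans _ ac).
Qed.

Lemma BN_add k c c' d f g : BN k c d f -> BN k c' d g ->
  BN k (c + c') d (fun x => f x + g x).
Proof.
elim: k c c' f g => [|k IH] c c' f g [f1 f2] [g1 g2].
  by split=> // x; rewrite (le_trans (ler_normD _ _))// lerD.
split; first by move=> x; rewrite (le_trans (ler_normD _ _))// lerD.
have [f' [df bf]] := f2; have [g' [dg bg]] := g2.
exists (fun x => f' x + g' x); split; last by rewrite mulrDl; exact: IH.
by move=> x; exact: is_deriveD.
Qed.

Lemma BN_mul k c c' d d' f g : 0 <= d -> 0 <= d' -> BN k c d f -> BN k c' d' g ->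
  BN k (c * c') (d + d') (fun x => f x * g x).
Proof.
move=> d0 d'0; elim: k c c' f g => [|k IH] c c' f g /[dup] bf [f1 f2] /[dup] bg [g1 g2].
  by split=> // x; rewrite normrM ler_pM.
split; first by move=> x; rewrite normrM ler_pM.
have [f' [df bf']] := f2; have [g' [dg bg']] := g2.
exists (fun x => f' x * g x + f x * g' x); split.
  move=> x; have h := is_deriveM (df x) (dg x).
  by apply: (is_derive_eq h); rewrite /GRing.scale /= addrC (mulrC (g x)).
have -> : c * c' * (d + d') = c * d * c' + c * (c' * d') by ring.
by apply: BN_add; apply: IH => //; exact: BN_pred.
Qed.

Lemma BN_trig k c (l a : R) : `|a| <= c ->
  BN k c `|l| (fun x => a * sin (l * x)) /\ BN k c `|l| (fun x => a * cos (l * x)).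
Proof.
have dl (x : R) : is_derive x 1 (fun x : R => l * x) l.
  by apply: is_derive_eq; rewrite /GRing.scale /= mulr1 ?mul0r ?addr0.
have b1 c' (a' : R) : `|a'| <= c' -> forall x, `|a' * sin (l * x)| <= c'.
  move=> ac x; rewrite normrM; apply: le_trans ac; rewrite ler_piMr//.
  exact: sin_max.
have b2 c' (a' : R) : `|a'| <= c' -> forall x, `|a' * cos (l * x)| <= c'.
  move=> ac x; rewrite normrM; apply: le_trans ac; rewrite ler_piMr//.
  exact: cos_max.
elim: k c a => [|k IH] c a ac; first by split; split => //; [exact: b1|exact: b2].
have al : `|a * l| <= c * `|l| by rewrite normrM ler_wpM2r.
split; split; [exact: b1| |exact: b2|].
  exists (fun x => a * l * cos (l * x)); split.
    move=> x; have h := is_derive1_comp (is_derive_sin (l * x)) (dl x).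
    apply: (is_derive_eq (is_deriveZ a h)).
    by rewrite /GRing.scale /=; ring.
  by have [] := IH _ _ al.
exists (fun x => - (a * l) * sin (l * x)); split.
  move=> x; have h := is_derive1_comp (is_derive_cos (l * x)) (dl x).
  by apply: (is_derive_eq (is_deriveZ a h)); rewrite /GRing.scale /=; ring.
by rewrite -normrN in al; have [] := IH _ _ al.
Qed.

Definition smooth1 f := forall k (x : R), derivable (derive1n k f) x 1.

Lemma BN_derive1n k c d f : (forall k, BN k c d f) ->
  (forall x : R, derivable (derive1n k f) x 1) /\ (forall x, `|derive1n k f x| <= c * d ^+ k).
Proof.
move=> bf.
have main : forall j c f, BN (k.+1 + j) c d f -> BN j.+1 (c * d ^+ k) d (derive1n k f).
  elim: k {bf} => [|k IH] j c' f'; first by rewrite mulr1.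
  rewrite addSn -addnS => /IH[_ [g [dg bg]]].
  rewrite (_ : derive1n k.+1 f' = g) ?exprSr ?mulrA//.
  apply/funext => x; rewrite derive1nS derive1E.
  by have dgx := dg x; rewrite derive_val.
have [h1 [g [dg _]]] := main 0 c f (bf (k.+1 + 0)%N).
by split => // x; have [] := dg x.
Qed.
Lemma smooth1_derivable f x : smooth1 f -> derivable f x 1.
Proof. by move=> /(_ 0%N x); rewrite derive1n0. Qed.
Lemma smooth1_derive f : smooth1 f -> smooth1 (derive1 f).
Proof. by move=> sf k x; have := sf k.+1 x; rewrite derive1Sn. Qed.

(** By the mean value inequality [fn n - fn N] has a small Lipschitz constant. This bound survives
    the pointwise limit, so the difference quotients of [f] stay close to those of the single
    function [fn N]. *)
Lemma derive_limit (fn dfn : nat -> R -> R) f df :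
  (forall n (x : R), is_derive x 1 (fn n) (dfn n x)) -> (forall x, fn ^~ x @ \oo --> f x) ->
  (forall e : R, 0 < e -> exists N, forall n, (N <= n)%N -> forall x, `|dfn n x - df x| <= e) ->
  forall x : R, is_derive x 1 f (df x).
Proof.
move=> dfn_ fnf dfnu x.
have key (e : R) : 0 < e -> \forall h \near 0^', `|h^-1 *: (f (h + x) - f x) - df x| <= e.
  move=> e0; have e4 : 0 < e / 4 by rewrite divr_gt0.
  have [N HN] := dfnu _ e4.
  have lip n y z : (N <= n)%N -> `|(fn n y - fn N y) - (fn n z - fn N z)| <= e / 2 * `|y - z|.
    move=> Nn; apply: (@lipschitz_derive R (fun u => fn n u - fn N u) (fun u => dfn n u - dfn N u)).
    move=> u; have -> : dfn n u - dfn N u = (dfn n u - df u) - (dfn N u - df u) by ring.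
    apply: le_trans (ler_normB _ _) _.
    have := HN n Nn u; have := HN N (leqnn _) u; lra.
  have lipf y z : `|(f y - fn N y) - (f z - fn N z)| <= e / 2 * `|y - z|.
    have cv : (fun n => `|(fn n y - fn N y) - (fn n z - fn N z)|) @ \oo -->
        `|(f y - fn N y) - (f z - fn N z)|.
      apply: cvg_norm; apply: cvgB; apply: cvgB; do ?exact: fnf; exact: cvg_cst.
    rewrite -(cvg_lim (@Rhausdorff R) cv); apply: limr_le; first by apply/cvg_ex; eexists; exact: cv.
    by exists N => // n /= Nn; exact: lip.
  have := dfn_ N x => -[dx dv].
  have /cvgrPdist_le/(_ _ e4) := dx; rewrite -/(derive _ _ _) dv.
  move=> hN.
  near=> h.
  have hn0 : h != 0 by near: h; exact: nbhs_dnbhs_neq.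
  have h1 : `|dfn N x - h^-1 *: (fn N (h + x) - fn N x)| <= e / 4.
    have : `|dfn N x - h^-1 *: ((fn N \o shift x) (h *: 1) - fn N x)| <= e / 4 by near: h.
    by rewrite /= /shift /GRing.scale/= mulr1.
  have h2 := lipf (h + x) x; rewrite addrK in h2.
  have h3 := HN N (leqnn _) x.
  have -> : h^-1 *: (f (h + x) - f x) - df x =
    h^-1 * ((f (h + x) - fn N (h + x)) - (f x - fn N x))
    - (dfn N x - h^-1 *: (fn N (h + x) - fn N x)) + (dfn N x - df x).
    by rewrite /GRing.scale /=; ring.
  have h4 : `|h^-1 * ((f (h + x) - fn N (h + x)) - (f x - fn N x))| <= e / 2.
    by rewrite normrM normfV ler_pdivrMl ?normr_gt0// mulrC.
  apply: le_trans (ler_normD _ _) _.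
  have := ler_normB (h^-1 * ((f (h + x) - fn N (h + x)) - (f x - fn N x)))
    (dfn N x - h^-1 *: (fn N (h + x) - fn N x)).
  lra.
have cv : h^-1 *: ((f \o shift x) (h *: 1) - f x) @[h --> 0^'] --> df x.
  apply/cvgrPdist_le => e e0; near=> h.
  rewrite distrC /= /shift {2}/GRing.scale/= mulr1.
  by near: h; exact: key.
have dd : derivable f x 1 by apply/cvg_ex; exists (df x).
by split => //; apply: (cvg_lim _ cv).
Unshelve. all: by end_near. Qed.

Lemma inv_nat_small (e : R) : 0 < e -> exists k : nat, (k.+1%:R^-1 : R) < e.
Proof.
move=> e0; exists (Num.bound e^-1); rewrite invf_plt ?posrE//.
by apply: lt_trans (archi_boundP _) _; rewrite ?invr_ge0 ?ltr_nat// ltW.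
Qed.

Lemma half_pow_small (e : R) : 0 < e -> exists M, forall n, (M <= n)%N -> 2 * 2^-1 ^+ n < e.
Proof.
move=> e0; have : (fun n => 2 * 2^-1 ^+ n : R) @ \oo --> (2 * 0 : R).
  by apply: cvgM; [exact: cvg_cst|apply: cvg_expr; rewrite ger0_norm; lra].
rewrite mulr0 => /cvgrPdist_lt/(_ _ e0)[M _ HM]; exists M => n Mn.
by have := HM n Mn; rewrite /= sub0r normrN ger0_norm// mulr_ge0 ?exprn_ge0.
Qed.

Lemma geometric_cauchy (u : nat -> R) (N : nat) :
  (forall n, (N <= n)%N -> `|u n.+1 - u n| <= 2^-1 ^+ n) ->
  forall n, (N <= n)%N -> forall k, `|u (n + k)%N - u n| <= 2 * 2^-1 ^+ n - 2 * 2^-1 ^+ (n + k).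
Proof.
move=> h n Nn; elim=> [|k IH]; first by rewrite addn0 !subrr normr0.
have := h (n + k)%N (leq_trans Nn (leq_addr _ _)).
rewrite addnS exprS; have := ler_normD (u (n + k).+1 - u (n + k)%N) (u (n + k)%N - u n).
have -> : u (n + k).+1 - u (n + k)%N + (u (n + k)%N - u n) = u (n + k).+1 - u n by ring.
lra.
Qed.

Lemma geometric_cvg (u : nat -> R) (N : nat) :
  (forall n, (N <= n)%N -> `|u n.+1 - u n| <= 2^-1 ^+ n) ->
  u @ \oo --> limn u /\ forall n, (N <= n)%N -> `|limn u - u n| <= 2 * 2^-1 ^+ n.
Proof.
move=> h; have hc := geometric_cauchy h.
have cv : cvgn u.
  apply/cauchy_cvgP/cauchy_exP => e e0 /=.
  have [M HM] := half_pow_small e0.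
  exists (u (maxn N M)); exists (maxn N M) => // n /= mn.
  rewrite /ball /= distrC; have := hc _ (leq_maxl N M) (n - maxn N M)%N; rewrite subnKC// => hcc.
  have := HM (maxn N M) (leq_maxr _ _).
  have : 0 <= 2 * 2^-1 ^+ n :> R by rewrite mulr_ge0 ?exprn_ge0.
  lra.
split => // n Nn.
have cv2 : (fun k => `|u k - u n|) @ \oo --> `|limn u - u n|.
  by apply: cvg_norm; apply: cvgB => //; exact: cvg_cst.
rewrite -(cvg_lim (@Rhausdorff R) cv2); apply: limr_le; first by apply/cvg_ex; eexists; exact: cv2.
exists n => // k /= nk; have := hc n Nn (k - n)%N; rewrite subnKC//.
have : 0 <= 2 * 2^-1 ^+ k :> R by rewrite mulr_ge0 ?exprn_ge0.
lra.
Qed.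

(** Step [n] controls only the derivatives of order at most [n]. For a fixed order [k] this is a
    geometric bound from the index [k] on, so the derivatives of every order converge uniformly. *)
Lemma smooth1_limit (fn : nat -> R -> R) :
  (forall n, smooth1 (fn n)) ->
  (forall n k x, (k <= n)%N -> `|derive1n k (fn n.+1) x - derive1n k (fn n) x| <= 2^-1 ^+ n) ->
  smooth1 (fun x => limn (fn ^~ x)).
Proof.
move=> sfn dfn.
have c k x : (fun n => derive1n k (fn n) x) @ \oo --> limn (fun n => derive1n k (fn n) x) /\
    forall n, (k <= n)%N -> `|limn (fun n => derive1n k (fn n) x) - derive1n k (fn n) x| <= 2 * 2^-1 ^+ n.
  by apply: geometric_cvg => n kn; exact: dfn.
have ders k (x : R) : is_derive x 1 (fun x => limn (fun n => derive1n k (fn n) x))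
     (limn (fun n => derive1n k.+1 (fn n) x)).
  move: x; apply: (@derive_limit (fun n => derive1n k (fn n)) (fun n => derive1n k.+1 (fn n))).
  - move=> n x; rewrite derive1nS derive1E; apply: DeriveDef => //; exact: sfn.
  - by move=> x; have [] := c k x.
  - move=> e e0.
    have [M HM] := half_pow_small e0.
    exists (maxn k.+1 M) => n; rewrite geq_max => /andP[kn Mn] x.
    rewrite distrC; have [_ /(_ n kn)] := c k.+1 x.
    have := HM n Mn.
    lra.
have E k : derive1n k (fun x => limn (fn ^~ x)) = (fun x => limn (fun n => derive1n k (fn n) x)).
  elim: k => [|k IH]; first by [].
  rewrite derive1nS IH; apply/funext => x; rewrite derive1E.
  by have dd := ders k x; rewrite derive_val.
by move=> k x; rewrite E; have [] := ders k x.
Qed.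

End derivative_bounds.

(** * Integer parameters of the construction *)

Section sequences.
Variable m : nat.
Hypothesis m0 : (0 < m)%N.

(** Of the three factors [L], one pays for the Lipschitz constant of [kap n], one for that of its
    inverse, and one is kept so that the fibre coordinate of a graph point is near a multiple of
    [1 / m] even after multiplication by [L] (see [coord]). The power of 2 makes the errors
    summable, and [m] compensates for the period [1 / m]. *)
Definition contr_nat (n L : nat) : nat := (2 ^ n.+2 * m * L ^ 3)%N.

(** The old Lipschitz bound, times the square of the contraction strength, times [2 q] as an upper
    bound of the factor [1 + q] caused by the shear [y - q x]. *)
Definition next_lip (n : nat) (s : nat * nat) : nat :=
  (s.2 * contr_nat n s.2 ^ 2 * (2 * s.1))%N.

(** The exponent has to grow with [n]: at step [n] up to [n] derivatives are taken at the price of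
    one factor of the base each. The fixed supply of twenty covers the other powers that occur and
    leaves two factors to beat [2 ^ n]. *)
Definition next_ratio (n : nat) (s : nat * nat) : nat :=
  ((16 * m * next_lip n s) ^ (n + 20))%N.

Fixpoint qlip (n : nat) : nat * nat :=
  if n is n'.+1 then (((qlip n').1 * next_ratio n' (qlip n'))%N, next_lip n' (qlip n'))
  else (1%N, 1%N).

Definition qn n := (qlip n).1.
Definition Lam n := (qlip n).2.
Definition Sn n := contr_nat n (Lam n).
(** One scale that dominates [Lam n.+1], [Sn n], [qn n] and [wfreq], so that all estimates of step
    [n] can be written as powers of it. *)
Definition Gn n := (16 * m * Lam n.+1)%N.
Definition ell n := (Gn n ^ (n + 20))%N.

Lemma qnS n : qn n.+1 = (qn n * ell n)%N. Proof. by []. Qed.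
Lemma LamS n : Lam n.+1 = (Lam n * Sn n ^ 2 * (2 * qn n))%N. Proof. by []. Qed.

Lemma qn_Lam_gt0 n : (0 < qn n)%N && (0 < Lam n)%N.
Proof.
elim: n => [//|n /andP[q0 L0]].
have S0 : (0 < Sn n)%N.
  rewrite /Sn /contr_nat; have l3 : (0 < Lam n ^ 3)%N by rewrite expn_gt0 L0.
  have p2 : (0 < 2 ^ n.+2)%N by rewrite expn_gt0.
  by move: (2 ^ _)%N (Lam n ^ 3)%N p2 l3 => a b a0 b0; rewrite !muln_gt0 a0 b0 m0.
have L1 : (0 < Lam n.+1)%N.
  rewrite LamS; have s2 : (0 < Sn n ^ 2)%N by rewrite expn_gt0 S0.
  by move: (Sn n ^ 2)%N s2 => a a0; rewrite !muln_gt0 a0 L0 q0.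
have G0 : (0 < Gn n)%N by rewrite /Gn; move: (Lam _) L1 => a a0; rewrite !muln_gt0 m0 a0.
by rewrite L1 qnS /ell; move: (Gn n) G0 => a a0; rewrite muln_gt0 q0 expn_gt0 a0.
Qed.

Lemma qn_gt0 n : (0 < qn n)%N. Proof. by have /andP[] := qn_Lam_gt0 n. Qed.
Lemma Lam_gt0 n : (0 < Lam n)%N. Proof. by have /andP[] := qn_Lam_gt0 n. Qed.
Lemma Sn_gt0 n : (0 < Sn n)%N.
Proof.
rewrite /Sn /contr_nat; have l3 : (0 < Lam n ^ 3)%N by rewrite expn_gt0 Lam_gt0.
have p2 : (0 < 2 ^ n.+2)%N by rewrite expn_gt0.
by move: (2 ^ _)%N (Lam n ^ 3)%N p2 l3 => a b a0 b0; rewrite !muln_gt0 a0 b0 m0.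
Qed.
Lemma Gn_gt0 n : (0 < Gn n)%N. Proof.
by rewrite /Gn; have := Lam_gt0 n.+1; move: (Lam _) => a a0; rewrite !muln_gt0 m0 a0.
Qed.
Lemma ell_gt0 n : (0 < ell n)%N. Proof. by rewrite /ell expn_gt0 Gn_gt0. Qed.

Lemma Sn_ge n : (2 ^ n.+2 <= Sn n)%N.
Proof.
by rewrite /Sn /contr_nat -mulnA leq_pmulr// muln_gt0 m0 expn_gt0 Lam_gt0.
Qed.
Lemma LamS_ge n : (Lam n * Sn n ^ 2 * (1 + qn n) <= Lam n.+1)%N.
Proof. by rewrite LamS leq_mul2l mul2n -addnn leq_add2r qn_gt0 orbT. Qed.

Lemma LamS_ge2 n : (2 * Lam n * Sn n <= Lam n.+1)%N.
Proof.
rewrite LamS.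
have -> : (Lam n * Sn n ^ 2 * (2 * qn n) = (2 * Lam n * Sn n) * (Sn n * qn n))%N.
  by rewrite expnS expn1; lia.
by rewrite leq_pmulr// muln_gt0 Sn_gt0 qn_gt0.
Qed.
Lemma Sn_LamS n : (Sn n <= Lam n.+1)%N.
Proof. by apply: leq_trans (LamS_ge2 n); rewrite leq_pmull// muln_gt0 Lam_gt0. Qed.

Lemma qn_LamS n : (qn n <= Lam n.+1)%N.
Proof.
rewrite LamS mulnA leq_pmull//.
have s2 : (0 < Sn n ^ 2)%N by rewrite expn_gt0 Sn_gt0.
by have := Lam_gt0 n; move: (Lam n) (Sn n ^ 2)%N s2 => b a a0 b0; rewrite !muln_gt0 a0 b0.
Qed.

Lemma Lam_qn_LamS n : (Lam n + qn n <= Lam n.+1)%N.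
Proof.
apply: leq_trans (LamS_ge n).
have := Lam_gt0 n; have := qn_gt0 n; have : (0 < Sn n ^ 2)%N by rewrite expn_gt0 Sn_gt0.
move: (Sn n ^ 2)%N (Lam n) (qn n) => s l q s0 q0 l0.
have : (l * (1 + q) <= l * s * (1 + q))%N by rewrite leq_mul2r leq_pmulr ?orbT.
nia.
Qed.
Lemma Lam_double n : (2 * Lam n <= Lam n.+1)%N.
Proof. by apply: leq_trans (LamS_ge2 n); rewrite leq_pmulr// Sn_gt0. Qed.

Lemma Lam_ge n : (2 ^ n <= Lam n)%N.
Proof.
by elim: n => // n IH; apply: leq_trans (Lam_double n); rewrite expnS leq_mul2l IH.
Qed.

Lemma Lam_homo n k : (n <= k)%N -> (Lam n <= Lam k)%N.
Proof.
move=> /subnK <-; elim: (k - n)%N => // j IH; rewrite addSn.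
by apply: leq_trans (Lam_double _); apply: (leq_trans IH); rewrite leq_pmull.
Qed.
Lemma Gn_ge16 n : (16 <= Gn n)%N.
Proof. by rewrite /Gn -mulnA leq_pmulr// muln_gt0 m0 Lam_gt0. Qed.

Lemma Gn_ge n : (16 * 2 ^ n <= Gn n)%N.
Proof.
rewrite /Gn -mulnA leq_mul2l /=; apply: (leq_trans (Lam_ge n)).
apply: (@leq_trans (Lam n.+1)); last by rewrite leq_pmull.
by apply: leq_trans (Lam_double n); rewrite leq_pmull.
Qed.

Lemma ell_ge2 n : (2 <= ell n)%N.
Proof.
apply: (@leq_trans (Gn n)); first by apply: leq_trans (Gn_ge16 n).
by rewrite /ell addnS expnS leq_pmulr// expn_gt0 Gn_gt0.
Qed.
Lemma qn_ge_ell n : (ell n <= qn n.+1)%N.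
Proof. by rewrite qnS leq_pmull// qn_gt0. Qed.

(** This makes the time [tn n] a multiple of [qn n]. It holds because [Lam n.+1] was given the
    factor [2 * qn n]. *)
Lemma dvd_ell n : (2 * m * qn n %| ell n)%N.
Proof.
apply: (@dvdn_trans (Gn n)); last by rewrite /ell addnS expnS dvdn_mulr.
by apply/dvdnP; exists (8 * (Lam n * Sn n ^ 2) * 2)%N; rewrite /Gn LamS; lia.
Qed.

(** The summand 1 adds [1 / qn n.+1] to the fraction at each step. As a consequence [qn n * alpha]
    exceeds an integer by about [1 / ell n], which is the slow drift that drives the dynamics. *)
Fixpoint pn (n : nat) : nat := if n is n'.+1 then (pn n' * ell n' + 1)%N else 1%N.

End sequences.

(** * The rotation angle and its approximation errors *)

Section alpha.
Context (R : realType) (m : nat) (m0 : (0 < m)%N).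
Local Notation q n := ((qn m n)%:R : R).
Local Notation p n := ((pn m n)%:R : R).
Local Notation l n := ((ell m n)%:R : R).
Local Notation G n := ((Gn m n)%:R : R).

Definition alpha : R := sup [set p n / q n | n in [set: nat]].
Definition eps n : R := q n * alpha - p n.

Lemma q_gt0 n : 0 < q n. Proof. by rewrite ltr0n qn_gt0. Qed.
Lemma l_gt0 n : 0 < l n. Proof. by rewrite ltr0n ell_gt0. Qed.
Lemma G_gt0 n : 0 < G n. Proof. by rewrite ltr0n Gn_gt0. Qed.

(** The intervals [[p / q, (p + 1) / q]] are nested because every ratio [ell] is at least 2, and the
    supremum of the left end points lies in all of them. *)
Lemma alpha_bounds n : p n / q n <= alpha <= (p n + 1) / q n.
Proof.
have qS k : q k.+1 = q k * l k by rewrite qnS natrM.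
have pS k : p k.+1 = p k * l k + 1 by rewrite /= natrD natrM.
have inc k : p k / q k <= p k.+1 / q k.+1.
  rewrite qS pS; have -> : p k / q k = p k * l k / (q k * l k).
    by field; rewrite !gt_eqF ?q_gt0 ?l_gt0.
  by rewrite ler_pM2r ?invr_gt0 ?mulr_gt0 ?q_gt0 ?l_gt0// lerDl.
have dec k : (p k.+1 + 1) / q k.+1 <= (p k + 1) / q k.
  rewrite qS pS; have -> : (p k + 1) / q k = (p k + 1) * l k / (q k * l k).
    by field; rewrite !gt_eqF ?q_gt0 ?l_gt0.
  rewrite ler_pM2r ?invr_gt0 ?mulr_gt0 ?q_gt0 ?l_gt0//.
  have : 2 <= l k by rewrite ler_nat ell_ge2.
  lra.
have inc' i k : p i / q i <= p (i + k)%N / q (i + k)%N.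
  by elim: k => [|k IH]; rewrite ?addn0// addnS (le_trans IH).
have dec' i k : (p (i + k)%N + 1) / q (i + k)%N <= (p i + 1) / q i.
  by elim: k => [|k IH]; rewrite ?addn0// addnS; apply: le_trans IH.
have cross i k : p i / q i <= (p k + 1) / q k.
  have [ik|/ltnW ki] := leqP i k.
    have := inc' i (k - i)%N; rewrite subnKC// => h; apply: (le_trans h).
    by rewrite ler_pM2r ?invr_gt0 ?q_gt0// lerDl.
  have := dec' k (i - k)%N; rewrite subnKC// => h; apply: le_trans h.
  by rewrite ler_pM2r ?invr_gt0 ?q_gt0// lerDl.
have ub : has_ubound [set p n / q n | n in [set: nat]].
  by exists ((p 0%N + 1) / q 0%N) => _ [i _ <-].
apply/andP; split; first by apply: ub_le_sup => //; exists n.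
by apply: ge_sup; [exists (p 0%N / q 0%N), 0%N|move=> _ [i _ <-]].
Qed.
Lemma eps_rec n : l n * eps n = 1 + eps n.+1.
Proof. by rewrite /eps qnS /= natrD !natrM; ring. Qed.

Lemma eps_bounds n : 0 < eps n <= 2 / l n.
Proof.
have h k : 0 <= eps k <= 1.
  have /andP[a1 a2] := alpha_bounds k; rewrite /eps.
  rewrite ler_pdivrMr ?q_gt0// mulrC in a1; rewrite ler_pdivlMr ?q_gt0// mulrC in a2.
  by apply/andP; split; lra.
have /andP[h1 h2] := h n.+1; have r := eps_rec n.
apply/andP; split; first by rewrite -(pmulr_rgt0 _ (l_gt0 n)) r; lra.
by rewrite ler_pdivlMr ?l_gt0// mulrC r; lra.
Qed.

Lemma eps_gt0 n : 0 < eps n. Proof. by have /andP[] := eps_bounds n. Qed.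
Lemma G_ge n : 16 * 2 ^+ n <= G n.
Proof. by rewrite -natrX -natrM ler_nat Gn_ge. Qed.
Lemma G_ge16 n : 16 <= G n.
Proof. by rewrite ler_nat Gn_ge16. Qed.

(** Two of the factors of [ell n] are left over; [G n >= 16] and [G n >= 16 * 2 ^ n] turn them into
    the small factor. *)
Lemma eps_small n j : (j <= n + 18)%N -> eps n * G n ^+ j <= 2^-1 ^+ n / 8.
Proof.
move=> jn; have /andP[e0 e1] := eps_bounds n; have G0 := G_gt0 n.
have G1 : 1 <= G n by apply: le_trans (G_ge16 n); rewrite ler1n.
apply: (@le_trans _ _ (2 / l n * G n ^+ (n + 18))).
  have g1 : 0 <= G n ^+ j by rewrite exprn_ge0 ?ltW.
  have g2 : G n ^+ j <= G n ^+ (n + 18) by rewrite ler_weXn2l.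
  by apply: ler_pM => //; exact: ltW.
rewrite /ell natrX (_ : n + 20 = (n + 18) + 2)%N; last by lia.
rewrite exprD.
have -> : 2 / (G n ^+ (n + 18) * G n ^+ 2) * G n ^+ (n + 18) = 2 / G n ^+ 2.
  by field; rewrite expf_neq0 ?gt_eqF.
rewrite ler_pdivrMr ?exprn_gt0// exprVn.
have h := G_ge n; have h16 := G_ge16 n.
have p0 : 0 < 2 ^+ n :> R by rewrite exprn_gt0.
have : 16 * 2 ^+ n * 16 <= G n ^+ 2 by rewrite expr2 ler_pM// mulr_ge0// ltW.
move=> h2; apply: (@le_trans _ _ (2 ^- n / 8 * (16 * 2 ^+ n * 16))).
  rewrite (_ : _ * _ = 32); last by field; rewrite gt_eqF.
  by rewrite ler_nat.
by rewrite ler_pM2l// divr_gt0 ?invr_gt0.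
Qed.

(** If [b] were a denominator, [eps N * b] would be an integer, but for large [N] it lies strictly
    between 0 and 1. *)
Lemma alpha_irrational : irrational alpha.
Proof.
case=> r _ ra.
pose b : R := (denq r)%:~R.
have b0 : 0 < b by rewrite ltr0z denq_gt0.
have ab : alpha * b = (numq r)%:~R by rewrite -ra /ratr mulfVK// gt_eqF.
have [N Nb] : exists N, b <= 2 ^+ N.
  exists (Num.bound b); apply: (@le_trans _ _ (Num.bound b)%:R).
    by apply/ltW; have := archi_boundP (ltW b0).
  by rewrite -natrX ler_nat ltnW// ltn_expl.
have h : 0 < eps N * b < 1.
  rewrite mulr_gt0 ?eps_gt0//=.
  apply: (@le_lt_trans _ _ (eps N * G N ^+ 1)).
    rewrite ler_pM2l ?eps_gt0// expr1; apply: (le_trans Nb).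
    by apply: le_trans (G_ge N); rewrite ler_peMl ?exprn_ge0// ler1n.
  apply: (@le_lt_trans _ _ (2^-1 ^+ N / 8)); first by apply: eps_small; lia.
  by rewrite ltr_pdivrMr// mul1r (@le_lt_trans _ _ 1)// ?exprn_ile1 ?invr_ge0// ?invf_le1// ?ler1n// ltr1n.
have : eps N * b = ((Posz (qn m N)) * numq r - (Posz (pn m N)) * denq r)%:~R.
  by rewrite /eps mulrBl -mulrA ab intrB !intrM.
by move: h => /[swap] ->; rewrite ltr0z ltrz1 => /andP[]; lia.
Qed.

End alpha.

(** * The conjugacies, their matrices and the approximating cocycles *)

Section conjugacies.
Context (R : realType) (m : nat) (m0 : (0 < m)%N).
Local Notation w := (wfreq R m).
Local Notation q n := ((qn m n)%:R : R).
Local Notation p n := ((pn m n)%:R : R).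
Local Notation G n := ((Gn m n)%:R : R).
Local Notation S n := ((Sn m n)%:R : R).
Local Notation L n := ((Lam m n)%:R : R).
Local Notation al := (alpha R m).
Local Notation ep n := (eps R m n).
Implicit Types (x y : R) (n : nat).

(** The fibre map of the conjugacy after [n] steps. The new contraction is applied first, and the
    shear [q n' * x] lets its attracting points wind around the torus [q n'] times. *)
Fixpoint kap n x y : R :=
  if n is n'.+1 then kap n' x (contr m (S n') (y - q n' * x)) else y.

Fixpoint iot n x y : R :=
  if n is n'.+1 then contr m (S n')^-1 (iot n' x y) + q n' * x else y.

Lemma S_ge1 n : 1 <= S n. Proof. by rewrite ler1n Sn_gt0. Qed.
Lemma S_gt0 n : 0 < S n. Proof. by rewrite ltr0n Sn_gt0. Qed.
Lemma L_ge1 n : 1 <= L n. Proof. by rewrite ler1n Lam_gt0. Qed.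
Lemma L_gt0 n : 0 < L n. Proof. by rewrite ltr0n Lam_gt0. Qed.
Lemma q_ge1 n : 1 <= q n. Proof. by rewrite ler1n qn_gt0. Qed.

Lemma contrVK n : cancel (contr m (S n)^-1) (contr m (S n)).
Proof.
move=> y; rewrite -{1}(invrK (S n)); apply: contrK => //.
by rewrite invr_gt0 S_gt0.
Qed.

Lemma kapK n x : cancel (iot n x) (kap n x).
Proof.
elim: n => [//|n IH] y /=; rewrite addrK contrVK; exact: IH.
Qed.

Lemma iotK n x : cancel (kap n x) (iot n x).
Proof.
elim: n => [//|n IH] y /=; rewrite IH contrK ?S_gt0//; ring.
Qed.

Lemma L_step n : L n * S n ^+ 2 * (1 + q n) <= L n.+1.
Proof.
have -> : 1 + q n = (1 + qn m n)%N%:R by rewrite natrD.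
by rewrite -natrX -!natrM ler_nat LamS_ge.
Qed.

Lemma kap_lip n x x' y y' :
  `|kap n x y - kap n x' y'| <= L n * (`|x - x'| + `|y - y'|).
Proof.
elim: n x x' y y' => [|n IH] x x' y y'; first by rewrite mul1r lerDr.
apply: le_trans (IH _ _ _ _) _.
have [cl _] := contr_lip m0 (S_ge1 n).
have h1 := cl (y - q n * x) (y' - q n * x').
have h2 : `|y - q n * x - (y' - q n * x')| <= `|y - y'| + q n * `|x - x'|.
  have -> : y - q n * x - (y' - q n * x') = (y - y') - q n * (x - x') by ring.
  by apply: le_trans (ler_normB _ _) _; rewrite normrM ger0_norm.
apply: le_trans (_ : L n * S n ^+ 2 * (1 + q n) * (`|x - x'| + `|y - y'|) <= _); last first.
  by rewrite ler_wpM2r ?addr_ge0// L_step.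
set s2 := S n ^+ 2 in h1 *.
have -> : L n * s2 * (1 + q n) * (`|x - x'| + `|y - y'|) =
  L n * (s2 * ((1 + q n) * (`|x - x'| + `|y - y'|))) by ring.
rewrite ler_wpM2l//.
have s20 : 0 <= s2 by exact: sqr_ge0.
have s1 : 1 <= s2 by rewrite exprn_ege1// S_ge1.
have h3 := le_trans h1 (ler_wpM2l s20 h2).
apply: le_trans (lerD (ler_peMl (normr_ge0 _) s1) h3) _.
rewrite -mulrDr ler_wpM2l//.
have q0 : 0 <= q n by [].
have h4 : 0 <= q n * `|y - y'| by rewrite mulr_ge0.
by rewrite mulrDl mul1r mulrDr; lra.
Qed.

Lemma iot_lip n x y y' : `|iot n x y - iot n x y'| <= L n * `|y - y'|.
Proof.
elim: n y y' => [|n IH] y y'; first by rewrite mul1r.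
rewrite /= opprD addrACA subrr addr0.
have [_ cl] := contr_lip m0 (S_ge1 n); apply: le_trans (cl _ _) _.
apply: le_trans (ler_wpM2l (sqr_ge0 _) (IH _ _)) _.
rewrite mulrCA mulrA ler_wpM2r//; apply: le_trans (L_step n).
by rewrite ler_peMr ?lerDl// mulr_ge0 ?sqr_ge0.
Qed.

Lemma kap_shift n x y (z : int) : kap n x (y + z%:~R / m%:R) = kap n x y + z%:~R / m%:R.
Proof.
elim: n y => [//|n IH] y /=.
by rewrite addrAC contr_shift// IH.
Qed.

Lemma kap_shiftZ n x y (z : int) : kap n x (y + z%:~R) = kap n x y + z%:~R.
Proof.
have -> : z%:~R = (z * m)%:~R / m%:R :> R.
  by rewrite intrM mulfK// gt_eqF// mR_gt0.
exact: kap_shift.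
Qed.

Lemma contr_shiftZ S y (z : int) : contr m S (y + z%:~R) = contr m S y + z%:~R :> R.
Proof.
have -> : z%:~R = (z * m)%:~R / m%:R :> R.
  by rewrite intrM mulfK// gt_eqF// mR_gt0.
exact: contr_shift.
Qed.

Fixpoint winding n : nat := if n is n'.+1 then (winding n' + qn m n')%N else 0%N.

(** The shears wind, so [kap n] is not periodic in [x]; as the defect is an integer, the conjugacy
    still descends to the torus. *)
Lemma kap_base n x y (z : int) :
  kap n (x + z%:~R) y = kap n x y - (z * Posz (winding n))%:~R.
Proof.
elim: n y => [|n IH] y /=; first by rewrite mulr0 subr0.
rewrite IH.
have -> : y - q n * (x + z%:~R) = y - q n * x + (- (Posz (qn m n) * z))%:~R.
  by rewrite intrN intrM /= -[(Posz (qn m n))%:~R]/(q n); ring.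
rewrite contr_shiftZ kap_shiftZ -addrA -[in RHS]intrN -intrB.
by congr (_ + _%:~R); rewrite PoszD; lia.
Qed.

Fixpoint Bm n x : mat2 R := if n is n'.+1 then
  mul2 (Bm n' x) (mul2 (diag2 (S n')) (rot2 (w * - (q n' * x)))) else one2 R.

Lemma lifts_Bm n x : lifts m (Bm n x) (kap n x).
Proof.
elim: n => [|n IH]; first exact: lifts1.
apply: (lifts_comp IH).
apply: (lifts_comp _ (lifts_rot m (- (q n * x)))).
by apply: lifts_plift => //; apply: pos2_diag; exact: S_gt0.
Qed.

Lemma det_Bm n x : det2 (Bm n x) = 1.
Proof.
elim: n => [|n IH]; first by rewrite /det2/= mulr1 mulr0 subr0.
by rewrite !det2M IH det_rot2 det_diag2 ?gt_eqF ?S_gt0// !mul1r.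
Qed.

Lemma lifts_adj (A : mat2 R) g h : det2 A = 1 -> lifts m A g -> cancel h g ->
  lifts m (adj2 A) h.
Proof.
move=> dA Ag hg y; have [r r0 []] := Ag (h y); rewrite hg => r1 r2.
have rn0 : r != 0 by rewrite gt_eqF.
have c : cos (w * y) = r^-1 * (r * cos (w * y)) by rewrite mulKf.
have s : sin (w * y) = r^-1 * (r * sin (w * y)) by rewrite mulKf.
exists r^-1; first by rewrite invr_gt0.
rewrite c s -r1 -r2 /=; move: dA; rewrite /det2 => dA.
split.
  transitivity (r^-1 * (cos (w * h y) * (m11 A * m22 A - m12 A * m21 A))); first by ring.
  by rewrite dA mulr1.
transitivity (r^-1 * (sin (w * h y) * (m11 A * m22 A - m12 A * m21 A))); first by ring.
by rewrite dA mulr1.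
Qed.

(** Two consecutive cocycles differ only by a translation of the fibre by [- eps n], made in the
    coordinates between the contraction of step [n] and its shear. [Nm n] is this translation seen
    through the contraction. *)
Definition Nm n : mat2 R :=
  mul2 (mul2 (diag2 (S n)) (rot2 (w * - ep n))) (diag2 (S n)^-1).
Definition Cm n x : mat2 R := mul2 (mul2 (Bm n x) (Nm n)) (adj2 (Bm n x)).
Fixpoint Am n x : mat2 R := if n is n'.+1 then mul2 (Am n' x) (Cm n' x) else one2 R.

Definition gm n x y := kap n x (contr m (S n) (contr m (S n)^-1 (iot n x y) - ep n)).

Lemma lifts_Cm n x : lifts m (Cm n x) (gm n x).
Proof.
apply: (@lifts_comp R m _ _ (kap n x \o (fun y => contr m (S n) (contr m (S n)^-1 y - ep n)))).
  apply: lifts_comp; first exact: lifts_Bm.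
  apply: (@lifts_comp R m _ _ (contr m (S n) \o (fun y => y - ep n)) (contr m (S n)^-1)).
    apply: lifts_comp (lifts_rot m _).
    by apply: lifts_plift => //; apply: pos2_diag; exact: S_gt0.
  by apply: lifts_plift => //; apply: pos2_diag; rewrite invr_gt0 S_gt0.
apply: lifts_adj (kapK n x); first exact: det_Bm.
exact: lifts_Bm.
Qed.

(** Advancing the base by [alpha] changes the shear of step [n] by [pn n + eps n]. [Qn] collects the
    integer parts, so that the lift [Fm n] stays near the identity. *)
Fixpoint Qn n : R := if n is n'.+1 then Qn n' + p n' else 0.

Lemma Qn_int n : exists z : int, Qn n = z%:~R.
Proof.
elim: n => [|n [z IH]]; first by exists 0.
by exists (z + Posz (pn m n)); rewrite /= IH intrD.
Qed.

(** The fibre map of the rotation by the final angle [alpha], conjugated by the first [n] steps; all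
    stages share the same base map. *)
Definition Fm n x y := kap n (x + al) (iot n x y) + Qn n.

(** The integer part of the change of the shear commutes with all maps involved and is absorbed by
    [Qn], so only [eps n] remains in [gm n]. *)
Lemma FmS n x y : Fm n.+1 x y = Fm n x (gm n x y).
Proof.
rewrite /Fm /gm iotK /=.
have -> : contr m (S n)^-1 (iot n x y) + q n * x - q n * (x + al) =
    contr m (S n)^-1 (iot n x y) - ep n + (- Posz (pn m n))%:~R.
  by rewrite intrN /eps -[(Posz _)%:~R]/(p n); ring.
by rewrite contr_shiftZ kap_shiftZ intrN; rewrite -[(Posz _)%:~R]/(p n); ring.
Qed.

Lemma lifts_Fm n x : lifts m (Am n x) (Fm n x).
Proof.
elim: n => [|n IH].
  have -> : Fm 0 x = id by apply/funext => y; rewrite /Fm /= addr0.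
  exact: lifts1.
have -> : Fm n.+1 x = Fm n x \o gm n x by apply/funext => y; rewrite FmS.
by apply: lifts_comp IH _; exact: lifts_Cm.
Qed.
Lemma det_Nm n : det2 (Nm n) = 1.
Proof. by rewrite !det2M det_rot2 !det_diag2 ?mul1r// ?invr_eq0 gt_eqF// S_gt0. Qed.

Lemma det_Am n x : det2 (Am n x) = 1.
Proof.
elim: n => [|n IH]; first by rewrite /det2/= mulr1 mulr0 subr0.
by rewrite /= det2M IH mul1r /Cm det2M det_adj2 det_Bm det2M det_Bm det_Nm !mul1r.
Qed.

Lemma dist_Fm n x y : `|Fm n.+1 x y - Fm n x y| <= L n.+1 * ep n.
Proof.
have [cl1 _] := contr_lip m0 (S_ge1 n); have e0 := eps_gt0 R m0 n.
rewrite /Fm opprD addrACA /=.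
have -> : contr m (S n)^-1 (iot n x y) + q n * x - q n * (x + al) =
    contr m (S n)^-1 (iot n x y) - ep n + (- Posz (pn m n))%:~R.
  by rewrite intrN /eps -[(Posz _)%:~R]/(p n); ring.
rewrite contr_shiftZ kap_shiftZ intrN -[(Posz _)%:~R]/(p n).
set a := kap n _ _; rewrite -{1}(contrVK n (iot n x y)); set b := kap n _ _.
have -> : a - p n - b + (Qn n + p n - Qn n) = a - b by ring.
apply: le_trans (kap_lip _ _ _ _ _) _; rewrite subrr normr0 add0r.
apply: le_trans (ler_wpM2l _ (cl1 _ _)) _ => //.
rewrite addrAC subrr add0r normrN gtr0_norm// mulrA ler_pM2r//.
by apply: le_trans (L_step n); rewrite ler_peMr ?lerDl ?mulr_ge0 ?sqr_ge0.
Qed.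
Lemma LG n : L n.+1 * 16 * m%:R = G n.
Proof. by rewrite /Gn !natrM mulrC mulrCA mulrA mulrC; ring. Qed.

Lemma L_eps n j : (j <= n + 17)%N -> L n.+1 * ep n * G n ^+ j <= 2^-1 ^+ n / (128 * m%:R).
Proof.
move=> jn; have mm := mR_gt0 R m0.
have := @eps_small R m m0 n j.+1; rewrite exprS -{1}LG.
have -> : ep n * (L n.+1 * 16 * m%:R * G n ^+ j) = (L n.+1 * ep n * G n ^+ j) * (16 * m%:R) by ring.
rewrite -ler_pdivlMr ?mulr_gt0// => h.
have -> : 2^-1 ^+ n / (128 * m%:R) = 2^-1 ^+ n / 8 / (16 * m%:R) :> R.
  by field; rewrite gt_eqF.
by apply: h; lia.
Qed.

(** This keeps [Fm n] in the range where a lift is determined by its matrix ([lifts_eq_plift]); the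
    bound leaves room for a geometric series of increments. *)
Lemma Fm_near n x y : `|Fm n x y - y| <= (2 - 2 * 2^-1 ^+ n) / (128 * m%:R).
Proof.
have mm := mR_gt0 R m0.
elim: n => [|n IH]; first by rewrite /Fm /= addr0 subrr normr0 mulr1 subrr mul0r.
have h2 : `|Fm n.+1 x y - Fm n x y| <= 2^-1 ^+ n / (128 * m%:R).
  by apply: le_trans (dist_Fm n x y) _; rewrite -[leLHS]mulr1; exact: (@L_eps n 0).
have -> : Fm n.+1 x y - y = (Fm n.+1 x y - Fm n x y) + (Fm n x y - y) by ring.
apply: le_trans (ler_normD _ _) _; apply: le_trans (lerD h2 IH) _.
by rewrite -mulrDl ler_pM2r ?invr_gt0 ?mulr_gt0// exprS; lra.
Qed.

End conjugacies.

(** * Smooth convergence of the cocycle matrices and the limit cocycle *)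

Section limit_cocycle.
Context (R : realType) (m : nat) (m0 : (0 < m)%N).
Local Notation w := (wfreq R m).
Local Notation q n := ((qn m n)%:R : R).
Local Notation G n := ((Gn m n)%:R : R).
Local Notation S n := ((Sn m n)%:R : R).
Local Notation L n := ((Lam m n)%:R : R).
Local Notation ep n := (eps R m n).
Implicit Types (x y c d : R) (n k : nat) (b : bool).

Definition entry b b' (A : mat2 R) :=
  if b then (if b' then m11 A else m12 A) else (if b' then m21 A else m22 A).

Definition mbnd c d (A : R -> mat2 R) :=
  forall b b' k, BN k c d (fun x => entry b b' (A x)).

Lemma BN_opp k c d f : BN k c d f -> BN k c d (fun x => - f x).
Proof.
elim: k c f => [|k IH] c f [f1 f2]; first by split=> // x; rewrite normrN.
split; first by move=> x; rewrite normrN.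
have [f' [df bf]] := f2; exists (fun x => - f' x); split; last exact: IH.
by move=> x; exact: is_deriveN.
Qed.

Lemma mbnd_mul c c' d d' A B : 0 <= d -> 0 <= d' -> mbnd c d A -> mbnd c' d' B ->
  mbnd (2 * (c * c')) (d + d') (fun x => mul2 (A x) (B x)).
Proof.
move=> d0 d0' bA bB b b' k; have -> : 2 * (c * c') = c * c' + c * c' by ring.
case: b b' => -[]; apply: BN_add; apply: BN_mul => //;
  by [exact: (bA true true)|exact: (bA true false)|exact: (bA false true)|exact: (bA false false)|
  exact: (bB true true)|exact: (bB true false)|exact: (bB false true)|exact: (bB false false)].
Qed.

Lemma mbnd_adj c d A : mbnd c d A -> mbnd c d (fun x => adj2 (A x)).
Proof.
move=> bA [] [] k /=; [exact: (bA false false)| | |exact: (bA true true)]; apply: BN_opp.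
  exact: (bA true false).
exact: (bA false true).
Qed.
Lemma mbnd_le c d c' d' A : 0 <= d -> c <= c' -> d <= d' -> mbnd c d A -> mbnd c' d' A.
Proof. by move=> d0 cc dd bA b b' k; apply: BN_le (bA b b' k). Qed.
Lemma mbnd_cst c d A : 0 <= d -> (forall b b', `|entry b b' A| <= c) -> mbnd c d (fun=> A).
Proof. by move=> d0 h b b' k; exact: BN_cst. Qed.

Lemma w_ge0 : 0 <= w. Proof. exact/ltW/wfreq_gt0. Qed.

Lemma w_le4 : w <= 4 * m%:R.
Proof.
rewrite ler_pM2r ?mR_gt0//; have := @pihalf_lt2 R; lra.
Qed.

Lemma L4 n : 4 * L n * S n <= L n.+1.
Proof.
have -> : 4 * L n * S n = (4 * Lam m n * Sn m n)%N%:R by rewrite !natrM.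
rewrite ler_nat LamS.
have s4 : (4 <= Sn m n)%N by apply: leq_trans (Sn_ge m0 n); rewrite -[4%N]/(2 ^ 2)%N leq_exp2l.
have q1 := qn_gt0 m0 n.
rewrite (_ : _ * _ * (2 * _) = (2 * Sn m n * qn m n) * (Lam m n * Sn m n))%N; last first.
  by rewrite expnS expn1; lia.
rewrite -mulnA leq_mul2r; apply/orP; right.
by move: (Sn m n) (qn m n) s4 q1 => s q s4 q1; nia.
Qed.

(** The amplitudes of the stretchings multiply and the frequencies of the rotations add up; [Lam]
    grows fast enough to bound both. *)
Lemma mbnd_Bm n : mbnd (L n) (w * L n) (Bm m n).
Proof.
have w0 := w_ge0; elim: n => [|n IH].
  rewrite mulr1; apply: mbnd_cst => //.
  by case=> -[]; rewrite /= ?normr0 ?normr1.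
have d1 : mbnd (S n) 0 (fun=> diag2 (S n)).
  apply: mbnd_cst => //; have s1 := S_ge1 R m0 n.
  case=> -[] /=; rewrite ?normr0 ?ger0_norm ?invr_ge0//.
  by apply: le_trans s1; rewrite invf_le1 ?(lt_le_trans ltr01)// S_ge1.
have d2 : mbnd 1 (w * q n) (fun x => rot2 (w * - (q n * x))).
  have e x : w * - (q n * x) = - (w * q n) * x by ring.
  have -> : (fun x => rot2 (w * - (q n * x))) = (fun x => rot2 (- (w * q n) * x)).
    by apply/funext => x; rewrite e.
  have nw : w * q n = `|- (w * q n)| by rewrite normrN ger0_norm// mulr_ge0.
  have n1 : `|1 : R| <= 1 by rewrite normr1.
  move=> b b' k; have [s c] := BN_trig k (- (w * q n)) n1; rewrite [X in BN _ _ X]nw.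
  have one (h : R -> R) : (fun x => 1 * h x) = h by apply/funext => x; rewrite mul1r.
  rewrite one in s; rewrite one in c.
  by case: b b' => -[] //=; exact: BN_opp.
have wL : 0 <= w * L n by rewrite mulr_ge0.
have wq : 0 <= w * q n by rewrite mulr_ge0.
have d3 := mbnd_mul (lexx 0) wq d1 d2.
have wq' : 0 <= 0 + w * q n by rewrite add0r.
have d4 := mbnd_mul wL wq' IH d3.
apply: mbnd_le d4.
- by rewrite addr_ge0.
- by apply: le_trans (L4 n); rewrite mulr1; lra.
- by rewrite add0r -mulrDr ler_wpM2l// -natrD ler_nat Lam_qn_LamS.
Qed.

Definition add2 (A B : mat2 R) :=
  Mat2 (m11 A + m11 B) (m12 A + m12 B) (m21 A + m21 B) (m22 A + m22 B).

Definition scale2 (s : R) (A : mat2 R) := Mat2 (s * m11 A) (s * m12 A) (s * m21 A) (s * m22 A).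

(** [Nm n] minus the identity, with the diagonal conjugation carried out. Each entry contains the
    sine, or the cosine minus 1, of a multiple of [eps n], which is where the smallness comes
    from. *)
Definition N'm n : mat2 R := let t := w * - ep n in
  Mat2 (cos t - 1) (- (S n ^+ 2 * sin t)) ((S n) ^- 2 * sin t) (cos t - 1).

Definition Em n x := mul2 (mul2 (Bm m n x) (N'm n)) (adj2 (Bm m n x)).

Lemma Cm_Em n x : Cm m n x = add2 (one2 R) (Em n x).
Proof.
have sn0 : S n != 0 by rewrite gt_eqF ?S_gt0.
have eN : Nm R m n = add2 (one2 R) (N'm n).
  by rewrite /Nm /mul2 /add2 /= invrK; congr Mat2; field.
have dB := det_Bm m0 n x; rewrite /Cm /Em eN.
have -> : mul2 (mul2 (Bm m n x) (add2 (one2 R) (N'm n))) (adj2 (Bm m n x)) =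
    add2 (scale2 (det2 (Bm m n x)) (one2 R)) (mul2 (mul2 (Bm m n x) (N'm n)) (adj2 (Bm m n x))).
  by rewrite /mul2 /add2 /scale2 /det2 /=; congr Mat2; ring.
by rewrite dB /scale2 /= mulr1 mulr0.
Qed.
Lemma AmS n x : Am m n.+1 x = add2 (Am m n x) (mul2 (Am m n x) (Em n x)).
Proof. by rewrite /= Cm_Em /mul2 /add2 /=; congr Mat2; ring. Qed.

Lemma sin_le_norm (t : R) : `|sin t| <= `|t|.
Proof.
have := @lipschitz_derive R sin cos 1 (fun x => is_derive_sin x) (@cos_max R) t 0.
by rewrite sin0 !subr0 mul1r.
Qed.

Lemma cos_sub1_le_norm (t : R) : `|cos t - 1| <= `|t|.
Proof.
have h (x : R) : `|- sin x| <= 1 by rewrite normrN sin_max.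
have := @lipschitz_derive R cos (fun x => - sin x) 1 (fun x => is_derive_cos x) h t 0.
by rewrite cos0 subr0 mul1r.
Qed.

Lemma N'm_le n b b' : `|entry b b' (N'm n)| <= S n ^+ 2 * (w * ep n).
Proof.
have e0 := eps_gt0 R m0 n; have s1 := S_ge1 R m0 n; have w0 := w_ge0.
have s2 : 1 <= S n ^+ 2 by rewrite exprn_ege1.
have nt : `|w * - ep n| = w * ep n by rewrite mulrN normrN ger0_norm// mulr_ge0// ltW.
have we : 0 <= w * ep n by rewrite -nt.
have c1 := cos_sub1_le_norm (w * - ep n); have t1 := sin_le_norm (w * - ep n).
rewrite nt in c1 t1.
case: b b' => -[] /=; rewrite ?normrN.
- by apply: (le_trans c1); rewrite ler_peMl.
- by rewrite normrM ger0_norm ?sqr_ge0// ler_wpM2l ?sqr_ge0.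
- rewrite normrM ger0_norm ?invr_ge0 ?sqr_ge0//; apply: ler_pM => //.
  by apply: le_trans s2; rewrite invf_le1 ?exprn_gt0 ?(lt_le_trans ltr01)// exprn_ege1.
- by apply: (le_trans c1); rewrite ler_peMl.
Qed.

Lemma G_ge_Lam n : L n.+1 <= G n /\ S n <= G n /\ L n <= G n /\ q n <= G n.
Proof.
have h : (Lam m n.+1 <= Gn m n)%N by rewrite /Gn leq_pmull// muln_gt0 m0.
rewrite !ler_nat; do ! split => //; apply: leq_trans h.
- exact: Sn_LamS.
- exact: Lam_homo.
- exact: qn_LamS.
Qed.

(** Four of the six factors [G n] bound the square of [L n * S n], and the other two bound the
    constant [4 * w]. *)
Lemma mbnd_Em n : mbnd (G n ^+ 6 * ep n) (2 * w * L n) (Em n).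
Proof.
have e0 := eps_gt0 R m0 n; have w0 := w_ge0; have G0 := G_gt0 R m0 n.
have wL : 0 <= w * L n by rewrite mulr_ge0.
have d1 : mbnd (S n ^+ 2 * (w * ep n)) 0 (fun=> N'm n) by apply: mbnd_cst => // b b'; exact: N'm_le.
have d2 := mbnd_mul wL (lexx 0) (mbnd_Bm n) d1.
have wL' : 0 <= w * L n + 0 by rewrite addr0.
have d3 := mbnd_mul wL' wL d2 (mbnd_adj (mbnd_Bm n)).
apply: mbnd_le d3 => //.
- by rewrite addr_ge0.
- have -> : 2 * (2 * (L n * (S n ^+ 2 * (w * ep n))) * L n) =
     (L n * S n) ^+ 2 * (4 * w) * ep n by ring.
  rewrite ler_pM2r// (_ : 6 = 4 + 2)%N// exprD.
  have [g1 [g2 [g3 g4]]] := G_ge_Lam n.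
  apply: ler_pM; [exact: sqr_ge0|by rewrite mulr_ge0| |].
    by rewrite -[4%N]/(2 * 2)%N exprM lerXn2r ?nnegrE ?mulr_ge0 ?sqr_ge0// expr2 ler_pM.
  apply: (@le_trans _ _ (16 * m%:R)); first by have := w_le4; lra.
  apply: (@le_trans _ _ (G n)).
    by rewrite -LG -mulrA ler_peMl ?mulr_ge0// L_ge1.
  by rewrite expr2 ler_peMl ?(ltW G0)// (le_trans _ (G_ge16 R m0 n))// ler1n.
- lra.
Qed.

Lemma mbnd_AE n c : mbnd c (2 * w * L n) (Am m n) -> c <= 2 ->
  mbnd (G n ^+ 7 * ep n) (G n) (fun x => mul2 (Am m n x) (Em n x)).
Proof.
have e0 := eps_gt0 R m0 n; have w0 := w_ge0; have G0 := G_gt0 R m0 n.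
have wL : 0 <= 2 * w * L n by rewrite mulr_ge0// mulr_ge0.
move=> bA c2; have d := mbnd_mul wL wL bA (mbnd_Em n).
apply: mbnd_le d; first by rewrite addr_ge0.
- have -> : 2 * (c * (G n ^+ 6 * ep n)) = 2 * c * (G n ^+ 6 * ep n) by ring.
  have -> : G n ^+ 7 * ep n = G n * (G n ^+ 6 * ep n) by ring.
  rewrite ler_wpM2r//; first by rewrite mulr_ge0 ?exprn_ge0 ?ltW.
  by apply: le_trans (G_ge16 R m0 n); lra.
- have -> : 2 * w * L n + 2 * w * L n = w * (4 * L n) by ring.
  have L2 : 2 * L n <= L n.+1 by rewrite -natrM ler_nat Lam_double.
  have : w * (4 * L n) <= (4 * m%:R) * (2 * L n.+1).
    by have w4 := w_le4; apply: ler_pM => //; lra.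
  move/le_trans; apply; rewrite -LG.
  have -> : 4 * m%:R * (2 * L n.+1) = 8 * (L n.+1 * m%:R) by ring.
  have -> : L n.+1 * 16 * m%:R = 16 * (L n.+1 * m%:R) by ring.
  by rewrite ler_wpM2r ?mulr_ge0// ler_nat.
Qed.

(** The bound [2 - 2^-1 ^+ n] leaves half of [2^-1 ^+ n] for the increment [Am * Em] of step [n]. *)
Lemma mbnd_Am n : mbnd (2 - 2^-1 ^+ n) (2 * w * L n) (Am m n).
Proof.
have w0 := w_ge0; elim: n => [|n IH].
  apply: mbnd_cst; first by rewrite mulr_ge0// mulr_ge0.
  by case=> -[]; rewrite /= ?normr0 ?normr1; lra.
have e0 := eps_gt0 R m0 n; have G0 := G_gt0 R m0 n.
have hp : 0 < 2^-1 ^+ n :> R by rewrite exprn_gt0.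
have wL : 0 <= 2 * w * L n by rewrite mulr_ge0// mulr_ge0.
have d := mbnd_mul wL wL IH (mbnd_Em n).
have L2 : 2 * L n <= L n.+1 by rewrite -natrM ler_nat Lam_double.
have dle : 2 * w * L n + 2 * w * L n <= 2 * w * L n.+1.
  have w2 : 0 <= 2 * w by rewrite mulr_ge0.
  by rewrite -mulrDr ler_wpM2l//; lra.
have dle' : 2 * w * L n <= 2 * w * L n + 2 * w * L n by rewrite lerDl.
have h7 : G n ^+ 7 * ep n <= 2^-1 ^+ n / 8 by rewrite mulrC; apply: eps_small => //; lia.
have h6 : 4 * (G n ^+ 6 * ep n) <= 2^-1 ^+ n / 8.
  apply: le_trans h7; have -> : G n ^+ 7 * ep n = G n * (G n ^+ 6 * ep n) by ring.
  rewrite ler_wpM2r//; first by rewrite mulr_ge0 ?exprn_ge0 ?ltW.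
  by apply: le_trans (G_ge16 R m0 n); rewrite ler_nat.
have d' := mbnd_le wL (lexx _) dle' IH.
have d0 : 0 <= 2 * w * L n + 2 * w * L n by rewrite addr_ge0.
have key : mbnd (2 - 2^-1 ^+ n + 2 * ((2 - 2^-1 ^+ n) * (G n ^+ 6 * ep n)))
   (2 * w * L n + 2 * w * L n) (Am m n.+1).
  move=> b b' k; have h1 := d' b b' k; have h2 := d b b' k.
  have := BN_add h1 h2.
  by congr BN; apply/funext => x; rewrite AmS; case: b b' {h1 h2} => -[].
apply: mbnd_le key => //.
have g0 : 0 <= G n ^+ 6 * ep n by rewrite mulr_ge0 ?exprn_ge0 ?ltW.
have : (2 - 2^-1 ^+ n) * (G n ^+ 6 * ep n) <= 2 * (G n ^+ 6 * ep n) by rewrite ler_wpM2r//; lra.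
by rewrite (exprS _ n); lra.
Qed.

Lemma BN_AE n b b' k :
  BN k (G n ^+ 7 * ep n) (G n) (fun x => entry b b' (mul2 (Am m n x) (Em n x))).
Proof.
apply: (mbnd_AE (mbnd_Am n)); have : 0 < 2^-1 ^+ n :> R by rewrite exprn_gt0.
lra.
Qed.
Lemma entryD b b' A B : entry b b' (add2 A B) = entry b b' A + entry b b' B.
Proof. by case: b b' => -[]. Qed.

Lemma smooth1_Am n b b' : smooth1 (fun x => entry b b' (Am m n x)).
Proof.
move=> k; have [//] := BN_derive1n k (fun j => mbnd_Am n b b' j).
Qed.

Lemma derive1n_add (f g : R -> R) k : smooth1 f -> smooth1 g ->
  derive1n k (f \+ g) = derive1n k f \+ derive1n k g.
Proof.
move=> sf sg; elim: k => [//|k IH].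
rewrite !derive1nS IH; apply/funext => x; rewrite /= !derive1E.
by apply: deriveD; [exact: sf|exact: sg].
Qed.

(** Each of the [k] derivatives costs one factor [G n] on top of the seven in the amplitude; for
    [k <= n] the sum is within the range of [eps_small]. *)
Lemma derive1n_AmS n k b b' x : (k <= n)%N ->
  `|derive1n k (fun x => entry b b' (Am m n.+1 x)) x -
    derive1n k (fun x => entry b b' (Am m n x)) x| <= 2^-1 ^+ n / 8.
Proof.
move=> kn; set f := fun x => entry b b' (Am m n x).
set g := fun x => entry b b' (mul2 (Am m n x) (Em n x)).
have sg : smooth1 g by move=> j; have [] := BN_derive1n j (fun i => BN_AE n b b' i).
have -> : (fun x => entry b b' (Am m n.+1 x)) = f \+ g.
  by apply/funext => u; rewrite AmS entryD.
rewrite derive1n_add//; last exact: smooth1_Am.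
rewrite /= addrAC subrr add0r.
have [_ /(_ x)] := BN_derive1n k (fun i => BN_AE n b b' i).
move/le_trans; apply; rewrite mulrAC -exprD mulrC.
by apply: eps_small => //; lia.
Qed.

Definition Ainf x : mat2 R := Mat2
  (limn (fun n => m11 (Am m n x))) (limn (fun n => m12 (Am m n x)))
  (limn (fun n => m21 (Am m n x))) (limn (fun n => m22 (Am m n x))).

Lemma entry_Ainf b b' x : entry b b' (Ainf x) = limn (fun n => entry b b' (Am m n x)).
Proof. by case: b b' => -[]. Qed.
Lemma entry_AmS n b b' x :
  `|entry b b' (Am m n.+1 x) - entry b b' (Am m n x)| <= 2^-1 ^+ n / 8.
Proof. exact: (@derive1n_AmS n 0 b b' x). Qed.

Lemma Ainf_cvg b b' x : (fun n => entry b b' (Am m n x)) @ \oo --> entry b b' (Ainf x).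
Proof.
rewrite entry_Ainf; apply: (geometric_cvg (N := 0) _).1 => n _.
apply: le_trans (entry_AmS _ _ _ _) _.
by rewrite ler_pdivrMr// ler_peMr ?exprn_ge0// ler1n.
Qed.

Lemma smooth1_Ainf b b' : smooth1 (fun x => entry b b' (Ainf x)).
Proof.
have -> : (fun x => entry b b' (Ainf x)) = (fun x => limn (fun n => entry b b' (Am m n x))).
  by apply/funext => x; rewrite entry_Ainf.
apply: (@smooth1_limit R (fun n x => entry b b' (Am m n x))) => [n|n k x kn].
  exact: smooth1_Am.
apply: le_trans (derive1n_AmS _ _ _ kn) _.
by rewrite ler_pdivrMr// ler_peMr ?exprn_ge0// ler1n.
Qed.

(** Close enough to the identity that every direction moves by less than a right angle, as [plift]
    requires. *)
Definition near1 (A : mat2 R) := forall b b', `|entry b b' A - entry b b' (one2 R)| <= 4^-1.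

Lemma near1_Am n x : near1 (Am m n x).
Proof.
move=> b b'; have : `|entry b b' (Am m n x) - entry b b' (one2 R)| <= (2 - 2 * 2^-1 ^+ n) / 8.
  elim: n => [|n IH]; first by rewrite subrr normr0 mulr1 subrr mul0r.
  have := entry_AmS n b b' x; have := ler_normD (entry b b' (Am m n.+1 x) - entry b b' (Am m n x))
    (entry b b' (Am m n x) - entry b b' (one2 R)).
  by rewrite addrA subrK exprS; lra.
by have : 0 <= 2^-1 ^+ n :> R by [rewrite exprn_ge0|]; lra.
Qed.

Lemma near1_Ainf x : near1 (Ainf x).
Proof.
move=> b b'.
have cv : (fun n => `|entry b b' (Am m n x) - entry b b' (one2 R)|) @ \oo -->
    `|entry b b' (Ainf x) - entry b b' (one2 R)|.
  by apply: cvg_norm; apply: cvgB; [exact: Ainf_cvg|exact: cvg_cst].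
rewrite -(cvg_lim (@Rhausdorff R) cv); apply: limr_le.
  by apply/cvg_ex; eexists; exact: cv.
by exists 0%N => // n _; exact: near1_Am.
Qed.

Lemma near1_dot A t : near1 A -> 2^-1 <= dot2 A t.
Proof.
move=> n1; have := n1 true true; have := n1 true false; have := n1 false true.
have := n1 false false; rewrite /= !subr0 /dot2.
set c := cos t; set s := sin t; have cs : c ^+ 2 + s ^+ 2 = 1 := cos2Dsin2 t.
move: A {n1} => [a b c' d] /=.
rewrite !ler_norml => /andP[d1 d2] /andP[c1 c2] /andP[b1 b2] /andP[a1 a2].
have h1 : a * c ^+ 2 >= 3 / 4 * c ^+ 2 by rewrite ler_wpM2r ?sqr_ge0//; lra.
have h2 : d * s ^+ 2 >= 3 / 4 * s ^+ 2 by rewrite ler_wpM2r ?sqr_ge0//; lra.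
have h3 : `|(b + c') * (c * s)| <= 2^-1 * `|c * s|.
  by rewrite normrM ler_wpM2r// ler_norml; lra.
have h4 : `|c * s| <= 2^-1 * (c ^+ 2 + s ^+ 2).
  rewrite ler_norml; have := sqr_ge0 (c - s); have := sqr_ge0 (c + s).
  by rewrite !expr2 => ? ?; apply/andP; split; lra.
move: h3; rewrite ler_norml => /andP[h3 _]; lra.
Qed.
Lemma near1_pos A : near1 A -> pos2 A.
Proof. by move=> n1 t; apply: lt_le_trans (near1_dot t n1). Qed.

Lemma det_Ainf x : det2 (Ainf x) = 1.
Proof.
have cv : (fun n => det2 (Am m n x)) @ \oo --> det2 (Ainf x).
  have c := Ainf_cvg; rewrite /det2.
  apply: cvgB; apply: cvgM; [exact: (c true true)|exact: (c false false)|
    exact: (c true false)|exact: (c false true)].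
apply: (cvg_unique (@Rhausdorff R) cv).
by rewrite /=; under eq_cvg do rewrite (det_Am m0); exact: cvg_cst.
Qed.

Lemma near1_adj A : near1 A -> near1 (adj2 A).
Proof.
move=> n1 [] [] /=; have := n1 true true; have := n1 true false; have := n1 false true;
  have := n1 false false; rewrite /= !subr0 ?normrN //.
Qed.

Definition Finf x y := plift m (Ainf x) y.
Definition Finv x y := plift m (adj2 (Ainf x)) y.

Lemma plift_inv A : near1 A -> det2 A = 1 -> cancel (plift m A) (plift m (adj2 A)).
Proof.
move=> n1 dA y.
have h := lifts_comp (lifts_plift m0 (near1_pos (near1_adj n1))) (lifts_plift m0 (near1_pos n1)).
rewrite adj2_mul// in h.
apply: (lifts_unique m0 h (@lifts1 R m)) => /=.
have := plift_dist m0 A y; have := plift_dist m0 (adj2 A) (plift m A y).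
set a := plift m (adj2 A) _; set b := plift m A y.
have mm := mR_gt0 R m0.
have -> : 2 / m%:R = 4 * (1 / (2 * m%:R)) :> R by field; rewrite gt_eqF.
have -> : a - y = (a - b) + (b - y) by ring.
have := ler_normD (a - b) (b - y).
have : 0 < 1 / (2 * m%:R) :> R by rewrite divr_gt0// mulr_gt0.
lra.
Qed.
Lemma FinfK x : cancel (Finf x) (Finv x).
Proof. by apply: plift_inv; [exact: near1_Ainf|exact: det_Ainf]. Qed.

Lemma FinvK x : cancel (Finv x) (Finf x).
Proof.
have e : adj2 (adj2 (Ainf x)) = Ainf x.
  by case: (Ainf x) => a b c d; rewrite /adj2 /= !opprK.
have := @plift_inv (adj2 (Ainf x)); rewrite e; apply.
  exact/near1_adj/near1_Ainf.
by rewrite det_adj2 det_Ainf.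
Qed.

(** The conjugated cocycle and the projective lift of its matrix are two lifts near the identity,
    hence equal. Convergence of matrices thereby becomes convergence of the maps. *)
Lemma Fm_plift n x y : Fm m n x y = plift m (Am m n x) y.
Proof.
apply: lifts_eq_plift => //; [exact/near1_pos/near1_Am|exact: lifts_Fm|].
apply: le_lt_trans (Fm_near m0 n x y) _; have mm := mR_gt0 R m0.
have : 0 <= 2^-1 ^+ n :> R by rewrite exprn_ge0.
move=> h; rewrite invfM mulrA ltr_pM2r ?invr_gt0//; lra.
Qed.

Lemma Fm_cvg x y : (fun n => Fm m n x y) @ \oo --> Finf x y.
Proof.
under eq_fun do rewrite Fm_plift.
apply: cvgD; first exact: cvg_cst.
apply: cvgM; last exact: cvg_cst.
apply: (continuous_cvg _ (@continuous_atan R _)).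
have c := Ainf_cvg; set t := w * y.
apply: cvgM.
  apply: cvgB; last by apply: cvgM; [exact: (c true false)|exact: cvg_cst].
  apply: cvgD; first by apply: cvgM; [exact: (c false true)|exact: cvg_cst].
  apply: cvgM; last exact: cvg_cst.
  by apply: cvgB; [exact: (c false false)|exact: (c true true)].
apply: cvgV; first by rewrite gt_eqF//; exact/near1_pos/near1_Ainf.
apply: cvgD; last by apply: cvgM; [exact: (c false false)|exact: cvg_cst].
apply: cvgD; first by apply: cvgM; [exact: (c true true)|exact: cvg_cst].
apply: cvgM; last exact: cvg_cst.
by apply: cvgD; [exact: (c true false)|exact: (c false true)].
Qed.
Lemma G_homo n k : (n <= k)%N -> G n <= G k.
Proof. by move=> nk; rewrite ler_nat /Gn leq_mul2l Lam_homo ?orbT. Qed.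

(** The whole sequence is multiplied by [2 * G n ^+ 12] before the geometric argument is applied.
    The twelfth power later pays for the time and the Lipschitz constants when orbits are
    followed. *)
Lemma Finf_dist n x y : `|Finf x y - Fm m n x y| * G n ^+ 12 <= 2^-1 ^+ n.
Proof.
have mm := mR_ge1 R m0; have G0 := G_gt0 R m0.
pose c := 2 * G n ^+ 12; have c0 : 0 < c by rewrite mulr_gt0 ?exprn_gt0.
have h k : (n <= k)%N -> `|Fm m k.+1 x y * c - Fm m k x y * c| <= 2^-1 ^+ k.
  move=> nk; rewrite -mulrBl normrM (gtr0_norm c0).
  have /(ler_wpM2r (ltW c0)) := dist_Fm m0 k x y; move/le_trans; apply.
  have := @L_eps R m m0 k 12; rewrite addnC => /(_ (leq_addr _ _)) h.
  have hG : G n ^+ 12 <= G k ^+ 12 by rewrite lerXn2r ?nnegrE ?(ltW (G0 _)) ?G_homo.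
  have Le : 0 <= L k.+1 * ep k by rewrite mulr_ge0// ltW// eps_gt0.
  have := ler_wpM2l Le hG.
  have : 2^-1 ^+ k / (128 * m%:R) <= 2^-1 ^+ k / 2 :> R.
    rewrite ler_wpM2l ?exprn_ge0// lef_pV2 ?posrE ?mulr_gt0 ?(lt_le_trans ltr01)//; lra.
  rewrite /c mulrCA; lra.
have [cv hl] := geometric_cvg h.
have e : limn (fun k => Fm m k x y * c) = Finf x y * c.
  by apply: cvg_lim => //; apply: cvgM; [exact: Fm_cvg|exact: cvg_cst].
have := hl n (leqnn _); rewrite e -mulrBl normrM (gtr0_norm c0) /c mulrCA; lra.
Qed.
Lemma Finf_shift x y (z : int) : Finf x (y + z%:~R / m%:R) = Finf x y + z%:~R / m%:R.
Proof. exact: plift_shift. Qed.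
Lemma Finv_shift x y (z : int) : Finv x (y + z%:~R / m%:R) = Finv x y + z%:~R / m%:R.
Proof. exact: plift_shift. Qed.

(** One turn of the base adds [pi m q] to the angle of each rotation, which changes the matrix at
    most by a sign. The sign occurs twice in [Cm n] and cancels, so the cocycle matrix is
    periodic. *)
Lemma Bm_base n x : exists s : R, s ^+ 2 = 1 /\ Bm m n (x + 1) = scale2 s (Bm m n x).
Proof.
elim: n => [|n [s [s2 IH]]].
  by exists 1; rewrite expr1n /scale2 /= mulr1 mulr0.
exists (s * (-1) ^+ (m * qn m n)); split.
  by rewrite exprMn s2 mul1r -exprM mulnC exprM sqrrN !expr1n.
rewrite /= IH; set k := (m * qn m n)%N.
have -> : w * - (q n * (x + 1)) = w * - (q n * x) - pi *+ k.
  by rewrite /k /wfreq -[pi *+ _]mulr_natr natrM; ring.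
set t := w * - (q n * x).
have ct : cos (t - pi *+ k) = (-1) ^+ k * cos t.
  have := alternatingn (@cosDpi R) k (t - pi *+ k); rewrite subrK => ->.
  by rewrite mulrA -exprD addnn -mul2n exprM sqrrN !expr1n mul1r.
have st : sin (t - pi *+ k) = (-1) ^+ k * sin t.
  have := alternatingn (@sinDpi R) k (t - pi *+ k); rewrite subrK => ->.
  by rewrite mulrA -exprD addnn -mul2n exprM sqrrN !expr1n mul1r.
by rewrite /rot2 ct st /mul2 /scale2 /=; congr Mat2; ring.
Qed.

Lemma Am_base n x : Am m n (x + 1) = Am m n x.
Proof.
elim: n => [//|n IH]; rewrite /= IH; congr mul2.
have [s [s2 e]] := Bm_base n x; rewrite /Cm e.
have e1 A N : mul2 (mul2 (scale2 s A) N) (adj2 (scale2 s A)) =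
    scale2 (s ^+ 2) (mul2 (mul2 A N) (adj2 A)).
  by rewrite /mul2 /scale2 /=; congr Mat2; ring.
by rewrite e1 s2; case: (mul2 _ _) => a b c d; rewrite /scale2 /= !mul1r.
Qed.

Lemma Ainf_base x (z : int) : Ainf (x + z%:~R) = Ainf x.
Proof.
have b1 y : Ainf (y + 1) = Ainf y.
  by rewrite /Ainf; under eq_fun do rewrite Am_base; under [X in Mat2 _ (limn X)]eq_fun do rewrite Am_base;
    under [X in Mat2 _ _ (limn X)]eq_fun do rewrite Am_base; under [X in Mat2 _ _ _ (limn X)]eq_fun do rewrite Am_base.
have bn (n : nat) y : Ainf (y + n%:R) = Ainf y.
  by elim: n => [|n IH]; rewrite ?addr0// -natr1 addrA b1.
case: z => n; first exact: bn.
by rewrite NegzE intrN -(bn n.+1) subrK.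
Qed.

End limit_cocycle.

(** * Smoothness in two variables *)

Section smooth2.
Context (R : realType).
Implicit Types (f g : R * R -> R) (x v : R * R) (k : nat).

(** Unlike [Ck], every level also records the continuity of the function itself, so the inductions
    for products and compositions have it at hand. *)
Fixpoint Sm k f : Prop := continuous f /\
  if k is k'.+1 then (forall x v, derivable f x v) /\
    forall v, Sm k' (fun x => 'D_v f x) else True.

Lemma SmS k f (df : R * R -> R * R -> R) : continuous f ->
  (forall x v, is_derive x v f (df v x)) -> (forall v, Sm k (df v)) -> Sm k.+1 f.
Proof.
move=> cf hf hd; split=> //; split; first by move=> x v; have [] := hf x v.
move=> v; have -> : (fun x => 'D_v f x) = df v; last exact: hd.
by apply/funext => x; have h := hf x v; rewrite derive_val.
Qed.
Lemma Sm_derive k f : Sm k.+1 f -> (forall x v, is_derive x v f ('D_v f x)) /\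
  forall v, Sm k (fun x => 'D_v f x).
Proof. by move=> [_ [h1 h2]]; split => // x v; exact/derivableP. Qed.
Lemma Sm_cont k f : Sm k f -> continuous f.
Proof. by case: k => [|k] []. Qed.

Lemma Sm_Ck k f : Sm k f -> Ck k f.
Proof.
elim: k f => [|k IH] f; first by case.
move=> [cf [df sf]]; split=> // v; exact: IH (sf v).
Qed.

Lemma Sm_pred k f : Sm k.+1 f -> Sm k f.
Proof.
elim: k f => [|k IH] f Sf; first by split => //; exact: Sm_cont Sf.
have [d s] := Sm_derive Sf; apply: (SmS (Sm_cont Sf) d) => v; exact: IH.
Qed.

Lemma Sm_add k f g : Sm k f -> Sm k g -> Sm k (fun x => f x + g x).
Proof.
have cc f' g' : continuous f' -> continuous g' -> continuous (fun x : R * R => f' x + g' x : R).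
  by move=> cf cg x; apply: cvgD; [exact: cf|exact: cg].
elim: k f g => [|k IH] f g Sf Sg.
  by split=> //; apply: cc; [exact: Sm_cont Sf|exact: Sm_cont Sg].
have [df sf] := Sm_derive Sf; have [dg sg] := Sm_derive Sg.
apply: (@SmS _ _ (fun v x => 'D_v f x + 'D_v g x)).
- by apply: cc; [exact: Sm_cont Sf|exact: Sm_cont Sg].
- by move=> v; exact: IH.
Qed.

Lemma Sm_mul k f g : Sm k f -> Sm k g -> Sm k (fun x => f x * g x).
Proof.
have cc f' g' : continuous f' -> continuous g' -> continuous (fun x : R * R => f' x * g' x : R).
  by move=> cf cg x; apply: cvgM; [exact: cf|exact: cg].
elim: k f g => [|k IH] f g Sf Sg.
  by split=> //; apply: cc; [exact: Sm_cont Sf|exact: Sm_cont Sg].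
have [df sf] := Sm_derive Sf; have [dg sg] := Sm_derive Sg.
apply: (@SmS _ _ (fun v x => f x * 'D_v g x + g x * 'D_v f x)).
- by apply: cc; [exact: Sm_cont Sf|exact: Sm_cont Sg].
- by move=> v; apply: Sm_add; apply: IH => //; exact: Sm_pred.
Qed.

Lemma Sm_cst k (a : R) : Sm k (fun=> a).
Proof.
elim: k a => [|k IH] a; first by split => // x; exact: cvg_cst.
apply: (@SmS _ _ (fun _ _ => 0)) => //.
by move=> x; exact: cvg_cst.
Qed.

Lemma Sm_opp k f : Sm k f -> Sm k (fun x => - f x).
Proof.
move=> sf; have -> : (fun x => - f x) = (fun x => -1 * f x).
  by apply/funext => x; rewrite mulN1r.
by apply: Sm_mul => //; exact: Sm_cst.
Qed.

(** Reduces a directional derivative in the plane to a derivative in one variable, where the chain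
    rule for [u \o f] is available. *)
Lemma is_derive_line f x v (df : R) :
  is_derive x v f df <-> is_derive (0 : R) 1 (fun h : R => f (h *: v + x)) df.
Proof.
have E : (fun h : R => h^-1 *: ((f \o shift x) (h *: v) - f x)) =
    (fun h : R => h^-1 *: (((fun h : R => f (h *: v + x)) \o shift 0) (h *: 1) - f (0 *: v + x))).
  by apply/funext => h; rewrite /= /shift /= addr0 scale0r add0r /GRing.scale /= mulr1.
by split => -[dd dv]; split; rewrite /derivable /derive ?E // -?E.
Qed.

Lemma is_derive_comp2 (u : R -> R) f x v (du df : R) :
  is_derive (f x) 1 u du -> is_derive x v f df -> is_derive x v (u \o f) (du * df).
Proof.
move=> hu /is_derive_line hf; apply/is_derive_line.
apply: (@is_derive1_comp R u (fun h => f (h *: v + x))) => //.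
by rewrite scale0r add0r.
Qed.

Lemma smooth1_continuous (u : R -> R) : smooth1 u -> continuous u.
Proof.
by move=> su x; apply: differentiable_continuous; apply/derivable1_diffP; exact: smooth1_derivable.
Qed.

Lemma Sm_comp1 k (u : R -> R) f : smooth1 u -> Sm k f -> Sm k (u \o f).
Proof.
have cc (u' : R -> R) f' : smooth1 u' -> continuous f' -> continuous (u' \o f').
  by move=> su cf x; apply: continuous_comp; [exact: cf|exact: smooth1_continuous].
elim: k u f => [|k IH] u f su Sf.
  by split => //; apply: cc => //; exact: Sm_cont Sf.
have [df sf] := Sm_derive Sf.
apply: (@SmS _ _ (fun v x => (derive1 u \o f) x * 'D_v f x)).
- by apply: cc => //; exact: Sm_cont Sf.
- move=> x v; apply: is_derive_comp2 => //.
  by rewrite /= derive1E; apply/derivableP; exact: smooth1_derivable.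
- move=> v; apply: Sm_mul => //; apply: IH; [exact: smooth1_derive|exact: Sm_pred].
Qed.

Lemma Sm_inv k f : (forall x, f x != 0) -> Sm k f -> Sm k (fun x => (f x)^-1).
Proof.
move=> f0; elim: k => [|k IH] Sf.
  by split=> // x; apply: cvgV; [exact: f0|exact: (Sm_cont Sf)].
have [df sf] := Sm_derive Sf; have iS := IH (Sm_pred Sf).
apply: (@SmS _ _ (fun v x => - ((f x)^-1 * (f x)^-1) * 'D_v f x)).
- by move=> x; apply: cvgV; [exact: f0|exact: (Sm_cont Sf)].
- move=> x v; have dx := df x v; split; first exact: derivableV.
  by rewrite deriveV// /GRing.scale /= expr2 invfM.
- by move=> v; apply: Sm_mul => //; apply: Sm_opp; exact: Sm_mul.
Qed.

Lemma Sm_atan_ratio k f g : (forall x, 0 < g x) -> Sm k f -> Sm k g ->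
  Sm k (fun x => atan (f x / g x)).
Proof.
move=> g0 Sf Sg; have gn0 x : g x != 0 by rewrite gt_eqF.
have cc : continuous (fun x => atan (f x / g x)).
  move=> x; apply: (continuous_comp (f := fun x => f x / g x)); last exact: continuous_atan.
  by apply: cvgM; [exact: (Sm_cont Sf)|apply: cvgV => //; exact: (Sm_cont Sg)].
case: k Sf Sg => [|k] Sf Sg; first by split.
have Sr := Sm_mul Sf (Sm_inv gn0 Sg); have [dr sr] := Sm_derive Sr.
apply: (@SmS _ _ (fun v x => (1 + (f x / g x) * (f x / g x))^-1 * 'D_v (fun x => f x / g x) x)) => //.
  by move=> x v; apply: (@is_derive_comp2 _ (fun x => f x / g x)).
move=> v; apply: Sm_mul => //; apply: Sm_inv.
  by move=> x; rewrite gt_eqF// ltr_pwDl// -expr2 sqr_ge0.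
apply: Sm_add; first exact: Sm_cst.
by apply: Sm_mul; exact: Sm_pred Sr.
Qed.

Lemma Sm_fst k : Sm k (fst : R * R -> R).
Proof.
have c : continuous (fst : R * R -> R) by move=> x; exact: cvg_fst.
case: k => [|k]; first by split.
apply: (@SmS _ _ (fun v _ => v.1)) => //; last by move=> v; exact: Sm_cst.
move=> x v; apply/is_derive_line.
have -> : (fun h : R => (h *: v + x).1) = (fun h : R => h * v.1 + x.1) by [].
by apply: is_derive_eq; rewrite /GRing.scale /= mulr0 mulr1 ?add0r ?addr0.
Qed.

Lemma Sm_snd k : Sm k (snd : R * R -> R).
Proof.
have c : continuous (snd : R * R -> R) by move=> x; exact: cvg_snd.
case: k => [|k]; first by split.
apply: (@SmS _ _ (fun v _ => v.2)) => //; last by move=> v; exact: Sm_cst.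
move=> x v; apply/is_derive_line.
have -> : (fun h : R => (h *: v + x).2) = (fun h : R => h * v.2 + x.2) by [].
by apply: is_derive_eq; rewrite /GRing.scale /= mulr0 mulr1 ?add0r ?addr0.
Qed.

Lemma smooth1_trig : smooth1 (@sin R) /\ smooth1 (@cos R).
Proof.
have n1 : `|1 : R| <= 1 by rewrite normr1.
have sE : @sin R = (fun x : R => 1 * sin (1 * x)) by apply/funext => x; rewrite !mul1r.
have cE : @cos R = (fun x : R => 1 * cos (1 * x)) by apply/funext => x; rewrite !mul1r.
split => k; [rewrite sE|rewrite cE].
  by have [] := BN_derive1n k (fun j => (BN_trig j 1 n1).1).
by have [] := BN_derive1n k (fun j => (BN_trig j 1 n1).2).
Qed.

Variable m : nat.

(** The translation [s] serves the inverse diffeomorphism, whose fibre map is read at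
    [x - alpha]. *)
Lemma Sm_plift k (A : R -> mat2 R) (s : R) :
  (forall b b', smooth1 (fun x : R => entry b b' (A x))) -> (forall x : R, pos2 (A x)) ->
  Sm k (fun x => plift m (A (x.1 + s)) x.2).
Proof.
move=> sA pA; have [ss sc] := smooth1_trig.
have S1 : Sm k (fun x => x.1 + s) by apply: Sm_add (Sm_fst k) (Sm_cst k s).
have Sa b b' : Sm k (fun x => entry b b' (A (x.1 + s))) by apply: (Sm_comp1 (sA b b') S1).
have S2 : Sm k (fun x => wfreq R m * x.2) by apply: Sm_mul (Sm_cst k _) (Sm_snd k).
have Sc : Sm k (fun x => cos (wfreq R m * x.2)) := Sm_comp1 sc S2.
have Ss : Sm k (fun x => sin (wfreq R m * x.2)) := Sm_comp1 ss S2.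
apply: Sm_add (Sm_snd k) _; apply: Sm_mul (Sm_cst k _); apply: Sm_atan_ratio.
- by move=> x; exact: pA.
- apply: Sm_add; last first.
    by apply: Sm_opp; apply: Sm_mul (Sa true false) _; rewrite /=; exact: Sm_mul.
  apply: Sm_add; first by apply: Sm_mul (Sa false true) _; exact: Sm_mul.
  apply: Sm_mul; last exact: Sm_mul.
  by apply: Sm_add (Sa false false) _; apply: Sm_opp; exact: (Sa true true).
- apply: Sm_add; last by apply: Sm_mul (Sa false false) _; exact: Sm_mul.
  apply: Sm_add; first by apply: Sm_mul (Sa true true) _; exact: Sm_mul.
  apply: Sm_mul; last exact: Sm_mul.
  by apply: Sm_add (Sa true false) (Sa false true).
Qed.

End smooth2.

(** * Maps of the torus given by lifts *)

Section torus_lifts.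
Context (R : realType).
Implicit Types (x y : R) (s t : torus1 R).

Lemma toT_int x (z : int) : toT (x + z%:~R) = toT x.
Proof. by apply/eqP; rewrite toT_eq addrAC subrr add0r intr_int. Qed.

Lemma toT_eqP x y : toT x = toT y -> exists z : int, y = x + z%:~R.
Proof.
move=> /eqP; rewrite eq_sym toT_eq => /intrP[z e]; exists z; rewrite -e; ring.
Qed.
Lemma toT_repr x : exists z : int, repr (toT x) = x + z%:~R.
Proof. by apply: toT_eqP; rewrite /toT reprK. Qed.

Lemma reprT t : toT (repr t) = t. Proof. by rewrite /toT reprK. Qed.
Lemma mdist_toT_le x y : mdist (toT x) (toT y) <= `|x - y|.
Proof. by rewrite mdist_torus1E -toTB torus1_norm_le. Qed.

Lemma toT_near x t (d : R) : mdist (toT x) t < d -> exists2 y, toT y = t & `|x - y| < d.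
Proof.
rewrite mdist_torus1E => h.
have [||_ [u /= ut <-] ud] := @inf_lt _ [set `|x| | x in toT @^-1` [set (toT x - t)]] d => //.
  by have [v vt] := toT_surj (toT x - t); exists `|v|, v.
exists (x - u); first by rewrite toTB ut opprB addrC subrK.
by rewrite opprB addrC subrK.
Qed.
Lemma mdist_prodE (M N : metricType R) (p q : M * N) :
  mdist p q = Num.max (mdist p.1 q.1) (mdist p.2 q.2).
Proof. by []. Qed.

Lemma torus2_continuous (f : torus2 R -> torus2 R) (F1 F2 : R * R -> R) :
  continuous F1 -> continuous F2 ->
  (forall x : R * R, f (toT x.1, toT x.2) = (toT (F1 x), toT (F2 x))) -> continuous f.
Proof.
move=> c1 c2 fF [s t]; have [x xs] := toT_surj s; have [y yt] := toT_surj t.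
apply/cvg_ballP => e e0.
have /cvgrPdist_lt/(_ _ e0) h1 := c1 (x, y); have /cvgrPdist_lt/(_ _ e0) h2 := c2 (x, y).
have [d /= d0 hd] : \forall z \near (x, y), `|F1 (x, y) - F1 z| < e /\ `|F2 (x, y) - F2 z| < e.
  by apply: filterS2 h1 h2.
have [d' /= d'0 sd] : exists2 d' : R, 0 < d' & forall z : R * R, `|x - z.1| < d' -> `|y - z.2| < d' ->
     `|F1 (x, y) - F1 z| < e /\ `|F2 (x, y) - F2 z| < e.
  case: d d0 hd => A B [/= /nbhs_ballP[a a0 hA] /nbhs_ballP[b b0 hB]] hd.
  exists (Num.min a b); first by rewrite lt_min a0 b0.
  move=> z; rewrite !lt_min => /andP[z1 _] /andP[_ z2]; apply: hd.
  by split; [exact: hA|exact: hB].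
apply: filterS (nbhsx_ballx (s, t) _ d'0) => -[s' t'] [/=]; rewrite !ballEmdist /= -xs -yt.
move=> /toT_near[x' <- xx'] /toT_near[y' <- yy'].
have := sd (x', y') xx' yy' => -[e1 e2].
rewrite (fF (x, y)) (fF (x', y')) mdist_prodE gt_max.
by rewrite (le_lt_trans (mdist_toT_le _ _) e1) (le_lt_trans (mdist_toT_le _ _) e2).
Qed.

End torus_lifts.

(** * The diffeomorphism of the torus *)

Section phi.
Context (R : realType) (m : nat) (m0 : (0 < m)%N).
Local Notation al := (alpha R m).
Local Notation F := (@Finf R m).
Local Notation Fi := (@Finv R m).

(** Evaluated at arbitrary representatives; by [fibTE] the choice does not matter for a fibre map
    that is periodic in [x] and commutes with integer translations of [y]. *)
Definition fibT (A : R -> R -> R) (s t : torus1 R) : torus1 R := toT (A (repr s) (repr t)).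

Lemma fibTE (A : R -> R -> R) x y :
  (forall x y (z : int), A x (y + z%:~R) = A x y + z%:~R) ->
  (forall x (z : int), A (x + z%:~R) =1 A x) -> fibT A (toT x) (toT y) = toT (A x y).
Proof.
move=> A1 A2; rewrite /fibT; have [z ->] := toT_repr x; have [z' ->] := toT_repr y.
by rewrite A2 A1 toT_int.
Qed.

Lemma Finf_shiftZ x y (z : int) : F x (y + z%:~R) = F x y + z%:~R.
Proof.
have -> : z%:~R = (z * m)%:~R / m%:R :> R by rewrite intrM mulfK// gt_eqF// mR_gt0.
exact: Finf_shift.
Qed.

Lemma Finv_shiftZ x y (z : int) : Fi x (y + z%:~R) = Fi x y + z%:~R.
Proof.
have -> : z%:~R = (z * m)%:~R / m%:R :> R by rewrite intrM mulfK// gt_eqF// mR_gt0.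
exact: Finv_shift.
Qed.
Lemma Finf_base x (z : int) : F (x + z%:~R) =1 F x.
Proof. by move=> y; rewrite /Finf Ainf_base. Qed.
Lemma Finv_base x (z : int) : Fi (x + z%:~R) =1 Fi x.
Proof. by move=> y; rewrite /Finv Ainf_base. Qed.

Definition phi_fun (z : torus2 R) : torus2 R := (z.1 + toT al, fibT F z.1 z.2).
Definition phi_inv (z : torus2 R) : torus2 R := (z.1 - toT al, fibT Fi (z.1 - toT al) z.2).

Lemma phi_funE x y : phi_fun (toT x, toT y) = (toT (x + al), toT (F x y)).
Proof.
by rewrite /phi_fun /= toTD fibTE//; [exact: Finf_shiftZ|exact: Finf_base].
Qed.

Lemma phi_invE x y : phi_inv (toT x, toT y) = (toT (x - al), toT (Fi (x - al) y)).
Proof.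
by rewrite /phi_inv /= -toTB fibTE//; [exact: Finv_shiftZ|exact: Finv_base].
Qed.

Lemma Cinfty_Finf : Cinfty (fun x : R * R => F x.1 x.2).
Proof.
move=> k; apply: Sm_Ck.
have := @Sm_plift R m k _ 0 (smooth1_Ainf m0) (fun x => near1_pos (near1_Ainf m0 x)).
by congr Sm; apply/funext => x; rewrite addr0.
Qed.

Lemma smooth1_opp (f : R -> R) : smooth1 f -> smooth1 (fun x => - f x).
Proof.
move=> sf; have main k : derive1n k (fun x => - f x) = (fun x => - derive1n k f x).
  elim: k => [//|k IH]; rewrite derive1nS IH; apply/funext => x.
  rewrite derive1E [LHS]deriveN; last exact: sf.
  by rewrite -derive1E -derive1nS.
by move=> k x; rewrite main; apply: derivableN; exact: sf.
Qed.

Lemma Cinfty_Finv : Cinfty (fun x : R * R => Fi (x.1 - al) x.2).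
Proof.
move=> k; apply: Sm_Ck.
have sa b b' : smooth1 (fun x : R => entry b b' (adj2 (Ainf m x))).
  have h c c' := @smooth1_Ainf R m m0 c c'.
  by case: b b' => -[]; [have := h false false|have := smooth1_opp (h true false)|
    have := smooth1_opp (h false true)|have := h true true].
exact: (@Sm_plift R m k _ (- al) sa (fun x => near1_pos (near1_adj (near1_Ainf m0 x)))).
Qed.
Lemma Cinfty_fst (s : R) : Cinfty (fun x : R * R => x.1 + s).
Proof. by move=> k; apply: Sm_Ck; apply: Sm_add (Sm_fst R k) (Sm_cst k s). Qed.
Lemma Cinfty_continuous (f : R * R -> R) : Cinfty f -> continuous f.
Proof. by move=> /(_ 0%N). Qed.

Lemma phi_funK : cancel phi_fun phi_inv.
Proof.
case=> s t; have [x <-] := toT_surj s; have [y <-] := toT_surj t.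
by rewrite phi_funE phi_invE addrK FinfK.
Qed.

Lemma phi_invK : cancel phi_inv phi_fun.
Proof.
case=> s t; have [x <-] := toT_surj s; have [y <-] := toT_surj t.
by rewrite phi_invE phi_funE subrK FinvK.
Qed.

Lemma phi_fun_continuous : continuous phi_fun.
Proof.
apply: (torus2_continuous (Cinfty_continuous (Cinfty_fst al))
  (Cinfty_continuous Cinfty_Finf)) => -[x y]; exact: phi_funE.
Qed.

Lemma phi_inv_continuous : continuous phi_inv.
Proof.
apply: (torus2_continuous (Cinfty_continuous (Cinfty_fst (- al)))
  (Cinfty_continuous Cinfty_Finv)) => -[x y]; exact: phi_invE.
Qed.

Lemma compact_torus2 : compact [set: torus2 R].
Proof.
by rewrite -setXTT; apply: compact_setX; exact: compact_torus1.
Qed.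

Definition phi : tds (torus2 R) :=
  Tds compact_torus2 phi_fun_continuous phi_inv_continuous phi_funK phi_invK.

Lemma phi_smooth : smooth_diffeo phi.
Proof.
split.
  exists (fun x => x.1 + al), (fun x => F x.1 x.2).
  by split; [exact: Cinfty_fst|exact: Cinfty_Finf|move=> [x y]; exact: phi_funE].
exists (fun x => x.1 - al), (fun x => Fi (x.1 - al) x.2).
by split; [exact: Cinfty_fst|exact: Cinfty_Finv|move=> [x y]; exact: phi_invE].
Qed.
Lemma phi_skew : is_skew_product phi (toT al).
Proof. by exists (fibT F). Qed.

End phi.

(** * Shadowing of orbits, rigidity times and half-turn times *)

Section orbits.
Context (R : realType) (m : nat) (m0 : (0 < m)%N).
Local Notation q n := ((qn m n)%:R : R).
Local Notation l n := ((ell m n)%:R : R).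
Local Notation G n := ((Gn m n)%:R : R).
Local Notation S n := ((Sn m n)%:R : R).
Local Notation L n := ((Lam m n)%:R : R).
Local Notation al := (alpha R m).
Local Notation ep n := (eps R m n).
Local Notation phi := (@phi R m m0).
Implicit Types (x y u v t : R) (n k s : nat).

(** The conjugacy of step [n] as a map from the plane to the torus. In the coordinates [(x, u)] the
    [n]-th approximation merely rotates [x]. *)
Definition Kt n x u : torus2 R := (toT x, toT (kap m n x u)).

Lemma Kt_onto n (z : torus2 R) : exists x u, z = Kt n x u.
Proof.
case: z => a b; have [x <-] := toT_surj a; have [y <-] := toT_surj b.
by exists x, (iot m n x y); rewrite /Kt kapK.
Qed.

Lemma Kt_lip n x x' u u' :
  mdist (Kt n x u) (Kt n x' u') <= L n * (`|x - x'| + `|u - u'|).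
Proof.
rewrite mdist_prodE ge_max; apply/andP; split; apply: le_trans (mdist_toT_le _ _) _.
  by rewrite -[leLHS]mul1r ler_pM ?L_ge1// lerDl.
exact: kap_lip.
Qed.
Lemma KtS n x u : Kt n.+1 x u = Kt n x (contr m (S n) (u - q n * x)).
Proof. by []. Qed.
Lemma Kt_base n x u (z : int) : Kt n (x + z%:~R) u = Kt n x u.
Proof. by rewrite /Kt toT_int kap_base// -intrN toT_int. Qed.
Lemma Kt_fib n x u (z : int) : Kt n x (u + z%:~R) = Kt n x u.
Proof. by rewrite /Kt kap_shiftZ// toT_int. Qed.

Lemma pow_Lam_le_ell n : (2 ^ n * Lam m n.+1 <= ell m n)%N.
Proof.
rewrite /ell (_ : n + 20 = 2 + (n + 18))%N; last by lia.
rewrite expnD; apply: (@leq_trans (Gn m n ^ 2)); last by rewrite leq_pmulr// expn_gt0 Gn_gt0.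
rewrite expnS expn1; apply: leq_mul; last by rewrite /Gn leq_pmull// muln_gt0 m0.
by apply: leq_trans (Gn_ge m0 n); rewrite leq_pmull.
Qed.

Lemma L_over_l n : L n.+1 / l n <= 2^-1 ^+ n.
Proof.
rewrite ler_pdivrMr ?l_gt0// exprVn mulrC ler_pdivlMr ?exprn_gt0// mulrC -natrX -natrM ler_nat.
exact: pow_Lam_le_ell.
Qed.

Lemma L_over_q n : L n / q n <= 2 * 2^-1 ^+ n.
Proof.
case: n => [|n]; first by rewrite divr1 mulr1 ler1n.
rewrite exprS mulrA divff ?mul1r//; apply: le_trans (L_over_l n).
by rewrite ler_wpM2l// lef_pV2 ?posrE ?q_gt0 ?l_gt0// ler_nat; exact: qn_ge_ell.
Qed.

Lemma L_mul_eps n : L n.+1 * ep n <= 2^-1 ^+ n / 8.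
Proof.
have := @L_eps R m m0 n 0; rewrite expr0 mulr1 => /(_ isT) h.
apply: (le_trans h); rewrite ler_wpM2l ?exprn_ge0// lef_pV2 ?posrE//.
  by have := mR_ge1 R m0; lra.
by rewrite mulr_gt0// mR_gt0.
Qed.

Lemma L_over_S n : L n / S n <= 2^-1 ^+ n / 4.
Proof.
rewrite ler_pdivrMr ?S_gt0//.
have h : (2 ^ n.+2 * Lam m n <= Sn m n)%N.
  rewrite /Sn /contr_nat (expnS (Lam m n) 2) -mulnA leq_mul2l; apply/orP; right.
  have l2 : (0 < Lam m n ^ 2)%N by rewrite expn_gt0 Lam_gt0.
  by rewrite mulnCA leq_pmulr// muln_gt0 m0.
have h' : 2 ^+ n.+2 * L n <= S n by rewrite -natrX -natrM ler_nat.
have p2 : 0 < 2 ^+ n :> R by rewrite exprn_gt0.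
rewrite exprVn -invfM mulrC ler_pdivlMr ?mulr_gt0//.
by apply: le_trans h'; rewrite !exprS mulrC; lra.
Qed.

Fixpoint ylift x y k : R := if k is k'.+1 then Finf m (x + k'%:R * al) (ylift x y k') else y.

Lemma iter_phi x y k :
  iter k phi (toT x, toT y) = (toT (x + k%:R * al), toT (ylift x y k)).
Proof.
elim: k => [|k IH]; first by rewrite mul0r addr0.
rewrite iterS IH /= (phi_funE m0) -addrA -[k.+1%:R]natr1.
by congr (toT _, _); ring.
Qed.
Lemma Finf_Fm n x y : `|Finf m x y - Fm m n x y| <= 2^-1 ^+ n / G n ^+ 12.
Proof. by rewrite ler_pdivlMr ?exprn_gt0 ?G_gt0// Finf_dist. Qed.

(** The cocycle [Fm n] leaves the coordinate [u] fixed, so only the distance between [Finf] and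
    [Fm n] accumulates, linearly in time. The integer [z] gathers the corrections [Qn n]. *)
Lemma shadow_lift n x u k : exists z : int,
  `|iot m n (x + k%:R * al) (ylift x (kap m n x u) k - z%:~R) - u| <=
    k%:R * (L n * (2^-1 ^+ n / G n ^+ 12)).
Proof.
have [Q QE] := @Qn_int R m n.
elim: k => [|k [z IH]]; first by exists 0; rewrite !mul0r addr0 subr0 iotK// subrr normr0.
exists (z + Q); set y := ylift _ _ k in IH *; set x' := x + k%:R * al in IH *.
have -> : x + k.+1%:R * al = x' + al by rewrite /x' -natr1; ring.
rewrite /= -/y -/x'.
have e1 : iot m n (x' + al) (Fm m n x' (y - z%:~R) - Q%:~R) = iot m n x' (y - z%:~R).
  by rewrite /Fm QE addrK iotK.
have e2 : Finf m x' y - (z + Q)%:~R = Finf m x' (y - z%:~R) - Q%:~R.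
  by rewrite -(intrN _ z) Finf_shiftZ// intrN intrD; ring.
rewrite e2.
have := iot_lip m0 n (x' + al) (Finf m x' (y - z%:~R) - Q%:~R) (Fm m n x' (y - z%:~R) - Q%:~R).
rewrite e1 opprB addrA subrK => h1.
have h2 := le_trans h1 (ler_wpM2l (ltW (L_gt0 R m0 n)) (Finf_Fm n x' (y - z%:~R))).
have := ler_normD (iot m n (x' + al) (Finf m x' (y - z%:~R) - Q%:~R) - iot m n x' (y - z%:~R))
  (iot m n x' (y - z%:~R) - u).
rewrite addrA subrK -[k.+1%:R]natr1 mulrDl mul1r; lra.
Qed.

(** During [s] periods of length [q n] the true orbit follows the rotation of the base coordinate. A
    time of [s q] steps and two Lipschitz constants cost at most [s * G ^ 3], well within the
    available twelfth power. *)
Lemma shadow n x u k s : (k <= s * qn m n)%N ->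
  mdist (iter k phi (Kt n x u)) (Kt n (x + k%:R * al) u) <= s%:R * 2^-1 ^+ n.
Proof.
move=> ks; rewrite iter_phi; have [z h] := shadow_lift n x u k.
have G0 := G_gt0 R m0 n; have G1 : 1 <= G n by apply: le_trans (G_ge16 R m0 n); rewrite ler1n.
have p0 : 0 <= 2^-1 ^+ n :> R by rewrite exprn_ge0.
rewrite mdist_prodE /= mdistxx ge_max mulr_ge0//=.
set y := ylift _ _ _ in h *; set x' := x + _ in h *.
rewrite -(toT_int y (- z)) intrN; apply: le_trans (mdist_toT_le _ _) _.
rewrite -[y - _](kapK m0 n x'); apply: le_trans (kap_lip m0 n x' x' _ _) _.
rewrite subrr normr0 add0r; apply: le_trans (ler_wpM2l _ h) _ => //.
have kq : k%:R <= s%:R * q n by rewrite -natrM ler_nat.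
have [_ [_ [LG qG]]] := G_ge_Lam R m0 n.
have -> : L n * (k%:R * (L n * (2^-1 ^+ n / G n ^+ 12))) =
  (k%:R * L n ^+ 2 / G n ^+ 12) * 2^-1 ^+ n by ring.
rewrite ler_wpM2r// ler_pdivrMr ?exprn_gt0//.
apply: (@le_trans _ _ (s%:R * q n * L n ^+ 2)); first by rewrite ler_wpM2r ?sqr_ge0.
rewrite -mulrA ler_wpM2l//; apply: (@le_trans _ _ (G n * G n ^+ 2)).
  have h1 : L n ^+ 2 <= G n ^+ 2 by rewrite lerXn2r ?nnegrE ?(ltW G0).
  by apply: ler_pM => //; exact: sqr_ge0.
by rewrite -exprS ler_weXn2l.
Qed.
Lemma natM_alpha n k : (k * qn m n)%:R * al = k%:R * ep n + (Posz (k * pn m n))%:~R.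
Proof. by rewrite /eps -[(Posz _)%:~R]/((k * pn m n)%:R) !natrM; ring. Qed.

(** Modulo 1, [q n * alpha] is [eps n], which is [1 / ell n] up to an error [eps n.+1 / ell n].
    Iterating [phi] by [s * q n] thus moves the base coordinate in steps of [s / ell n]. *)
Lemma shadow_q n x u s k : (k <= ell m n)%N ->
  mdist (iter (s * qn m n * k) phi (Kt n.+1 x u)) (Kt n.+1 (x + (s * k)%:R / l n) u) <=
  s%:R * 2^-1 ^+ n.
Proof.
move=> kl; have h : (s * qn m n * k <= s * qn m n.+1)%N.
  by rewrite -mulnA leq_mul2l qnS leq_mul2l kl !orbT.
apply: le_trans (metric_triangle _ _ _) _; apply: le_trans (lerD (shadow _ _ h) (lexx _)) _.
have -> : (s * qn m n * k)%N = ((s * k) * qn m n)%N by lia.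
rewrite natM_alpha addrA Kt_base.
have h2 := Kt_lip n.+1 (x + (s * k)%:R * ep n) (x + (s * k)%:R / l n) u u.
rewrite subrr normr0 addr0 in h2.
have e0 := eps_gt0 R m0 n.+1; have l0 := l_gt0 R m0 n.
have h3 : `|x + (s * k)%:R * ep n - (x + (s * k)%:R / l n)| <= s%:R * ep n.+1.
  have -> : x + (s * k)%:R * ep n - (x + (s * k)%:R / l n) = (s * k)%:R * (l n * ep n - 1) / l n.
    by field; rewrite gt_eqF.
  rewrite eps_rec// addrAC subrr add0r.
  have -> : (s * k)%:R * ep n.+1 / l n = (s%:R * ep n.+1) * (k%:R / l n) by rewrite natrM; ring.
  have se : 0 <= s%:R * ep n.+1 by rewrite mulr_ge0// ltW.
  rewrite ger0_norm; last by rewrite mulr_ge0// divr_ge0// ltW.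
  by rewrite ler_piMr// ler_pdivrMr// mul1r ler_nat.
have h4 := L_mul_eps n.+1.
have h5 : L n.+1 * ep n.+1 <= L n.+2 * ep n.+1.
  by rewrite ler_wpM2r ?(ltW e0)// ler_nat Lam_homo.
have := le_trans h2 (ler_wpM2l (ltW (L_gt0 R m0 n.+1)) h3).
have s0 : 0 <= s%:R :> R by [].
have := ler_wpM2l s0 (le_trans h5 h4).
have p0 : 0 <= 2^-1 ^+ n :> R by rewrite exprn_ge0.
have := mulr_ge0 s0 p0.
by rewrite exprS; lra.
Qed.

(** The shear in front of the last contraction turns the displacement [u' - u], reduced modulo 1,
    into a base displacement below [1 / q n]. The earlier steps, with Lipschitz constant [L n],
    hardly notice it. Any two transported circles therefore nearly coincide after a rotation of the
    parameter. *)
Lemma KtS_twist n x x' u u' : exists2 c : R, 0 <= c < 1 &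
  forall t, mdist (Kt n.+1 (x + t) u) (Kt n.+1 (x' + c + t) u') <= 2 * 2^-1 ^+ n.
Proof.
have q0 := q_gt0 R m0 n; have qn0 : q n != 0 by rewrite gt_eqF.
pose z := Num.floor (u' - u); pose b : R := u' - u - z%:~R.
pose c0 := x - x' + b / q n; pose zc := Num.floor c0.
have /andP[b0 b1] : 0 <= b < 1.
  by have := floor_itv (u' - u); rewrite /b -/z intrD1 => /andP[]; lra.
exists (c0 - zc%:~R).
  by have := floor_itv c0; rewrite -/zc intrD1 => /andP[]; lra.
move=> t.
have -> : x' + (c0 - zc%:~R) + t = (x + b / q n + t) + (- zc)%:~R.
  by rewrite intrN /c0; ring.
rewrite Kt_base !KtS.
have -> : u' - q n * (x + b / q n + t) = u - q n * (x + t) + z%:~R.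
  by rewrite /b; field.
rewrite contr_shiftZ// Kt_fib; apply: le_trans (Kt_lip _ _ _ _ _) _.
rewrite subrr normr0 addr0; apply: le_trans (L_over_q n).
rewrite ler_wpM2l//.
have -> : x + t - (x + b / q n + t) = - (b / q n) by ring.
rewrite normrN ger0_norm ?divr_ge0 ?(ltW q0)//.
by rewrite -[leRHS]mul1r ler_wpM2r ?invr_ge0 ?ltW.
Qed.

Lemma nat_floor (r : R) : 0 <= r -> exists k : nat, k%:R <= r < k%:R + 1.
Proof.
move=> r0; exists (Num.truncn r); have := truncn_itv r0.
by rewrite -natr1.
Qed.

Lemma orbit_shift n s (z z' : torus2 R) : (0 < s)%N -> exists k0, forall k, (k < ell m n)%N ->
  mdist (iter (s * qn m n * k) phi z) (iter (s * qn m n * ((k + k0) %% ell m n)) phi z')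
    <= 5 * s%:R * 2^-1 ^+ n.
Proof.
move=> s0; have [x [u ->]] := Kt_onto n.+1 z; have [x' [u' ->]] := Kt_onto n.+1 z'.
have l0 := l_gt0 R m0 n; have sR : 0 < s%:R :> R by rewrite ltr0n.
have [c /andP[c0 c1] hc] := KtS_twist n x x' u u'.
have [k0 /andP[k0l k0u]] : exists k0 : nat, k0%:R <= c * l n / s%:R < k0%:R + 1.
  by apply: nat_floor; rewrite divr_ge0 ?mulr_ge0// ltW.
exists k0 => k kl; set k1 := ((k + k0) %% ell m n)%N.
have k1l : (k1 < ell m n)%N by rewrite ltn_mod ell_gt0.
have h1 := shadow_q x u s (ltnW kl); have h2 := shadow_q x' u' s (ltnW k1l).
pose t : R := (s * k)%:R / l n.
have h3 := hc t.
have h4 : mdist (Kt n.+1 (x' + (s * k1)%:R / l n) u') (Kt n.+1 (x' + c + t) u') <= s%:R * 2^-1 ^+ n.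
  have kE : (s * k1)%:R / l n = (s * k)%:R / l n + s%:R * k0%:R / l n -
      (Posz (s * ((k + k0) %/ ell m n)))%:~R.
    have : (k + k0)%:R = ((k + k0) %/ ell m n)%:R * l n + k1%:R by rewrite -natrM -natrD -divn_eq.
    rewrite -[(Posz _)%:~R]/((s * _)%:R) !natrM natrD => e.
    have -> : k1%:R = k%:R + k0%:R - ((k + k0) %/ ell m n)%:R * l n by rewrite e addrAC subrr add0r.
    by field; rewrite gt_eqF.
  rewrite kE addrA -[- _%:~R]intrN Kt_base; apply: le_trans (Kt_lip _ _ _ _ _) _.
  rewrite subrr normr0 addr0.
  have -> : x' + ((s * k)%:R / l n + s%:R * k0%:R / l n) - (x' + c + t) = s%:R * k0%:R / l n - c.
    by rewrite /t; ring.
  have e1 : `|s%:R * k0%:R / l n - c| <= s%:R / l n.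
    have -> : s%:R * k0%:R / l n - c = (s%:R * k0%:R - c * l n) / l n by field; rewrite gt_eqF.
    rewrite normrM normfV (gtr0_norm l0) ler_pM2r ?invr_gt0//.
    rewrite ler_pdivlMr// in k0l; rewrite ltr_pdivrMr// in k0u.
    by rewrite ler_norml; apply/andP; split; lra.
  apply: le_trans (ler_wpM2l _ e1) _ => //.
  by have := ler_wpM2l (ltW sR) (L_over_l n); rewrite mulrCA.
have s1 : 1 <= s%:R :> R by rewrite ler1n.
have p0 : 0 <= 2^-1 ^+ n :> R by rewrite exprn_ge0.
have := ler_wpM2r p0 s1; rewrite mul1r => sp.
apply: le_trans (metric_triangle _ (Kt n.+1 (x + t) u) _) _.
have := metric_triangle (Kt n.+1 (x + t) u) (Kt n.+1 (x' + c + t) u')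
  (iter (s * qn m n * k1) phi (Kt n.+1 x' u')).
have := metric_triangle (Kt n.+1 (x' + c + t) u') (Kt n.+1 (x' + (s * k1)%:R / l n) u')
  (iter (s * qn m n * k1) phi (Kt n.+1 x' u')).
rewrite metric_sym in h4; rewrite metric_sym in h2.
lra.
Qed.

(** During the time [q n] the base coordinate moves only by [eps n] modulo 1, and the fibre
    coordinate stays. *)
Lemma rigid n (z : torus2 R) : mdist (iter (qn m n) phi z) z <= 2 * 2^-1 ^+ n.
Proof.
have [x [u ->]] := Kt_onto n z.
have h : (qn m n <= 1 * qn m n)%N by rewrite mul1n.
apply: le_trans (metric_triangle _ _ _) _; apply: le_trans (lerD (shadow x u h) (lexx _)) _.
have := natM_alpha n 1; rewrite mul1n => ->; rewrite addrA Kt_base mul1r.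
have := Kt_lip n (x + ep n) x u u; rewrite subrr normr0 addr0 addrAC subrr add0r mul1r.
have e0 := eps_gt0 R m0 n; rewrite gtr0_norm//.
have := L_mul_eps n; have : L n * ep n <= L n.+1 * ep n by rewrite ler_wpM2r ?(ltW e0)// ler_nat Lam_homo.
have p0 : 0 <= 2^-1 ^+ n :> R by rewrite exprn_ge0.
lra.
Qed.

(** By this time the base coordinate has moved by about [1 / (2 m q n)] modulo 1, which is half a
    period of the contraction of step [n]. *)
Definition tn n : nat := (ell m n %/ (2 * m))%N.

Lemma tn_alpha n : exists z : int,
  (tn n)%:R * al = (1 + ep n.+1) / (2 * m%:R * q n) + z%:~R.
Proof.
have [j jE] := dvdnP (dvd_ell m0 n); have mm := mR_gt0 R m0; have q0 := q_gt0 R m0 n.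
have tE : tn n = (j * qn m n)%N.
  rewrite /tn jE (_ : j * (2 * m * qn m n) = j * qn m n * (2 * m))%N; last by lia.
  by rewrite mulnK// muln_gt0.
exists (Posz (j * pn m n)); rewrite tE natM_alpha; congr (_ + _).
have := @eps_rec R m n; rewrite jE !natrM => <-.
by field; rewrite !gt_eqF.
Qed.

(** The small base displacement is invisible to the first [n] steps of the conjugacy, but it shifts
    the argument of the last contraction by [- 1 / (2 m)]. *)
Lemma half_turn n x u :
  mdist (iter (tn n) phi (Kt n.+1 x u))
    (Kt n x (contr m (S n) (u - q n * x - 1 / (2 * m%:R)))) <= 4 * 2^-1 ^+ n.
Proof.
have mm := mR_ge1 R m0; have q0 := q_gt0 R m0 n; have q1 := q_ge1 R m0 n.
have th : (tn n <= 1 * qn m n.+1)%N.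
  by rewrite mul1n; apply: leq_trans (qn_ge_ell m0 n); exact: leq_div.
apply: le_trans (metric_triangle _ _ _) _; apply: le_trans (lerD (shadow x u th) (lexx _)) _.
have [z zE] := tn_alpha n; rewrite zE addrA Kt_base.
set d := 1 / (2 * m%:R * q n).
have d0 : 0 <= d <= 1 / q n.
  rewrite divr_ge0 ?mulr_ge0 ?(ltW q0)//= ler_pdivrMr ?mulr_gt0//; last by lra.
  by rewrite mulrCA mul1r mulVf ?gt_eqF//; lra.
have e0 := eps_gt0 R m0 n.+1.
have h1 : mdist (Kt n.+1 (x + (1 + ep n.+1) / (2 * m%:R * q n)) u) (Kt n.+1 (x + d) u) <= 2^-1 ^+ n.+1 / 8.
  apply: le_trans (Kt_lip _ _ _ _ _) _; rewrite subrr normr0 addr0.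
  have -> : x + (1 + ep n.+1) / (2 * m%:R * q n) - (x + d) = ep n.+1 / (2 * m%:R * q n).
    by rewrite /d; ring.
  have mq : 1 <= 2 * m%:R * q n.
    by rewrite -[1]mul1r ler_pM//; lra.
  have em : 0 <= ep n.+1 / (2 * m%:R * q n).
    by rewrite divr_ge0 ?(ltW e0)// (le_trans ler01 mq).
  rewrite ger0_norm//.
  apply: le_trans (L_mul_eps n.+1); apply: ler_pM => //.
  - by rewrite ler_nat Lam_homo.
  - by rewrite ler_pdivrMr ?(lt_le_trans ltr01 mq)// ler_peMr// ltW.
have h2 : mdist (Kt n.+1 (x + d) u) (Kt n x (contr m (S n) (u - q n * x - 1 / (2 * m%:R)))) <= 2 * 2^-1 ^+ n.
  rewrite KtS; have -> : u - q n * (x + d) = u - q n * x - 1 / (2 * m%:R).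
    by rewrite /d; field; rewrite !gt_eqF//; lra.
  apply: le_trans (Kt_lip _ _ _ _ _) _; rewrite subrr normr0 addr0 addrAC subrr add0r.
  apply: le_trans (L_over_q n); rewrite ler_wpM2l//.
  by move/andP: d0 => [d1 d2]; rewrite mul1r in d2; rewrite ger0_norm.
have := metric_triangle (Kt n.+1 (x + (1 + ep n.+1) / (2 * m%:R * q n)) u) (Kt n.+1 (x + d) u)
 (Kt n x (contr m (S n) (u - q n * x - 1 / (2 * m%:R)))).
have p0 : 0 <= 2^-1 ^+ n :> R by rewrite exprn_ge0.
rewrite exprS in h1 *; lra.
Qed.

Lemma flat_close n x a b c : `|contr m (S n) a - c| <= 1 / S n -> `|contr m (S n) b - c| <= 1 / S n ->
  mdist (Kt n x (contr m (S n) a)) (Kt n x (contr m (S n) b)) <= 2^-1 ^+ n / 2.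
Proof.
move=> ha hb; have := Kt_lip n x x (contr m (S n) a) (contr m (S n) b).
rewrite subrr normr0 add0r => /le_trans; apply.
have h : `|contr m (S n) a - contr m (S n) b| <= 2 / S n.
  by have := ler_normB (contr m (S n) a - c) (contr m (S n) b - c); rewrite opprB addrA subrK; lra.
by have := ler_wpM2l (ltW (L_gt0 R m0 n)) h; have := L_over_S n; rewrite mulrCA; lra.
Qed.

(** Both arguments lie in the flat part around the attracting point [j / m], so the contraction
    brings the two points together. *)
Lemma half_turn_flat n x u v (j : int) :
  `|u - q n * x - 1 / (2 * m%:R) - j%:~R / m%:R| <= 1 / (2 * m%:R) - 1 / S n ->
  `|v - q n * x - j%:~R / m%:R| <= 1 / (2 * m%:R) - 1 / S n ->
  mdist (iter (tn n) phi (Kt n.+1 x u)) (Kt n.+1 x v) <= 5 * 2^-1 ^+ n.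
Proof.
move=> hu hv; have S1 := S_ge1 R m0 n; apply: le_trans (metric_triangle _ _ _) _.
apply: le_trans (lerD (half_turn n x u) (lexx _)) _; rewrite KtS.
have := flat_close x (contr_flat m0 S1 hu) (contr_flat m0 S1 hv).
have : 0 <= 2^-1 ^+ n :> R by rewrite exprn_ge0.
lra.
Qed.

(* The two halves of a period of the fibre coordinate: on one of them the
   iterate phi ^ tn is close to the identity, on the other one it is close to
   the translation of the fibres by - 1 / m. *)
Lemma half_turn_stay n x u (j : int) :
  j%:~R / m%:R + 1 / S n <= u - q n * x <= j%:~R / m%:R + 1 / (2 * m%:R) - 1 / S n ->
  mdist (iter (tn n) phi (Kt n.+1 x u)) (Kt n.+1 x u) <= 5 * 2^-1 ^+ n.
Proof.
have mm : 0 < 1 / (2 * m%:R) :> R by rewrite divr_gt0// mulr_gt0// mR_gt0.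
by move=> /andP[pl pu]; apply: (@half_turn_flat _ _ _ _ j); rewrite ler_norml; apply/andP; split; lra.
Qed.

Lemma half_turn_move n x u (j : int) :
  j%:~R / m%:R + 1 / (2 * m%:R) + 1 / S n <= u - q n * x <= j%:~R / m%:R + 1 / m%:R - 1 / S n ->
  mdist (iter (tn n) phi (Kt n.+1 x u)) (Kt n.+1 x (u - 1 / m%:R)) <= 5 * 2^-1 ^+ n.
Proof.
have mm : 0 < 1 / (2 * m%:R) :> R by rewrite divr_gt0// mulr_gt0// mR_gt0.
have mE : 1 / m%:R = 1 / (2 * m%:R) + 1 / (2 * m%:R) :> R by field; rewrite gt_eqF// mR_gt0.
by move=> /andP[pl pu]; apply: (@half_turn_flat _ _ _ _ j); rewrite ler_norml; apply/andP; split; lra.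
Qed.

Lemma S_ge_m n : 16 * m%:R <= S n.+2.
Proof.
rewrite -natrM ler_nat /Sn /contr_nat; have h : (0 < Lam m n.+2 ^ 3)%N by rewrite expn_gt0 Lam_gt0.
apply: (@leq_trans (2 ^ n.+4 * m)); last by rewrite leq_pmulr.
rewrite leq_mul2r -[16%N]/(2 ^ 4)%N leq_exp2l//; lia.
Qed.

(** Going back in time moves the argument [u - q i * x] of the contraction in tiny steps
    [q i * ep i], so at some past time it was next to an integer, an attracting point. There, points
    at distance up to [1 / (4 m)] are squeezed together. The index [i = n + 2] ensures
    [16 m <= S i]. *)
Lemma proximal n x u u' : `|u - u'| <= 1 / (4 * m%:R) -> exists k x0,
  [/\ mdist (Kt n.+3 x0 u) (Kt n.+3 x0 u') <= 2^-1 ^+ n.+2,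
      mdist (iter k phi (Kt n.+3 x0 u)) (Kt n.+3 x u) <= 2^-1 ^+ n.+2 &
      mdist (iter k phi (Kt n.+3 x0 u')) (Kt n.+3 x u') <= 2^-1 ^+ n.+2].
Proof.
pose i := n.+2; move=> uu; rewrite -/i.
have e0 := eps_gt0 R m0 i; have q0 := q_gt0 R m0 i; have mm := mR_gt0 R m0.
have qe0 : 0 < q i * ep i by rewrite mulr_gt0.
pose y0 := u - q i * x; pose z := Num.ceil y0.
have /andP[z1 z2] : y0 <= z%:~R < y0 + 1.
  by have := ceil_itv y0; rewrite intrB -/z => /andP[]; rewrite /=; lra.
have [k /andP[k1 k2]] : exists k : nat, k%:R <= (z%:~R - y0) / (q i * ep i) < k%:R + 1.
  by apply: nat_floor; rewrite divr_ge0 ?(ltW qe0)// subr_ge0.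
rewrite ler_pdivlMr// in k1; rewrite ltr_pdivrMr// in k2.
have l0 := l_gt0 R m0 i.
(* Since [ell i * eps i] is at least 1, at most [ell i] steps are needed to cover a distance of at
   most 1, so that [shadow] applies with [s = 1]. *)
have kl : (k <= ell m i)%N.
  rewrite -(@ler_nat R) leNgt; apply/negP => lk.
  have : 1 <= l i * ep i by rewrite eps_rec// lerDl ltW// eps_gt0.
  have : l i * (q i * ep i) < k%:R * (q i * ep i) by rewrite ltr_pM2r.
  have : 1 * (l i * ep i) <= q i * (l i * ep i) by rewrite ler_wpM2r ?q_ge1// mulr_ge0// ltW.
  rewrite mul1r mulrCA; lra.
have kt : (k * qn m i <= 1 * qn m i.+1)%N by rewrite mul1n qnS mulnC leq_mul2l kl orbT.
pose x0 := x - (k * qn m i)%:R * al.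
exists (k * qn m i)%N, x0.
have h v : mdist (iter (k * qn m i) phi (Kt i.+1 x0 v)) (Kt i.+1 x v) <= 2^-1 ^+ i.
  have := shadow x0 v kt; rewrite /x0 subrK mul1r; move/le_trans; apply.
  by rewrite exprS ler_piMl ?exprn_ge0// invf_le1 ?ler1n.
split; [|exact: h|exact: h].
have xE : x0 = (x - k%:R * ep i) + (- Posz (k * pn m i))%:~R.
  by rewrite /x0 natM_alpha intrN; ring.
rewrite xE !Kt_base !(KtS i).
have flat v : `|v - u| <= 1 / (4 * m%:R) ->
    `|contr m (S i) (v - q i * (x - k%:R * ep i)) - (z * Posz m)%:~R / m%:R| <= 1 / S i.
  move=> vu; apply: contr_flat => //; first exact: S_ge1.
  have -> : (z * Posz m)%:~R / m%:R = z%:~R :> R by rewrite intrM mulfK// gt_eqF.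
  have -> : v - q i * (x - k%:R * ep i) - z%:~R = (v - u) + (y0 + k%:R * (q i * ep i) - z%:~R).
    by rewrite /y0; ring.
  have h1 : `|y0 + k%:R * (q i * ep i) - z%:~R| <= q i * ep i by rewrite ler_norml; lra.
  have h2 : q i * ep i <= 1 / (16 * m%:R).
    apply: (@le_trans _ _ (L i.+1 * ep i)); first by rewrite ler_wpM2r ?(ltW e0)// ler_nat qn_LamS.
    have := @L_eps R m m0 i 0; rewrite expr0 mulr1 => /(_ isT) h2; apply: (le_trans h2).
    apply: ler_pM; rewrite ?exprn_ge0 ?invr_ge0 ?mulr_ge0//.
      by rewrite exprn_ile1 ?invr_ge0// invf_le1 ?ler1n.
    by rewrite lef_pV2 ?posrE ?mulr_gt0// ler_wpM2r ?(ltW mm)// ler_nat.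
  have h3 : 1 / S i <= 1 / (16 * m%:R).
    by rewrite !mul1r lef_pV2 ?posrE ?S_gt0 ?mulr_gt0// S_ge_m.
  apply: le_trans (ler_normD _ _) _.
  have -> : 1 / (2 * m%:R) = 8 * (1 / (16 * m%:R)) :> R by field; rewrite gt_eqF.
  have e4 : 1 / (4 * m%:R) = 4 * (1 / (16 * m%:R)) :> R by field; rewrite gt_eqF.
  have : 0 < 1 / (16 * m%:R) :> R by rewrite divr_gt0// mulr_gt0.
  rewrite e4 in vu; lra.
have f1 := flat u; rewrite subrr normr0 in f1.
have f2 := flat u'; rewrite distrC in f2.
have {}f1 := f1 (ltW (divr_gt0 ltr01 (mulr_gt0 (ltr0n _ 4) mm))); have {}f2 := f2 uu.
apply: le_trans (flat_close _ f1 f2) _; rewrite ler_pdivrMr// ler_peMr ?exprn_ge0//; lra.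
Qed.

End orbits.

(** * Minimality of the powers and the maximal equicontinuous factor *)

Section metric_compact.
Context (R : realType).

Lemma compact_unif_continuous (X : metricType R) (Y : pseudoMetricType R) (f : X -> Y) :
  compact [set: X] -> continuous f -> forall e : R, 0 < e ->
  exists2 d : R, 0 < d & forall x y, mdist x y < d -> ball (f x) e (f y).
Proof.
move=> /compact_near_coveringP cX cf e e0.
have /(_ R (0 : R)^'+ (fun d x => forall y, mdist x y < d -> ball (f x) e (f y))) := cX.
case/(_ _ _)/Wrap => [x _|].
  have e2 : 0 < e / 2 by rewrite divr_gt0.
  have := cf x; move/cvg_ballP/(_ _ e2) => /nbhs_ballP[d /= d0 hd].
  have d2 : 0 < d / 2 by rewrite divr_gt0.
  exists (ball x (d / 2), [set u : R | u <= d / 2]) => /=.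
    split; first exact: nbhsx_ballx.
    by near=> u; near: u; exact: nbhs_right_le.
  move=> [x' u] /= [xx' ud] y x'y; move: xx'; rewrite ballEmdist /= => xx'.
  have := metric_triangle x x' y.
  by move=> ?; apply: (@ball_splitr _ _ (f x)); apply: hd; rewrite ballEmdist /=; lra.
move=> [d /= d0 hd]; exists (d / 2); first by rewrite divr_gt0.
move=> x y; apply: (hd (d / 2)) => //=; last by rewrite divr_gt0.
by rewrite sub0r normrN gtr0_norm ?divr_gt0// ltr_pdivrMr// ltr_pMr// ltr1n.
Unshelve. all: by end_near. Qed.

End metric_compact.

Section topological_dynamics.
Context (R : realType) (m : nat) (m0 : (0 < m)%N).
Local Notation al := (alpha R m).
Local Notation phi := (@phi R m m0).
Local Notation rot := (rotation (toT al)).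

Lemma half_pow_lt (c e : R) : 0 <= c -> 0 < e -> exists n, c * 2^-1 ^+ n < e.
Proof.
move=> c0 e0; have c1 : 0 < c + 1 by rewrite ltr_wpDl.
have [N /(_ N (leqnn _)) h] := half_pow_small (divr_gt0 e0 c1); exists N.
rewrite ltr_pdivlMr// in h; apply: le_lt_trans h.
have p0 : 0 <= 2^-1 ^+ N :> R by rewrite exprn_ge0.
have := mulr_ge0 c0 p0; lra.
Qed.

Lemma iterz_tds_iter (X : metricType R) (psi : tds X) s k z :
  iterz (tds_iter psi s) (Posz k) z = iter (s * k) psi z.
Proof.
rewrite /= mulnC; elim: k => [//|k IH].
by rewrite iterS IH mulSn iterD.
Qed.

Lemma orbit_dense s (z z' : torus2 R) (e : R) : (0 < s)%N -> 0 < e ->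
  exists k, mdist z (iter (s * k) phi z') < e.
Proof.
move=> s0 e0; have [n h] := @half_pow_lt (5 * s%:R) e (mulr_ge0 (ler0n _ 5) (ler0n _ s)) e0.
have [k0 /(_ 0%N (ell_gt0 m0 n))] := orbit_shift m0 n z z' s0.
rewrite muln0 /= -mulnA => hk; exists (qn m n * ((0 + k0) %% ell m n))%N.
exact: le_lt_trans hk h.
Qed.

Lemma phi_iter_minimal s : (0 < s)%N -> minimal (tds_iter phi s).
Proof.
move=> s0 z' O [z Oz] oO.
have /nbhs_ballP[e /= e0 he] := open_nbhs_nbhs (conj oO Oz).
have [k hk] := orbit_dense z z' s0 e0.
exists (iter (s * k) phi z'); split; first by apply: he; rewrite ballEmdist.
by exists (Posz k) => //; rewrite iterz_tds_iter.
Qed.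

Lemma phi_factor : is_factor phi rot fst.
Proof.
split=> //; first by move=> x; exact: cvg_fst.
by move=> s _; exists (s, 0).
Qed.
Lemma iter_rotation (s : torus1 R) (b : torus1 R) n : iter n (rotation b) s = s + b *+ n.
Proof. by elim: n => [|n IH]; rewrite ?mulr0n ?addr0// iterS IH /= mulrS addrA addrAC addrC. Qed.
Lemma mdistT_translate (s t b : torus1 R) : mdist (s + b) (t + b) = mdist s t.
Proof. by rewrite !mdist_torus1E opprD addrACA subrr addr0. Qed.

Lemma rotation_equicontinuous (b : torus1 R) : Defs.equicontinuous (rotation b).
Proof.
move=> e e0; exists e => // x y xy n.
by rewrite !iter_rotation mdistT_translate.
Qed.

(** Images under an equicontinuous factor that are close at one time stay close, so proximal points
    have close images. Two points of a fibre are joined by [4 m] steps of length at most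
    [1 / (4 m)], each of cost [3 e']; this explains [e' = e / (12 m)]. *)
Lemma equicontinuous_factor_fibre (Z : metricType R) (rho : tds Z) (r : torus2 R -> Z) :
  is_factor phi rho r -> Defs.equicontinuous rho ->
  forall z z' : torus2 R, z.1 = z'.1 -> r z = r z'.
Proof.
move=> [cr _ rphi] er z z' zz'; apply: mdist_positivity; apply/eqP.
rewrite eq_le mdist_ge0 andbT; apply/ler_addgt0Pl => e; rewrite addr0 => e0.
have mm := mR_gt0 R m0.
have riter k w : r (iter k phi w) = iter k rho (r w).
  elim: k => [//|k IH]; rewrite !iterS -IH.
  exact: (congr1 (fun f => f (iter k phi w)) rphi).
pose e' := e / (12 * m%:R); have e'0 : 0 < e' by rewrite divr_gt0// mulr_gt0.
have [d d0 hd] := er _ e'0.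
have md : 0 < Num.min d e' by rewrite lt_min d0.
have [d1 d10 hd1] := compact_unif_continuous (@compact_torus2 R) cr md.
have [n hn] := half_pow_lt ler01 d10; rewrite mul1r in hn.
have hn2 : 2^-1 ^+ n.+2 < d1.
  apply: le_lt_trans hn; rewrite !exprS mulrA ler_piMl ?exprn_ge0//; lra.
have [x xz] := toT_surj z.1; have [y yz] := toT_surj z.2; have [y' yz'] := toT_surj z'.2.
pose u := iot m n.+3 x y.
pose u1 := iot m n.+3 x y'.
pose u' := u1 - (Num.floor (u1 - u))%:~R.
have zE : z = Kt m n.+3 x u.
  by rewrite /Kt kapK// xz yz; case: (z).
have z'E : z' = Kt m n.+3 x u'.
  by rewrite /u' -intrN Kt_fib// /Kt kapK// xz yz' zz'; case: (z').
have uu' : `|u' - u| <= 1.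
  by have := floor_itv (u1 - u); rewrite intrD1 /u' ler_norml => /andP[]; lra.
have step v v' : `|v - v'| <= 1 / (4 * m%:R) ->
    mdist (r (Kt m n.+3 x v)) (r (Kt m n.+3 x v')) <= 3 * e'.
  move=> vv'; have [k [x0 [h1 h2 h3]]] := proximal m0 n x vv'.
  have := hd1 _ _ (le_lt_trans h1 hn2); rewrite ballEmdist /= lt_min => /andP[/hd/(_ k) g1 _].
  have := hd1 _ _ (le_lt_trans h2 hn2); rewrite ballEmdist /= lt_min => /andP[_ g2].
  have := hd1 _ _ (le_lt_trans h3 hn2); rewrite ballEmdist /= lt_min => /andP[_ g3].
  rewrite !riter in g2 g3.
  have := metric_triangle (r (Kt m n.+3 x v)) (iter k rho (r (Kt m n.+3 x0 v))) (r (Kt m n.+3 x v')).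
  have := metric_triangle (iter k rho (r (Kt m n.+3 x0 v))) (iter k rho (r (Kt m n.+3 x0 v'))) (r (Kt m n.+3 x v')).
  rewrite (metric_sym (r (Kt m n.+3 x v)) (iter _ _ _)); lra.
have chain j : mdist (r (Kt m n.+3 x u)) (r (Kt m n.+3 x (u + j%:R * ((u' - u) / (4 * m%:R))))) <= j%:R * (3 * e').
  elim: j => [|j IH]; first by rewrite !mul0r addr0 mdistxx.
  apply: le_trans (metric_triangle _ _ _) _; apply: le_trans (lerD IH (step _ (u + j.+1%:R * ((u' - u) / (4 * m%:R))) _)) _.
    have -> : u + j%:R * ((u' - u) / (4 * m%:R)) - (u + j.+1%:R * ((u' - u) / (4 * m%:R))) =
      - ((u' - u) / (4 * m%:R)) by rewrite -natr1; ring.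
    have m4 : 0 < 4 * m%:R :> R by rewrite mulr_gt0.
    by rewrite normrN normrM normfV (gtr0_norm m4) ler_pM2r ?invr_gt0.
  by rewrite -[j.+1%:R]natr1; lra.
have := chain (4 * m)%N; rewrite -zE.
have -> : u + (4 * m)%:R * ((u' - u) / (4 * m%:R)) = u' by rewrite natrM; field; rewrite gt_eqF.
rewrite -z'E => /le_trans; apply.
rewrite /e' natrM.
have -> : 4 * m%:R * (3 * (e / (12 * m%:R))) = e by field; rewrite gt_eqF.
by [].
Qed.

(** A factor that is constant on fibres descends to the base, and the section through 0 gives a
    continuous formula for the descended map. *)
Lemma phi_MEF : is_MEF phi rot fst.
Proof.
split; [exact: phi_factor|exact: rotation_equicontinuous|].
move=> Z rho r rF er; have fib := equicontinuous_factor_fibre rF er.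
have [cr sr rphi] := rF.
exists (fun s : torus1 R => r (s, 0)); split.
  split; last by apply/funext => z /=; apply: fib.
  split.
  - move=> s; apply: (continuous_comp (f := fun s : torus1 R => (s, 0 : torus1 R))); last exact: cr.
    apply: (@continuous_nonexpansive R (torus1 R) (torus2 R)) => a b.
    by rewrite mdist_prodE /= mdistxx ge_max lexx mdist_ge0.
  - move=> z /sr[p _ <-]; exists p.1 => //; exact: fib.
  - apply/funext => s /=.
    have := congr1 (fun f => f (s, 0)) rphi; rewrite /= => <-.
    exact: fib.
move=> q [_ rq]; apply/funext => s.
by rewrite rq.
Qed.

End topological_dynamics.

(** * Squared moduli of complex numbers *)

Section complex_squares.
Context (R : realType).
Local Notation C := (R[i]).
Implicit Types (z w : C).

Lemma reM z w : re (z * w) = re z * re w - im z * im w.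
Proof. by case: z w => a b [c d]. Qed.
Lemma imM z w : im (z * w) = re z * im w + im z * re w.
Proof. by case: z w => a b [c d]. Qed.
Lemma reD z w : re (z + w) = re z + re w. Proof. by case: z w => a b [c d]. Qed.
Lemma imD z w : im (z + w) = im z + im w. Proof. by case: z w => a b [c d]. Qed.
Lemma reN z : re (- z) = - re z. Proof. by case: z. Qed.
Lemma imN z : im (- z) = - im z. Proof. by case: z. Qed.
Lemma reB z w : re (z - w) = re z - re w. Proof. by rewrite reD reN. Qed.
Lemma imB z w : im (z - w) = im z - im w. Proof. by rewrite imD imN. Qed.
Lemma reJ z : re (z^*)%C = re z. Proof. by case: z. Qed.
Lemma imJ z : im (z^*)%C = - im z. Proof. by case: z. Qed.
Definition reimE := (reM, imM, reB, imB, reD, imD, reN, imN, reJ, imJ).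

Lemma cplxP z w : re z = re w -> im z = im w -> z = w.
Proof. by case: z w => a b [c d] /= -> ->. Qed.

Lemma csq_ge0 z : 0 <= csqnorm z. Proof. by rewrite addr_ge0 ?sqr_ge0. Qed.
Lemma csqM z w : csqnorm (z * w) = csqnorm z * csqnorm w.
Proof. by rewrite /csqnorm reM imM; ring. Qed.
Lemma csqN z : csqnorm (- z) = csqnorm z.
Proof. by rewrite /csqnorm reN imN !sqrrN. Qed.
Lemma csqJ z : csqnorm (z^*)%C = csqnorm z.
Proof. by rewrite /csqnorm reJ imJ sqrrN. Qed.
Lemma csqD_le z w : csqnorm (z + w) <= 2 * csqnorm z + 2 * csqnorm w.
Proof.
rewrite /csqnorm reD imD; have := sqr_ge0 (re z - re w); have := sqr_ge0 (im z - im w).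
rewrite !sqrrD !sqrrN; lra.
Qed.
Lemma csq0 : csqnorm (0 : C) = 0. Proof. by rewrite /csqnorm /= expr0n addr0. Qed.
Lemma csqnorm1 : csqnorm (1 : C) = 1. Proof. by rewrite /csqnorm /= expr0n expr1n addr0. Qed.
Lemma csq_eq0 z : csqnorm z = 0 -> z = 0.
Proof.
move=> /eqP; rewrite paddr_eq0 ?sqr_ge0// !sqrf_eq0 => /andP[/eqP a /eqP b].
exact: cplxP.
Qed.
Lemma csqX z n : csqnorm (z ^+ n) = csqnorm z ^+ n.
Proof. by elim: n => [|n IH]; rewrite ?csqnorm1// !exprS csqM IH. Qed.
Lemma csqV z : csqnorm z^-1 = (csqnorm z)^-1.
Proof.
have [->|z0] := eqVneq z 0; first by rewrite invr0 csq0 invr0.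
have n0 : csqnorm z != 0 by apply: contraNneq z0 => /csq_eq0 ->.
by apply: (mulfI n0); rewrite -csqM divff// csqnorm1 divff.
Qed.
Lemma mulJ_csq z : z * (z^*)%C = (csqnorm z)%:C%C.
Proof. by apply: cplxP; rewrite !reimE /csqnorm /=; ring. Qed.
Lemma normc_csqnorm z : `|z| = (Num.sqrt (csqnorm z))%:C%C.
Proof. by case: z. Qed.

Lemma le_norm_csqnorm z (e : R) : 0 <= e -> (`|z| <= e%:C%C) = (csqnorm z <= e ^+ 2).
Proof.
move=> e0; rewrite normc_csqnorm lecR -{2}(sqr_sqrtr (csq_ge0 z)).
by rewrite ler_pXn2r ?nnegrE ?sqrtr_ge0.
Qed.

Definition circle : set C := [set z | csqnorm z = 1].

Lemma circle_neq0 z : circle z -> z != 0.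
Proof. by move=> h; apply/eqP => z0; move: h; rewrite z0 /circle /= csq0 => /esym/eqP; rewrite oner_eq0. Qed.

Lemma circleV z : circle z -> z^-1 = (z^*)%C.
Proof.
move=> h; have z0 := circle_neq0 h; apply: (mulfI z0).
by rewrite divff// mulJ_csq h.
Qed.

Lemma re_sqr_le z : re z ^+ 2 <= csqnorm z. Proof. by rewrite lerDl sqr_ge0. Qed.
Lemma im_sqr_le z : im z ^+ 2 <= csqnorm z. Proof. by rewrite lerDr sqr_ge0. Qed.

End complex_squares.

(** * Square integrable functions and their inner product *)

Section L2_theory.
Context (R : realType) (X : pmetricType R) (mu : probability (borel X) R).
Local Notation C := (R[i]).
Local Notation L2 := (L2 mu).
Local Notation inner := (L2inner mu).
Implicit Types (f g h : X -> C) (u v : borel X -> R) (a : C).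

Definition cmeas f := measurable_fun setT (fun x : borel X => re (f x)) /\
  measurable_fun setT (fun x : borel X => im (f x)).

(** Working with squared norms avoids roots; the triangle inequality then takes the form of
    [L2ND_le], with factors 2. *)
Definition L2N f : R := \int[mu]_x csqnorm (f x).

Definition intg u := mu.-integrable setT (EFin \o u).

Lemma L2norm_L2N f : L2norm mu f = Num.sqrt (L2N f). Proof. by []. Qed.

Lemma cmeas_csq f : cmeas f -> measurable_fun setT (fun x : borel X => csqnorm (f x)).
Proof.
move=> [mr mi]; apply: measurable_funD; apply: measurable_funX; [exact: mr|exact: mi].
Qed.

Lemma L2P f : L2 f <-> cmeas f /\ intg (fun x => csqnorm (f x)).
Proof.
split=> [[mr mi fi]|[[mr mi] fi]].
  split=> //; apply/integrableP; split.
    by apply/measurable_EFinP; exact: cmeas_csq.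
  by under eq_integral do rewrite /= ger0_norm ?csq_ge0//.
split=> //; have /integrableP[_] := fi.
by under eq_integral do rewrite /= ger0_norm ?csq_ge0//.
Qed.

Lemma intg_le u v : measurable_fun setT u -> (forall x, `|u x| <= v x) -> intg v -> intg u.
Proof.
move=> mu_ uv iv; apply: (le_integrable _ _ _ iv) => //.
  exact/measurable_EFinP.
move=> x _ /=; rewrite lee_fin; apply: le_trans (uv x) _; exact: ler_norm.
Qed.
Lemma intgD u v : intg u -> intg v -> intg (fun x => u x + v x).
Proof. by move=> iu iv; exact: (integrableD _ iu iv). Qed.
Lemma intgZ (c : R) u : intg u -> intg (fun x => c * u x).
Proof. by move=> iu; exact: (integrableZl _ c iu). Qed.
Lemma intgB u v : intg u -> intg v -> intg (fun x => u x - v x).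
Proof. by move=> iu iv; exact: (integrableB _ iu iv). Qed.

Lemma intg_cst (c : R) : intg (fun=> c).
Proof.
apply/integrableP; split; first exact: measurable_cst.
under eq_integral do rewrite /=.
by rewrite integral_cst//= [X in (_ * X)%E](@probability_setT _ _ _ mu) mule1 ltry.
Qed.
Lemma RintD u v : intg u -> intg v ->
  \int[mu]_x (u x + v x) = \int[mu]_x u x + \int[mu]_x v x.
Proof. by move=> iu iv; exact: RintegralD. Qed.
Lemma RintZ (c : R) u : intg u -> \int[mu]_x (c * u x) = c * \int[mu]_x u x.
Proof. by move=> iu; exact: RintegralZl. Qed.

Lemma RintN u : intg u -> \int[mu]_x (- u x) = - \int[mu]_x u x.
Proof.
move=> iu; rewrite -mulN1r -RintZ//; apply: eq_Rintegral => x _.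
by rewrite mulN1r.
Qed.
Lemma RintB u v : intg u -> intg v ->
  \int[mu]_x (u x - v x) = \int[mu]_x u x - \int[mu]_x v x.
Proof. by move=> iu iv; exact: RintegralB. Qed.
Lemma Rint_le u v : intg u -> intg v -> (forall x, u x <= v x) ->
  \int[mu]_x u x <= \int[mu]_x v x.
Proof. by move=> iu iv uv; apply: le_Rintegral. Qed.
Lemma Rint_cst (c : R) : \int[mu]_x c = c.
Proof. by rewrite Rintegral_cst// [X in fine X](@probability_setT _ _ _ mu) mulr1. Qed.
Lemma L2N_ge0 f : 0 <= L2N f.
Proof. by apply: Rintegral_ge0 => x _; exact: csq_ge0. Qed.

Lemma cmeasD f g : cmeas f -> cmeas g -> cmeas (fun x => f x + g x).
Proof.
move=> [fr fi] [gr gi]; split.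
  by under eq_fun do rewrite reD; exact: measurable_funD.
by under eq_fun do rewrite imD; exact: measurable_funD.
Qed.

Lemma cmeasM f g : cmeas f -> cmeas g -> cmeas (fun x => f x * g x).
Proof.
move=> [fr fi] [gr gi]; split.
  by under eq_fun do rewrite reM; apply: measurable_funB; exact: measurable_funM.
by under eq_fun do rewrite imM; apply: measurable_funD; exact: measurable_funM.
Qed.
Lemma cmeas_cst a : cmeas (fun=> a).
Proof. by split; exact: measurable_cst. Qed.

Lemma cmeasJ f : cmeas f -> cmeas (fun x => (f x)^*%C).
Proof.
move=> [fr fi]; split; first by under eq_fun do rewrite reJ.
by under eq_fun do rewrite imJ; exact: measurableT_comp.
Qed.
Lemma cmeasZ a f : cmeas f -> cmeas (fun x => a * f x).
Proof. by move=> mf; apply: cmeasM => //; exact: cmeas_cst. Qed.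
Lemma cmeasN f : cmeas f -> cmeas (fun x => - f x).
Proof. by move=> /(cmeasZ (-1)); under eq_fun do rewrite mulN1r. Qed.
Lemma cmeasB f g : cmeas f -> cmeas g -> cmeas (fun x => f x - g x).
Proof. by move=> mf mg; apply: cmeasD => //; exact: cmeasN. Qed.

Lemma L2_meas f : L2 f -> cmeas f. Proof. by case/L2P. Qed.
Lemma L2_intg f : L2 f -> intg (fun x => csqnorm (f x)). Proof. by case/L2P. Qed.

Lemma L2_le f u : cmeas f -> intg u -> (forall x, csqnorm (f x) <= u x) -> L2 f.
Proof.
move=> mf iu fu; apply/L2P; split => //; apply: intg_le iu; first exact: cmeas_csq.
by move=> x; rewrite ger0_norm ?csq_ge0.
Qed.

Lemma L2D f g : L2 f -> L2 g -> L2 (fun x => f x + g x).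
Proof.
move=> Lf Lg; apply: (@L2_le _ (fun x => 2 * csqnorm (f x) + 2 * csqnorm (g x))).
- by apply: cmeasD; exact: L2_meas.
- by apply: intgD; apply: intgZ; exact: L2_intg.
- by move=> x; exact: csqD_le.
Qed.

Lemma L2Z a f : L2 f -> L2 (fun x => a * f x).
Proof.
move=> Lf; apply: (@L2_le _ (fun x => csqnorm a * csqnorm (f x))).
- by apply: cmeasZ; exact: L2_meas.
- by apply: intgZ; exact: L2_intg.
- by move=> x; rewrite csqM.
Qed.
Lemma L2opp f : L2 f -> L2 (fun x => - f x).
Proof. by move=> /(L2Z (-1)); under eq_fun do rewrite mulN1r. Qed.
Lemma L2B f g : L2 f -> L2 g -> L2 (fun x => f x - g x).
Proof. by move=> Lf Lg; apply: L2D => //; exact: L2opp. Qed.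
Lemma L2_bounded f (K : R) : cmeas f -> (forall x, csqnorm (f x) <= K) -> L2 f.
Proof. by move=> mf fK; apply: (L2_le mf (intg_cst K)). Qed.
Lemma L2_cst a : L2 (fun=> a).
Proof. by apply: L2_bounded (cmeas_cst a) (fun=> lexx _). Qed.

Lemma L2_sum (I : Type) (r : seq I) (F : I -> X -> C) : (forall i, L2 (F i)) ->
  L2 (fun x => \sum_(i <- r) F i x).
Proof.
move=> LF; elim: r => [|i r IH].
  by under eq_fun do rewrite big_nil; exact: L2_cst.
by under eq_fun do rewrite big_cons; exact: L2D.
Qed.

Lemma L2NZ a f : L2 f -> L2N (fun x => a * f x) = csqnorm a * L2N f.
Proof.
move=> Lf; rewrite /L2N -RintZ; last exact: L2_intg.
by apply: eq_Rintegral => x _; rewrite csqM.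
Qed.

Lemma L2ND_le f g : L2 f -> L2 g -> L2N (fun x => f x + g x) <= 2 * L2N f + 2 * L2N g.
Proof.
move=> Lf Lg; have If := L2_intg Lf; have Ig := L2_intg Lg.
rewrite -!RintZ// -RintD; [|exact: intgZ|exact: intgZ].
apply: Rint_le; [exact: L2_intg (L2D Lf Lg)|by apply: intgD; exact: intgZ|].
by move=> x; exact: csqD_le.
Qed.
Lemma L2N_opp f : L2N (fun x => - f x) = L2N f.
Proof. by apply: eq_Rintegral => x _; rewrite csqN. Qed.

Lemma L2NB_le f g : L2 f -> L2 g -> L2N (fun x => f x - g x) <= 2 * L2N f + 2 * L2N g.
Proof.
by move=> Lf Lg; have := L2ND_le Lf (L2opp Lg); rewrite L2N_opp.
Qed.
Lemma L2N_sym f g : L2N (fun x => f x - g x) = L2N (fun x => g x - f x).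
Proof. by rewrite -L2N_opp; apply: eq_Rintegral => x _; rewrite opprB. Qed.

Lemma L2N_tri f g h : L2 f -> L2 g -> L2 h ->
  L2N (fun x => f x - h x) <= 2 * L2N (fun x => f x - g x) + 2 * L2N (fun x => g x - h x).
Proof.
move=> Lf Lg Lh; have := L2ND_le (L2B Lf Lg) (L2B Lg Lh).
by under [X in L2N X <= _]eq_fun do rewrite addrA subrK.
Qed.
Lemma L2N_bounded f (K : R) : L2 f -> (forall x, csqnorm (f x) <= K) -> L2N f <= K.
Proof. by move=> Lf h; rewrite -[leRHS]Rint_cst; apply: Rint_le => //; [exact: L2_intg|exact: intg_cst]. Qed.

Lemma mulJ_le (z w : C) : `|re (z * w^*%C)| <= csqnorm z + csqnorm w /\
  `|im (z * w^*%C)| <= csqnorm z + csqnorm w.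
Proof.
case: z w => a b [c d]; rewrite !reimE /csqnorm /= !ler_norml.
have := sqr_ge0 (a - c); have := sqr_ge0 (a + c); have := sqr_ge0 (b - d); have := sqr_ge0 (b + d).
have := sqr_ge0 (a - d); have := sqr_ge0 (a + d); have := sqr_ge0 (b - c); have := sqr_ge0 (b + c).
rewrite !sqrrD !sqrrN; nra.
Qed.

Lemma intg_inner f g : L2 f -> L2 g ->
  intg (fun x => re (f x * (g x)^*%C)) /\ intg (fun x => im (f x * (g x)^*%C)).
Proof.
move=> Lf Lg; have [mr mi] := cmeasM (L2_meas Lf) (cmeasJ (L2_meas Lg)).
have i := intgD (L2_intg Lf) (L2_intg Lg).
by split; apply: intg_le i => // x; have [] := mulJ_le (f x) (g x).
Qed.

Lemma re_inner f g : re (inner f g) = \int[mu]_x re (f x * (g x)^*%C). Proof. by []. Qed.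
Lemma im_inner f g : im (inner f g) = \int[mu]_x im (f x * (g x)^*%C). Proof. by []. Qed.

Lemma innerJ f g : L2 f -> L2 g -> inner g f = (inner f g)^*%C.
Proof.
move=> Lf Lg; have [i1 i2] := intg_inner Lf Lg.
apply: cplxP; rewrite ?reJ ?imJ !(re_inner, im_inner).
  by apply: eq_Rintegral => x _; rewrite !reimE; ring.
by rewrite -RintN//; apply: eq_Rintegral => x _; rewrite !reimE; ring.
Qed.

Lemma innerDl f g h : L2 f -> L2 g -> L2 h ->
  inner (fun x => f x + g x) h = inner f h + inner g h.
Proof.
move=> Lf Lg Lh; have [f1 f2] := intg_inner Lf Lh; have [g1 g2] := intg_inner Lg Lh.
apply: cplxP; rewrite ?reD ?imD !(re_inner, im_inner) -RintD//;
  by apply: eq_Rintegral => x _; rewrite !reimE; ring.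
Qed.

Lemma innerZl a f g : L2 f -> L2 g -> inner (fun x => a * f x) g = a * inner f g.
Proof.
move=> Lf Lg; have [f1 f2] := intg_inner Lf Lg.
apply: cplxP; rewrite ?reM ?imM !(re_inner, im_inner) -!RintZ//.
  rewrite -RintB; [|exact: intgZ|exact: intgZ].
  by apply: eq_Rintegral => x _; rewrite !reimE; ring.
rewrite -RintD; [|exact: intgZ|exact: intgZ].
by apply: eq_Rintegral => x _; rewrite !reimE; ring.
Qed.

Lemma innerBl f g h : L2 f -> L2 g -> L2 h ->
  inner (fun x => f x - g x) h = inner f h - inner g h.
Proof.
move=> Lf Lg Lh; rewrite -[in RHS]mulN1r -innerZl// -innerDl//; last exact: L2Z.
by congr inner; apply/funext => x; rewrite mulN1r.
Qed.

Lemma innerZr a f g : L2 f -> L2 g -> inner f (fun x => a * g x) = a^*%C * inner f g.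
Proof.
move=> Lf Lg; rewrite (innerJ (L2Z a Lg) Lf) innerZl// (innerJ Lf Lg).
by apply: cplxP; rewrite !reimE; ring.
Qed.

Lemma innerBr f g h : L2 f -> L2 g -> L2 h ->
  inner f (fun x => g x - h x) = inner f g - inner f h.
Proof.
move=> Lf Lg Lh; rewrite (innerJ (L2B Lg Lh) Lf) innerBl// (innerJ Lf Lg) (innerJ Lf Lh).
by apply: cplxP; rewrite !reimE; ring.
Qed.

Lemma inner_sqr f : inner f f = (L2N f)%:C%C.
Proof.
apply: cplxP; rewrite !(re_inner, im_inner).
  by apply: eq_Rintegral => x _; rewrite mulJ_csq.
by rewrite -[RHS](Rint_cst 0); apply: eq_Rintegral => x _; rewrite mulJ_csq.
Qed.

Lemma L2ND f g : L2 f -> L2 g ->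
  L2N (fun x => f x + g x) = L2N f + L2N g + 2 * re (inner f g).
Proof.
move=> Lf Lg; have [f1 f2] := intg_inner Lf Lg.
have If := L2_intg Lf; have Ig := L2_intg Lg.
rewrite re_inner -RintZ// -(RintD If Ig) -(RintD (intgD If Ig) (intgZ 2 f1)).
by apply: eq_Rintegral => x _; rewrite /csqnorm !reimE; ring.
Qed.

Lemma L2N_ae0 f : L2 f -> L2N f = 0 -> eqL2 mu f (fun=> 0).
Proof.
move=> Lf f0; have If := L2_intg Lf.
have : (\int[mu]_x `|(csqnorm (f x))%:E| = 0)%E.
  under eq_integral do rewrite /= ger0_norm ?csq_ge0//.
  rewrite -[LHS]fineK; last exact: integrable_fin_num If.
  by rewrite -/(Rintegral mu setT _) -/(L2N f) f0.
have mf : measurable_fun setT (fun x : borel X => (csqnorm (f x))%:E).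
  by apply/measurable_EFinP; exact: cmeas_csq (L2_meas Lf).
move/(ae_eq_integral_abs mu measurableT mf).1.
apply: filterS => x /(_ Logic.I) /= [] /csq_eq0; exact.
Qed.

Lemma ae_Rint u v : measurable_fun setT u -> measurable_fun setT v ->
  {ae mu, forall x, u x = v x} -> \int[mu]_x u x = \int[mu]_x v x.
Proof.
move=> mu_ mv uv; rewrite /Rintegral; congr fine.
apply: ae_eq_integral => //; [exact/measurable_EFinP|exact/measurable_EFinP|].
by apply: filterS uv => x -> _.
Qed.
Lemma aeS (P Q : X -> Prop) : (forall x, P x -> Q x) ->
  {ae mu, forall x, P x} -> {ae mu, forall x, Q x}.
Proof. by move=> PQ; exact: (@filterS (borel X) (almost_everywhere mu) _ P Q PQ). Qed.
Lemma aeS2 (P Q S : X -> Prop) : (forall x, P x -> Q x -> S x) ->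
  {ae mu, forall x, P x} -> {ae mu, forall x, Q x} -> {ae mu, forall x, S x}.
Proof. by move=> PQ; exact: (@filterS2 (borel X) (almost_everywhere mu) _ P Q S PQ). Qed.

Lemma L2N_ae f g : cmeas f -> cmeas g -> eqL2 mu f g -> L2N f = L2N g.
Proof.
move=> mf mg fg; apply: ae_Rint; [exact: cmeas_csq|exact: cmeas_csq|].
by apply: aeS fg => x ->.
Qed.

Lemma eqL2_sub0 f g : eqL2 mu (fun x => f x - g x) (fun=> 0) <-> eqL2 mu f g.
Proof.
split; apply: aeS => x; last by move=> ->; rewrite subrr.
by move=> /eqP; rewrite subr_eq0 => /eqP.
Qed.

Lemma eqL2_refl f : eqL2 mu f f. Proof. exact: aeW. Qed.
Lemma eqL2_sym f g : eqL2 mu f g -> eqL2 mu g f.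
Proof. by apply: aeS => x ->. Qed.
Lemma eqL2_trans f g h : eqL2 mu f g -> eqL2 mu g h -> eqL2 mu f h.
Proof. by apply: aeS2 => x -> ->. Qed.
Lemma eqL2_L2N f g : L2 f -> L2 g -> L2N (fun x => f x - g x) = 0 -> eqL2 mu f g.
Proof. by move=> Lf Lg h; apply/eqL2_sub0; apply: L2N_ae0 => //; exact: L2B. Qed.

Lemma inner_ae f f' g g' : cmeas f -> cmeas f' -> cmeas g -> cmeas g' ->
  eqL2 mu f f' -> eqL2 mu g g' -> inner f g = inner f' g'.
Proof.
move=> mf mf' mg mg' ff gg; have [r i] := cmeasM mf (cmeasJ mg).
have [r' i'] := cmeasM mf' (cmeasJ mg').
by apply: cplxP; rewrite !(re_inner, im_inner); apply: ae_Rint => //;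
  apply: aeS2 ff gg => x -> ->.
Qed.

Lemma cauchy_schwarz f g : L2 f -> L2 g -> csqnorm (inner f g) <= L2N f * L2N g.
Proof.
move=> Lf Lg; have [g0|g0] := eqVneq (L2N g) 0.
  have e := L2N_ae0 Lg g0.
  rewrite (inner_ae (L2_meas Lf) (L2_meas Lf) (L2_meas Lg) (cmeas_cst 0) (eqL2_refl f) e).
  have -> : (fun=> 0 : C) = (fun x : X => 0 * g x) by apply/funext => x; rewrite mul0r.
  by rewrite innerZr// rmorph0 mul0r csq0 g0 mulr0.
(* The number [a] below minimizes the norm of [f + a g]. *)
have gp : 0 < L2N g by rewrite lt_def g0 L2N_ge0.
set z := inner f g; pose a := (- z * (L2N g)^-1%:C%C).
have := L2N_ge0 (fun x => f x + a * g x).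
rewrite L2ND//; last exact: L2Z.
rewrite L2NZ// innerZr// -/z.
have -> : csqnorm a = csqnorm z / L2N g ^+ 2.
  rewrite /a csqM csqN; congr (_ * _).
  by rewrite /csqnorm /= expr0n addr0 exprVn.
have -> : re (a^*%C * z) = - csqnorm z / L2N g.
  by rewrite /a /csqnorm !reimE /=; ring.
rewrite -(pmulr_rge0 _ gp) => h.
have : L2N g * (L2N f + csqnorm z / L2N g ^+ 2 * L2N g + 2 * (- csqnorm z / L2N g)) =
   L2N f * L2N g - csqnorm z by field.
by move=> e; rewrite e in h; rewrite -subr_ge0.
Qed.

End L2_theory.

(** * Borel maps and measure preserving maps *)

Section borel_maps.
Context (R : realType).

Lemma cont_borel (Y Z : pmetricType R) (T : Y -> Z) :
  continuous T -> measurable_fun setT (T : borel Y -> borel Z).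
Proof.
move=> cT; apply: (measurability (@open Z : set (set (borel Z)))) => //.
move=> _ [B oB <-]; rewrite setTI; apply: sub_sigma_algebra.
by apply: open_comp => // x _; exact: cT.
Qed.

Lemma cont_borelR (Y : ptopologicalType) (u : Y -> R) :
  continuous u -> measurable_fun setT (u : borel Y -> R).
Proof.
move=> cu; apply: (measurability _ (RGenOpens.measurableE R)) => //.
move=> _ [_ [a [b ->] <-]]; rewrite setTI; apply: sub_sigma_algebra.
by apply: open_comp; [move=> x _; exact: cu|exact: interval_open].
Qed.

End borel_maps.

Definition mpres (R : realType) (X Y : pmetricType R) (mu : probability (borel X) R)
    (nu : probability (borel Y) R) (T : X -> Y) :=
  measurable_fun setT (T : borel X -> borel Y) /\
  forall A : set (borel Y), measurable A -> mu (T @^-1` A) = nu A.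

Section measure_preserving.
Context (R : realType) (X Y : pmetricType R).
Variables (mu : probability (borel X) R) (nu : probability (borel Y) R).
Local Notation C := (R[i]).
Implicit Types (f g h : Y -> C) (u v : borel Y -> R) (T : X -> Y).
Local Notation mpres := (mpres mu nu).

Lemma Rint_mpres T u : mpres T -> intg nu u ->
  intg mu (u \o T) /\ \int[mu]_x u (T x) = \int[nu]_x u x.
Proof.
move=> [mT pT] iu; have mpu : measurable_fun setT u.
  by apply/measurable_EFinP; case/integrableP: iu.
have e (F : Y -> \bar R) : measurable_fun setT (F : borel Y -> \bar R) -> (forall x, 0 <= F x)%E ->
    (\int[mu]_x F (T x) = \int[nu]_x F x)%E.
  move=> mF F0.
  transitivity (\int[pushforward mu (T : borel X -> borel Y)]_x F x)%E.
    by rewrite ge0_integral_pushforward//= preimage_setT.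
  by apply: eq_measure_integral => A mA _; exact: pT.
have iuT : intg mu (u \o T).
  apply/integrableP; split.
    by apply/measurable_EFinP; apply: measurableT_comp.
  have /integrableP[_ h] := iu.
  have := e (fun x => `|(u x)%:E|)%E; rewrite /= => -> //.
  by apply/measurable_EFinP; apply: measurableT_comp.
split=> //; rewrite /Rintegral; congr fine; rewrite [LHS]integralE [RHS]integralE.
congr (_ - _)%E.
  under eq_integral do rewrite (funepos_comp (EFin \o u) T).
  apply: (e (EFin \o u)^\+%E) => //.
  by apply: measurable_funepos; exact/measurable_EFinP.
under eq_integral do rewrite (funeneg_comp (EFin \o u) T).
apply: (e (EFin \o u)^\-%E) => //.
by apply: measurable_funeneg; exact/measurable_EFinP.
Qed.
Lemma cmeas_mpres T f : mpres T -> cmeas f -> cmeas (f \o T).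
Proof. by move=> [mT _] [r i]; split; apply: measurableT_comp (r) mT || apply: measurableT_comp (i) mT. Qed.

Lemma L2_mpres T f : mpres T -> L2 nu f -> L2 mu (f \o T).
Proof.
move=> mT /L2P[mf If]; apply/L2P; split; first exact: cmeas_mpres.
by have [] := Rint_mpres mT If.
Qed.
Lemma L2N_mpres T f : mpres T -> L2 nu f -> L2N mu (f \o T) = L2N nu f.
Proof. by move=> mT /L2P[mf If]; have [] := Rint_mpres mT If. Qed.

Lemma inner_mpres T f g : mpres T -> L2 nu f -> L2 nu g ->
  L2inner mu (f \o T) (g \o T) = L2inner nu f g.
Proof.
move=> mT Lf Lg; have [i1 i2] := intg_inner Lf Lg.
by apply: cplxP; rewrite !(re_inner, im_inner); [case: (Rint_mpres mT i1)|case: (Rint_mpres mT i2)].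
Qed.

Lemma eqL2_mpres T f g : mpres T -> eqL2 nu f g -> eqL2 mu (f \o T) (g \o T).
Proof.
move=> [mT pT] [N [mN N0 sN]]; exists (T @^-1` N); split.
- by rewrite -[_ @^-1` _]setTI; exact: mT.
- by rewrite pT.
- by move=> x /= h; apply: sN.
Qed.

End measure_preserving.

Section self_maps.
Context (R : realType) (X : pmetricType R) (mu : probability (borel X) R).
Implicit Types T : X -> X.
Local Notation mpres := (mpres mu mu).

Lemma mpres_id : mpres id.
Proof. by split=> //; exact: measurable_id. Qed.

Lemma mpres_comp T T' : mpres T -> mpres T' -> mpres (T \o T').
Proof.
move=> [mT pT] [mT' pT']; split; first exact: (measurableT_comp mT mT').
move=> A mA; rewrite comp_preimage pT' ?pT//.
by rewrite -[_ @^-1` _]setTI; exact: mT.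
Qed.

Lemma mpres_iter T n : mpres T -> mpres (iter n T).
Proof.
by move=> mT; elim: n => [|n IH]; [exact: mpres_id|exact: (mpres_comp mT IH)].
Qed.

Section tds.
Variable phi : tds X.
Hypothesis inv : invariant_measure phi mu.

Lemma mpres_tds : mpres phi.
Proof. by split; [exact: (cont_borel (@tds_continuous _ _ phi))|exact: inv]. Qed.

Lemma mpres_inv : mpres (tds_inv phi).
Proof.
have m : measurable_fun setT (tds_inv phi : borel X -> borel X).
  exact: (cont_borel (@tds_inv_continuous _ _ phi)).
split=> // A mA; rewrite -inv; last by rewrite -[_ @^-1` _]setTI; exact: m.
by congr (mu _); apply/funext => x; rewrite /preimage /= tds_mapK.
Qed.

End tds.
End self_maps.

(** * Limits of square integrable functions *)

Section L2_limits.
Context (R : realType) (X : pmetricType R) (mu : probability (borel X) R).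
Local Notation C := (R[i]).
Implicit Types (f g h : X -> C) (u v : borel X -> R) (a : C).

Lemma csq_cvg (F : nat -> C) (l : C) : re (F k) @[k --> \oo] --> re l ->
  im (F k) @[k --> \oo] --> im l -> csqnorm (F k) @[k --> \oo] --> csqnorm l.
Proof. by move=> hr hi; apply: cvgD; apply: cvgM. Qed.

Lemma L2_fatou (w : nat -> X -> C) f (K : R) : (forall k, L2 mu (w k)) -> cmeas f ->
  {ae mu, forall x, csqnorm (w k x) @[k --> \oo] --> csqnorm (f x)} ->
  (forall k, L2N mu (w k) <= K) -> L2 mu f /\ L2N mu f <= K.
Proof.
move=> Lw mf wf wK.
have mE g : cmeas g -> measurable_fun setT (fun x : borel X => (csqnorm (g x))%:E).
  by move=> mg; apply/measurable_EFinP; exact: cmeas_csq.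
have h : (\int[mu]_x (csqnorm (f x))%:E <= K%:E)%E.
  have : (\int[mu]_x (csqnorm (f x))%:E = \int[mu]_x limn_einf (fun k => (csqnorm (w k x))%:E))%E.
    apply: ae_eq_integral => //; first exact: mE.
      apply: measurableT_comp => //; apply: measurable_fun_limn_esup => k.
      by apply: measurableT_comp => //; exact: mE (L2_meas (Lw k)).
    apply: aeS wf => x h _.
    have : (csqnorm (w k x))%:E @[k --> \oo] --> (csqnorm (f x))%:E by apply: cvg_EFin => //; near=> k.
    by move=> /cvg_limn_einf_sup[-> _].
  move=> ->; apply: le_trans.
    apply: fatou => //; first by move=> k; exact: mE (L2_meas (Lw k)).
    by move=> k x _; rewrite lee_fin csq_ge0.
  have e k : (\int[mu]_x (csqnorm (w k x))%:E = (L2N mu (w k))%:E)%E.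
    rewrite /L2N /Rintegral fineK//; exact: integrable_fin_num (L2_intg (Lw k)).
  under eq_fun do rewrite e.
  rewrite limn_einf_lim; apply: lime_le; first exact: is_cvg_einfs.
  apply: nearW => n; apply: (@le_trans _ _ (L2N mu (w n))%:E); last by rewrite lee_fin.
  by apply: ereal_inf_lbound; exists n => //=.
have Lf : L2 mu f by case: mf => mr mi; split => //; apply: le_lt_trans h _; rewrite ltry.
split=> //; rewrite -lee_fin /L2N /Rintegral fineK//; exact: integrable_fin_num (L2_intg Lf).
Unshelve. all: by end_near. Qed.

Lemma markov_L2 f (e : R) : 0 < e -> L2 mu f ->
  (mu [set x | (e <= csqnorm (f x))%R] <= (L2N mu f / e)%:E)%E.
Proof.
move=> e0 Lf; set A : set (borel X) := [set x | _]; have mA : measurable A.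
  by rewrite -[A]setTI; apply: measurable_fun_le => //; exact: cmeas_csq (L2_meas Lf).
have iA : intg mu (\1_A : X -> R).
  apply: (intg_le _ _ (intg_cst mu 1)) => [|x]; first exact: measurable_indic.
  by rewrite indicE; case: (_ \in _); rewrite ?normr1 ?normr0.
rewrite -[mu _]fineK ?fin_num_measure// lee_fin ler_pdivlMr// mulrC.
have <- : \int[mu]_x (\1_A x : R) = fine (mu A) by rewrite /Rintegral integral_indic// setIT.
rewrite -RintZ//; apply: Rint_le => [||x]; [exact: intgZ|exact: L2_intg|].
by rewrite indicE; case: (boolP (x \in A)) => [/set_mem|_]; rewrite ?mulr1// mulr0 csq_ge0.
Qed.

Lemma borel_cantelli d (T : measurableType d) (nu : {measure set T -> \bar R})
  (A : nat -> set T) (c q : R) : 0 <= q < 1 ->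
  (forall n, measurable (A n)) -> (forall n, nu (A n) <= (c * q ^+ n)%:E)%E ->
  {ae nu, forall x, exists N, forall n, (N <= n)%N -> ~ A n x}.
Proof.
move=> /andP[q0 q1] mA Ac.
have S : (\sum_(n <oo) nu (A n) < +oo)%E.
  apply: (@le_lt_trans _ _ (c / (1 - q))%:E); last exact: ltry.
  apply: lime_le; first exact: is_cvg_nneseries.
  near=> n.
  apply: (@le_trans _ _ (\sum_(0 <= k < n) (c * q ^+ k)%:E)%E); first exact: lee_sum.
  have c0 : 0 <= c by have := le_trans (measure_ge0 nu _) (Ac 0%N); rewrite lee_fin expr0 mulr1.
  rewrite sumEFin lee_fin -mulr_sumr ler_wpM2l// big_mkord.
  have := subrX1 q n; rewrite -opprB => e.
  rewrite -[leRHS]mul1r ler_pdivlMr ?subr_gt0//.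
  by have := exprn_ge0 n q0; move: e; set s := \sum_(i < n) _; nra.
have := lim_sup_set_cvg0 mA S => h0.
exists (lim_sup_set A); split => //.
  by apply: bigcap_measurable => // k _; exact: bigcup_measurable.
move=> x /= /forallNP h n _.
have /existsNP[k /not_implyP[nk /contrapT Ak]] := h n.
by exists k.
Unshelve. all: by end_near. Qed.

(** The argument of Riesz and Fischer for fast Cauchy sequences. The rate factors as
    [8^-1 = 4^-1 * 2^-1]: by Markov's inequality the set where the squared increment exceeds
    [4^-1 ^+ n] has measure at most [c * 2^-1 ^+ n]. Almost everywhere the increments are then
    eventually at most [2^-1 ^+ n] in modulus. *)
Lemma L2_complete (w : nat -> X -> C) (c : R) : 0 <= c -> (forall n, L2 mu (w n)) ->
  (forall n, L2N mu (fun x => w n.+1 x - w n x) <= c * 8^-1 ^+ n) ->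
  exists2 f, L2 mu f & forall n, L2N mu (fun x => f x - w n x) <= 4 * c * 8^-1 ^+ n.
Proof.
move=> c0 Lw hw.
have B n k : L2N mu (fun x => w (n + k)%N x - w n x) <= 4 * c * 8^-1 ^+ n.
  elim: k n => [|k IH] n.
    have -> : (fun x => w (n + 0)%N x - w n x) = (fun=> 0).
      by apply/funext => x; rewrite addn0 subrr.
    rewrite /L2N; under eq_Rintegral do rewrite csq0.
    by rewrite Rint_cst; do ?apply: mulr_ge0 => //; apply: exprn_ge0.
  rewrite addnS -addSn; apply: le_trans (L2N_tri (Lw _) (Lw n.+1) (Lw n)) _.
  have := IH n.+1; have := hw n; rewrite exprS.
  have : 0 <= c * 8^-1 ^+ n by rewrite mulr_ge0 ?exprn_ge0.
  lra.
pose A n : set (borel X) := [set x | 4^-1 ^+ n <= csqnorm (w n.+1 x - w n x)].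
have mA n : measurable (A n).
  rewrite -[A n]setTI; apply: measurable_fun_le => //.
  by apply: cmeas_csq; apply: (@L2_meas _ _ mu); exact: L2B.
pose E : set (borel X) := \bigcup_N \bigcap_(n in [set n | (N <= n)%N]) ~` A n.
pose f x : C := if `[< E x >] then
  Complex (limn (fun n => re (w n x))) (limn (fun n => im (w n x))) else 0.
have q4 n : (4^-1 : R) ^+ n = (2^-1 ^+ n) ^+ 2.
  by rewrite -exprM mulnC exprM; congr (_ ^+ n); field.
have cE (P : C -> R) : (forall z w, P (z - w) = P z - P w) -> (forall z, P z ^+ 2 <= csqnorm z) ->
    forall x, E x -> cvgn (fun n => P (w n x)).
  move=> PB Pn x [N _ hN].
  apply/cvg_ex; eexists; apply: (@geometric_cvg _ _ N _).1 => n Nn /=.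
  rewrite -PB.
  have : P (w n.+1 x - w n x) ^+ 2 <= (2^-1 ^+ n) ^+ 2.
    by apply: le_trans (Pn _) _; rewrite -q4 ltW// ltNge; apply/negP; exact: hN.
  rewrite -[X in X <= _](real_normK (num_real _)) ler_pXn2r ?nnegrE ?exprn_ge0//.
have cre := cE (@complex.Re R) (@reB R) (@re_sqr_le R); have cim := cE (@complex.Im R) (@imB R) (@im_sqr_le R).
have mE : measurable E.
  by apply: bigcup_measurable => N _; apply: bigcap_measurable => [|n _]; [exists N => /=|exact: measurableC].
have aeE : {ae mu, forall x, E x}.
  apply: (aeS (P := fun x => exists N, forall n, (N <= n)%N -> ~ A n x)) => [x [N hN]|]; first by exists N.
  apply: (@borel_cantelli _ _ mu A c 2^-1 _ mA) => [|n]; first by lra.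
  apply: le_trans (markov_L2 _ (L2B (Lw n.+1) (Lw n))) _; first exact: exprn_gt0.
  have e8 : (8^-1 : R) = 2^-1 * 4^-1 by field.
  by rewrite lee_fin ler_pdivrMr ?exprn_gt0// -mulrA -exprMn -e8; exact: hw.
have lim x : E x -> (re (w k x) @[k --> \oo] --> re (f x)) /\ (im (w k x) @[k --> \oo] --> im (f x)).
  by move=> Ex; rewrite /f asboolT//=; split; [exact: cre|exact: cim].
have mf : cmeas f.
  have ind : forall (P : C -> R), P 0 = 0 -> (forall n, measurable_fun setT (fun x : borel X => P (w n x))) ->
     (forall x, E x -> P (w k x) @[k --> \oo] --> P (f x)) -> measurable_fun setT (fun x : borel X => P (f x)).
    move=> P P0 mP PE.
    apply: (@measurable_fun_cvg _ (borel X) R setT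
      (fun n (x : borel X) => \1_E x * P (w n x)) (fun x : borel X => P (f x))).
      by move=> n; apply: measurable_funM => //; exact: measurable_indic.
    move=> x _; rewrite indicE; case: (pselect (E x)) => Ex.
      by rewrite mem_set//; under eq_cvg do rewrite mul1r; exact: PE.
    rewrite memNset//; under eq_cvg do rewrite mul0r.
    by rewrite /f asboolF// P0; exact: cvg_cst.
  split; apply: ind => //.
  - by move=> n; have [] := L2_meas (Lw n).
  - by move=> x /lim[].
  - by move=> n; have [] := L2_meas (Lw n).
  - by move=> x /lim[].
have F n : L2 mu (fun x => f x - w n x) /\ L2N mu (fun x => f x - w n x) <= 4 * c * 8^-1 ^+ n.
  apply: (@L2_fatou (fun k x => w (n + k)%N x - w n x)).
  - by move=> k; exact: L2B.
  - by apply: cmeasB => //; exact: L2_meas (Lw n).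
  - apply: aeS aeE => x /lim[hr hi]; apply: csq_cvg.
      under eq_cvg do rewrite reB; rewrite reB; apply: cvgB; last exact: cvg_cst.
      by apply: cvg_comp (cvg_addnl n) hr.
    under eq_cvg do rewrite imB; rewrite imB; apply: cvgB; last exact: cvg_cst.
    by apply: cvg_comp (cvg_addnl n) hi.
  - by move=> k; exact: B.
exists f; last by move=> n; case: (F n).
have := L2D (F 0%N).1 (Lw 0%N).
by under [X in L2 mu X -> _]eq_fun do rewrite subrK.
Qed.

End L2_limits.

(** * Continuous functions are dense and determine measures *)

Section continuous_functions.
Context (R : realType) (X : pmetricType R).
Local Notation C := (R[i]).
Hypothesis cX : compact [set: X].

Lemma lipschitz_continuous (u : X -> R) (K : R) :
  (forall x y, `|u x - u y| <= K * mdist x y) -> continuous u.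
Proof.
move=> h x; apply/cvgrPdist_lt => e e0.
have K0 : 0 < `|K| + 1 by rewrite ltr_wpDl.
have : nbhs x (ball x (e / (`|K| + 1))) by apply: nbhsx_ballx; exact: divr_gt0.
apply: filterS => y; rewrite ballEmdist /= => d.
apply: le_lt_trans (h x y) _; apply: (@le_lt_trans _ _ ((`|K| + 1) * mdist x y)).
  by rewrite ler_wpM2r ?mdist_ge0// (le_trans (ler_norm K))// lerDl.
by move: d; rewrite ltr_pdivlMr// mulrC.
Qed.

Lemma continuous_bounded (u : X -> R) : continuous u -> exists K, forall x, `|u x| <= K.
Proof.
move=> cu; have : compact (u @` setT).
  by apply: continuous_compact => //; exact: continuous_subspaceT.
move/compact_bounded => [M [_ hM]]; exists (M + 1) => x.
by apply: hM; [rewrite ltrDl|exists x].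
Qed.

Definition infd (F : set X) (x : X) : R := inf [set mdist x y | y in F].

Lemma infd_lip (F : set X) x y : F !=set0 -> `|infd F x - infd F y| <= mdist x y.
Proof.
move=> [z0 Fz0].
have h a b : infd F a <= infd F b + mdist a b.
  rewrite -lerBlDr; apply: lb_le_inf; first by exists (mdist b z0), z0.
  move=> _ [z Fz <-]; rewrite lerBlDr.
  apply: (@le_trans _ _ (mdist a z)).
    by apply: ge_inf; [exists 0 => _ [w _ <-]; exact: mdist_ge0|exists z].
  by rewrite addrC; exact: metric_triangle.
rewrite ler_norml; have := h x y; have := h y x; rewrite (metric_sym y x); lra.
Qed.

Lemma open_approx (U : set X) : open U -> exists u : nat -> X -> R,
  [/\ forall k, continuous (u k), forall k x, 0 <= u k x <= 1 &
      forall x, u k x @[k --> \oo] --> (\1_U x : R)].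
Proof.
move=> oU; have [F0|/set0P F0] := eqVneq (~` U) set0.
  have -> : U = setT by rewrite -[U]setCK F0 setC0.
  exists (fun _ _ => 1); split => [k|k x|x]; first exact: cst_continuous.
    by rewrite ler01 lexx.
  by rewrite indicT; exact: cvg_cst.
have d0 x : 0 <= infd (~` U) x.
  apply: lb_le_inf; first by case: F0 => z Fz; exists (mdist x z), z.
  by move=> _ [z _ <-]; exact: mdist_ge0.
exists (fun k x => Num.min 1 (k%:R * infd (~` U) x)); split => [k|k x|x].
- apply: (@lipschitz_continuous _ k%:R) => x y.
  apply: (@le_trans _ _ `|k%:R * infd (~` U) x - k%:R * infd (~` U) y|).
    by rewrite /Num.min; case: ltP => a; case: ltP => b; rewrite ler_norml;
      have := ler_norm (k%:R * infd (~` U) x - k%:R * infd (~` U) y);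
      have := ler_norm (-(k%:R * infd (~` U) x - k%:R * infd (~` U) y));
      rewrite normrN; move: a b; lra.
  by rewrite -mulrBr normrM ger0_norm// ler_wpM2l//; exact: infd_lip.
- by rewrite le_min ler01 mulr_ge0//= ge_min lexx.
- rewrite indicE; case: (pselect (U x)) => Ux; last first.
    rewrite memNset//; suff -> : infd (~` U) x = 0.
      by under eq_cvg do rewrite mulr0; rewrite minElt ltr10; exact: cvg_cst.
    apply/eqP; rewrite eq_le d0 andbT; apply: ge_inf.
      by exists 0 => _ [w _ <-]; exact: mdist_ge0.
    by exists x => //; exact: mdistxx.
  rewrite mem_set//.
  have : nbhs x U by exact: open_nbhs_nbhs.
  move/nbhs_ballP => [e /= e0 he].
  have dx : e <= infd (~` U) x.
    apply: lb_le_inf; first by case: F0 => z Fz; exists (mdist x z), z.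
    move=> _ [z Fz <-]; rewrite leNgt; apply/negP => h; apply: Fz; apply: he.
    by rewrite ballEmdist.
  apply: cvg_near_cst; near=> k; rewrite minElt; case: ltP => //; rewrite leNgt => /negP[].
  apply: lt_le_trans (_ : k%:R * e <= _); last by rewrite ler_wpM2l.
  rewrite -ltr_pdivrMr// mul1r; near: k; exact: nbhs_infty_gtr.
Unshelve. all: by end_near. Qed.

Definition ccont (f : X -> C) := continuous (fun x => re (f x)) /\ continuous (fun x => im (f x)).

Lemma ccont_cst (a : C) : ccont (fun=> a).
Proof. by split; exact: cst_continuous. Qed.

Lemma ccontD f g : ccont f -> ccont g -> ccont (fun x => f x + g x).
Proof.
move=> [fr fi] [gr gi]; split.
  by under eq_fun do rewrite reD; move=> x; apply: cvgD; [exact: fr|exact: gr].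
by under eq_fun do rewrite imD; move=> x; apply: cvgD; [exact: fi|exact: gi].
Qed.

Lemma ccontM f g : ccont f -> ccont g -> ccont (fun x => f x * g x).
Proof.
move=> [fr fi] [gr gi]; split.
  under eq_fun do rewrite reM; move=> x.
  by apply: cvgB; apply: cvgM; [exact: fr|exact: gr|exact: fi|exact: gi].
under eq_fun do rewrite imM; move=> x.
by apply: cvgD; apply: cvgM; [exact: fr|exact: gi|exact: fi|exact: gr].
Qed.
Lemma ccontZ (a : C) f : ccont f -> ccont (fun x => a * f x).
Proof. by move=> cf; apply: ccontM => //; exact: ccont_cst. Qed.

Lemma ccontB f g : ccont f -> ccont g -> ccont (fun x => f x - g x).
Proof.
move=> cf /(ccontZ (-1)) cg.
have -> : (fun x => f x - g x) = (fun x => f x + (-1) * g x).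
  by apply/funext => x; rewrite mulN1r.
exact: ccontD.
Qed.

Lemma ccont_bounded f : ccont f -> exists2 K : R, 0 <= K & forall x, csqnorm (f x) <= K.
Proof.
move=> [/continuous_bounded[K h] /continuous_bounded[L k]].
have sq (a b : R) : `|a| <= b -> a ^+ 2 <= b ^+ 2.
  by move=> ab; rewrite -(real_normK (num_real a)) lerXn2r ?nnegrE// (le_trans _ ab).
exists (K ^+ 2 + L ^+ 2); first by rewrite addr_ge0 ?sqr_ge0.
by move=> x; apply: lerD; exact: sq.
Qed.
Lemma ccont_cmeas f : ccont f -> cmeas f.
Proof. by move=> [a b]; split; exact: cont_borelR. Qed.

Lemma ccont_L2 (mu : probability (borel X) R) f : ccont f -> L2 mu f.
Proof.
by move=> cf; have [K _ h] := ccont_bounded cf; exact: (@L2_bounded _ _ mu f K (ccont_cmeas cf) h).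
Qed.

Section one_measure.
Variable mu : probability (borel X) R.

Lemma intg_bounded (u : borel X -> R) (K : R) : measurable_fun setT u ->
  (forall x, `|u x| <= K) -> intg mu u.
Proof. by move=> mu_ h; apply: (intg_le mu_ h); exact: intg_cst. Qed.

Lemma Rint_dct (w : nat -> borel X -> R) (v : borel X -> R) (u : borel X -> R) :
  (forall k, measurable_fun setT (w k)) -> intg mu v -> (forall k x, `|w k x| <= v x) ->
  (forall x, w k x @[k --> \oo] --> u x) ->
  \int[mu]_x w k x @[k --> \oo] --> \int[mu]_x u x.
Proof.
move=> mw iv wv wu.
have mu_ : measurable_fun setT u by apply: (measurable_fun_cvg mw) => x _; exact: wu.
have iw k : intg mu (w k) by apply: intg_le iv.
have uv x : `|u x| <= v x.
  have := wu x => /cvg_norm /cvg_lim <- //; apply: limr_le.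
    by apply/cvg_ex; eexists; apply: cvg_norm; exact: wu.
  by apply: nearW => k; exact: wv.
have iu : intg mu u by apply: intg_le iv.
have [] := @dominated_convergence _ _ _ mu setT measurableT (fun k => EFin \o w k)
   (EFin \o u) (EFin \o v).
- by move=> k; apply/measurable_EFinP.
- by apply/measurable_EFinP.
- by apply: aeW => x _ /=; apply: cvg_EFin; [exact: nearW|exact: wu].
- exact: iv.
- by apply: aeW => x k _ /=; rewrite lee_fin.
move=> _ _; rewrite -[X in _ --> X -> _]fineK; last exact: integrable_fin_num iu.
exact: fine_cvg.
Qed.

Definition cdense : set (X -> C) := [set f | L2 mu f /\
  forall e : R, 0 < e -> exists2 g, ccont g & L2N mu (fun x => f x - g x) <= e].

Lemma cdense_ccont f : ccont f -> cdense f.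
Proof.
move=> cf; split; first exact: ccont_L2.
move=> e e0; exists f => //.
rewrite /L2N; under eq_Rintegral do rewrite subrr csq0.
by rewrite Rint_cst ltW.
Qed.

Lemma cdense_lim f : L2 mu f -> (forall e : R, 0 < e -> exists2 g, cdense g &
  L2N mu (fun x => f x - g x) <= e) -> cdense f.
Proof.
move=> Lf h; split => // e e0.
have e4 : 0 < e / 4 by rewrite divr_gt0.
have [g [Lg /(_ _ e4)[k ck gk]] fg] := h _ e4.
exists k => //; apply: le_trans (L2N_tri Lf Lg (ccont_L2 mu ck)) _; lra.
Qed.

Lemma cdenseD f g : cdense f -> cdense g -> cdense (fun x => f x + g x).
Proof.
move=> [Lf df] [Lg dg]; split; first exact: L2D.
move=> e e0; have e4 : 0 < e / 4 by rewrite divr_gt0.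
have [f' cf' ff'] := df _ e4; have [g' cg' gg'] := dg _ e4.
exists (fun x => f' x + g' x); first exact: ccontD.
have -> : (fun x => f x + g x - (f' x + g' x)) = (fun x => (f x - f' x) + (g x - g' x)).
  by apply/funext => x; ring.
have L1 := L2B Lf (ccont_L2 mu cf'); have L2' := L2B Lg (ccont_L2 mu cg').
apply: le_trans (L2ND_le L1 L2') _; lra.
Qed.

Lemma cdenseZ (a : C) f : cdense f -> cdense (fun x => a * f x).
Proof.
move=> [Lf df]; split; first exact: L2Z.
move=> e e0; have c0 := csq_ge0 a.
have [|g cg fg] := df (e / (csqnorm a + 1)); first by rewrite divr_gt0// ltr_wpDl.
exists (fun x => a * g x); first exact: ccontZ.
have -> : (fun x => a * f x - a * g x) = (fun x => a * (f x - g x)).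
  by apply/funext => x; rewrite mulrBr.
rewrite L2NZ; last by apply: L2B => //; exact: ccont_L2.
apply: (@le_trans _ _ ((csqnorm a + 1) * L2N mu (fun x => f x - g x))).
  by rewrite ler_wpM2r ?L2N_ge0// lerDl.
by rewrite -ler_pdivlMl ?ltr_wpDl// mulrC.
Qed.

Lemma cdense_sum (I : Type) (r : seq I) (F : I -> X -> C) : (forall i, cdense (F i)) ->
  cdense (fun x => \sum_(i <- r) F i x).
Proof.
move=> dF; elim: r => [|i r IH].
  by under eq_fun do rewrite big_nil; exact/cdense_ccont/ccont_cst.
by under eq_fun do rewrite big_cons; exact: cdenseD.
Qed.

Lemma cdense_dct (w : nat -> X -> C) f (v : borel X -> R) : (forall k, cdense (w k)) ->
  L2 mu f -> intg mu v -> (forall k x, csqnorm (f x - w k x) <= v x) ->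
  (forall x, csqnorm (f x - w k x) @[k --> \oo] --> (0 : R)) -> cdense f.
Proof.
move=> dw Lf iv fv f0; apply: cdense_lim => // e e0.
have Lw k : L2 mu (w k) by case: (dw k).
have := @Rint_dct (fun k x => csqnorm (f x - w k x)) v (fun=> 0) _ iv _ f0.
rewrite Rint_cst => h.
have {}h : \int[mu]_x csqnorm (f x - w k x) @[k --> \oo] --> (0 : R).
  apply: h => [k|k x]; last by rewrite ger0_norm ?csq_ge0.
  by apply: cmeas_csq; exact: L2_meas (L2B Lf (Lw k)).
move/cvgrPdist_le : h => /(_ e e0)[k _ /(_ k (leqnn k))]; rewrite sub0r normrN => h.
by exists (w k) => //; apply: le_trans h; exact: ler_norm.
Qed.
Lemma csq_real (a : R) : csqnorm (a%:C%C) = a ^+ 2.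
Proof. by rewrite /csqnorm /= expr0n addr0. Qed.

Lemma indic_bigcup_sum (F : (set X)^nat) (k : nat) (x : X) (j : nat) :
  trivIset setT F -> F j x -> \sum_(i < k) (\1_(F i) x : R)%:C%C = ((j < k)%N%:R : R)%:C%C.
Proof.
move=> tF Fj; have e i : (\1_(F i) x : R) = (i == j)%:R.
  rewrite indicE; case: eqP => [->|ij]; first by rewrite mem_set.
  rewrite memNset// => Fi; apply: ij; apply: (tF i j) => //.
  by exists x.
elim: k => [|k IH]; first by rewrite big_ord0.
rewrite big_ord_recr /= IH e -raddfD/= ltnS (leq_eqVlt j k) (eq_sym k j); congr (_%:C%C).
by case: ltngtP => _; rewrite ?addr0 ?add0r.
Qed.

(** Open sets are stable under intersection and their indicators are limits of continuous functions.
    The sets with approximable indicator form a Dynkin system, so they include all Borel sets. *)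
Lemma cdense_indic (A : set (borel X)) : measurable A -> cdense (fun x => (\1_A x)%:C%C).
Proof.
have LI (B : set (borel X)) : measurable B -> L2 mu (fun x => (\1_B x)%:C%C).
  move=> mB; apply: (@L2_bounded _ _ _ _ 1).
    by split; [exact: measurable_indic|exact: measurable_cst].
  by move=> x; rewrite csq_real indicE; case: (_ \in _); rewrite ?expr1n ?expr0n.
have csq1 (a b : R) : 0 <= a <= 1 -> 0 <= b <= 1 -> csqnorm (a%:C%C - b%:C%C) <= 1.
  by move=> ? ?; rewrite /csqnorm /= subr0 expr0n addr0; nra.
have ind01 (B : set (borel X)) x : 0 <= (\1_B x : R) <= 1.
  by rewrite indicE; case: (_ \in _); rewrite ?lexx ?ler01.
apply: (@dynkin_induction _ (borel X) (@open X) (fun A => cdense (fun x => (\1_A x)%:C%C))) => //.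
- by move=> U V; exact: openI.
- by apply: cdense_ccont; rewrite indicT; exact: (ccont_cst 1).
- move=> U oU; have [u [cu u01 uU]] := open_approx oU.
  apply: (@cdense_dct (fun k x => (u k x)%:C%C) _ (fun=> 1)).
  + by move=> k; apply: cdense_ccont; split; [exact: cu|exact: cst_continuous].
  + by apply: LI; exact: sub_sigma_algebra.
  + exact: intg_cst.
  + by move=> k x; exact: csq1.
  + move=> x; rewrite -[X in _ --> X](@csq0 R) -(subrr (\1_U x)%:C%C).
    apply: csq_cvg => /=; last by rewrite subrr; exact: cvg_cst.
    by apply: cvgB; [exact: cvg_cst|exact: uU].
- move=> S mS dS.
  have -> : (fun x => (\1_(~` S) x)%:C%C) = (fun x => 1 + (-1) * (\1_S x)%:C%C) :> (X -> C).
    apply/funext => x; rewrite !indicE in_setC; case: (_ \in _) => /=; by rewrite ?mulr1 ?mulr0 ?addr0 ?subrr.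
  by apply: cdenseD; [exact/cdense_ccont/ccont_cst|exact: cdenseZ].
- move=> F mF tF dF.
  have out x : ~ (\bigcup_i F i) x -> forall i, (\1_(F i) x : R) = 0.
    by move=> nF i; rewrite indicE memNset// => Fi; apply: nF; exists i.
  apply: (@cdense_dct (fun k x => \sum_(i < k) (\1_(F i) x)%:C%C) _ (fun=> 1)).
  + by move=> k; exact: cdense_sum.
  + by apply: LI; exact: bigcup_measurable.
  + exact: intg_cst.
  + move=> k x; case: (pselect ((\bigcup_i F i) x)) => [[j _ Fj]|nF].
      rewrite (indic_bigcup_sum k tF Fj); apply: csq1 => //.
      by case: (j < k)%N; rewrite ?ler01 ?lexx.
    rewrite big1; last by move=> i _; rewrite out.
    by apply: (csq1 _ 0) => //; rewrite lexx ler01.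
  + move=> x; apply: cvg_near_cst; case: (pselect ((\bigcup_i F i) x)) => [[j _ Fj]|nF].
      near=> k; rewrite (indic_bigcup_sum k tF Fj) (_ : (j < k)%N); last by near: k; exact: nbhs_infty_gt.
      by rewrite indicE mem_set ?subrr ?csq0//; exists j.
    apply: nearW => k; rewrite big1; last by move=> i _; rewrite out.
    by rewrite indicE memNset// subrr csq0.
Unshelve. all: by end_near. Qed.

Import HBNNSimple.

Lemma cdense_nnsfun (h : {nnsfun borel X >-> R}) : cdense (fun x => (h x)%:C%C).
Proof.
have -> : (fun x => (h x)%:C%C) = fun x => \sum_(y <- finmap.enum_fset (fset_set (range h))) y%:C%C * (\1_(h @^-1` [set y]) x : R)%:C%C.
  apply/funext => x; rewrite {1}fimfunE fsbig_finite//= (rmorph_sum (real_complex R)).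
  by apply: eq_bigr => y _; rewrite (rmorphM (real_complex R)).
by apply: cdense_sum => y; apply: cdenseZ; apply: cdense_indic; exact: measurable_sfunP.
Qed.

Lemma cdense_nonneg (u : borel X -> R) : measurable_fun setT u -> (forall x, 0 <= u x) ->
  L2 mu (fun x => (u x)%:C%C) -> cdense (fun x => (u x)%:C%C).
Proof.
move=> mu_ u0 Lu; have mE : measurable_fun setT (EFin \o u) by exact/measurable_EFinP.
pose h := nnsfun_approx measurableT mE.
have hc x : h n x @[n --> \oo] --> u x.
  have := cvg_nnsfun_approx measurableT mE (fun x _ => u0 x) (Logic.I : setT x).
  exact: fine_cvg.
have hu n x : h n x <= u x.
  rewrite -(cvg_lim (@Rhausdorff R) (hc x)); apply: (nondecreasing_cvgn_le (u_ := fun n => h n x)).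
    by move=> i j ij; have /lefP := nd_nnsfun_approx measurableT mE ij; exact.
  by apply/cvg_ex; exists (u x); exact: hc.
apply: (@cdense_dct (fun n x => (h n x)%:C%C) _ (fun x => csqnorm (u x)%:C%C)) => //.
- by move=> n; exact: cdense_nnsfun.
- exact: L2_intg.
- move=> n x; rewrite -(rmorphB (real_complex R)) !csq_real.
  by have := hu n x; have := u0 x; have : 0 <= h n x by []; nra.
move=> x; rewrite -[X in _ --> X](@csq0 R) -(subrr (u x)%:C%C).
apply: csq_cvg => /=; last by rewrite subrr; exact: cvg_cst.
by apply: cvgB; [exact: cvg_cst|exact: hc].
Qed.

Lemma cdense_L2 f : L2 mu f -> cdense f.
Proof.
move=> Lf; have [mr mi] := L2_meas Lf.
have pos (u : borel X -> R) : measurable_fun setT u -> (forall x, u x ^+ 2 <= csqnorm (f x)) ->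
    cdense (fun x => (Num.max (u x) 0)%:C%C).
  move=> mu_ uf; have mm : measurable_fun setT (fun x : borel X => Num.max (u x) 0).
    by apply: measurable_maxr => //; exact: measurable_cst.
  apply: cdense_nonneg => // [x|]; first by rewrite le_max lexx orbT.
  apply: (L2_le _ (L2_intg Lf)) => [|x]; first by split; [exact: mm|exact: measurable_cst].
  by rewrite csq_real; apply: le_trans (uf x); rewrite maxEle; case: ifP => _; rewrite ?expr0n ?sqr_ge0.
have part (u : borel X -> R) : measurable_fun setT u -> (forall x, u x ^+ 2 <= csqnorm (f x)) ->
    cdense (fun x => (u x)%:C%C).
  move=> mu_ uf; have -> : (fun x => (u x)%:C%C) =
      fun x => (Num.max (u x) 0)%:C%C + (-1) * (Num.max (- u x) 0)%:C%C :> C.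
    apply/funext => x; rewrite mulN1r -(rmorphB (real_complex R)) !maxEle; congr (_%:C%C).
    by case: ifP; case: ifP => h1 h2; lra.
  apply: cdenseD; [exact: pos|apply: cdenseZ; apply: pos]; first exact: measurableT_comp.
  by move=> x; rewrite sqrrN.
have -> : f = (fun x => (re (f x))%:C%C + 'i%C * (im (f x))%:C%C).
  by apply/funext => x; apply: cplxP; rewrite !reimE /=; ring.
by apply: cdenseD; last apply: cdenseZ; apply: part => // x; rewrite ?re_sqr_le ?im_sqr_le.
Qed.

End one_measure.

Lemma measure_continuous_eq (mu nu : probability (borel X) R) :
  (forall u : X -> R, continuous u -> \int[mu]_x u x = \int[nu]_x u x) ->
  forall A : set (borel X), measurable A -> mu A = nu A.
Proof.
move=> h A mA; refine (@measure_unique _ R (borel X) (@open X) (fun=> setT) erefl _ _ _ mu nu _ _ A mA) => //.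
- by move=> U V; exact: openI.
- by move=> _; exact: openT.
- by apply/seteqP; split=> // x _; exists 0%N.
- move=> U oU; have [u [cu u01 uU]] := open_approx oU.
  have mU : measurable (U : set (borel X)) by exact: sub_sigma_algebra.
  have c (ka : probability (borel X) R) : \int[ka]_x u k x @[k --> \oo] --> fine (ka U).
    have -> : fine (ka U) = \int[ka]_x (\1_U x : R) by rewrite /Rintegral integral_indic// setIT.
    apply: (@Rint_dct ka (fun k x => u k x) (fun=> 1)) => //.
    + by move=> k; exact: cont_borelR.
    + exact: intg_cst.
    + by move=> k x; have := u01 k x; case/andP => a b; rewrite ger0_norm.
  have := c mu; under eq_cvg do rewrite h//; move=> cm.
  have e : fine (mu U) = fine (nu U) by apply: (cvg_unique _ cm (c nu)).
  by rewrite -[LHS]fineK ?fin_num_measure// e fineK ?fin_num_measure.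
by move=> _; rewrite ltey_eq fin_num_measure.
Qed.

End continuous_functions.

Lemma ccont_comp (R : realType) (X Y : pmetricType R) (T : X -> Y) (f : Y -> R[i]) :
  continuous T -> ccont f -> ccont (f \o T).
Proof.
by move=> cT [cr ci]; split=> x; [apply: (@continuous_comp _ _ _ T (fun y => re (f y)))
  |apply: (@continuous_comp _ _ _ T (fun y => im (f y)))]; first [exact: cT|exact: cr|exact: ci].
Qed.

(** * Roots of unity and finite Fourier analysis *)

Section unit_circle.
Context (R : realType).
Local Notation C := (R[i]).
Implicit Types (s t : R) (z w : C).

(** The exponential of [2 pi i t], the parametrization that is also used in [circle_lebesgue]. *)
Definition ec t : C := Complex (cos (2 * pi * t)) (sin (2 * pi * t)).

Lemma ecD s t : ec (s + t) = ec s * ec t.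
Proof.
apply: cplxP; rewrite ?reM ?imM /= mulrDr ?cosD ?sinD //.
by rewrite addrC; congr (_ + _); rewrite mulrC.
Qed.
Lemma ec0 : ec 0 = 1.
Proof. by apply: cplxP; rewrite /= mulr0 ?cos0 ?sin0. Qed.

Lemma ec1 : ec 1 = 1.
Proof.
by apply: cplxP; rewrite /= mulr1 mulrC mulr_natr ?cos2pi ?sin2pi.
Qed.
Lemma circle_ec t : circle (ec t).
Proof. by rewrite /circle /csqnorm /= cos2Dsin2. Qed.

Lemma ecN t : ec (- t) = (ec t)^-1.
Proof.
have e0 := circle_neq0 (circle_ec t).
by apply: (mulfI e0); rewrite -ecD subrr ec0 divff.
Qed.
Lemma ec_mulrn t n : ec (t *+ n) = ec t ^+ n.
Proof. by elim: n => [|n IH]; rewrite ?mulr0n ?ec0// mulrS ecD IH exprS. Qed.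
Lemma ec_nat n : ec n%:R = 1.
Proof. by rewrite ec_mulrn ec1 expr1n. Qed.
Lemma ec_int (k : int) : ec k%:~R = 1.
Proof. by case: k => n; rewrite ?ec_nat// NegzE mulrNz ecN ec_nat invr1. Qed.

Lemma ec_neq1 t : 0 < t < 1 -> ec t != 1.
Proof.
move=> /andP[t0 t1]; apply/eqP => /(congr1 (@complex.Re R)) /= /eqP; apply/negP.
have s0 : 0 < sin (pi * t).
  by apply: sin_gt0_pi; rewrite mulr_gt0 ?pi_gt0//= gtr_pMr ?pi_gt0.
have -> : 2 * pi * t = (pi * t) *+ 2 by rewrite mulr2n; ring.
rewrite cos_mulr2n cos2sin2 -subr_eq0 mulr2n.
by apply: ltr0_neq0; have := exprn_gt0 2 s0; lra.
Qed.

Lemma circle_ecP z : circle z -> exists t, [/\ 0 <= t, t < 1 & ec t = z].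
Proof.
case: z => a b; rewrite /circle /csqnorm /= => ab.
have b2 := sqr_ge0 b; have a1 : -1 <= a <= 1 by apply/andP; split; nra.
have p0 := pi_gt0 R.
have sE : sin (acos a) = `|b|.
  rewrite sin_acos// -sqrtr_sqr; congr Num.sqrt; lra.
have c0 := acos_ge0 a1; have cp := acos_lepi a1.
have cK : cos (acos a) = a by rewrite acosK// in_itv.
have [b0|b0] := leP 0 b.
  exists (acos a / (2 * pi)); split.
  - by rewrite divr_ge0// mulr_ge0// ltW.
  - by rewrite ltr_pdivrMr ?mulr_gt0//; lra.
  - rewrite /ec (_ : 2 * pi * (acos a / (2 * pi)) = acos a).
      by rewrite cK sE ger0_norm.
    by rewrite mulrC divfK// mulf_neq0 ?pnatr_eq0// lt0r_neq0.
have cp0 : 0 < acos a.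
  apply: acos_gt0; case/andP: a1 => -> /=; rewrite le_eqVlt => /orP[/eqP a1|//].
  by exfalso; move: ab b0; rewrite a1 expr1n; nra.
exists (1 - acos a / (2 * pi)); split.
- by rewrite subr_ge0 ler_pdivrMr ?mulr_gt0//; lra.
- by rewrite ltrBlDr ltrDl divr_gt0// mulr_gt0.
- rewrite ecD ec1 mul1r ecN circleV; last exact: circle_ec.
  rewrite /ec (_ : 2 * pi * (acos a / (2 * pi)) = acos a).
    by rewrite /= cK sE ltr0_norm// opprK.
  by rewrite mulrC divfK// mulf_neq0 ?pnatr_eq0// lt0r_neq0.
Qed.

Lemma sum_root_unity (w : C) (M : nat) : w ^+ M = 1 -> w != 1 -> \sum_(l < M) w ^+ l = 0.
Proof.
move=> wM w1; have := subrX1 w M; rewrite wM subrr => /esym/eqP.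
by rewrite mulf_eq0 subr_eq0 (negbTE w1) => /eqP.
Qed.

Definition rt (M : nat) : C := ec M%:R^-1.

Lemma rt_pow M j : (0 < M)%N -> rt M ^+ j = ec (j%:R / M%:R).
Proof. by move=> M0; rewrite /rt -ec_mulrn; congr ec; rewrite mulr_natl. Qed.
Lemma rt_M M : (0 < M)%N -> rt M ^+ M = 1.
Proof. by move=> M0; rewrite rt_pow// divff ?ec1// pnatr_eq0 -lt0n. Qed.

Lemma rt_neq1 M j : (0 < j < M)%N -> rt M ^+ j != 1.
Proof.
move=> /andP[j0 jM]; have M0 := leq_ltn_trans (leq0n j) jM.
rewrite rt_pow//; apply: ec_neq1; rewrite divr_gt0 ?ltr0n//=.
by rewrite ltr_pdivrMr ?ltr0n// mul1r ltr_nat.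
Qed.

Lemma circle_rt M : circle (rt M). Proof. exact: circle_ec. Qed.
Lemma circleX z n : circle z -> circle (z ^+ n).
Proof. by rewrite /circle /= csqX => ->; rewrite expr1n. Qed.
Lemma circleM z w : circle z -> circle w -> circle (z * w).
Proof. by rewrite /circle /= csqM => -> ->; rewrite mulr1. Qed.
Lemma circleVr z : circle z -> circle z^-1.
Proof. by rewrite /circle /= csqV => ->; rewrite invr1. Qed.

(** Plancherel's identity for the cyclic group of order [M]: after expanding the squares and summing
    over [l], only the diagonal terms survive. *)
Lemma parseval (M : nat) (a : 'I_M -> C) : (0 < M)%N ->
  \sum_(l < M) csqnorm (\sum_(j < M) a j * rt M ^+ j ^+ l) = M%:R * \sum_(j < M) csqnorm (a j).
Proof.
move=> M0; set w := rt M; have cw := circle_rt M; have w0 := circle_neq0 cw.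
have [rC [rCM rCs rCm]] : exists f : R -> C, [/\ (forall x, f x = x%:C%C),
   (forall (I : Type) (r : seq I) (F : I -> R), f (\sum_(i <- r) F i) = \sum_(i <- r) f (F i)) &
   forall x y, f (x * y) = f x * f y].
  by exists (real_complex R); split => // [I r F|x y]; rewrite ?rmorph_sum ?rmorphM.
have inj x y : rC x = rC y -> x = y by rewrite !rCM => -[].
apply: inj; rewrite rCm !rCs [in RHS]rCM.
have -> : (M%:R : R)%:C%C = M%:R :> C by rewrite -[LHS]/(real_complex R M%:R) rmorph_nat.
transitivity (\sum_(l < M) \sum_(i < M) \sum_(j < M) a i * (a j)^*%C * (w ^+ i / w ^+ j) ^+ l).
  apply: eq_bigr => l _; rewrite rCM -mulJ_csq (raddf_sum (@conjc R)) /=.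
  rewrite mulr_suml; apply: eq_bigr => i _; rewrite mulr_sumr; apply: eq_bigr => j _.
  rewrite rmorphM /= -(circleV (circleX l (circleX j cw))) exprMn exprVn; ring.
rewrite exchange_big /= mulr_sumr; apply: eq_bigr => i _.
rewrite exchange_big /= (bigD1 i) //= [X in _ + X]big1 => [|j ji].
  rewrite addr0 rCM -mulJ_csq divff ?expf_neq0//.
  under eq_bigr do rewrite expr1n mulr1.
  by rewrite sumr_const card_ord mulr_natl.
rewrite -mulr_sumr sum_root_unity ?mulr0//.
  by rewrite exprMn exprVn -!exprM mulnC exprM rt_M// expr1n mulnC exprM rt_M// expr1n divr1.
rewrite -subr_eq0; have [ij|ij] := ltnP i j.
  apply/eqP => /subr0_eq e.
  have : w ^+ (j - i) = 1.
    by apply: (mulIf (expf_neq0 i w0)); rewrite -exprD subnK ?(ltnW ij)// mul1r; move/(congr1 ( *%R^~ (w ^+ j))): e; rewrite divfK ?expf_neq0// mul1r.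
  apply/eqP; apply: rt_neq1; rewrite subn_gt0 ij /=.
  exact: leq_ltn_trans (leq_subr _ _) (ltn_ord j).
have {}ij : (j < i)%N by rewrite ltn_neqAle ij andbT; apply: contra_neq ji => /val_inj.
apply/eqP => /subr0_eq e.
have : w ^+ (i - j) = 1.
  by apply: (mulIf (expf_neq0 j w0)); rewrite -exprD subnK ?(ltnW ij)// mul1r; move/(congr1 ( *%R^~ (w ^+ j))): e; rewrite divfK ?expf_neq0// mul1r.
apply/eqP; apply: rt_neq1; rewrite subn_gt0 ij /=.
exact: leq_ltn_trans (leq_subr _ _) (ltn_ord i).
Qed.

(** The finite Fourier transform turns the cyclic convolution into multiplication by values of the
    polynomial at roots of unity, and these lie on the circle. *)
Lemma cyclic_conv_bound (M : nat) (a : nat -> C) (p : nat -> C) (d : nat) (K : R) : (0 < M)%N ->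
  (forall z, circle z -> csqnorm (\sum_(k < d) p k * z ^+ k) <= K) ->
  \sum_(j < M) csqnorm (\sum_(k < d) p k * a ((j + k) %% M)%N) <=
  K * \sum_(j < M) csqnorm (a j).
Proof.
move=> M0 pK; have MR : 0 < M%:R :> R by rewrite ltr0n.
rewrite -(ler_pM2l MR) mulrCA.
rewrite -(parseval (fun j : 'I_M => \sum_(k < d) p k * a ((j + k) %% M)%N) M0).
rewrite -(parseval (fun j : 'I_M => a j) M0) mulr_sumr; apply: ler_sum => l _.
set w := rt M; have cw : circle w := circle_rt M; have w0 := circle_neq0 cw.
have -> : \sum_(j < M) (\sum_(k < d) p k * a ((j + k) %% M)%N) * w ^+ j ^+ l =
   (\sum_(k < d) p k * (w^-1 ^+ l) ^+ k) * \sum_(j < M) a j * w ^+ j ^+ l.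
  rewrite mulr_suml.
  under eq_bigr do rewrite mulr_suml.
  rewrite exchange_big /=; apply: eq_bigr => k _.
  rewrite -mulrA -[RHS]/(p k * _) mulr_sumr.
  rewrite (eq_bigr (fun j : 'I_M => p k * (a ((j + k) %% M)%N * w ^+ j ^+ l))); last first.
    by move=> j _; rewrite mulrA.
  rewrite -[LHS]mulr_sumr; congr (_ * _).
  pose h (j : 'I_M) : 'I_M := Ordinal (ltn_pmod (j + k) M0).
  have hb : bijective h.
    apply: injF_bij => i j /(congr1 val) /= e; apply: val_inj => /=.
    have : (i = j %[mod M])%N by apply/eqP; rewrite -(eqn_modDr k); apply/eqP.
    by rewrite !modn_small.
  rewrite [RHS](reindex h) /=; last exact: onW_bij.
  apply: eq_bigr => j _; rewrite mulrCA; congr (_ * _).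
  have wm n : w ^+ (n %% M) = w ^+ n.
    by rewrite [in RHS](divn_eq n M) exprD mulnC exprM rt_M// expr1n mul1r.
  rewrite wm exprD exprMn -!exprM (mulnC l k) exprVn mulrCA mulVf ?mulr1//.
  exact: expf_neq0.
rewrite csqM ler_wpM2r ?csq_ge0//; apply: pK.
by apply: circleX; exact: circleVr.
Qed.

Lemma ec_lip s t : csqnorm (ec s - ec t) <= (2 * pi * (s - t)) ^+ 2 * 2.
Proof.
have lip (f f' : R -> R) : (forall x : R, is_derive x 1 f (f' x)) -> (forall x, `|f' x| <= 1) ->
   (f (2 * pi * s) - f (2 * pi * t)) ^+ 2 <= (2 * pi * (s - t)) ^+ 2.
  move=> df f1; have := lipschitz_derive (K := 1) (fun x => df x) f1.
  move=> /(_ (2 * pi * s) (2 * pi * t)); rewrite mul1r -mulrBr => h.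
  by rewrite -(real_normK (num_real (f _ - _))) -(real_normK (num_real (_ * _))) lerXn2r ?nnegrE.
have hc := lip cos (fun x => - sin x) (fun x => is_derive_cos x).
have hs := lip sin cos (fun x => is_derive_sin x).
rewrite /csqnorm !reimE /= mulr_natr mulr2n; apply: lerD.
  by apply: hc => x; rewrite normrN ler_norml sin_geN1 sin_le1.
by apply: hs => x; rewrite ler_norml cos_geN1 cos_le1.
Qed.

End unit_circle.

(** * Uniform approximation by Laurent polynomials on the circle *)

Section weierstrass.
Context (R : realType).
Local Notation C := (R[i]).
Implicit Types (s t : R) (z w : C) (f h : C -> C).

(** Continuity on the circle in the uniform form, with squared moduli; it is equivalent to
    topological continuity by [within_continuous_ucirc] and [ucirc_within_continuous]. *)
Definition ucirc f := forall e : R, 0 < e -> exists2 d : R, 0 < d &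
  forall z w, circle z -> circle w -> csqnorm (z - w) <= d -> csqnorm (f z - f w) <= e.

Lemma csqB_circle z w : circle z -> circle w -> csqnorm (z - w) = csqnorm (z / w - 1).
Proof.
move=> cz cw; have w0 := circle_neq0 cw.
have -> : z - w = (z / w - 1) * w by rewrite mulrBl divfK// mul1r.
by rewrite csqM cw mulr1.
Qed.

Lemma ucirc_bounded f : ucirc f -> exists2 K : R, 0 <= K & forall z, circle z -> csqnorm (f z) <= K.
Proof.
move=> /(_ 1 ltr01)[d d0 hd]; have /compact_near_coveringP := @segment_compact R 0 1.
move=> /(_ R +oo%R (fun K t => csqnorm (f (ec t)) <= K)); case/(_ _ _)/Wrap => [t _|[M [_ hM]]]; last first.
  exists (`|M| + 1); first by rewrite addr_ge0.
  move=> z /circle_ecP[t [t0 t1 <-]]; apply: (hM (`|M| + 1)); last by rewrite /= in_itv /= t0 ltW.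
  by rewrite (le_lt_trans (ler_norm M))// ltrDl.
have c0 : 0 < (2 * pi) ^+ 2 * 2 :> R by rewrite mulr_gt0// exprn_gt0// mulr_gt0// pi_gt0.
have r0 : 0 < d / ((2 * pi) ^+ 2 * 2) by rewrite divr_gt0.
exists (ball t (Num.sqrt (d / ((2 * pi) ^+ 2 * 2))), [set K | 2 + 2 * csqnorm (f (ec t)) <= K]) => /=.
  by split; [apply: nbhsx_ballx; rewrite sqrtr_gt0|exact: nbhs_pinfty_ge (num_real _)].
move=> [s K] /= [ts hK]; apply: le_trans hK.
have st : csqnorm (ec s - ec t) <= d.
  apply: le_trans (ec_lip _ _) _; rewrite exprMn mulrAC mulrC -ler_pdivlMr//.
  rewrite -(sqr_sqrtr (ltW r0)) -(real_normK (num_real (s - t))) lerXn2r ?nnegrE ?sqrtr_ge0//.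
  by rewrite distrC ltW.
have := csqD_le (f (ec s) - f (ec t)) (f (ec t)); rewrite subrK => /le_trans; apply.
by rewrite lerD2r; have := hd _ _ (circle_ec _) (circle_ec _) st; lra.
Qed.

(** On the circle this is the [n]-th power of [|1 + z|^2] divided by its mean value: the kernel of
    de la Vallee Poussin. *)
Definition kern (n : nat) z : C := ((1 + z) * (1 + z^-1)) ^+ n / 'C(n.*2, n)%:R.

Lemma kern_csq z : circle z -> (1 + z) * (1 + z^-1) = (4 - csqnorm (z - 1))%:C%C.
Proof.
move=> cz; rewrite circleV//; move: cz; rewrite /circle /csqnorm; case: z => a b /= cz.
apply: cplxP; rewrite !reimE /=; last by ring.
have -> : (a - 1) ^+ 2 + (b - 0) ^+ 2 = a ^+ 2 + b ^+ 2 - 2 * a + 1 by ring.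
by move: cz; rewrite !expr2; lra.
Qed.

Lemma kern_real n z : circle z -> kern n z = ((4 - csqnorm (z - 1)) ^+ n / 'C(n.*2, n)%:R)%:C%C.
Proof.
move=> cz; rewrite /kern kern_csq// -(rmorphXn (real_complex R)) /=.
by rewrite -(rmorph_nat (real_complex R)) -(fmorphV (real_complex R)) -(rmorphM (real_complex R)).
Qed.

Lemma csq_circle_le4 z : circle z -> csqnorm (z - 1) <= 4.
Proof.
move=> cz; have := csqD_le z (-1); rewrite csqN csqnorm1.
by rewrite (_ : csqnorm z = 1)//; lra.
Qed.

(** [kern n] is a Laurent polynomial of degree [n] with constant term 1, and summing over the
    [n.+1]-st roots of unity kills every other frequency. Averages with this kernel can thus be
    finite sums instead of integrals. *)
Lemma kern_sum n z : circle z -> \sum_(j < n.+1) kern n (z / rt R n.+1 ^+ j) = n.+1%:R.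
Proof.
move=> cz; have z0 := circle_neq0 cz.
set w := rt R n.+1; have cw : circle w := circle_rt _ _; have w0 := circle_neq0 cw.
have C0 : 'C(n.*2, n)%:R != 0 :> C by rewrite pnatr_eq0 -lt0n bin_gt0 -addnn leq_addr.
rewrite -mulr_suml; apply: (canLR (mulfK C0)).
have e (u : C) : u != 0 -> ((1 + u) * (1 + u^-1)) ^+ n = \sum_(k < n.*2.+1) 'C(n.*2, k)%:R * (u ^+ k / u ^+ n).
  move=> u0; have -> : (1 + u) * (1 + u^-1) = (u + 1) ^+ 2 / u by field.
  rewrite exprMn -exprM mul2n exprVn addrC exprDn mulr_suml; apply: eq_bigr => k _.
  by rewrite expr1n mul1r mulr_natl -mulrnAl.
under eq_bigr => j _ do rewrite e ?mulf_neq0 ?invr_eq0 ?expf_neq0//.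
rewrite exchange_big /=.
have nn : (n < n.*2.+1)%N by rewrite ltnS -addnn leq_addr.
rewrite (bigD1 (Ordinal nn)) //= [X in _ + X]big1 => [|k kn].
  rewrite addr0; under eq_bigr => j _ do rewrite divff ?mulr1 ?expf_neq0 ?mulf_neq0 ?invr_eq0 ?expf_neq0//.
  by rewrite sumr_const card_ord mulr_natl.
rewrite -mulr_sumr; apply/eqP; rewrite mulf_eq0; apply/orP; right; apply/eqP.
have wk j : (z / w ^+ j) ^+ k / (z / w ^+ j) ^+ n = z ^+ k / z ^+ n * (w ^+ n / w ^+ k) ^+ j.
  rewrite !exprMn !exprVn -!exprM !(mulnC j) !exprM; field.
  by rewrite !expf_neq0.
under eq_bigr => j _ do rewrite wk; rewrite -mulr_sumr sum_root_unity ?mulr0//.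
  by rewrite exprMn exprVn -!exprM mulnC exprM rt_M// expr1n mulnC exprM rt_M// expr1n divr1.
have kn' : (k : nat) != n by apply: contraNneq kn => kn; apply/eqP/val_inj.
have k2 : (k <= n.*2)%N by rewrite -ltnS.
rewrite -subr_eq0; apply/eqP => /subr0_eq e'.
have {}e' : w ^+ n = w ^+ k by move/(congr1 ( *%R^~ (w ^+ k))): e'; rewrite divfK ?expf_neq0// mul1r.
have [nk|nk|nk] := ltngtP n k.
- have : w ^+ (k - n) = 1.
    by apply: (mulIf (expf_neq0 n w0)); rewrite -exprD subnK ?(ltnW nk)// mul1r.
  by apply/eqP; apply: rt_neq1; rewrite subn_gt0 nk /= ltnS leq_subLR addnn.
- have : w ^+ (n - k) = 1.
    by apply: (mulIf (expf_neq0 k w0)); rewrite -exprD subnK ?(ltnW nk)// mul1r.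
  by apply/eqP; apply: rt_neq1; rewrite subn_gt0 nk /= ltnS leq_subr.
- by move/eqP: kn' => /(_ (esym nk)).
Qed.

(** By induction through the middle coefficient ['C(n.*2.+1, n)]. It shows that normalizing [kern]
    costs only a linear factor. *)
Lemma central_bin n : (4 ^ n <= n.*2.+1 * 'C(n.*2, n))%N.
Proof.
elim: n => [|n IH]; first by rewrite bin0.
have e1 : ((n.+1).*2 * 'C(n.*2.+1, n) = n.+1 * 'C(n.+1.*2, n.+1))%N.
  by rewrite doubleS; have := mul_bin_diag n.*2.+2 n.
have e2 : (n.*2.+1 * 'C(n.*2, n) = n.+1 * 'C(n.*2.+1, n))%N.
  have := mul_bin_diag n.*2.+1 n; rewrite /= => ->.
  have e : (n.*2.+1 - n = n.+1)%N by rewrite -addnn -addnS addKn.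
  by rewrite -(@bin_sub n.*2.+1 n) ?e// -addnn -addnS leq_addr.
move: e1 e2 IH; rewrite expnS; move: ('C(n.*2, n)) ('C(n.*2.+1, n)) ('C(n.+1.*2, n.+1)) (4 ^ n)%N => a b c d.
move=> e1 e2 IH.
have {}e1 : (2 * b = c)%N by nia.
subst c; rewrite doubleS.
have : (n.+1 * d <= n.+1 * (n.*2.+1 * a))%N by rewrite leq_mul2l IH orbT.
rewrite e2 -muln2; move: e2; rewrite -muln2 => e2; nia.
Qed.

Lemma lin_geom (q e : R) : 0 < q < 1 -> 0 < e -> exists n, n.*2.+1%:R * q ^+ n <= e.
Proof.
(* With [s] the root of [q], one factor [s ^+ n] absorbs the linear growth and the other tends to
   0. *)
move=> /andP[q0 q1] e0; pose s := Num.sqrt q.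
have s0 : 0 < s by rewrite sqrtr_gt0.
have s2 : s ^+ 2 = q by rewrite sqr_sqrtr// ltW.
have s1 : s < 1 by rewrite ltNge; apply/negP => s1; move: q1; rewrite -s2; nra.
have b n : n%:R * (1 - s) * s ^+ n <= 1 - s ^+ n.
  elim: n => [|n IH]; first by rewrite !mul0r expr0 subrr.
  have sn : s ^+ n.+1 <= 1 by rewrite exprn_ile1// ltW.
  have := ler_wpM2l (ltW s0) IH; have : 0 <= (1 - s) * (1 - s ^+ n.+1) by rewrite mulr_ge0// subr_ge0// ltW.
  by rewrite -natr1 exprS; lra.
have c0 : 0 < 2 / (1 - s) + 1 by rewrite ltr_wpDl// divr_ge0// subr_ge0 ltW.
have [n] : exists n, s ^+ n <= e / (2 / (1 - s) + 1).
  have ns : `|s| < 1 by rewrite gtr0_norm.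
  have /cvgr0Pnorm_le/(_ _ (divr_gt0 e0 c0))[n _ /(_ n (leqnn n))] := cvg_expr ns.
  by rewrite /= ger0_norm ?exprn_ge0 ?(ltW s0)// => h; exists n.
rewrite ler_pdivlMr// => hn; exists n; apply: le_trans hn; have sn0 : 0 <= s ^+ n by rewrite exprn_ge0// ltW.
rewrite -s2 exprAC expr2 mulrCA; apply: ler_wpM2l => //.
have sn1 : s ^+ n <= 1 by rewrite exprn_ile1// ltW.
have : n%:R * s ^+ n <= 1 / (1 - s) by rewrite ler_pdivlMr ?subr_gt0//; have := b n; lra.
by rewrite -addn1 natrD -muln2 natrM; lra.
Qed.

Lemma kern_small (d e : R) : 0 < d -> 0 < e -> exists n, forall z, circle z -> d <= csqnorm (z - 1) ->
  (4 - csqnorm (z - 1)) ^+ n / 'C(n.*2, n)%:R <= e.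
Proof.
move=> d0 e0; pose d' := Num.min d 1.
have d'1 : d' <= 1 by rewrite ge_min lexx orbT.
have d'0 : 0 < d' by rewrite lt_min d0 ltr01.
have d'd : d' <= d by rewrite ge_min lexx.
have [|n hn] := @lin_geom (1 - d' / 4) e _ e0; first by apply/andP; split; lra.
exists n => z cz dz; apply: le_trans hn.
have b0 : 0 < 'C(n.*2, n)%:R :> R by rewrite ltr0n bin_gt0 -addnn leq_addr.
have c4 := csq_circle_le4 cz.
rewrite ler_pdivrMr//.
apply: (@le_trans _ _ ((4 * (1 - d' / 4)) ^+ n)).
  by rewrite lerXn2r ?nnegrE//; lra.
rewrite exprMn mulrAC ler_wpM2r//; first by rewrite exprn_ge0//; lra.
by rewrite -natrX -natrM ler_nat central_bin.
Qed.
Lemma realC_sum (I : Type) (r : seq I) (P : pred I) (F : I -> R) :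
  (\sum_(i <- r | P i) F i)%:C%C = \sum_(i <- r | P i) (F i)%:C%C.
Proof. exact: (rmorph_sum (real_complex R)). Qed.

Lemma jensen_csq (M : nat) (c : 'I_M -> R) (a : 'I_M -> C) : (forall j, 0 <= c j) ->
  \sum_j c j = 1 -> csqnorm (\sum_j (c j)%:C%C * a j) <= \sum_j c j * csqnorm (a j).
Proof.
move=> c0 c1.
have key (x : 'I_M -> R) : (\sum_j c j * x j) ^+ 2 <= \sum_j c j * x j ^+ 2.
  set s := \sum_j _; have : 0 <= \sum_j c j * (x j - s) ^+ 2.
    by apply: sumr_ge0 => j _; rewrite mulr_ge0 ?sqr_ge0.
  have -> : \sum_j c j * (x j - s) ^+ 2 = \sum_j c j * x j ^+ 2 - 2 * s * (\sum_j c j * x j) + s ^+ 2 * \sum_j c j.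
    rewrite (eq_bigr (fun j => c j * x j ^+ 2 - 2 * s * (c j * x j) + s ^+ 2 * c j)).
      by rewrite big_split /= sumrB -!mulr_sumr.
    by move=> j _; ring.
  by rewrite c1 -/s expr2; lra.
have e : \sum_j (c j)%:C%C * a j = Complex (\sum_j c j * re (a j)) (\sum_j c j * im (a j)).
  by apply: cplxP; rewrite /= ?(raddf_sum (@complex.Re R)) ?(raddf_sum (@complex.Im R));
    apply: eq_bigr => j _; rewrite /= !reimE /=; ring.
rewrite e /csqnorm /=.
under [leRHS]eq_bigr do rewrite mulrDr; rewrite big_split /=.
exact: lerD.
Qed.

(** The approximation is a convex combination of the samples [f (w ^+ j)] with weights given by
    [kern]. Samples near [z] differ from [f z] by at most [e / 2], and the far ones have small total
    weight. *)
Lemma weierstrass f (e : R) : ucirc f -> 0 < e -> exists N p, forall z, circle z ->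
  csqnorm (f z - laurent N p z) <= e.
Proof.
move=> uf e0; have [K K0 hK] := ucirc_bounded uf.
have [|d d0 hd] := uf (e / 2); first by rewrite divr_gt0.
have e'0 : 0 < e / 2 / (4 * K + 1) by rewrite !divr_gt0//; lra.
have [n hn] := kern_small d0 e'0.
pose M := n.+1; pose w := rt R M; have cw : circle w := circle_rt _ _; have w0 := circle_neq0 cw.
pose c z (j : 'I_M) : R := M%:R^-1 * ((4 - csqnorm (z / w ^+ j - 1)) ^+ n / 'C(n.*2, n)%:R).
have czw z (j : 'I_M) : circle z -> circle (z / w ^+ j) by move=> cz; exact: circleM cz (circleVr (circleX _ cw)).
have c0 z j : circle z -> 0 <= c z j.
  move=> cz; rewrite /c mulr_ge0 ?invr_ge0// divr_ge0// exprn_ge0// subr_ge0.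
  exact: csq_circle_le4 (czw _ _ cz).
have cE z j : circle z -> (c z j)%:C%C = M%:R^-1 * kern n (z / w ^+ j).
  move=> cz; rewrite kern_real; last exact: czw.
  by rewrite -(rmorph_nat (real_complex R)) -(fmorphV (real_complex R)) -(rmorphM (real_complex R)).
have c1 z : circle z -> \sum_j c z j = 1.
  move=> cz; suff : (\sum_j c z j)%:C%C = 1%:C%C :> C by case.
  rewrite realC_sum.
  under eq_bigr => j _ do rewrite cE//.
  by rewrite -mulr_sumr kern_sum// mulVf// pnatr_eq0.
(* Multiplication by [z ^+ n] clears the negative powers in [kern] and leaves a polynomial. *)
pose p : {poly C} := \sum_(j < M) (f (w ^+ j) / M%:R / 'C(n.*2, n)%:R) *:
  ((1 + (w ^+ j)^-1 *: 'X) * ('X + (w ^+ j)%:P)) ^+ n.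
have pE z : circle z -> laurent n p z = \sum_j (c z j)%:C%C * f (w ^+ j).
  move=> cz; have z0 := circle_neq0 cz.
  rewrite /laurent /p horner_sum mulr_suml; apply: eq_bigr => j _.
  have hE : ((1 + (w ^+ j)^-1 *: 'X) * ('X + (w ^+ j)%:P)).[z] = (1 + (w ^+ j)^-1 * z) * (z + w ^+ j).
    by rewrite !hornerE.
  rewrite cE// hornerZ horner_exp hE /kern.
  have -> : 1 + (z / w ^+ j)^-1 = (z + w ^+ j) / z.
    by field; rewrite z0 expf_neq0.
  have -> : (1 + z / w ^+ j) * ((z + w ^+ j) / z) = (1 + (w ^+ j)^-1 * z) * (z + w ^+ j) / z.
    by rewrite mulrA (mulrC z).
  rewrite [X in _ = _ * (X / _) * _]exprMn [in RHS]exprVn.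
  move: ((1 + (w ^+ j)^-1 * z) * (z + w ^+ j)) => v.
  have C0 : 'C(n.*2, n)%:R != 0 :> C by rewrite pnatr_eq0 -lt0n bin_gt0 -addnn leq_addr.
  have M0 : M%:R != 0 :> C by rewrite pnatr_eq0.
  by field; rewrite C0 M0 expf_neq0.
exists n, p => z cz; rewrite pE//.
have -> : f z - \sum_j (c z j)%:C%C * f (w ^+ j) = \sum_j (c z j)%:C%C * (f z - f (w ^+ j)).
  under [RHS]eq_bigr do rewrite mulrBr; rewrite sumrB -mulr_suml.
  have -> : \sum_j (c z j)%:C%C = 1 :> C.
    by rewrite -realC_sum c1.
  by rewrite mul1r.
have := @jensen_csq M (c z) (fun j => f z - f (w ^+ j)) (fun j => c0 z j cz) (c1 z cz).
move/le_trans; apply.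
apply: (@le_trans _ _ (\sum_j (c z j * (e / 2) + M%:R^-1 * (e / 2)))).
  apply: ler_sum => j _; have [far|near] := leP d (csqnorm (z / w ^+ j - 1)); last first.
    rewrite -[leLHS]addr0 lerD//; last by rewrite mulr_ge0 ?invr_ge0// divr_ge0// ltW.
    rewrite ler_wpM2l ?c0//; apply: hd => //; first exact: circleX.
    by rewrite csqB_circle ?ltW//; exact: circleX.
  rewrite -[leLHS]add0r lerD//; first by rewrite mulr_ge0 ?c0// divr_ge0// ltW.
  rewrite /c -mulrA ler_wpM2l ?invr_ge0//.
  have h := hn _ (czw z j cz) far.
  have f4 : csqnorm (f z - f (w ^+ j)) <= 4 * K + 1.
    have := csqD_le (f z) (- f (w ^+ j)); rewrite csqN.
    have := hK _ cz; have := hK _ (circleX j cw); lra.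
  have h0 : 0 <= (4 - csqnorm (z / w ^+ j - 1)) ^+ n / 'C(n.*2, n)%:R.
    by rewrite divr_ge0// exprn_ge0// subr_ge0; exact: csq_circle_le4 (czw z j cz).
  apply: le_trans (ler_pM h0 (csq_ge0 _) h f4) _.
  by rewrite divfK// gt_eqF//; lra.
have -> : \sum_j (c z j * (e / 2) + M%:R^-1 * (e / 2)) = e / 2 + e / 2.
  rewrite big_split /= -mulr_suml c1// mul1r; congr (_ + _).
  by rewrite sumr_const card_ord -[LHS]mulr_natl mulVKf// pnatr_eq0.
lra.
Qed.

End weierstrass.

(** * Laurent polynomials in the Koopman operator *)

Section koopman_polynomials.
Context (R : realType) (X : pmetricType R) (phi : tds X) (mu : probability (borel X) R).
Hypothesis inv : invariant_measure phi mu.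
Local Notation C := (R[i]).
Local Notation psi := (tds_inv phi).
Implicit Types (g h u : X -> C) (p q : {poly C}) (a z : C) (f : C -> C).

Definition kpoly p g x : C := \sum_(k < size p) p`_k * g (iter k phi x).

Lemma kpoly_wide p g x d : (size p <= d)%N ->
  kpoly p g x = \sum_(k < d) p`_k * g (iter k phi x).
Proof.
move=> pd; rewrite /kpoly (big_ord_widen d (fun k => p`_k * g (iter k phi x)) pd) [RHS]big_mkcond.
rewrite [LHS]big_mkcond; apply: eq_bigr => k _; case: ltnP => // pk.
by rewrite nth_default// mul0r.
Qed.

Lemma kpolyD p q g x : kpoly (p + q) g x = kpoly p g x + kpoly q g x.
Proof.
rewrite (@kpoly_wide p _ _ (maxn (size p) (size q))) ?leq_maxl//.
rewrite (@kpoly_wide q _ _ (maxn (size p) (size q))) ?leq_maxr//.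
rewrite (@kpoly_wide (p + q) _ _ (maxn (size p) (size q))) ?size_polyD//.
by rewrite -big_split; apply: eq_bigr => k _; rewrite coefD mulrDl.
Qed.

Lemma kpolyZ a p g x : kpoly (a *: p) g x = a * kpoly p g x.
Proof.
rewrite (@kpoly_wide (a *: p) _ _ (size p)) ?size_scale_leq// mulr_sumr.
by apply: eq_bigr => k _; rewrite coefZ mulrA.
Qed.

Lemma kpoly_sum (I : Type) (r : seq I) (F : I -> {poly C}) g x :
  kpoly (\sum_(i <- r) F i) g x = \sum_(i <- r) kpoly (F i) g x.
Proof.
elim: r => [|i r IH]; first by rewrite !big_nil /kpoly size_poly0 big_ord0.
by rewrite !big_cons kpolyD IH.
Qed.
Lemma kpoly0 g x : kpoly 0 g x = 0.
Proof. by rewrite /kpoly size_poly0 big_ord0. Qed.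

Lemma kpolyXn n g x : kpoly 'X^n g x = g (iter n phi x).
Proof.
rewrite /kpoly size_polyXn big_ord_recr /= coefXn eqxx mul1r big1 ?add0r// => k _.
by rewrite coefXn ltn_eqF ?mul0r.
Qed.
Lemma kpolyC a g x : kpoly a%:P g x = a * g x.
Proof. by rewrite -mul_polyC_ || idtac; rewrite -[a%:P]mulr1 mul_polyC kpolyZ -(expr0 'X) kpolyXn. Qed.

Lemma kpoly_mulX p g x : kpoly (p * 'X) g x = kpoly p g (phi x).
Proof.
rewrite (@kpoly_wide (p * 'X) _ _ (size p).+1); last first.
  by have := size_polyMleq p 'X; rewrite size_polyX addnC.
rewrite big_ord_recl /= coefMX /= mul0r add0r; apply: eq_bigr => k _.
by rewrite coefMX /= -iterSr.
Qed.

Lemma kpoly_comm p g (s : X -> X) : (forall x, s (phi x) = phi (s x)) ->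
  kpoly p (g \o s) = kpoly p g \o s.
Proof.
move=> sp; apply/funext => x; apply: eq_bigr => k _ /=; congr (_ * g _).
by elim: (nat_of_ord k) => //= n IH; rewrite sp IH.
Qed.

Lemma kpolyM p q g x : kpoly (p * q) g x = kpoly p (kpoly q g) x.
Proof.
elim/poly_ind: p x => [|p a IH] x; first by rewrite mul0r !kpoly0.
by rewrite mulrDl !kpolyD mulrAC !kpoly_mulX IH kpolyC mul_polyC kpolyZ.
Qed.
Lemma kpolyMXn p n g x : kpoly (p * 'X^n) g x = kpoly p g (iter n phi x).
Proof. by rewrite mulrC kpolyM kpolyXn. Qed.
Lemma kpoly_gD p g h x : kpoly p (fun x => g x + h x) x = kpoly p g x + kpoly p h x.
Proof. by rewrite -big_split; apply: eq_bigr => k _; rewrite mulrDr. Qed.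
Lemma kpoly_gZ a p g x : kpoly p (fun x => a * g x) x = a * kpoly p g x.
Proof. by rewrite mulr_sumr; apply: eq_bigr => k _; rewrite mulrCA. Qed.
Lemma L2_iter n g : L2 mu g -> L2 mu (fun x => g (iter n phi x)).
Proof. by move=> Lg; exact: (L2_mpres (mpres_iter n (mpres_tds inv)) Lg). Qed.
Lemma kpoly_L2 p g : L2 mu g -> L2 mu (kpoly p g).
Proof. by move=> Lg; apply: L2_sum => k; apply: L2Z; exact: L2_iter. Qed.

Lemma Rint_sum (I : Type) (r : seq I) (F : I -> borel X -> R) : (forall i, intg mu (F i)) ->
  intg mu (fun x => \sum_(i <- r) F i x) /\
  \int[mu]_x (\sum_(i <- r) F i x) = \sum_(i <- r) \int[mu]_x F i x.
Proof.
move=> iF; elim: r => [|i r [IH1 IH2]].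
  under eq_fun do rewrite big_nil; rewrite big_nil; split; first exact: intg_cst.
  by rewrite Rint_cst.
split; first by under eq_fun do rewrite big_cons; exact: intgD.
under eq_Rintegral do rewrite big_cons.
by rewrite RintD// big_cons IH2.
Qed.

(** An orbit segment of length [M + size p] is closed up cyclically, so that [cyclic_conv_bound]
    applies. The first [M] terms are true values of the polynomial in the operator, and the wrapped
    ones only add nonnegative terms. Integration removes the dependence on the orbit, and [M] is
    taken large. *)
Lemma kpoly_bound p g (K : R) : (forall z, circle z -> csqnorm p.[z] <= K) -> L2 mu g ->
  L2N mu (kpoly p g) <= K * L2N mu g.
Proof.
move=> pK Lg; set h := kpoly p g; have Lh : L2 mu h by exact: kpoly_L2.
have K0 : 0 <= K by apply: le_trans (pK 1 _); [exact: csq_ge0|exact: csqnorm1].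
have pK' z : circle z -> csqnorm (\sum_(k < size p) p`_k * z ^+ k) <= K.
  by move=> cz; have := pK z cz; rewrite horner_coef.
have key M : (0 < M)%N -> M%:R * L2N mu h <= (M + size p)%:R * (K * L2N mu g).
  move=> M0; have MN : (0 < M + size p)%N by rewrite addn_gt0 M0.
  have sumE (v : X -> C) n : L2 mu v -> intg mu (fun x => \sum_(j < n) csqnorm (v (iter j phi x))) /\
      \int[mu]_x \sum_(j < n) csqnorm (v (iter j phi x)) = n%:R * L2N mu v.
    move=> Lv; have [i1 i2] := @Rint_sum _ (index_enum 'I_n) (fun j x => csqnorm (v (iter j phi x)))
      (fun j => L2_intg (L2_iter j Lv)).
    split=> //; rewrite i2 (eq_bigr (fun=> L2N mu v)) ?sumr_const ?card_ord ?mulr_natl// => j _.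
    exact: (L2N_mpres (mpres_iter j (mpres_tds inv)) Lv).
  have [i1 e1] := sumE h M Lh; have [i2 e2] := sumE g (M + size p)%N Lg.
  rewrite -e1 mulrCA -e2 -RintZ//; apply: Rint_le => //; first exact: intgZ.
  move=> x; have := cyclic_conv_bound (fun j => g (iter j phi x)) MN pK'.
  apply: le_trans.
  rewrite [leRHS]big_split_ord /= -[leLHS]addr0; apply: lerD; last first.
    by apply: sumr_ge0 => j _; exact: csq_ge0.
  apply: ler_sum => j _; rewrite le_eqVlt; apply/orP; left; apply/eqP; congr csqnorm.
  apply: eq_bigr => k _; rewrite modn_small; last by rewrite -addSn leq_add// ltnW.
  by rewrite addnC iterD.
rewrite leNgt; apply/negP => lt.
have [M hM] : exists M, (size p)%:R * (K * L2N mu g) / (L2N mu h - K * L2N mu g) < M.+1%:R.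
  exists (Num.bound ((size p)%:R * (K * L2N mu g) / (L2N mu h - K * L2N mu g))).
  apply: lt_trans (archi_boundP _) _; last by rewrite ltr_nat.
  by rewrite divr_ge0 ?mulr_ge0 ?L2N_ge0// subr_ge0 ltW.
have := key M.+1 isT; move: hM; rewrite ltr_pdivrMr ?subr_gt0// natrD; lra.
Qed.

Definition lop (N : nat) p g : X -> C := kpoly p g \o iter N psi.

Lemma iter_psiK n x : iter n phi (iter n psi x) = x.
Proof. by elim: n x => // n IH x; rewrite iterSr /= tds_invK IH. Qed.
Lemma iter_phiK n x : iter n psi (iter n phi x) = x.
Proof. by elim: n x => // n IH x; rewrite iterSr /= tds_mapK IH. Qed.
Lemma psi_phi_comm n x : iter n psi (phi x) = phi (iter n psi x).
Proof. by elim: n => //= n ->; rewrite tds_mapK tds_invK. Qed.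

Lemma iterz_sub (k N : nat) x : iterz phi (k%:Z - N%:Z) x = iter k phi (iter N psi x).
Proof.
have [kN|Nk] := ltnP k N.
  have -> : (k%:Z - N%:Z)%R = Negz (N - k).-1 by rewrite NegzE prednK ?subn_gt0//; lia.
  rewrite [LHS]/= -[psi (iter _ _ _)]/(iter (N - k).-1.+1 psi x) prednK ?subn_gt0//.
  by rewrite -{2}(subnKC (ltnW kN)) iterD iter_psiK.
rewrite subzn//= -{2}(subnK Nk) iterD iter_psiK //.
Qed.
Lemma laurent_koopmanE N p g : laurent_koopman phi N p g = lop N p g.
Proof. by apply/funext => x; apply: eq_bigr => k _; rewrite iterz_sub. Qed.
Lemma lop_L2 N p g : L2 mu g -> L2 mu (lop N p g).
Proof. by move=> Lg; exact: (L2_mpres (mpres_iter N (mpres_inv inv)) (kpoly_L2 p Lg)). Qed.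

Lemma lop_bound N p g (K : R) : (forall z, circle z -> csqnorm (laurent N p z) <= K) -> L2 mu g ->
  L2N mu (lop N p g) <= K * L2N mu g.
Proof.
move=> pK Lg; rewrite (L2N_mpres (mpres_iter N (mpres_inv inv)) (kpoly_L2 p Lg)).
apply: kpoly_bound => // z cz; have := pK z cz; rewrite /laurent csqM csqV.
by rewrite (circleX N cz) invr1 mulr1.
Qed.
Lemma lop_shift N M p g : lop (N + M) (p * 'X^M) g = lop N p g.
Proof. by apply/funext => x; rewrite /lop /= kpolyMXn addnC iterD iter_psiK. Qed.

Lemma laurent_shift N M p z : circle z -> laurent (N + M) (p * 'X^M) z = laurent N p z.
Proof.
move=> /circle_neq0 z0; rewrite /laurent hornerM hornerXn exprD.
by rewrite -mulf_div divff ?mulr1// expf_neq0.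
Qed.

Lemma lop_lin a N p M q g : lop (N + M) (a *: (p * 'X^M) + q * 'X^N) g =
  (fun x => a * lop N p g x + lop M q g x).
Proof.
rewrite -(lop_shift N M p) -(lop_shift M N q) (addnC M N); apply/funext => x.
by rewrite /lop /= kpolyD kpolyZ.
Qed.

Lemma laurent_lin a N p M q z : circle z -> laurent (N + M) (a *: (p * 'X^M) + q * 'X^N) z =
  a * laurent N p z + laurent M q z.
Proof.
move=> cz; rewrite -(laurent_shift N M p cz) -(laurent_shift M N q cz) (addnC M N).
by rewrite /laurent hornerD hornerZ mulrDl mulrA.
Qed.

Lemma lop_mul N p M q g : lop (N + M) (p * q) g = lop N p (lop M q g).
Proof.
apply/funext => x; rewrite /lop /= kpoly_comm; last exact: psi_phi_comm.
rewrite /= addnC iterD -kpolyM; congr (kpoly _ _ _).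
Qed.
Lemma laurent_mul N p M q z : laurent (N + M) (p * q) z = laurent N p z * laurent M q z.
Proof. by rewrite /laurent hornerM exprD mulf_div. Qed.

(** On the circle the value is the conjugate of that of [p] times [z ^+ size p]; this polynomial
    represents the adjoint operator. *)
Definition pstar p : {poly C} := \sum_(k < size p) ((p`_k)^*%C) *: 'X^(size p - k).

Lemma horner_pstar p z : circle z -> (pstar p).[z] = (p.[z])^*%C * z ^+ size p.
Proof.
move=> cz; have z0 := circle_neq0 cz.
rewrite /pstar horner_sum horner_coef (raddf_sum (@conjc R)) mulr_suml.
apply: eq_bigr => k _; rewrite hornerZ hornerXn /= (rmorphM (@conjc R)) (rmorphXn (@conjc R)) /= -mulrA; congr (_ * _).
rewrite -(circleV cz); have := ltnW (ltn_ord k); move: (nat_of_ord k) => j js.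
rewrite -{2}(subnK js) exprD mulrCA -exprMn mulVf// expr1n mulr1 //.
Qed.

Lemma laurent_star N p z : circle z ->
  laurent (size p) (pstar p * 'X^N) z = (laurent N p z)^*%C.
Proof.
move=> cz; have z0 := circle_neq0 cz.
rewrite /laurent hornerM hornerXn horner_pstar// rmorphM fmorphV rmorphXn /=.
by rewrite -(circleV cz) exprVn invrK; field; rewrite expf_neq0.
Qed.
Lemma inner_iter n g h : L2 mu g -> L2 mu h ->
  L2inner mu (fun x => g (iter n phi x)) (fun x => h (iter n phi x)) = L2inner mu g h.
Proof. by move=> Lg Lh; exact: (inner_mpres (mpres_iter n (mpres_tds inv)) Lg Lh). Qed.

Lemma inner_suml (I : Type) (r : seq I) (F : I -> X -> C) h : (forall i, L2 mu (F i)) -> L2 mu h ->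
  L2inner mu (fun x => \sum_(i <- r) F i x) h = \sum_(i <- r) L2inner mu (F i) h.
Proof.
move=> LF Lh; elim: r => [|i r IH].
  rewrite big_nil; under [X in L2inner _ X]eq_fun do rewrite big_nil.
  have -> : (fun=> 0 : C) = (fun x => 0 * h x) by apply/funext => x; rewrite mul0r.
  by rewrite innerZl// mul0r.
rewrite big_cons -IH -innerDl//; last exact: L2_sum.
by congr L2inner; apply/funext => x; rewrite big_cons.
Qed.

Lemma inner_sumr (I : Type) (r : seq I) (F : I -> X -> C) h : (forall i, L2 mu (F i)) -> L2 mu h ->
  L2inner mu h (fun x => \sum_(i <- r) F i x) = \sum_(i <- r) L2inner mu h (F i).
Proof.
move=> LF Lh; rewrite (innerJ (L2_sum r LF) Lh) inner_suml// (raddf_sum (@conjc R)).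
by apply: eq_bigr => i _; rewrite (innerJ (LF i) Lh).
Qed.

Lemma inner_kpoly p g h : L2 mu g -> L2 mu h ->
  L2inner mu g (kpoly p h) = L2inner mu (kpoly (pstar p) g) (fun x => h (iter (size p) phi x)).
Proof.
move=> Lg Lh; rewrite inner_sumr//; last by move=> k; apply: L2Z; exact: L2_iter.
have -> : kpoly (pstar p) g = fun x => \sum_(k < size p) ((p`_k)^*%C) * g (iter (size p - k) phi x).
  by apply/funext => x; rewrite kpoly_sum; apply: eq_bigr => k _; rewrite kpolyZ kpolyXn.
rewrite inner_suml; [|by move=> k; apply: L2Z; exact: L2_iter|exact: L2_iter].
apply: eq_bigr => k _; rewrite innerZr ?innerZl//; try exact: L2_iter.
congr (_ * _); rewrite -(inner_iter (size p - k) Lg (L2_iter k Lh)); congr L2inner.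
by apply/funext => x; rewrite -iterD subnKC// ltnW.
Qed.

Lemma inner_lop N p g h : L2 mu g -> L2 mu h ->
  L2inner mu g (lop N p h) = L2inner mu (lop (size p) (pstar p * 'X^N) g) h.
Proof.
move=> Lg Lh; rewrite -(inner_iter N Lg (lop_L2 N p Lh)).
have -> : (fun x => lop N p h (iter N phi x)) = kpoly p h.
  by apply/funext => x; rewrite /lop /= iter_phiK.
rewrite inner_kpoly//; last exact: L2_iter.
rewrite -(inner_iter (size p) (lop_L2 _ _ Lg) Lh); congr L2inner.
apply/funext => x; rewrite /lop /= iter_phiK kpolyMXn.
by have /(congr1 (@^~ x)) := @kpoly_comm (pstar p) g (iter N phi) (fun x => esym (iterSr _ _ _)).
Qed.

End koopman_polynomials.

(** * Functional calculus for continuous functions on the circle *)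

Section functional_calculus.
Context (R : realType) (X : pmetricType R) (phi : tds X) (mu : probability (borel X) R).
Hypothesis inv : invariant_measure phi mu.
Local Notation C := (R[i]).
Implicit Types (g h u : X -> C) (p q : {poly C}) (a z : C) (f : C -> C).

(* [u] represents [f(U) g]; the factor 4 comes from |a + b|^2 <= 2|a|^2 + 2|b|^2. *)
Definition fcalc f g u := L2 mu u /\ forall N p (K : R),
  (forall z, circle z -> csqnorm (f z - laurent N p z) <= K) ->
  L2N mu (fun x => u x - lop phi N p g x) <= 4 * K * L2N mu g.

Lemma laurentB N p M q z : circle z ->
  laurent (M + N) ((-1) *: (q * 'X^N) + p * 'X^M) z = laurent N p z - laurent M q z.
Proof. by move=> cz; rewrite laurent_lin// mulN1r addrC. Qed.
Lemma lopB N p M q g : lop phi (M + N) ((-1) *: (q * 'X^N) + p * 'X^M) g =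
  fun x => lop phi N p g x - lop phi M q g x.
Proof. by rewrite lop_lin; apply/funext => x; rewrite mulN1r addrC. Qed.

Lemma lop_diff_bound f g N p M q (K L : R) : L2 mu g ->
  (forall z, circle z -> csqnorm (f z - laurent N p z) <= K) ->
  (forall z, circle z -> csqnorm (f z - laurent M q z) <= L) ->
  L2N mu (fun x => lop phi N p g x - lop phi M q g x) <= (2 * K + 2 * L) * L2N mu g.
Proof.
move=> Lg hK hL; rewrite -lopB; apply: lop_bound => // z cz; rewrite laurentB//.
have -> : laurent N p z - laurent M q z = - (f z - laurent N p z) + (f z - laurent M q z) by ring.
apply: le_trans (csqD_le _ _) _; rewrite csqN.
by have := hK z cz; have := hL z cz; lra.
Qed.

Lemma eps_le (A B D : R) : 0 <= D -> (forall e, 0 < e -> A <= B + e * D) -> A <= B.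
Proof.
move=> D0 h; apply/ler_addgt0Pl => e e0.
have D1 : 0 < D + 1 by lra.
have := h (e / (D + 1)) (divr_gt0 e0 D1) => /le_trans; apply.
rewrite addrC lerD2r mulrAC ler_pdivrMr// ler_pM2l//; lra.
Qed.

(** One good approximation for every [e] suffices: two Laurent polynomials that are both near [f]
    are near each other, and [lop_bound] transfers this to the operators. *)
Lemma fcalcI f g u : L2 mu g -> L2 mu u ->
  (forall e : R, 0 < e -> exists N p, (forall z, circle z -> csqnorm (f z - laurent N p z) <= e) /\
     L2N mu (fun x => u x - lop phi N p g x) <= e) -> fcalc f g u.
Proof.
move=> Lg Lu h; split=> // N p K hK.
apply: (@eps_le _ _ (2 + 4 * L2N mu g)); first by have := L2N_ge0 mu g; lra.
move=> e e0; have [M [q [hq uq]]] := h _ e0.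
apply: le_trans (L2N_tri Lu (lop_L2 inv M q Lg) (lop_L2 inv N p Lg)) _.
have := lop_diff_bound Lg hq hK; lra.
Qed.

(** Approximations of accuracy [8^-1 ^+ n] yield a sequence with the rate demanded by
    [L2_complete]. *)
Lemma fcalc_ex f g : ucirc f -> L2 mu g -> exists u, fcalc f g u.
Proof.
move=> uf Lg.
have /choice[P hP] n : exists P : nat * {poly C}, forall z, circle z ->
    csqnorm (f z - laurent P.1 P.2 z) <= 8^-1 ^+ n.
  have [|N [p hp]] := weierstrass uf (_ : 0 < 8^-1 ^+ n); first by rewrite exprn_gt0// invr_gt0.
  by exists (N, p).
pose w n := lop phi (P n).1 (P n).2 g.
have g0 := L2N_ge0 mu g.
have e8 n : 0 < 8^-1 ^+ n :> R by rewrite exprn_gt0// invr_gt0.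
have [|n|n|u Lu hu] := @L2_complete _ _ mu w (4 * L2N mu g).
- by lra.
- exact: lop_L2.
- apply: le_trans (lop_diff_bound Lg (hP n.+1) (hP n)) _; rewrite exprS.
  by have := mulr_ge0 (ltW (e8 n)) g0; set x := _ ^+ n; nra.
exists u; apply: fcalcI => // e e0.
have [n [n1 n2]] : exists n, 8^-1 ^+ n <= e /\ 4 * (4 * L2N mu g) * 8^-1 ^+ n <= e.
  pose c := 1 + 16 * L2N mu g; have c0 : 0 < c by rewrite /c; lra.
  have [n hn] := half_pow_lt ler01 (divr_gt0 e0 c0); rewrite mul1r in hn.
  have h8 : 8^-1 ^+ n <= 2^-1 ^+ n :> R by rewrite lerXn2r ?nnegrE//; lra.
  have : 8^-1 ^+ n <= e / c by rewrite (le_trans h8)// ltW.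
  rewrite ler_pdivlMr// => h; exists n; move: h; rewrite /c.
  by have := mulr_ge0 (ltW (e8 n)) g0; have := ltW (e8 n); split; lra.
by exists (P n).1, (P n).2; split => [z cz|]; [apply: le_trans (hP n z cz) _|apply: le_trans (hu n) _].
Qed.

Lemma fcalc_uniq f g u u' : ucirc f -> L2 mu g -> fcalc f g u -> fcalc f g u' -> eqL2 mu u u'.
Proof.
move=> uf Lg [Lu hu] [Lu' hu']; apply: eqL2_L2N => //; apply/eqP; rewrite eq_le L2N_ge0 andbT.
have g0 := L2N_ge0 mu g.
apply: (@eps_le _ _ (16 * L2N mu g)); first by lra.
move=> e e0; rewrite add0r; have [N [p hp]] := weierstrass uf e0.
apply: le_trans (L2N_tri Lu (lop_L2 inv N p Lg) Lu') _.
have := hu _ _ _ hp; have := hu' _ _ _ hp; rewrite L2N_sym; lra.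
Qed.
Lemma fcalc_eq f f' g u : (forall z, circle z -> f z = f' z) -> fcalc f g u -> fcalc f' g u.
Proof. by move=> ff [Lu h]; split=> // N p K hK; apply: h => z cz; rewrite ff//; exact: hK. Qed.

Lemma fcalc_ae f g g' u u' : L2 mu g -> L2 mu g' -> L2 mu u' -> eqL2 mu g g' -> eqL2 mu u u' ->
  fcalc f g u -> fcalc f g' u'.
Proof.
move=> Lg Lg' Lu' gg uu [Lu h]; split=> // N p K hK.
rewrite -(L2N_ae (L2_meas Lg) (L2_meas Lg') gg) (_ : L2N mu _ = L2N mu (fun x => u x - lop phi N p g x)).
  exact: h.
apply/esym/L2N_ae; [exact: L2_meas (L2B Lu (lop_L2 inv N p Lg))|
  exact: L2_meas (L2B Lu' (lop_L2 inv N p Lg'))|].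
apply: eqL2_trans (_ : eqL2 mu _ (fun x => u' x - lop phi N p g x)) _.
  by apply: aeS uu => x ->.
have : eqL2 mu (lop phi N p g) (lop phi N p g'); last by apply: aeS => x ->.
apply: (eqL2_mpres (mpres_iter N (mpres_inv inv))).
have /ae_foralln : forall k : nat, eqL2 mu (fun x => g (iter k phi x)) (fun x => g' (iter k phi x)).
  by move=> k; exact: (eqL2_mpres (mpres_iter k (mpres_tds inv))).
by apply: aeS => x hx; apply: eq_bigr => k _; rewrite hx.
Qed.

Lemma fcalc_norm f g u (K : R) : L2 mu g -> fcalc f g u ->
  (forall z, circle z -> csqnorm (f z) <= K) -> L2N mu u <= 4 * K * L2N mu g.
Proof.
move=> Lg [Lu h] fK; have := h 0%N 0 K.
have -> : (fun x => u x - lop phi 0 0 g x) = u.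
  by apply/funext => x; rewrite /lop /= kpoly0 subr0.
by apply => z cz; rewrite /laurent horner0 mul0r subr0; exact: fK.
Qed.

Lemma fcalc_laurent N p g : L2 mu g -> fcalc (laurent N p) g (lop phi N p g).
Proof.
move=> Lg; apply: fcalcI => //; first exact: lop_L2.
move=> e e0; exists N, p; split=> [z _|]; first by rewrite subrr csq0 ltW.
rewrite (_ : L2N mu _ = 0) ?ltW// /L2N -[RHS](Rint_cst mu 0); apply: eq_Rintegral => x _.
by rewrite subrr csq0.
Qed.

Lemma fcalc_lin a f f' g u u' : L2 mu g -> ucirc f -> ucirc f' -> fcalc f g u -> fcalc f' g u' ->
  fcalc (fun z => a * f z + f' z) g (fun x => a * u x + u' x).
Proof.
move=> Lg uf uf' [Lu hu] [Lu' hu']; apply: fcalcI => //; first by apply: L2D => //; exact: L2Z.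
move=> e e0; have a0 := csq_ge0 a; have g0 := L2N_ge0 mu g.
pose c := (2 * csqnorm a + 2) * (1 + 4 * L2N mu g).
have c0 : 0 < c by rewrite /c mulr_gt0//; lra.
have ec0 := divr_gt0 e0 c0.
have [N [p hp]] := weierstrass uf ec0; have [M [q hq]] := weierstrass uf' ec0.
exists (N + M)%N, (a *: (p * 'X^M) + q * 'X^N).
have ece : (2 * csqnorm a + 2) * (e / c) <= e /\ (2 * csqnorm a + 2) * (4 * (e / c) * L2N mu g) <= e.
  have -> : e = e / c * c by rewrite divfK// gt_eqF.
  rewrite mulfK ?gt_eqF//; have := ltW ec0; set d := e / c => d0.
  rewrite /c; have := mulr_ge0 d0 g0; have := mulr_ge0 (mulr_ge0 d0 g0) a0; have := mulr_ge0 d0 a0.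
  by split; nra.
split=> [z cz|].
  rewrite laurent_lin//.
  have -> : a * f z + f' z - (a * laurent N p z + laurent M q z) =
    a * (f z - laurent N p z) + (f' z - laurent M q z) by ring.
  apply: le_trans (csqD_le _ _) _; rewrite csqM; apply: le_trans ece.1.
  have := ler_wpM2l a0 (hp z cz); have := hq z cz; lra.
rewrite lop_lin.
have -> : (fun x => a * u x + u' x - (a * lop phi N p g x + lop phi M q g x)) =
   (fun x => a * (u x - lop phi N p g x) + (u' x - lop phi M q g x)).
  by apply/funext => x; ring.
have L1 := L2B Lu (lop_L2 inv N p Lg); have L2' := L2B Lu' (lop_L2 inv M q Lg).
apply: le_trans (L2ND_le (L2Z a L1) L2') _; rewrite L2NZ//; apply: le_trans ece.2.
have := ler_wpM2l a0 (hu _ _ _ hp); have := hu' _ _ _ hq; lra.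
Qed.
Lemma lop_glin a N p g h : lop phi N p (fun x => a * g x + h x) =
  fun x => a * lop phi N p g x + lop phi N p h x.
Proof. by apply/funext => x; rewrite /lop /= kpoly_gD kpoly_gZ. Qed.

Lemma fcalc_glin a f g g' u u' : L2 mu g -> L2 mu g' -> ucirc f -> fcalc f g u -> fcalc f g' u' ->
  fcalc f (fun x => a * g x + g' x) (fun x => a * u x + u' x).
Proof.
move=> Lg Lg' uf [Lu hu] [Lu' hu'].
apply: fcalcI; [by apply: L2D => //; exact: L2Z|by apply: L2D => //; exact: L2Z|].
move=> e e0; have a0 := csq_ge0 a; have g0 := L2N_ge0 mu g; have g'0 := L2N_ge0 mu g'.
pose c := 1 + 8 * csqnorm a * L2N mu g + 8 * L2N mu g'.
have c0 : 0 < c by rewrite /c; have := mulr_ge0 a0 g0; lra.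
have ec0 := divr_gt0 e0 c0.
have [N [p hp]] := weierstrass uf ec0; exists N, p.
have ee : e = e / c * c by rewrite divfK// gt_eqF.
have := ltW ec0; set d := e / c in hp ee * => d0.
have h1 := mulr_ge0 d0 (mulr_ge0 a0 g0); have h2 := mulr_ge0 d0 g'0.
split=> [z cz|]; first by apply: le_trans (hp z cz) _; rewrite ee /c; lra.
rewrite lop_glin.
have -> : (fun x => a * u x + u' x - (a * lop phi N p g x + lop phi N p g' x)) =
   (fun x => a * (u x - lop phi N p g x) + (u' x - lop phi N p g' x)).
  by apply/funext => x; ring.
have L1 := L2B Lu (lop_L2 inv N p Lg); have L2' := L2B Lu' (lop_L2 inv N p Lg').
apply: le_trans (L2ND_le (L2Z a L1) L2') _; rewrite L2NZ//.
rewrite [leRHS]ee /c; have := ler_wpM2l a0 (hu _ _ _ hp); have := hu' _ _ _ hp; lra.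
Qed.

Lemma fcalc_mul f f' g u u' : L2 mu g -> ucirc f -> ucirc f' -> fcalc f g u -> fcalc f' u u' ->
  fcalc (fun z => f' z * f z) g u'.
Proof.
move=> Lg uf uf' [Lu hu] [Lu' hu']; apply: fcalcI => // e e0.
have [K K0 hK] := ucirc_bounded uf; have [K' K'0 hK'] := ucirc_bounded uf'.
have g0 := L2N_ge0 mu g; have u0 := L2N_ge0 mu u.
(* q approximates f' up to d' and p approximates f up to d *)
have [d' d'0 [hd1 hd2]] : exists2 d' : R, 0 < d' & 2 * K * d' <= e / 2 /\ 8 * d' * L2N mu u <= e / 2.
  pose c := 1 + 4 * K + 16 * L2N mu u; have c0 : 0 < c by rewrite /c; lra.
  exists (e / c); first exact: divr_gt0.
  have ee : e = e / c * c by rewrite divfK// gt_eqF.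
  have := ltW (divr_gt0 e0 c0); move: ee; set d := e / c => ee d0.
  by rewrite ee /c; have := mulr_ge0 d0 K0; have := mulr_ge0 d0 u0; split; lra.
have [M [q hq]] := weierstrass uf' d'0.
have qB z : circle z -> csqnorm (laurent M q z) <= 2 * K' + 2 * d'.
  move=> cz; have -> : laurent M q z = f' z - (f' z - laurent M q z) by ring.
  apply: le_trans (csqD_le _ _) _; rewrite csqN; have := hK' z cz; have := hq z cz; lra.
set B := 2 * K' + 2 * d' in qB; have B0 : 0 <= B by rewrite /B; lra.
have [d d0 [hd3 hd4]] : exists2 d : R, 0 < d & 2 * B * d <= e / 2 /\ 8 * B * d * L2N mu g <= e / 2.
  pose c := 1 + 4 * B + 16 * (B * L2N mu g); have c0 : 0 < c by rewrite /c; have := mulr_ge0 B0 g0; lra.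
  exists (e / c); first exact: divr_gt0.
  have ee : e = e / c * c by rewrite divfK// gt_eqF.
  have := ltW (divr_gt0 e0 c0); move: ee; set d := e / c => ee d0.
  rewrite ee /c; have := mulr_ge0 d0 B0; have := mulr_ge0 d0 (mulr_ge0 B0 g0).
  by split; lra.
have [N [p hp]] := weierstrass uf d0.
exists (M + N)%N, (q * p); split=> [z cz|].
  rewrite laurent_mul.
  have -> : f' z * f z - laurent M q z * laurent N p z =
    (f' z - laurent M q z) * f z + laurent M q z * (f z - laurent N p z) by ring.
  apply: le_trans (csqD_le _ _) _.
  rewrite (csqM (f' z - _)) (csqM (laurent M q z)).
  have h1 := ler_pM (csq_ge0 _) (csq_ge0 _) (hq z cz) (hK z cz).
  have h2 := ler_pM (csq_ge0 _) (csq_ge0 _) (qB z cz) (hp z cz).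
  by move: h1 h2 hd1 hd3; rewrite (mulrC d'); lra.
rewrite lop_mul.
have Lp := lop_L2 inv N p Lg.
apply: le_trans (L2N_tri Lu' (lop_L2 inv M q Lu) (lop_L2 inv M q Lp)) _.
have -> : (fun x => lop phi M q u x - lop phi M q (lop phi N p g) x) =
    lop phi M q (fun x => (-1) * lop phi N p g x + u x).
  by rewrite lop_glin; apply/funext => x; rewrite mulN1r addrC.
have Ld : L2 mu (fun x => (-1) * lop phi N p g x + u x) by apply: L2D => //; exact: L2Z.
have h1 := lop_bound inv qB Ld.
have h2 : L2N mu (fun x => (-1) * lop phi N p g x + u x) <= 4 * d * L2N mu g.
  by under [X in L2N _ X]eq_fun do rewrite mulN1r addrC; exact: hu.
have h3 := hu' _ _ _ hq; have := ler_wpM2l B0 h2; move: h1 h3 hd2 hd4; lra.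
Qed.

Lemma ucirc_conj f : ucirc f -> ucirc (fun z => (f z)^*%C).
Proof.
move=> uf e e0; have [d d0 h] := uf e e0; exists d => // z w cz cw zw.
by rewrite -(rmorphB (@conjc R)) csqJ h.
Qed.

Lemma inner_continuity g g' h (e : R) : L2 mu g -> L2 mu g' -> L2 mu h ->
  L2N mu (fun x => g x - g' x) <= e -> csqnorm (L2inner mu g h - L2inner mu g' h) <= e * L2N mu h.
Proof.
move=> Lg Lg' Lh ge; rewrite -innerBl//; apply: le_trans (cauchy_schwarz (L2B Lg Lg') Lh) _.
by rewrite ler_wpM2r ?L2N_ge0.
Qed.

(** For Laurent polynomials the adjoint is given by [pstar]; the general case follows by continuity
    of the inner product. *)
Lemma fcalc_adj f g h u u' : L2 mu g -> L2 mu h -> ucirc f -> fcalc f g u ->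
  fcalc (fun z => (f z)^*%C) h u' -> L2inner mu u h = L2inner mu g u'.
Proof.
move=> Lg Lh uf [Lu hu] [Lu' hu'].
have g0 := L2N_ge0 mu g; have h0 := L2N_ge0 mu h.
apply/eqP; rewrite -subr_eq0; apply/eqP/csq_eq0/eqP; rewrite eq_le csq_ge0 andbT.
apply: (@eps_le _ _ (16 * L2N mu g * L2N mu h)); first by rewrite !mulr_ge0.
move=> e e0; rewrite add0r.
have [N [p hp]] := weierstrass (ucirc_conj uf) e0.
have hp' z : circle z -> csqnorm (f z - laurent (size p) (pstar p * 'X^N) z) <= e.
  move=> cz; rewrite laurent_star// -csqJ (rmorphB (@conjc R)) /= conjcK.
  exact: hp.
have e1 := inner_continuity Lu (lop_L2 inv _ _ Lg) Lh (hu _ _ _ hp').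
have e2 : csqnorm (L2inner mu g u' - L2inner mu g (lop phi N p h)) <= 4 * e * L2N mu h * L2N mu g.
  rewrite (innerJ Lu' Lg) (innerJ (lop_L2 inv N p Lh) Lg) -(rmorphB (@conjc R)) csqJ.
  exact: inner_continuity Lu' (lop_L2 inv N p Lh) Lg (hu' _ _ _ hp).
rewrite inner_lop// in e2.
set A := L2inner mu u h in e1 *; set B := L2inner mu g u' in e2 *.
set D := L2inner mu (lop _ _ _ _) h in e1 e2.
have -> : A - B = (A - D) - (B - D) by ring.
apply: le_trans (csqD_le _ _) _; rewrite csqN; move: e1 e2; lra.
Qed.

End functional_calculus.

(** * Spectra on invariant subspaces *)

Section spectra.
Context (R : realType) (X : pmetricType R) (phi : tds X) (mu : probability (borel X) R).
Hypothesis inv : invariant_measure phi mu.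
Local Notation C := (R[i]).
Local Notation L2 := (L2 mu).
Implicit Types (g h u : X -> C) (p q : {poly C}) (a z : C) (f : C -> C) (V : set (X -> C)).

(** Turns the existence statement [fcalc_ex] into an operator; the second branch makes it total. *)
Definition fcT f g : X -> C :=
  match pselect (exists u, fcalc phi mu f g u) with | left e => projT1 (cid e)
  | right _ => g end.

Lemma fcTP f g : ucirc f -> L2 g -> fcalc phi mu f g (fcT f g).
Proof.
move=> uf Lg; rewrite /fcT; case: pselect => [e|]; first exact: (projT2 (cid e)).
by move=> []; exact: fcalc_ex.
Qed.
Lemma fcT_L2 f g : ucirc f -> L2 g -> L2 (fcT f g).
Proof. by move=> uf Lg; case: (fcTP uf Lg). Qed.
Lemma L2norm_le g h (K : R) : 0 <= K -> L2N mu g <= K * L2N mu h ->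
  L2norm mu g <= Num.sqrt K * L2norm mu h.
Proof. by move=> K0 le; rewrite !L2norm_L2N -sqrtrM// ler_wsqrtr. Qed.

Lemma fcT_bounded_linear f V : ucirc f -> V `<=` L2 -> (forall g, V g -> V (fcT f g)) ->
  bounded_linear_on mu V (fcT f).
Proof.
move=> uf VL Vf; have [K K0 hK] := ucirc_bounded uf; split=> //.
  move=> a g h /VL Lg /VL Lh.
  have Lgh : L2 (fun x => a * g x + h x) by apply: L2D => //; exact: L2Z.
  apply: (fcalc_uniq inv uf Lgh); first exact: fcTP.
  by apply: fcalc_glin => //; exact: fcTP.
exists (Num.sqrt (4 * K)) => g /VL Lg; apply: L2norm_le; first by rewrite mulr_ge0.
exact: fcalc_norm Lg (fcTP uf Lg) hK.
Qed.
Lemma ucirc_ext f f' : (forall z, circle z -> f z = f' z) -> ucirc f -> ucirc f'.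
Proof. by move=> ff uf e /uf[d d0 h]; exists d => // z w cz cw; rewrite -!ff//; exact: h. Qed.
Lemma ucirc_cst a : ucirc (fun=> a).
Proof. by move=> e e0; exists 1 => // z w _ _ _; rewrite subrr csq0 ltW. Qed.
Lemma ucirc_id : ucirc (fun z : C => z).
Proof. by move=> e e0; exists e. Qed.

Lemma ucircD f f' : ucirc f -> ucirc f' -> ucirc (fun z => f z + f' z).
Proof.
move=> uf uf' e e0; have e4 : 0 < e / 4 by rewrite divr_gt0.
have [d d0 h] := uf _ e4; have [d' d'0 h'] := uf' _ e4.
exists (Num.min d d'); first by rewrite lt_min d0.
move=> z w cz cw; rewrite le_min => /andP[zd zd'].
have -> : f z + f' z - (f w + f' w) = (f z - f w) + (f' z - f' w) by ring.
apply: le_trans (csqD_le _ _) _.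
by have := h z w cz cw zd; have := h' z w cz cw zd'; lra.
Qed.

Lemma ucircM f f' : ucirc f -> ucirc f' -> ucirc (fun z => f z * f' z).
Proof.
move=> uf uf' e e0; have [K K0 hK] := ucirc_bounded uf; have [K' K'0 hK'] := ucirc_bounded uf'.
have e4 : 0 < e / (4 * (K + K' + 1)) by rewrite divr_gt0// mulr_gt0//; lra.
have [d d0 h] := uf _ e4; have [d' d'0 h'] := uf' _ e4.
exists (Num.min d d'); first by rewrite lt_min d0.
move=> z w cz cw; rewrite le_min => /andP[zd zd'].
have -> : f z * f' z - (f w * f' w) = (f z - f w) * f' z + f w * (f' z - f' w) by ring.
apply: le_trans (csqD_le _ _) _; rewrite !csqM.
have h1 := ler_pM (csq_ge0 _) (csq_ge0 _) (h z w cz cw zd) (hK' z cz).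
have h2 := ler_pM (csq_ge0 _) (csq_ge0 _) (hK w cw) (h' z w cz cw zd').
have -> : e = 4 * (K + K' + 1) * (e / (4 * (K + K' + 1))).
  by rewrite mulrC divfK// gt_eqF// mulr_gt0//; lra.
move: h1 h2 (ltW e4) K0 K'0; set c := e / _; nra.
Qed.

Lemma circle_dist a : ~ circle a -> exists2 c : R, 0 < c & forall z, circle z -> c <= csqnorm (z - a).
Proof.
move=> na; pose r := Num.sqrt (csqnorm a).
have r0 : 0 <= r := sqrtr_ge0 _.
have r2 : r ^+ 2 = csqnorm a by rewrite sqr_sqrtr// csq_ge0.
exists ((1 - r) ^+ 2).
  rewrite lt_def sqr_ge0 andbT sqrf_eq0 subr_eq0; apply/eqP => r1.
  by apply: na; rewrite /circle /= -r2 -r1 expr1n.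
move=> z cz; move: r2 cz; rewrite /circle /csqnorm !reimE /=.
move: (re z) (im z) (re a) (im a) => x y s t r2 cz.
have h : x * s + y * t <= r.
  rewrite leNgt; apply/negP => rl.
  have h1 : r ^+ 2 < (x * s + y * t) ^+ 2 by rewrite ltrXn2r// nnegrE (le_trans r0)// ltW.
  have h2 : (x * s + y * t) ^+ 2 <= (x ^+ 2 + y ^+ 2) * (s ^+ 2 + t ^+ 2).
    by rewrite -subr_ge0 (_ : _ - _ = (x * t - y * s) ^+ 2) ?sqr_ge0//; ring.
  by move: h2; rewrite cz -r2 mul1r leNgt h1.
have -> : (x - s) ^+ 2 + (y - t) ^+ 2 = (x ^+ 2 + y ^+ 2) + (s ^+ 2 + t ^+ 2) - 2 * (x * s + y * t) by ring.
rewrite cz -r2 sqrrB expr1n; lra.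
Qed.

Lemma ucirc_resolvent a : ~ circle a -> ucirc (fun z => (z - a)^-1).
Proof.
move=> /circle_dist[c c0 hc] e e0; exists (e * c ^+ 2); first by rewrite mulr_gt0// exprn_gt0.
have nz z : circle z -> z - a != 0.
  by move=> cz; apply/eqP => h; have := hc z cz; rewrite h csq0 leNgt c0.
move=> z w cz cw zw.
have -> : (z - a)^-1 - (w - a)^-1 = - (z - w) * ((z - a)^-1 * (w - a)^-1).
  by field; rewrite !nz.
rewrite !csqM csqN !csqV -invfM ler_pdivrMr; last first.
  by rewrite mulr_gt0//; apply: lt_le_trans c0 _; exact: hc.
apply: le_trans zw _; rewrite ler_pM2l// expr2.
by apply: ler_pM; [exact: ltW|exact: ltW|exact: hc|exact: hc].
Qed.

Lemma lop_XsubC a g : lop phi 0 ('X - a%:P) g = fun x => koopman phi g x - a * g x.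
Proof.
apply/funext => x; rewrite /lop /= kpolyD -polyCN kpolyC mulNr.
by rewrite -[in LHS](expr1 'X) kpolyXn.
Qed.
Lemma koopman_L2 g : L2 g -> L2 (koopman phi g).
Proof. exact: (L2_mpres (mpres_tds inv)). Qed.

Lemma fcalc_XsubC a g : L2 g -> fcalc phi mu (fun z => z - a) g (fun x => koopman phi g x - a * g x).
Proof.
move=> Lg; rewrite -lop_XsubC; apply: fcalc_eq (fcalc_laurent inv 0 ('X - a%:P) Lg) => z _.
by rewrite /laurent !hornerE expr0 divr1.
Qed.

Lemma fcalc_cst a g : L2 g -> fcalc phi mu (fun=> a) g (fun x => a * g x).
Proof.
move=> Lg; have := fcalc_laurent inv 0 a%:P Lg.
have -> : lop phi 0 a%:P g = fun x => a * g x by apply/funext => x; rewrite /lop /= kpolyC.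
by apply: fcalc_eq => z _; rewrite /laurent hornerC expr0 divr1.
Qed.
Lemma fcalc1 g : L2 g -> fcalc phi mu (fun=> 1) g g.
Proof. by move=> /(fcalc_cst 1); under [X in fcalc _ _ _ _ X]eq_fun do rewrite mul1r. Qed.

(** For [a] off the circle, [(z - a)^-1] is continuous on the circle, and the functional calculus
    makes it an inverse of [U - a]. Invariance of [V] under the calculus keeps this inverse inside
    [V]. *)
Lemma spectrum_on_circle V : V `<=` L2 ->
  (forall f g, ucirc f -> V g -> V (fcT f g)) -> spectrum_on mu V (koopman phi) `<=` @circle R.
Proof.
move=> VL Vf a nS; apply: contrapT => na; apply: nS.
have ur := ucirc_resolvent na; have [c c0 hc] := circle_dist na.
have us : ucirc (fun z => z - a) by apply: ucircD ucirc_id (ucirc_cst _).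
have nz z : circle z -> z - a != 0.
  by move=> cz; apply/eqP => h; have := hc z cz; rewrite h csq0 leNgt c0.
have u1 := ucirc_cst 1.
exists (fcT (fun z => (z - a)^-1)); split.
  by apply: fcT_bounded_linear => // g; exact: Vf.
move=> g Vg; have Lg := VL _ Vg.
have Ld : L2 (fun x => koopman phi g x - a * g x) by apply: L2B; [exact: koopman_L2|exact: L2Z].
split.
  apply: (fcalc_uniq inv u1 Lg _ (fcalc1 Lg)).
  have := fcalc_mul inv Lg us ur (fcalc_XsubC a Lg) (fcTP ur Ld).
  by apply: fcalc_eq => z cz; rewrite mulVf// nz.
apply: (fcalc_uniq inv u1 Lg _ (fcalc1 Lg)).
have := fcalc_mul inv Lg ur us (fcTP ur Lg) (fcalc_XsubC a (fcT_L2 ur Lg)).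
by apply: fcalc_eq => z cz; rewrite divff// nz.
Qed.

(** Weyl's criterion: an inverse of norm at most [c] is contradicted by a vector that is an
    eigenvector up to the squared relative error [(2 c^2 + 1)^-1]. *)
Lemma approximate_eigenvector V a : V `<=` L2 ->
  (forall e : R, 0 < e -> exists g, [/\ V g, V (fun x => koopman phi g x - a * g x), 0 < L2N mu g &
     L2N mu (fun x => koopman phi g x - a * g x) <= e * L2N mu g]) ->
  spectrum_on mu V (koopman phi) a.
Proof.
move=> VL h [S [[SV _ [c hc]] hS]].
have e0 : 0 < (2 * c ^+ 2 + 1)^-1 by rewrite invr_gt0; have := sqr_ge0 c; lra.
have [g [Vg Vd g0 ge]] := h _ e0.
have Ld := VL _ Vd; have Lg := VL _ Vg.
have [e _] := hS g Vg.
have := hc _ Vd; rewrite !L2norm_L2N (L2N_ae (L2_meas (VL _ (SV _ Vd))) (L2_meas Lg) e) => le.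
have : L2N mu g <= c ^+ 2 * L2N mu (fun x => koopman phi g x - a * g x).
  rewrite -[leLHS](sqr_sqrtr (L2N_ge0 mu g)) -[X in _ * X](sqr_sqrtr (L2N_ge0 mu _)) -exprMn.
  by rewrite lerXn2r ?nnegrE ?sqrtr_ge0// (le_trans _ le) ?sqrtr_ge0.
move=> /le_trans/(_ (ler_wpM2l (sqr_ge0 c) ge)).
rewrite mulrA ler_pMl//; apply/negP; rewrite -ltNge ltr_pdivrMr; have := sqr_ge0 c; lra.
Qed.

Hypothesis spec : dynamical_spectrum phi mu = @circle R.

Lemma is_functional_calculus_fcalc f T g : is_functional_calculus phi mu f T -> L2 g ->
  fcalc phi mu f g (T g).
Proof.
move=> [TL h] Lg; apply: fcalcI => //; first exact: TL.
(* The definition of the calculus bounds norms, [fcalc] bounds squared norms; an accuracy below 1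
   may be squared without loss. *)
move=> e e0; pose e1 := Num.min 1 (e / (L2N mu g + 1)).
have g0 := L2N_ge0 mu g.
have e10 : 0 < e1 by rewrite lt_min ltr01 divr_gt0//; lra.
pose e2 := Num.min e1 e.
have e20 : 0 < e2 by rewrite lt_min e10.
have e21 : e2 ^+ 2 <= e2.
  by rewrite expr2 ger_pMl// /e2 /e1 !ge_min lexx.
have [N [p [hp hT]]] := h _ e20; exists N, p; split=> [z cz|].
  rewrite (@le_trans _ _ (e2 ^+ 2))//; last by rewrite (le_trans e21)// ge_min lexx orbT.
  by rewrite -(le_norm_csqnorm _ (ltW e20)); apply: hp; rewrite spec.
rewrite -laurent_koopmanE.
have := hT g Lg; rewrite !L2norm_L2N => hh.
have : L2N mu (fun x => T g x - laurent_koopman phi N p g x) <= e2 ^+ 2 * L2N mu g.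
  rewrite -[leLHS](sqr_sqrtr (L2N_ge0 mu _)) -[X in _ * X](sqr_sqrtr (L2N_ge0 mu g)) -exprMn.
  by rewrite lerXn2r ?nnegrE ?sqrtr_ge0// mulr_ge0 ?sqrtr_ge0// ltW.
move=> /le_trans; apply; apply: (@le_trans _ _ (e1 * L2N mu g)).
  by rewrite ler_wpM2r// (le_trans e21)// ge_min lexx.
apply: (@le_trans _ _ (e / (L2N mu g + 1) * L2N mu g)); first by rewrite ler_wpM2r// ge_min lexx orbT.
rewrite mulrAC ler_pdivrMr; last by lra.
by rewrite ler_pM2l//; lra.
Qed.

Lemma fcT_is_functional_calculus f : ucirc f -> is_functional_calculus phi mu f (fcT f).
Proof.
move=> uf; split=> [g Lg|e e0]; first exact: fcT_L2.
have e20 : 0 < (e / 2) ^+ 2 by rewrite exprn_gt0// divr_gt0.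
have [N [p hp]] := weierstrass uf e20; exists N, p; split=> [z|g Lg].
  rewrite spec => cz; rewrite (le_norm_csqnorm _ (ltW e0)); apply: le_trans (hp z cz) _.
  by rewrite lerXn2r ?nnegrE//; lra.
have [_ h] := fcTP uf Lg; have := h _ _ _ hp; rewrite -laurent_koopmanE.
have -> : 4 * (e / 2) ^+ 2 = e ^+ 2 by field.
by move=> /(L2norm_le (sqr_ge0 e)); rewrite sqrtr_sqr gtr0_norm.
Qed.

End spectra.

(** * Topology and measurability on the complex plane *)

Section complex_topology.
Context (R : realType).
Local Notation C := (R[i]).
Implicit Types (z w a : C) (f : C -> C).

Lemma complex_pos (e : C) : 0 < e -> exists2 d : R, 0 < d & e = d%:C%C.
Proof.
case: e => a b; rewrite ltcE /= => /andP[/eqP -> a0]; by exists a.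
Qed.

Lemma lt_norm_csqnorm z (e : R) : 0 < e -> (`|z| < e%:C%C) = (csqnorm z < e ^+ 2).
Proof.
move=> e0; rewrite normc_csqnorm ltcR -{2}(sqr_sqrtr (csq_ge0 z)).
by rewrite ltr_pXn2r ?nnegrE ?sqrtr_ge0// ltW.
Qed.

Lemma nbhs_csqP z (A : set C) : nbhs (z : C^o) A <->
  exists2 d : R, 0 < d & forall w, csqnorm (z - w) < d -> A w.
Proof.
split=> [/nbhs_ballP[e /= /complex_pos[d d0 ->] h]|[d d0 h]].
  exists (d ^+ 2); first exact: exprn_gt0.
  by move=> w zw; apply: h; rewrite /ball /= lt_norm_csqnorm.
apply/nbhs_ballP; exists ((Num.sqrt d)%:C%C); first by rewrite /= ltcR sqrtr_gt0.
move=> w; rewrite /ball /= lt_norm_csqnorm ?sqrtr_gt0// sqr_sqrtr ?ltW//; exact: h.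
Qed.

Lemma continuous_re : continuous (fun z : C^o => re z).
Proof.
move=> z B /nbhs_ballP[e /= e0 he]; apply/nbhs_csqP; exists (e ^+ 2); first exact: exprn_gt0.
move=> w zw; apply: he; rewrite /ball /= -reB.
have := le_lt_trans (re_sqr_le (z - w)) zw.
by rewrite -[X in X < _](real_normK (num_real _)) ltr_pXn2r ?nnegrE// ltW.
Qed.

Lemma continuous_im : continuous (fun z : C^o => im z).
Proof.
move=> z B /nbhs_ballP[e /= e0 he]; apply/nbhs_csqP; exists (e ^+ 2); first exact: exprn_gt0.
move=> w zw; apply: he; rewrite /ball /= -imB.
have := le_lt_trans (im_sqr_le (z - w)) zw.
by rewrite -[X in X < _](real_normK (num_real _)) ltr_pXn2r ?nnegrE// ltW.
Qed.
Lemma measurable_re : measurable_fun setT (fun z : borel C^o => re z).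
Proof. exact: cont_borelR continuous_re. Qed.
Lemma measurable_im : measurable_fun setT (fun z : borel C^o => im z).
Proof. exact: cont_borelR continuous_im. Qed.
Lemma measurable_csqnorm : measurable_fun setT (fun z : borel C^o => csqnorm z).
Proof. by apply: measurable_funD; apply: measurable_funX; [exact: measurable_re|exact: measurable_im]. Qed.

Lemma meas_circle : measurable (@circle R : set (borel C^o)).
Proof.
have -> : @circle R = (fun z : borel C^o => csqnorm z) @^-1` [set 1] by [].
by rewrite -[_ @^-1` _]setTI; exact: measurable_csqnorm.
Qed.

Lemma measurable_ec (s : R -> R) : measurable_fun setT s ->
  measurable_fun setT (fun t => ec (s t) : borel C^o).
Proof.
move=> ms; apply: (@measurableT_comp _ _ _ _ _ _ (fun t => ec t : borel C^o) _ s) => //.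
apply: (measurability (@open C^o : set (set (borel C^o)))) => //.
move=> _ [B oB <-]; rewrite setTI; apply: open_measurable.
rewrite openE => t /= Bt.
have : nbhs (ec t : C^o) B by exact: open_nbhs_nbhs.
move=> /nbhs_csqP[d d0 h]; apply/nbhs_ballP.
have c0 : 0 < (2 * pi) ^+ 2 * 2 :> R by rewrite mulr_gt0// exprn_gt0// mulr_gt0// pi_gt0.
exists (Num.min 1 (d / ((2 * pi) ^+ 2 * 2))) => /=; first by rewrite lt_min ltr01 divr_gt0.
move=> s'; rewrite /ball /= lt_min => /andP[h1 h2]; apply: h.
apply: le_lt_trans (ec_lip _ _) _.
rewrite exprMn -(real_normK (num_real (t - s'))) mulrAC mulrC -ltr_pdivlMr//.
apply: le_lt_trans h2; rewrite expr2 ler_piMl//; exact: ltW.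
Qed.

Lemma within_continuousP f : {within (@circle R : set C^o), continuous (f : C^o -> C^o)} <->
  forall z, circle z -> forall e : R, 0 < e -> exists2 d : R, 0 < d &
    forall w, circle w -> csqnorm (z - w) < d -> csqnorm (f z - f w) < e.
Proof.
rewrite subspace_continuousP; split=> h z cz.
  move=> e e0.
  have : nbhs (z : C^o) [set w | circle w -> csqnorm (f z - f w) < e].
    by apply: (h z cz [set w | csqnorm (f z - w) < e]); apply/nbhs_csqP; exists e.
  by move=> /nbhs_csqP[d d0 hd]; exists d => // w cw zw; exact: hd.
move=> B /nbhs_csqP[e e0 he]; have [d d0 hd] := h z cz e e0.
apply/nbhs_csqP; exists d => // w zw cw; apply: he; exact: hd.
Qed.

(** Heine's theorem, with compactness taken from the parameter interval [[0, 1]]. *)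
Lemma within_continuous_ucirc f :
  {within (@circle R : set C^o), continuous (f : C^o -> C^o)} -> ucirc f.
Proof.
move=> /within_continuousP h e e0; have e4 : 0 < e / 4 by rewrite divr_gt0.
pose P (d t : R) := forall w, circle w -> csqnorm (ec t - w) <= d -> csqnorm (f (ec t) - f w) <= e.
have : compact (`[0, 1] : set R) by exact: segment_compact.
move/compact_near_coveringP => /(_ R (0 : R)^'+ P).
case/(_ _ _)/Wrap => [t _|].
  have [d d0 hd] := h _ (circle_ec t) _ e4.
  have d4 : 0 < d / 4 by rewrite divr_gt0.
  have c0 : 0 < (2 * pi) ^+ 2 * 2 :> R by rewrite mulr_gt0// exprn_gt0// mulr_gt0// pi_gt0.
  pose r := Num.min 1 (d / 4 / ((2 * pi) ^+ 2 * 2)).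
  have r0 : 0 < r by rewrite lt_min ltr01 divr_gt0.
  exists (ball t r, [set u : R | u <= d / 8]) => /=.
    split; first exact: nbhsx_ballx.
    by near=> u; near: u; apply: nbhs_right_le; rewrite divr_gt0.
  move=> [s u] /= [ts ud] w cw sw.
  have ds : csqnorm (ec t - ec s) < d / 4.
    apply: le_lt_trans (ec_lip _ _) _; move: ts; rewrite /ball /= lt_min => /andP[h1 h2].
    rewrite exprMn -(real_normK (num_real (t - s))) mulrAC mulrC -ltr_pdivlMr//.
    apply: le_lt_trans h2; rewrite expr2 ler_piMl//; exact: ltW.
  have tw : csqnorm (ec t - w) < d.
    have -> : ec t - w = (ec t - ec s) + (ec s - w) by ring.
    apply: le_lt_trans (csqD_le _ _) _; move: ds sw ud; lra.
  have := hd w cw tw; have := hd _ (circle_ec s) (lt_trans ds _).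
  have -> : f (ec s) - f w = - (f (ec t) - f (ec s)) + (f (ec t) - f w) by ring.
  move=> /(_ _)/Wrap[]; first by lra.
  move=> h1 h2; apply: le_trans (csqD_le _ _) _; rewrite csqN; move: h1 h2; lra.
move=> [d /= d0 hd]; exists (d / 2); first by rewrite divr_gt0.
move=> z w cz cw zw; have [t [t0 t1 tz]] := circle_ecP cz; rewrite -tz in zw *.
apply: (hd (d / 2)) => //=; last 2 first.
- by rewrite divr_gt0.
- by rewrite in_itv /= t0 ltW.
by rewrite sub0r normrN gtr0_norm ?divr_gt0// ltr_pdivrMr// ltr_pMr// ltr1n.
Unshelve. all: by end_near. Qed.

Lemma ucirc_within_continuous f : ucirc f ->
  {within (@circle R : set C^o), continuous (f : C^o -> C^o)}.
Proof.
move=> uf; apply/within_continuousP => z cz e e0.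
have e2 : 0 < e / 2 by rewrite divr_gt0.
have [d d0 hd] := uf _ e2; exists d => // w cw zw.
by apply: le_lt_trans (hd z w cz cw (ltW zw)) _; lra.
Qed.

Lemma ucirc_measurable (P : C -> R) f : (forall z w, `|P z - P w| ^+ 2 <= csqnorm (z - w)) ->
  ucirc f -> measurable_fun (@circle R : set (borel C^o)) (fun z : borel C^o => P (f z)).
Proof.
move=> hP uf; apply: (measurability _ (RGenOInfty.measurableE R)).
move=> _ [_ [a ->] <-].
pose U : set C^o := [set z | exists w, exists d : R, [/\ circle w, 0 < d,
  (forall w', circle w' -> csqnorm (w - w') < d -> a < P (f w')) & csqnorm (w - z) < d]].
have -> : @circle R `&` (fun z : borel C^o => P (f z)) @^-1` `]a, +oo[ = @circle R `&` U.
  apply/seteqP; split=> z [cz]; rewrite /= in_itv /= andbT.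
    move=> az; have e0 : 0 < ((P (f z) - a) / 2) ^+ 2 by rewrite exprn_gt0// divr_gt0// subr_gt0.
    have [d d0 hd] := uf _ e0; split=> //; exists z, d; split=> //; last by rewrite subrr csq0.
    move=> w cw zw; have := le_trans (hP (f z) (f w)) (hd z w cz cw (ltW zw)).
    rewrite ler_pXn2r ?nnegrE// ?ler_norml; first by move=> /andP[h1 h2]; lra.
    by rewrite divr_ge0// subr_ge0 ltW.
  by move=> [w [d [cw d0 h wz]]]; split=> //; exact: h.
apply: measurableI; first exact: meas_circle.
apply: sub_sigma_algebra; rewrite openE => z [w [d [cw d0 h wz]]].
apply/nbhs_csqP; pose s := Num.sqrt d - Num.sqrt (csqnorm (w - z)).
have s0 : 0 < s by rewrite subr_gt0 ltr_sqrt.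
exists (s ^+ 2); first exact: exprn_gt0.
move=> z' zz'; exists w, d; split=> //.
have : `|w - z'| <= `|w - z| + `|z - z'| by have := ler_normD (w - z) (z - z'); rewrite addrA subrK.
rewrite !normc_csqnorm -(rmorphD (real_complex R)) lecR => le.
rewrite -ltr_sqrt//; apply: le_lt_trans le _.
rewrite -ltrBrDl -/s -[ltRHS]ger0_norm ?ltW// -sqrtr_sqr ltr_sqrt// exprn_gt0//.
Qed.

Lemma ucirc_meas_re f : ucirc f ->
  measurable_fun (@circle R : set (borel C^o)) (fun z : borel C^o => re (f z)).
Proof.
apply: (@ucirc_measurable (@complex.Re R)) => z w.
by rewrite real_normK ?num_real// -reB re_sqr_le.
Qed.

Lemma ucirc_meas_im f : ucirc f ->
  measurable_fun (@circle R : set (borel C^o)) (fun z : borel C^o => im (f z)).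
Proof.
apply: (@ucirc_measurable (@complex.Im R)) => z w.
by rewrite real_normK ?num_real// -imB im_sqr_le.
Qed.

End complex_topology.

(** * Finite measures: bounded functions, densities, images *)

Section finite_measures.
Context d (T : measurableType d) (R : realType).
Implicit Types (u v w : T -> R).

Definition bmeas (D : set T) u := measurable_fun D u /\ exists K, forall x, D x -> `|u x| <= K.

Section one_measure.
Variable nu : {finite_measure set T -> \bar R}.
Variables (D : set T) (mD : measurable D).

Lemma bmeas_integrable u : bmeas D u -> nu.-integrable D (EFin \o u).
Proof.
move=> [mu_ [K hK]]; apply: (@le_integrable _ _ _ nu D mD _ (fun=> `|K|%:E)).
- exact/measurable_EFinP.
- by move=> x Dx /=; rewrite lee_fin normr_id (le_trans (hK x Dx))// ler_norm.
- apply/integrableP; split; first exact: measurable_cst.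
  under eq_integral do rewrite gee0_abs ?lee_fin//.
  by rewrite integral_cst// lte_mul_pinfty ?lee_fin// ltey_eq fin_num_measure.
Qed.
Lemma fintD u v : bmeas D u -> bmeas D v ->
  \int[nu]_(x in D) (u x + v x) = \int[nu]_(x in D) u x + \int[nu]_(x in D) v x.
Proof. by move=> bu bv; apply: RintegralD => //; exact: bmeas_integrable. Qed.
Lemma fintB u v : bmeas D u -> bmeas D v ->
  \int[nu]_(x in D) (u x - v x) = \int[nu]_(x in D) u x - \int[nu]_(x in D) v x.
Proof. by move=> bu bv; apply: RintegralB => //; exact: bmeas_integrable. Qed.
Lemma fintZ (c : R) u : bmeas D u ->
  \int[nu]_(x in D) (c * u x) = c * \int[nu]_(x in D) u x.
Proof. by move=> bu; apply: RintegralZl => //; exact: bmeas_integrable. Qed.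
Lemma fint_le u v : bmeas D u -> bmeas D v -> (forall x, D x -> u x <= v x) ->
  \int[nu]_(x in D) u x <= \int[nu]_(x in D) v x.
Proof. by move=> bu bv h; apply: le_Rintegral => //; exact: bmeas_integrable. Qed.
Lemma fint_cst (c : R) : \int[nu]_(x in D) c = c * fine (nu D).
Proof. by rewrite Rintegral_cst. Qed.
Lemma bmeas_cst (c : R) : bmeas D (fun=> c).
Proof. by split; [exact: measurable_cst|exists `|c|]. Qed.

Lemma bmeas_indic (A : set T) : measurable A -> bmeas D (\1_A : T -> R).
Proof.
by split; [exact: measurable_indic|exists 1 => x _; rewrite indicE; case: (_ \in _); rewrite ?normr1 ?normr0].
Qed.

Lemma bmeasD u v : bmeas D u -> bmeas D v -> bmeas D (fun x => u x + v x).
Proof.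
move=> [mu_ [K hK]] [mv [L hL]]; split; first exact: measurable_funD.
by exists (K + L) => x Dx; rewrite (le_trans (ler_normD _ _))// lerD ?hK ?hL.
Qed.

Lemma bmeasM u v : bmeas D u -> bmeas D v -> bmeas D (fun x => u x * v x).
Proof.
move=> [mu_ [K hK]] [mv [L hL]]; split; first exact: measurable_funM.
by exists (K * L) => x Dx; rewrite normrM ler_pM ?hK ?hL.
Qed.
Lemma bmeasZ (c : R) u : bmeas D u -> bmeas D (fun x => c * u x).
Proof. by move=> bu; apply: bmeasM => //; exact: bmeas_cst. Qed.

Lemma bmeasB u v : bmeas D u -> bmeas D v -> bmeas D (fun x => u x - v x).
Proof.
move=> bu /(bmeasZ (-1)) bv; have -> : (fun x => u x - v x) = (fun x => u x + (-1) * v x).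
  by apply/funext => x; rewrite mulN1r.
exact: bmeasD.
Qed.

Lemma fint_dist u v (e : R) : bmeas D u -> bmeas D v -> (forall x, D x -> `|u x - v x| <= e) ->
  `|\int[nu]_(x in D) u x - \int[nu]_(x in D) v x| <= e * fine (nu D).
Proof.
move=> bu bv h; rewrite -fintB// ler_norml -mulNr -!fint_cst.
have bd := bmeasB bu bv.
apply/andP; split; apply: fint_le => //; try exact: bmeas_cst; move=> x Dx;
  by have := h x Dx; rewrite ler_norml => /andP[].
Qed.

Lemma bmeas_sum (I : Type) (r : seq I) (F : I -> T -> R) : (forall i, bmeas D (F i)) ->
  bmeas D (fun x => \sum_(i <- r) F i x).
Proof.
move=> bF; elim: r => [|i r IH].
  by under eq_fun do rewrite big_nil; exact: bmeas_cst.
by under eq_fun do rewrite big_cons; exact: bmeasD.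
Qed.

Lemma fint_sum (I : Type) (r : seq I) (F : I -> T -> R) : (forall i, bmeas D (F i)) ->
  \int[nu]_(x in D) (\sum_(i <- r) F i x) = \sum_(i <- r) \int[nu]_(x in D) F i x.
Proof.
move=> bF; elim: r => [|i r IH].
  by under eq_Rintegral do rewrite big_nil; rewrite big_nil fint_cst mul0r.
under eq_Rintegral do rewrite big_cons.
by rewrite fintD ?IH ?big_cons//; exact: bmeas_sum.
Qed.

End one_measure.

Section density.
Variables (nu : {finite_measure set T -> \bar R}) (w : T -> R) (K : R).
Hypotheses (mw : measurable_fun setT w) (w0 : forall x, 0 <= w x) (wK : forall x, w x <= K).

Let rho (A : set T) : \bar R := (\int[nu]_(x in A) (w x)%:E)%E.

Let rho0 : rho set0 = 0%E. Proof. by rewrite /rho integral_set0. Qed.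

Let rho_ge0 A : (0 <= rho A)%E.
Proof. by apply: integral_ge0 => x _; rewrite lee_fin. Qed.

Let rho_sigma : semi_sigma_additive rho.
Proof.
move=> F mF tF mUF; rewrite /rho.
have -> : (\int[nu]_(x in \bigcup_n F n) (w x)%:E = \sum_(i <oo) \int[nu]_(x in F i) (w x)%:E)%E.
  rewrite ge0_integral_bigcup//; last by move=> x _; rewrite lee_fin.
  by apply/measurable_EFinP; exact: measurable_funTS.
by apply: is_cvg_ereal_nneg_natsum => n _; exact: rho_ge0.
Qed.

HB.instance Definition _ := isMeasure.Build _ _ _ rho rho0 rho_ge0 rho_sigma.

Let bw : bmeas setT w.
Proof. by split=> //; exists K => x _; rewrite ger0_norm. Qed.

Let rho_fin : fin_num_fun rho.
Proof.
move=> A mA; apply: integrable_fin_num => //; apply: (integrableS measurableT) => //.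
exact: bmeas_integrable.
Qed.

HB.instance Definition _ := Measure_isFinite.Build _ _ _ rho rho_fin.

(** The Radon-Nikodym theorem is used backwards: the derivative of the constructed measure equals
    [w] almost everywhere by uniqueness of densities, so the change of variables holds with [w]. *)
Lemma density_measure : exists rho' : {finite_measure set T -> \bar R},
  (forall A, measurable A -> rho' A = (\int[nu]_(x in A) (w x)%:E)%E) /\
  forall u, bmeas setT u -> \int[rho']_x u x = \int[nu]_x (u x * w x).
Proof.
exists rho; split=> // u bu; have [mu_ _] := bu.
have dom : (rho : {finite_measure set T -> \bar R}) `<< nu.
  move=> A A0 B mB BA; apply: null_set_integral => //; last exact: A0.
  by apply/measurable_EFinP; exact: measurable_funTS.
have iu := bmeas_integrable (rho : {finite_measure set T -> \bar R}) measurableT bu.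
rewrite /Rintegral -(Radon_Nikodym_change_of_variables dom measurableT iu); congr fine.
pose r := Radon_Nikodym (charge_of_finite_measure rho) nu.
have ir : nu.-integrable setT r by exact: Radon_Nikodym_integrable.
have /integrableP[mRN _] := ir; have iw := bmeas_integrable nu measurableT bw.
have mE (v : T -> R) : measurable_fun setT v -> measurable_fun setT (EFin \o v) by move=> ?; exact/measurable_EFinP.
apply: ae_eq_integral => //.
- by apply: emeasurable_funM; [exact: mE|exact: mRN].
- by apply: mE; exact: measurable_funM.
have : ae_eq nu setT r (EFin \o w).
  apply: integral_ae_eq => //; first exact: mE.
  by move=> E _ mE'; rewrite -Radon_Nikodym_integral.
by apply: filterS => x /= h _; rewrite EFinM -h.
Qed.

End density.
End finite_measures.


Section finite_measure_constructions.
Context (R : realType).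

Lemma restricted_measure d (T : measurableType d) (m : {measure set T -> \bar R}) (D : set T) :
  measurable D -> (m D < +oo)%E -> exists nu : {finite_measure set T -> \bar R},
  forall A, measurable A -> nu A = m (A `&` D).
Proof.
move=> mD fD; have fin : fin_num_fun (mrestr m mD).
  move=> A mA; rewrite /mrestr ge0_fin_numE ?measure_ge0//.
  by apply: le_lt_trans fD; apply: le_measure; rewrite ?inE; [exact: measurableI|exact: mD|exact: subIsetr].
pose H := Measure_isFinite.Build _ _ _ (mrestr m mD) fin.
pose nu : {finite_measure set T -> \bar R} := HB.pack (mrestr m mD) H.
by exists nu.
Qed.

Lemma image_measure d1 d2 (T1 : measurableType d1) (T2 : measurableType d2)
    (m : {finite_measure set T1 -> \bar R}) (f : T1 -> T2) : measurable_fun setT f ->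
  exists nu : {finite_measure set T2 -> \bar R},
    (forall A, measurable A -> nu A = m (f @^-1` A)) /\
    forall D u, measurable D -> bmeas D u -> measurable_fun setT (u \o f) -> f @^-1` D = setT ->
      \int[nu]_(y in D) u y = \int[m]_x u (f x).
Proof.
move=> mf; pose ff : {mfun T1 >-> T2} := HB.pack f (isMeasurableFun.Build _ _ _ _ f mf).
have fin : fin_num_fun (pushforward m ff).
  by move=> A mA; apply: fin_num_measure; rewrite -[_ @^-1` _]setTI; exact: (measurable_funP ff).
pose H := Measure_isFinite.Build _ _ _ (pushforward m ff) fin.
pose nu : {finite_measure set T2 -> \bar R} := HB.pack (pushforward m ff) (H mf).
exists (nu mf); split=> // D u mD bu muf fD.
have [mu_ [K hK]] := bu.
have bK : bmeas setT (u \o f) by split => //; exists K => x _; apply: hK; have : (f @^-1` D) x by rewrite fD.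
(* Adding [|K|] makes the integrand nonnegative, as the push-forward formula requires; the constants
   cancel because the total masses agree. *)
have e : \int[nu mf]_(y in D) (u y + `|K|) = \int[m]_x (u (f x) + `|K|).
  rewrite /Rintegral; congr fine.
  transitivity (\int[pushforward m f]_(y in D) (u y + `|K|)%:E)%E => //.
  rewrite ge0_integral_pushforward//; last 2 first.
  - by apply/measurable_EFinP; apply: measurable_funD.
  - move=> y; rewrite inE => Dy; rewrite lee_fin; have := hK y Dy; rewrite ler_norml => /andP[h _].
    by have := ler_norm K; lra.
  by rewrite fD.
have eD : fine (nu mf D) = fine (m setT) by rewrite -fD.
move: e; rewrite (fintD _ mD bu (bmeas_cst _ _)) (fintD _ measurableT bK (bmeas_cst _ _)).
by rewrite (fint_cst (nu mf) mD) (fint_cst m measurableT) eD; exact: addIr.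
Qed.

End finite_measure_constructions.

Section telescoping.
Context (R : realType).

(** The increments of [W] are nonnegative with sum 1, so the sum is a convex combination of the
    [a i], and only those of positive weight have to be near [b]. *)
Lemma telescope_close (M : nat) (W a : nat -> R) (b eta : R) : 0 <= eta ->
  (forall i, W i <= W i.+1) -> W 0%N = 0 -> W M.+1 = 1 ->
  (forall i, (i <= M)%N -> W i < W i.+1 -> `|b - a i| <= eta) ->
  `|b - \sum_(i < M.+1) a i * (W i.+1 - W i)| <= eta.
Proof.
move=> eta0 Wn W0 W1 h.
have s1 : \sum_(i < M.+1) (W i.+1 - W i) = 1.
  by rewrite -(big_mkord xpredT (fun i => W i.+1 - W i)) telescope_sumr// W0 W1 subr0.
have -> : b - \sum_(i < M.+1) a i * (W i.+1 - W i) = \sum_(i < M.+1) (b - a i) * (W i.+1 - W i).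
  rewrite -[X in X - _]mulr1 -s1 mulr_sumr -sumrB; apply: eq_bigr => i _.
  by rewrite mulrBl.
apply: le_trans (ler_norm_sum _ _ _) _; rewrite -[leRHS]mulr1 -s1 mulr_sumr.
apply: ler_sum => i _; rewrite normrM (ger0_norm (_ : 0 <= W i.+1 - W i)) ?subr_ge0//.
have := Wn i; rewrite le_eqVlt => /orP[/eqP->|Wi]; first by rewrite subrr !mulr0.
by rewrite ler_wpM2r ?subr_ge0//; apply: h => //; rewrite -ltnS.
Qed.

End telescoping.

(** * Riesz representation of positive functionals on the circle *)

Section riesz.
Context (R : realType).
Local Notation C := (R[i]).
Implicit Types (z w : C) (s t : R) (v : C -> R).

Definition dC z w : R := Num.sqrt (csqnorm (z - w)).

Lemma dC_ge0 z w : 0 <= dC z w. Proof. exact: sqrtr_ge0. Qed.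
Lemma dC_sqr z w : dC z w ^+ 2 = csqnorm (z - w).
Proof. by rewrite sqr_sqrtr// csq_ge0. Qed.
Lemma dCC z w : dC z w = dC w z.
Proof. by rewrite /dC -csqN opprB. Qed.

Lemma dCxx z : dC z z = 0. Proof. by rewrite /dC subrr csq0 sqrtr0. Qed.

Lemma dC_triangle z w x : dC z x <= dC z w + dC w x.
Proof.
have : `|z - x| <= `|z - w| + `|w - x| by have := ler_normD (z - w) (w - x); rewrite addrA subrK.
by rewrite !normc_csqnorm -(rmorphD (real_complex R)) lecR.
Qed.

Lemma ler_sqr_le (x y : R) : 0 <= y -> x ^+ 2 <= y ^+ 2 -> x <= y.
Proof.
move=> y0 h; rewrite leNgt; apply/negP => yx.
by move: h; rewrite leNgt ltr_pXn2r ?nnegrE// ?yx// ltW// (le_lt_trans y0).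
Qed.

Lemma dC_ec s t : dC (ec s) (ec t) <= 4 * pi * `|s - t|.
Proof.
have p0 : 0 <= 4 * pi :> R by rewrite mulr_ge0// pi_ge0.
apply: ler_sqr_le; first by rewrite mulr_ge0.
rewrite dC_sqr.
apply: le_trans (ec_lip _ _) _; rewrite !exprMn real_normK ?num_real//.
by have := sqr_ge0 (pi * (s - t)); rewrite exprMn; lra.
Qed.
Lemma dC_le z w (e : R) : 0 <= e -> (dC z w <= e) = (csqnorm (z - w) <= e ^+ 2).
Proof. by move=> e0; rewrite -dC_sqr ler_pXn2r ?nnegrE ?dC_ge0. Qed.

Definition rcirc v := ucirc (fun z => (v z)%:C%C).

Lemma rcircP v : rcirc v <-> forall e : R, 0 < e -> exists2 d : R, 0 < d &
  forall z w, circle z -> circle w -> dC z w <= d -> `|v z - v w| <= e.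
Proof.
split=> h e e0.
  have [d d0 hd] := h _ (exprn_gt0 2 e0); exists (Num.sqrt d); first by rewrite sqrtr_gt0.
  move=> z w cz cw; rewrite dC_le ?sqrtr_ge0// (sqr_sqrtr (ltW d0)) => /(hd _ _ cz cw).
  rewrite -(rmorphB (real_complex R)) csq_real -(real_normK (num_real _)).
  by rewrite ler_pXn2r ?nnegrE// ltW.
have s0 : 0 < Num.sqrt e by rewrite sqrtr_gt0.
have [d d0 hd] := h _ s0; exists (d ^+ 2); first exact: exprn_gt0.
move=> z w cz cw; rewrite -(dC_le _ _ (ltW d0)) => /(hd _ _ cz cw) le.
rewrite -(rmorphB (real_complex R)) csq_real -(real_normK (num_real _)).
by rewrite -[leRHS](sqr_sqrtr (ltW e0)) ler_pXn2r ?nnegrE// ltW.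
Qed.

Lemma rcirc_lipschitz v (K : R) : (forall z w, `|v z - v w| <= K * dC z w) -> rcirc v.
Proof.
move=> h; apply/rcircP => e e0.
have K1 : 0 < `|K| + 1 by rewrite ltr_wpDl.
exists (e / (`|K| + 1)); first exact: divr_gt0.
move=> z w _ _; rewrite ler_pdivlMr// => d; apply: le_trans (h z w) _; apply: le_trans d.
rewrite mulrC ler_wpM2l ?dC_ge0// (le_trans (ler_norm K))// lerDl//.
Qed.

Lemma rcirc_cst (c : R) : rcirc (fun=> c). Proof. exact: ucirc_cst. Qed.

Lemma rcirc_lin (a : R) v v' : rcirc v -> rcirc v' -> rcirc (fun z => a * v z + v' z).
Proof.
move=> rv rv'; have := ucircD (ucircM (ucirc_cst a%:C%C) rv) rv'.
by apply: ucirc_ext => z _; rewrite (rmorphD (real_complex R)) (rmorphM (real_complex R)).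
Qed.

Lemma rcirc_bounded v : rcirc v -> exists2 K : R, 0 <= K & forall z, circle z -> `|v z| <= K.
Proof.
move=> /ucirc_bounded[K K0 h]; exists (Num.sqrt K); first exact: sqrtr_ge0.
move=> z cz; have := h z cz; rewrite csq_real => le.
by apply: ler_sqr_le; rewrite ?sqrtr_ge0// real_normK ?num_real// sqr_sqrtr.
Qed.

Definition arc t : set C := [set ec s | s in [set s | 0 <= s <= t]].
Definition darc t z : R := inf [set dC z w | w in arc t].

Lemma arc_ne t : 0 <= t -> arc t !=set0.
Proof. by move=> t0; exists (ec 0), 0 => //=; rewrite lexx. Qed.
Lemma darc_lb t z : has_lbound [set dC z w | w in arc t].
Proof. by exists 0 => _ [w _ <-]; exact: dC_ge0. Qed.
Lemma darc_le t z w : arc t w -> darc t z <= dC z w.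
Proof. by move=> aw; apply: ge_inf; [exact: darc_lb|exists w]. Qed.

Lemma darc_ge t z (c : R) : 0 <= t -> (forall w, arc t w -> c <= dC z w) -> c <= darc t z.
Proof.
move=> t0 h; apply: lb_le_inf; first by have [w aw] := arc_ne t0; exists (dC z w), w.
by move=> _ [w aw <-]; exact: h.
Qed.
Lemma darc_ge0 t z : 0 <= t -> 0 <= darc t z.
Proof. by move=> t0; apply: darc_ge => // w _; exact: dC_ge0. Qed.

Lemma darc_lt t z (c : R) : 0 <= t -> darc t z < c -> exists2 w, arc t w & dC z w < c.
Proof.
move=> t0 /inf_lt[]; first by have [w aw] := arc_ne t0; exists (dC z w), w.
by move=> _ [w aw <-] h; exists w.
Qed.

Lemma darc_lip t z w : 0 <= t -> `|darc t z - darc t w| <= dC z w.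
Proof.
move=> t0; have h x y : darc t x <= darc t y + dC x y.
  rewrite -lerBlDr; apply: darc_ge => // u au; rewrite lerBlDr.
  by apply: le_trans (darc_le x au) _; rewrite addrC; exact: dC_triangle.
by rewrite ler_norml; have := h z w; have := h w z; rewrite (dCC w z); lra.
Qed.

Lemma darc_mono s t z : 0 <= s -> s <= t -> darc t z <= darc s z.
Proof.
move=> s0 st; apply: darc_ge => // w [x /= /andP[x0 xs] <-]; apply: darc_le.
by exists x => //=; rewrite x0 (le_trans xs).
Qed.

Lemma darc_step s t z : 0 <= s -> s <= t -> darc s z <= darc t z + 4 * pi * (t - s).
Proof.
move=> s0 st; have p0 : 0 <= 4 * pi :> R by rewrite mulr_ge0// pi_ge0.
rewrite -lerBlDr; apply: darc_ge; first exact: le_trans st.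
move=> w [x /= /andP[x0 xt] <-]; rewrite lerBlDr.
have [xs|sx] := leP x s.
  apply: le_trans (darc_le z (_ : arc s (ec x))) _; first by exists x => //=; rewrite x0.
  by rewrite lerDl mulr_ge0// subr_ge0.
apply: le_trans (darc_le z (_ : arc s (ec s))) _; first by exists s => //=; rewrite s0 lexx.
apply: le_trans (dC_triangle z (ec x) (ec s)) _; rewrite lerD2l.
apply: le_trans (dC_ec _ _) _; rewrite ler_wpM2l// ger0_norm; lra.
Qed.

Lemma darc0 t z : arc t z -> 0 <= t -> darc t z = 0.
Proof.
by move=> az t0; apply/eqP; rewrite eq_le darc_ge0// andbT -(dCxx z) darc_le.
Qed.
Lemma arc1 z : circle z -> arc 1 z.
Proof. by move=> /circle_ecP[t [t0 t1 <-]]; exists t => //=; rewrite t0 ltW. Qed.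

(** A continuous majorant of the indicator of the arc from angle 0 to angle [t], which decreases to
    it as [n] grows. *)
Definition tent t (n : nat) z : R := Num.max 0 (1 - n.+1%:R * darc t z).

Lemma tent_01 t n z : 0 <= t -> 0 <= tent t n z <= 1.
Proof.
move=> t0; rewrite /tent le_max lexx /= ge_max ler01 /= lerBlDr lerDl.
by rewrite mulr_ge0// darc_ge0.
Qed.

Lemma max0_lip (x y : R) : `|Num.max 0 x - Num.max 0 y| <= `|x - y|.
Proof.
have h1 := ler_norm (x - y); have h2 := ler_norm (- (x - y)); rewrite normrN in h2.
rewrite !maxEle; case: (leP 0 x) => a; case: (leP 0 y) => b;
  rewrite ler_norml; apply/andP; split; lra.
Qed.

Lemma rcirc_tent t n : 0 <= t -> rcirc (tent t n).
Proof.
move=> t0; apply: (@rcirc_lipschitz _ n.+1%:R) => z w; apply: le_trans (max0_lip _ _) _.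
have -> : 1 - n.+1%:R * darc t z - (1 - n.+1%:R * darc t w) = - (n.+1%:R * (darc t z - darc t w)) by ring.
by rewrite normrN normrM ger0_norm// ler_wpM2l// darc_lip.
Qed.
Lemma ler_max0 (x y : R) : x <= y -> Num.max 0 x <= Num.max 0 y.
Proof. by move=> xy; rewrite ge_max !le_max lexx /= xy orbT. Qed.

Lemma tent_mono s t n z : 0 <= s -> s <= t -> tent s n z <= tent t n z.
Proof.
move=> s0 st; apply: ler_max0; rewrite lerD2l lerN2 ler_wpM2l//; exact: darc_mono.
Qed.

Lemma tent_anti t n k z : 0 <= t -> (n <= k)%N -> tent t k z <= tent t n z.
Proof.
move=> t0 nk; apply: ler_max0; rewrite lerD2l lerN2 ler_wpM2r ?darc_ge0//.
by rewrite ler_nat.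
Qed.

Lemma tent_step s t n z : 0 <= s -> s <= t ->
  tent t n z <= tent s n z + n.+1%:R * (4 * pi * (t - s)).
Proof.
move=> s0 st; have p0 : 0 <= n.+1%:R * (4 * pi * (t - s)) :> R.
  by rewrite !mulr_ge0 ?pi_ge0// subr_ge0.
rewrite {1}/tent ge_max; apply/andP; split.
  by rewrite addr_ge0//; case/andP: (tent_01 n z s0).
apply: (@le_trans _ _ ((1 - n.+1%:R * darc s z) + n.+1%:R * (4 * pi * (t - s)))).
  by have := ler_wpM2l (ler0n R n.+1) (darc_step z s0 st); lra.
by rewrite lerD2r le_max lexx orbT.
Qed.
Lemma tent_on_arc t n z : 0 <= t -> arc t z -> tent t n z = 1.
Proof. by move=> t0 az; rewrite /tent darc0// mulr0 subr0 maxElt ltr01. Qed.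

Lemma tent_gt0 t n z : 0 <= t -> 0 < tent t n z -> darc t z < n.+1%:R^-1.
Proof.
move=> t0; rewrite /tent lt_max ltxx /= subr_gt0 => h.
by rewrite -(ltr_pM2l (_ : 0 < n.+1%:R)) ?ltr0n// divff// pnatr_eq0.
Qed.

(** If lengthening the arc raises the tent at [z], then a point of the added piece between [s] and
    [t] is close to [z]. *)
Lemma tent_jump s t n z : 0 <= s -> s <= t -> tent s n z < tent t n z ->
  dC z (ec t) <= n.+1%:R^-1 + 4 * pi * (t - s).
Proof.
move=> s0 st h; have t0 := le_trans s0 st.
have p0 : 0 <= 4 * pi :> R by rewrite mulr_ge0// pi_ge0.
have tp : 0 < tent t n z by apply: le_lt_trans h; case/andP: (tent_01 n z s0).
have d1 := tent_gt0 t0 tp.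
have d2 : darc t z < darc s z.
  by rewrite ltNge; apply/negP => d; move: h; rewrite ltNge => /negP[]; apply: ler_max0;
    rewrite lerD2l lerN2 ler_wpM2l.
have [|w [x /= /andP[x0 xt] <-] hw] := @darc_lt t z (Num.min (n.+1%:R^-1) (darc s z)) t0.
  by rewrite lt_min d1.
move: hw; rewrite lt_min => /andP[w1 w2].
have sx : s < x.
  rewrite ltNge; apply/negP => xs; move: w2; rewrite ltNge => /negP[]; apply: darc_le.
  by exists x => //=; rewrite x0.
apply: le_trans (dC_triangle z (ec x) (ec t)) _; apply: lerD; first exact: ltW.
apply: le_trans (dC_ec _ _) _; rewrite ler_wpM2l// ler0_norm; lra.
Qed.

Section functional.
Variable L : (C -> R) -> R.
Hypothesis Llin : forall (a : R) v v', rcirc v -> rcirc v' -> L (fun z => a * v z + v' z) = a * L v + L v'.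
Hypothesis Lpos : forall v, rcirc v -> (forall z, circle z -> 0 <= v z) -> 0 <= L v.

Lemma L_zero : L (fun=> 0) = 0.
Proof.
have := Llin (-1) (rcirc_cst 0) (rcirc_cst 0).
have -> : (fun=> -1 * 0 + 0) = (fun=> 0) :> (C -> R) by apply/funext => z; rewrite mulr0 addr0.
by move=> h; lra.
Qed.

Lemma L_le v v' : rcirc v -> rcirc v' -> (forall z, circle z -> v z <= v' z) -> L v <= L v'.
Proof.
move=> rv rv' h; have := Lpos (rcirc_lin (-1) rv rv'); rewrite Llin// mulN1r => p.
by rewrite -subr_ge0 addrC; apply: p => z cz; rewrite mulN1r addrC subr_ge0 h.
Qed.

Lemma L_cst (c : R) : L (fun=> c) = c * L (fun=> 1).
Proof.
have h := Llin c (rcirc_cst 1) (rcirc_cst 0); rewrite L_zero [RHS]addr0 in h; rewrite -h.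
by congr L; apply/funext => z; rewrite mulr1 addr0.
Qed.

Lemma L_sum (n : nat) (F : nat -> C -> R) : (forall i, rcirc (F i)) ->
  rcirc (fun z => \sum_(i < n) F i z) /\ L (fun z => \sum_(i < n) F i z) = \sum_(i < n) L (F i).
Proof.
move=> rF; elim: n => [|n [IH1 IH2]].
  have -> : (fun z => \sum_(i < 0) F i z) = (fun=> 0) by apply/funext => z; rewrite big_ord0.
  rewrite big_ord0.
  by split; [exact: rcirc_cst|exact: L_zero].
have e : (fun z => \sum_(i < n.+1) F i z) = fun z => 1 * (\sum_(i < n) F i z) + F n z.
  by apply/funext => z; rewrite big_ord_recr mul1r.
by rewrite e; split; [exact: rcirc_lin|rewrite Llin// IH2 mul1r big_ord_recr].
Qed.

Lemma L_dist v v' (e : R) : rcirc v -> rcirc v' -> (forall z, circle z -> `|v z - v' z| <= e) ->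
  `|L v - L v'| <= e * L (fun=> 1).
Proof.
move=> rv rv' h.
have rc := rcirc_lin 1 rv' (rcirc_cst e); have rc' := rcirc_lin 1 rv' (rcirc_cst (- e)).
have h1 : L v <= L v' + e * L (fun=> 1).
  have := @L_le v _ rv rc; rewrite Llin//; last exact: rcirc_cst.
  rewrite L_cst mul1r; apply => z /h; rewrite ler_norml mul1r; lra.
have h2 : L v' - e * L (fun=> 1) <= L v.
  have := @L_le _ v rc' rv; rewrite Llin//; last exact: rcirc_cst.
  rewrite L_cst mul1r mulNr; apply => z /h; rewrite ler_norml mul1r; lra.
by rewrite ler_norml; lra.
Qed.

(** The mass that the future measure gives to the closed arc from angle 0 to [t]. A possible atom at
    the point 1 is counted at angle 0, and angles from 1 on see the whole circle. *)
Definition cdf t : R := if t < 0 then 0 else if 1 <= t then L (fun=> 1)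
  else inf (range (fun n => L (tent t n))).

Let tent_lb t : 0 <= t -> lbound (range (fun n => L (tent t n))) 0.
Proof.
move=> t0 _ [n _ <-]; apply: Lpos; first exact: rcirc_tent.
by move=> z _; case/andP: (tent_01 n z t0).
Qed.

Lemma cdf_le_tent t n : 0 <= t -> cdf t <= L (tent t n).
Proof.
move=> t0; rewrite /cdf ltNge t0 /=; case: ifP => [t1|_].
  apply: L_le; [exact: rcirc_cst|exact: rcirc_tent|].
  move=> z cz; rewrite tent_on_arc//; have [s /= /andP[s0 s1] <-] := arc1 cz.
  by exists s => //=; rewrite s0 (le_trans s1).
by apply: ge_inf; [exists 0; exact: tent_lb|exists n].
Qed.

Lemma cdf_tent t (e : R) : 0 <= t -> 0 < e -> exists N, forall n, (N <= n)%N -> L (tent t n) <= cdf t + e.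
Proof.
move=> t0 e0.
have an n k : (n <= k)%N -> L (tent t k) <= L (tent t n).
  by move=> nk; apply: L_le; [exact: rcirc_tent|exact: rcirc_tent|move=> z _; exact: tent_anti].
rewrite /cdf ltNge t0 /=; case: ifP => [t1|_].
  exists 0%N => n _; apply: (@le_trans _ _ (L (fun=> 1))); last by rewrite lerDl ltW.
  apply: L_le; [exact: rcirc_tent|exact: rcirc_cst|].
  by move=> z _; case/andP: (tent_01 n z t0).
have /inf_lt[] : inf (range (fun n => L (tent t n))) < inf (range (fun n => L (tent t n))) + e.
- by rewrite ltrDl.
- by exists (L (tent t 0)), 0%N.
move=> _ [N _ <-] hN.
by exists N => n Nn; apply: le_trans (an _ _ Nn) _; exact: ltW.
Qed.

Lemma cdf_ge0 t : 0 <= cdf t.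
Proof.
rewrite /cdf; case: ifP => // /negbT; rewrite -leNgt => t0; case: ifP => _.
  by apply: Lpos => //; exact: rcirc_cst.
by apply: lb_le_inf; [exists (L (tent t 0)), 0%N|exact: tent_lb].
Qed.

Lemma cdf_nd : {homo cdf : s t / s <= t}.
Proof.
move=> s t st; have [s0|s0] := ltP s 0; first by rewrite {1}/cdf s0 cdf_ge0.
have t0 := le_trans s0 st.
have [t1|t1] := leP 1 t.
  rewrite [leRHS]/cdf ltNge t0 /= t1; apply: le_trans (cdf_le_tent 0 s0) _.
  apply: L_le; [exact: rcirc_tent|exact: rcirc_cst|].
  by move=> z _; case/andP: (tent_01 0 z s0).
rewrite [leRHS]/cdf ltNge t0 /= (leNgt 1 t) t1 /=.
apply: lb_le_inf; first by exists (L (tent t 0)), 0%N.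
move=> _ [n _ <-]; apply: le_trans (cdf_le_tent n s0) _.
by apply: L_le; [exact: rcirc_tent|exact: rcirc_tent|move=> z _; exact: tent_mono].
Qed.

(** For one fixed tent index, lengthening the arc from [t] to [s] changes the tent by at most a
    multiple of [s - t], while a large index makes the tent at [t] as good as [cdf t]. *)
Lemma cdf_rc : right_continuous cdf.
Proof.
move=> t; have L1 : 0 <= L (fun=> 1) by apply: Lpos => //; exact: rcirc_cst.
have [t0|t0] := ltP t 0.
  apply: cvg_near_cst; near=> s; rewrite /cdf t0; have -> // : s < 0.
  by near: s; exact: nbhs_right_lt.
have [t1|t1] := leP 1 t.
  apply: cvg_near_cst; near=> s; have ts : t < s by near: s; exact: nbhs_right_gt.
  by rewrite /cdf !ltNge t0 t1 /= (le_trans t0 (ltW ts)) /= (le_trans t1 (ltW ts)).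
apply/cvgrPdist_le => e e0; have e2 : 0 < e / 2 by rewrite divr_gt0.
have [n /(_ n (leqnn n)) hn] := cdf_tent t0 e2.
pose c := n.+1%:R * (4 * pi) * L (fun=> 1) + 1.
have c0 : 0 < c by rewrite /c ltr_wpDl// !mulr_ge0// pi_ge0.
near=> s; have ts : t < s by near: s; exact: nbhs_right_gt.
have sd : s < t + e / 2 / c by near: s; apply: nbhs_right_lt; rewrite ltrDl divr_gt0.
have s0 := le_trans t0 (ltW ts).
have h1 := cdf_nd (ltW ts).
have h2 : cdf s <= L (tent t n) + n.+1%:R * (4 * pi * (s - t)) * L (fun=> 1).
  apply: le_trans (cdf_le_tent n s0) _.
  have rt := rcirc_tent n t0; have rc := rcirc_cst (n.+1%:R * (4 * pi * (s - t))).
  have := L_le (rcirc_tent n s0) (rcirc_lin 1 rt rc); rewrite Llin// mul1r L_cst; apply.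
  by move=> z _; rewrite mul1r; apply: tent_step => //; exact: ltW.
have h3 : n.+1%:R * (4 * pi * (s - t)) * L (fun=> 1) <= e / 2.
  have : (s - t) * c <= e / 2 by rewrite -ler_pdivlMr//; lra.
  apply: le_trans; have -> : (s - t) * c = (s - t) * (n.+1%:R * (4 * pi) * L (fun=> 1)) + (s - t).
    by rewrite /c; ring.
  have -> : n.+1%:R * (4 * pi * (s - t)) * L (fun=> 1) = (s - t) * (n.+1%:R * (4 * pi) * L (fun=> 1)) by ring.
  by rewrite lerDl subr_ge0 ltW.
rewrite ler0_norm; lra.
Unshelve. all: by end_near. Qed.

HB.instance Definition _ := isCumulative.Build R _ R cdf cdf_nd cdf_rc.

Lemma cdf_itv (a b : R) : a <= b ->
  lebesgue_stieltjes_measure (cdf : cumulative R R) `]a, b]%classic = (cdf b - cdf a)%:E.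
Proof.
move=> ab; rewrite /lebesgue_stieltjes_measure /measure_extension measurable_mu_extE/=; last exact: is_ocitv.
by rewrite wlength_itv_bnd.
Qed.

Lemma cdf_measure : exists lam : {finite_measure set (measurableTypeR R) -> \bar R},
  lam setT = (cdf 1)%:E /\ forall t, 0 <= t <= 1 -> lam `]-oo, t]%classic = (cdf t)%:E.
Proof.
pose lsm : {measure set (measurableTypeR R) -> \bar R} :=
  lebesgue_stieltjes_measure (cdf : cumulative R R).
have lsm_itv (a b : R) : a <= b -> lsm `]a, b]%classic = (cdf b - cdf a)%:E := @cdf_itv a b.
have c1 : cdf (-1) = 0 by rewrite /cdf ltrN10.
have mD : measurable (`]-1, 1]%classic : set (measurableTypeR R)) by exact: measurable_itv.
have [|lam hlam] := @restricted_measure R _ _ lsm _ mD.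
  by rewrite lsm_itv ?ltry//; lra.
exists lam; split.
  by rewrite hlam// setTI lsm_itv ?c1 ?subr0//; lra.
move=> t /andP[t0 t1]; rewrite hlam; last exact: measurable_itv.
have -> : `]-oo, t]%classic `&` `]-1, 1]%classic = `]-1, t]%classic.
  apply/seteqP; split=> x /=; rewrite !in_itv /=; first by move=> [-> /andP[-> _]].
  by move=> /andP[-> xt]; rewrite xt (le_trans xt).
by rewrite lsm_itv ?c1 ?subr0//; lra.
Qed.

(** Both sides are compared with the Stieltjes sum [I0]. On the side of [L] the weights are
    differences of tents, on the side of the measure they are differences of indicators of
    half-lines; both evaluate to differences of [cdf], up to a small error for the tents. *)
Lemma riesz_circle : exists nu : {finite_measure set (borel C^o) -> \bar R},
  nu (~` (@circle R)) = 0%E /\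
  forall v, rcirc v -> \int[nu]_(z in (@circle R : set (borel C^o))) v z = L v.
Proof.
have [lam [lamT lamt]] := cdf_measure.
(* Clamping the parameter lets the pointwise estimates below hold for every real [t], not only on
   [[0, 1]]. *)
pose cl (t : R) := Num.min (Num.max t 0) 1.
have cl01 t : 0 <= cl t <= 1 by rewrite /cl le_min le_max lexx orbT ler01 /= ge_min lexx orbT.
have mcl : measurable_fun setT (cl : measurableTypeR R -> R).
  apply: (@measurable_minr _ _ _ setT (fun t => Num.max t 0) (fun=> 1)); last exact: measurable_cst.
  by apply: (@measurable_maxr _ _ _ setT id (fun=> 0)); [exact: measurable_id|exact: measurable_cst].
have mec := measurable_ec mcl.
have [nu [nuE nuint]] := image_measure lam mec.
exists nu; split.
  rewrite nuE; last by apply: measurableC; exact: (@meas_circle R).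
  rewrite (_ : _ @^-1` _ = set0) ?measure0//.
  by apply/seteqP; split=> // t /=; apply; exact: circle_ec.
move=> v rv; have [K K0 hK] := rcirc_bounded rv.
have mv := ucirc_meas_re rv.
have pc : (fun t => ec (cl t) : borel C^o) @^-1` (@circle R : set (borel C^o)) = setT.
  by apply/seteqP; split=> // t _; exact: circle_ec.
have bv : bmeas (@circle R : set (borel C^o)) v by split=> //; exists K.
have mvc : measurable_fun setT (fun t : measurableTypeR R => v (ec (cl t))).
  apply: (@measurable_comp _ _ _ _ _ _ (@circle R : set (borel C^o)) v setT (fun t : measurableTypeR R => ec (cl t) : borel C^o)) => //.
  - exact: meas_circle.
  - by move=> _ [t _ <-]; exact: circle_ec.
rewrite (nuint _ _ (@meas_circle R) bv mvc pc).
have bvc : bmeas setT (fun t : measurableTypeR R => v (ec (cl t))).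
  by split=> //; exists K => t _; apply: hK; exact: circle_ec.
have L1 : 0 <= L (fun=> 1) by apply: Lpos => //; exact: rcirc_cst.
have c1 : cdf 1 = L (fun=> 1) by rewrite /cdf ltNge ler01 lexx.
apply/eqP; rewrite -subr_eq0 -normr_le0.
apply: (@eps_le _ _ _ (2 * L (fun=> 1) + 1)); first by lra.
move=> eta eta0; rewrite add0r.
have [d d0 hd] := (rcircP v).1 rv eta eta0.
have p0 := pi_gt0 R.
have [M] := inv_nat_small (divr_gt0 (divr_gt0 d0 (ltr0n _ 2)) (mulr_gt0 (ltr0n _ 4) p0)).
rewrite ltr_pdivlMr ?mulr_gt0// mulrC => /ltW stepM; have M0 : 0 < M.+1%:R :> R by rewrite ltr0n.
pose tt (i : nat) : R := i%:R / M.+1%:R.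
have tt0 i : 0 <= tt i by rewrite divr_ge0.
have ttS i : tt i.+1 - tt i = M.+1%:R^-1 by rewrite /tt -natr1 mulrDl mul1r addrC addKr.
have ttM : tt M.+1 = 1 by rewrite /tt divff// gt_eqF.
have tt_le i : (i <= M.+1)%N -> tt i <= 1 by move=> iM; rewrite ler_pdivrMr// mul1r ler_nat.
(* The error [2 K e'] of replacing tents by [cdf] occurs in each of the [M.+2] summands. *)
have e'0 : 0 < eta / (2 * K * M.+2%:R + 1).
  by rewrite divr_gt0// ltr_wpDl// !mulr_ge0.
have e'E : eta / (2 * K * M.+2%:R + 1) * (2 * K * M.+2%:R + 1) = eta.
  by rewrite divfK// gt_eqF// ltr_wpDl// !mulr_ge0.
move: e'0 e'E; set e' := eta / (2 * K * M.+2%:R + 1) => e'0 e'E.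
have /choice[N hN] i : exists N, forall n, (N <= n)%N -> L (tent (tt i) n) <= cdf (tt i) + e'.
  exact: cdf_tent (tt0 i) e'0.
have [n0 hn0] := inv_nat_small (divr_gt0 d0 (ltr0n _ 2)).
(* The sum of all [N i] bounds each of them, and [n0] makes the tents narrow. *)
pose n := (n0 + \sum_(i < M.+2) N i)%N.
have nd : n.+1%:R^-1 <= d / 2.
  by apply: le_trans (ltW hn0); rewrite lef_pV2 ?posrE// ler_nat ltnS leq_addr.
have nN (i : 'I_M.+2) : (N i <= n)%N by rewrite /n (bigD1 i)//= addnCA leq_addr.
(* Starting from 0 makes the first increment the whole tent at angle 0, which accounts for an atom
   at the point 1. *)
pose W z (i : nat) : R := if i is j.+1 then tent (tt j) n z else 0.
have far i z : circle z -> (i <= M.+1)%N -> W z i < W z i.+1 -> dC z (ec (tt i)) <= d.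
  move=> cz iM; case: i iM => [|i] iM /=.
    have tt00 : tt 0%N = 0 by rewrite /tt mul0r.
    move=> /(tent_gt0 (tt0 0%N)) /(darc_lt (tt0 0%N))[w [x /= /andP[x0]]].
    rewrite tt00 => xle <-; have -> : x = 0 by apply/eqP; rewrite eq_le xle.
    by move=> /ltW/le_trans; apply; apply: le_trans nd _; lra.
  have le : tt i <= tt i.+1 by rewrite -subr_ge0 ttS invr_ge0.
  by move=> /(tent_jump (tt0 i) le); rewrite ttS => /le_trans; apply; rewrite [leRHS](splitr d) lerD.
pose S z : R := \sum_(i < M.+2) v (ec (tt i)) * (W z i.+1 - W z i).
have vS z : circle z -> `|v z - S z| <= eta.
  move=> cz; apply: (@telescope_close R M.+1 (W z) (fun i => v (ec (tt i)))) => //.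
  - exact: ltW.
  - case=> [|i] /=; first by case/andP: (tent_01 n z (tt0 0%N)).
    by apply: tent_mono => //; rewrite -subr_ge0 ttS invr_ge0.
  - by rewrite /= ttM tent_on_arc//; exact: arc1.
  - by move=> i iM h; apply: hd => //; [exact: circle_ec|exact: far].
have rW i : rcirc (W^~ i).
  by case: i => [|i]; [exact: rcirc_cst|exact: rcirc_tent].
pose G (i : nat) : R := if i is j.+1 then cdf (tt j) else 0.
have LW i : (i <= M.+2)%N -> `|L (W^~ i) - G i| <= e'.
  case: i => [|i] iM /=; first by rewrite L_zero subrr normr0 ltW.
  have h1 := cdf_le_tent n (tt0 i); have h2 := hN i n (nN (Ordinal iM)).
  by rewrite ger0_norm ?subr_ge0//; lra.
have rterm i : rcirc (fun z => v (ec (tt i)) * (W z i.+1 - W z i)) /\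
   L (fun z => v (ec (tt i)) * (W z i.+1 - W z i)) = v (ec (tt i)) * (L (W^~ i.+1) - L (W^~ i)).
  have rd := rcirc_lin (-1) (rW i) (rW i.+1).
  have e : (fun z => v (ec (tt i)) * (W z i.+1 - W z i)) =
    fun z => v (ec (tt i)) * (-1 * W z i + W z i.+1) + 0.
    by apply/funext => z; rewrite addr0 mulN1r [X in _ * X = _]addrC.
  rewrite e; split; first by apply: rcirc_lin => //; exact: rcirc_cst.
  rewrite Llin//; last exact: rcirc_cst.
  by rewrite Llin// L_zero addr0 mulN1r [X in _ * X = _]addrC.
have [rS LS] := @L_sum M.+2 _ (fun i => (rterm i).1).
have d1 : `|L v - L S| <= eta * L (fun=> 1) by apply: L_dist.
pose I0 : R := \sum_(i < M.+2) v (ec (tt i)) * (G i.+1 - G i).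
have d2 : `|L S - I0| <= eta.
  rewrite LS /I0 -sumrB; apply: le_trans (ler_norm_sum _ _ _) _.
  apply: (@le_trans _ _ (\sum_(i < M.+2) (2 * K * (e')))).
    apply: ler_sum => i _; rewrite (rterm i).2 -mulrBr normrM.
    have -> : 2 * K * e' = K * (2 * e') by ring.
    apply: ler_pM => //; first by apply: hK; exact: circle_ec.
    have -> : L (W^~ i.+1) - L (W^~ i) - (G i.+1 - G i) = (L (W^~ i.+1) - G i.+1) - (L (W^~ i) - G i) by ring.
    apply: le_trans (ler_normB _ _) _.
    by have := LW i.+1 (ltn_ord i); have := LW i (ltnW (ltn_ord i)); lra.
  by rewrite sumr_const card_ord -[X in X <= _]mulr_natr -e'E; have := ltW e'0; lra.
pose H (i : nat) : set (measurableTypeR R) := if i is j.+1 then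
  (if (j <= M)%N then `]-oo, tt j]%classic else setT) else set0.
have mH i : measurable (H i).
  by case: i => [|i] /=; [exact: measurable0|case: ifP => _ //; exact: measurable_itv].
have bH i : bmeas setT (\1_(H i) : measurableTypeR R -> R).
  exact: bmeas_indic.
have intH i : (i <= M.+2)%N -> \int[lam]_x (\1_(H i) x : R) = G i.
  move=> iM; rewrite /Rintegral integral_indic// setIT; case: i iM => [|i] iM /=; first by rewrite measure0.
  case: ifP => iM'; first by rewrite lamt// tt0 tt_le// ltnW.
  have -> : i = M.+1 by apply/eqP; rewrite eqn_leq -ltnS iM ltnNge iM'.
  by rewrite lamT ttM.
have Hsub i x : H i x -> H i.+1 x.
  case: i => [|i] //=; have [iM|iM] := leqP i.+1 M; last by [].
  by rewrite (ltnW iM) /= !in_itv /= => /le_trans; apply; rewrite -subr_ge0 ttS invr_ge0.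
pose V t (i : nat) : R := \1_(H i) t.
pose St t : R := \sum_(i < M.+2) v (ec (tt i)) * (V t i.+1 - V t i).
have vSt t : `|v (ec (cl t)) - St t| <= eta.
  apply: (@telescope_close R M.+1 (V t) (fun i => v (ec (tt i)))) => //.
  - exact: ltW.
  - move=> i; rewrite /V !indicE; case: (boolP (t \in H i)) => // /set_mem /Hsub/mem_set -> //.
  - by rewrite /V indic0.
  - by rewrite /V /= ltnn indicT.
  move=> i iM jump; apply: hd; [exact: circle_ec|exact: circle_ec|].
  have {jump} [Hi nHi] : H i.+1 t /\ ~ H i t.
    move: jump; rewrite /V !indicE; case: (boolP (t \in H i.+1)) => [/set_mem h1|_]; last first.
      by rewrite ltNge ler0n.
    by case: (boolP (t \in H i)) => [_|/negP h2 _]; [rewrite ltxx|split=> // h; apply: h2; exact: mem_set].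
  have close : `|cl t - tt i| <= M.+1%:R^-1.
    have /andP[c0 c1'] := cl01 t.
    case: i iM Hi nHi => [|i] iM.
      rewrite /= in_itv /= /tt mul0r => t0 _.
      by rewrite /cl (max_idPr t0) (min_idPl ler01) subr0 normr0 invr_ge0.
    rewrite /= (_ : (i <= M)%N) //= => Hi; rewrite in_itv /= => /negP; rewrite -ltNge => ti.
    have ti1 : tt i <= 1 by apply: tt_le; exact: leqW.
    have lo : tt i <= cl t by rewrite /cl le_min ti1 andbT le_max ltW.
    have hi : cl t <= tt i.+1.
      move: Hi; have [iM1|iM1] := leqP i.+1 M.
        by rewrite /= in_itv /= => tS; rewrite /cl ge_min; apply/orP; left; rewrite ge_max tS tt0.
      move=> _; have -> : i.+1 = M.+1 by apply/eqP; rewrite eqn_leq iM.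
      by rewrite ttM.
    by rewrite ler0_norm ?subr_le0// opprB -(ttS i); lra.
  apply: le_trans (dC_ec _ _) _; apply: (@le_trans _ _ (4 * pi * M.+1%:R^-1)).
    by rewrite ler_wpM2l// mulr_ge0// ltW.
  by apply: le_trans stepM _; lra.
have bV i : bmeas setT (fun t : measurableTypeR R => v (ec (tt i)) * (V t i.+1 - V t i)) by apply: bmeasZ; apply: bmeasB; exact: bH.
have d3 : `|\int[lam]_t v (ec (cl t)) - \int[lam]_t St t| <= eta * L (fun=> 1).
  rewrite -c1 (_ : cdf 1 = fine (lam setT)); last by rewrite lamT.
  apply: fint_dist => //; exact: (bmeas_sum (index_enum 'I_M.+2) (fun i => bV i)).
have e3 : \int[lam]_t St t = I0.
  rewrite /St fint_sum//; apply: eq_bigr => i _.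
  have bd : bmeas setT (fun x : measurableTypeR R => V x i.+1 - V x i) by apply: bmeasB; exact: bH.
  by rewrite fintZ// (fintB lam measurableT (bH i.+1) (bH i)) !intH// ltnW.
rewrite e3 in d3.
have -> : \int[lam]_x v (ec (cl x)) - L v =
  (\int[lam]_x v (ec (cl x)) - I0) - (L S - I0) - (L v - L S) by ring.
apply: le_trans (ler_normB _ _) _; apply: le_trans (lerD (ler_normB _ _) (lexx _)) _.
move: d1 d2 d3; lra.
Qed.

End functional.
End riesz.

(** * Existence of spectral measures on the circle *)

Section spectral_measures.
Context (R : realType) (X : pmetricType R) (phi : tds X) (mu : probability (borel X) R).
Hypothesis inv : invariant_measure phi mu.
Local Notation C := (R[i]).
Local Notation L2 := (L2 mu).
Local Notation inner := (L2inner mu).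
Local Notation fcT := (fcT phi mu).
Local Notation S1 := (@circle R : set (borel C^o)).
Local Notation finmeas := {finite_measure set (borel C^o) -> \bar R}.
Implicit Types (g h u : X -> C) (a z w : C) (f : C -> C) (v : C -> R) (nu : finmeas).

Let TP f g : ucirc f -> L2 g -> fcalc phi mu f g (fcT f g). Proof. exact: fcTP. Qed.
Let TL f g : ucirc f -> L2 g -> L2 (fcT f g). Proof. exact: fcT_L2. Qed.

Lemma fcT_mul f f' g : ucirc f -> ucirc f' -> L2 g ->
  eqL2 mu (fcT f' (fcT f g)) (fcT (fun z => f' z * f z) g).
Proof.
move=> uf uf' Lg; have um := ucircM uf' uf.
apply: (fcalc_uniq inv um Lg _ (TP um Lg)).
have := TP uf' (TL uf Lg); have := TP uf Lg; refine (fcalc_mul inv Lg uf uf').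
Qed.

Lemma inner_aeL g g' h : L2 g -> L2 g' -> L2 h -> eqL2 mu g g' -> inner g h = inner g' h.
Proof.
move=> Lg Lg' Lh e; have r := eqL2_refl mu h; exact: inner_ae (L2_meas Lg) (L2_meas Lg') (L2_meas Lh) (L2_meas Lh) e r.
Qed.

(** The adjoint of [h(U)] is the conjugate function of [U], so passing from [g] to [h(U) g]
    multiplies the integrand by [|h|^2]. *)
Lemma fcT_inner_mul f (h : C -> C) g : ucirc f -> ucirc h -> L2 g ->
  inner (fcT f (fcT h g)) (fcT h g) = inner (fcT (fun z => f z * (csqnorm (h z))%:C%C) g) g.
Proof.
move=> uf uh Lg; have Lh := TL uh Lg; have Lfh := TL uf Lh.
have uJ := ucirc_conj uh; have Lk := TL uJ Lfh.
have um := ucircM uJ (ucircM uf uh).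
have uM : ucirc (fun z => f z * (csqnorm (h z))%:C%C).
  by apply: ucirc_ext um => z _; rewrite -mulJ_csq; ring.
rewrite (innerJ Lh Lfh) (fcalc_adj inv Lg Lfh uh (TP uh Lg) (TP uJ Lfh)) -(innerJ Lg Lk).
apply: inner_aeL => //; first exact: TL.
apply: (fcalc_uniq inv uM Lg _ (TP uM Lg)).
have := fcalc_mul inv Lg (ucircM uf uh) uJ _ (TP uJ Lfh).
move=> /(_ (fcalc_mul inv Lg uh uf (TP uh Lg) (TP uf Lh))).
by apply: fcalc_eq => z _; rewrite -mulJ_csq; ring.
Qed.

Lemma fcT_cst_inner a g : L2 g -> inner (fcT (fun=> a) g) g = a * (L2N mu g)%:C%C.
Proof.
move=> Lg; have ua := ucirc_cst a; rewrite -inner_sqr -innerZl//.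
apply: inner_aeL => //; [exact: TL|exact: L2Z|].
refine (fcalc_uniq inv ua Lg _ (fcalc_cst inv a Lg)); exact: TP.
Qed.

Lemma fcT_lin a f f' g : ucirc f -> ucirc f' -> L2 g ->
  inner (fcT (fun z => a * f z + f' z) g) g = a * inner (fcT f g) g + inner (fcT f' g) g.
Proof.
move=> uf uf' Lg; have ul : ucirc (fun z => a * f z + f' z).
  by apply: ucircD => //; apply: ucircM => //; exact: ucirc_cst.
have L1 := TL uf Lg; have L2' := TL uf' Lg.
rewrite -innerZl// -innerDl//; last exact: L2Z.
apply: inner_aeL => //; [exact: TL|by apply: L2D => //; exact: L2Z|].
exact: (fcalc_uniq inv ul Lg (TP ul Lg) (fcalc_lin inv a Lg uf uf' (TP uf Lg) (TP uf' Lg))).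
Qed.

Lemma fcT_sqr f g : ucirc f -> L2 g ->
  inner (fcT (fun z => (csqnorm (f z))%:C%C) g) g = (L2N mu (fcT f g))%:C%C.
Proof.
move=> uf Lg; have Lf := TL uf Lg.
have := fcT_inner_mul (ucirc_cst 1) uf Lg; rewrite fcT_cst_inner// mul1r => ->.
by congr (inner (fcT _ g) g); apply/funext => z; rewrite mul1r.
Qed.

Lemma rcirc_sqrt v : rcirc v -> (forall z, circle z -> 0 <= v z) -> rcirc (fun z => Num.sqrt (v z)).
Proof.
move=> /rcircP rv v0; apply/rcircP => e e0.
have [d d0 hd] := rv (e ^+ 2) (exprn_gt0 _ e0); exists d => // z w cz cw zw.
have := hd z w cz cw zw; have := v0 z cz; have := v0 w cw.
move: (v z) (v w) => a b b0 a0 ab.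
have [a0' b0'] := (sqrtr_ge0 a, sqrtr_ge0 b).
rewrite -(@ler_pXn2r _ 2) ?nnegrE ?(ltW e0)//; apply: le_trans ab.
have -> : a - b = Num.sqrt a ^+ 2 - Num.sqrt b ^+ 2 by rewrite !sqr_sqrtr.
rewrite subr_sqr normrM expr2 ler_wpM2l//.
by rewrite ler_norml; move: (ler_norm (Num.sqrt a + Num.sqrt b)); lra.
Qed.

(** The spectral measure relative to the circle instead of the spectrum; both notions agree once the
    spectrum is the circle ([spectral_measureP]). *)
Definition smeas g nu := nu (~` S1) = 0%E /\
  forall f, ucirc f -> inner (fcT f g) g = cintegral nu S1 f.

Lemma rcirc_re f : ucirc f -> rcirc (fun z => re (f z)).
Proof.
move=> uf; apply/rcircP => e e0; have [d d0 hd] := uf (e ^+ 2) (exprn_gt0 _ e0).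
exists (Num.sqrt d); first by rewrite sqrtr_gt0.
move=> z w cz cw; rewrite /dC ler_sqrt ?(ltW d0)// => zw.
have := hd z w cz cw zw; rewrite /csqnorm reB => h.
rewrite -(@ler_pXn2r _ 2) ?nnegrE ?(ltW e0)// real_normK ?num_real//.
by apply: le_trans h; rewrite lerDl sqr_ge0.
Qed.

(** The functional sending [v] to the inner product of [v(U) g] and [g] is positive: a nonnegative
    [v] is the square of its root, so the value is a squared norm. Real functions have real values
    by [fcalc_adj], and complex ones are split into two parts. *)
Lemma smeas_exists g : L2 g -> exists nu, smeas g nu.
Proof.
move=> Lg; pose L v := re (inner (fcT (fun z => (v z)%:C%C) g) g).
have Llin (a : R) v v' : rcirc v -> rcirc v' -> L (fun z => a * v z + v' z) = a * L v + L v'.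
  move=> rv rv'; rewrite /L; have := fcT_lin a%:C%C rv rv' Lg.
  have -> : (fun z => a%:C%C * (v z)%:C%C + (v' z)%:C%C) = fun z => (a * v z + v' z)%:C%C.
    by apply/funext => z; rewrite (rmorphD (real_complex R)) (rmorphM (real_complex R)).
  by move=> ->; rewrite !reimE /=; ring.
have Lpos v : rcirc v -> (forall z, circle z -> 0 <= v z) -> 0 <= L v.
  move=> rv v0; have rs := rcirc_sqrt rv v0.
  have -> : L v = re (inner (fcT (fun z => (csqnorm (Num.sqrt (v z))%:C%C)%:C%C) g) g).
    rewrite /L; congr re; apply: inner_aeL => //; try apply: TL => //.
      by apply: ucirc_ext rv => z cz; rewrite /csqnorm /= expr0n addr0 sqr_sqrtr ?v0.
    have uv : ucirc (fun z => (csqnorm (Num.sqrt (v z))%:C%C)%:C%C).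
      by apply: ucirc_ext rv => z cz; rewrite /csqnorm /= expr0n addr0 sqr_sqrtr ?v0.
    apply: (fcalc_uniq inv uv Lg _ (TP uv Lg)); apply: fcalc_eq (TP rv Lg) => z cz.
    by rewrite /csqnorm /= expr0n addr0 sqr_sqrtr ?v0.
  by rewrite fcT_sqr// L2N_ge0.
have [nu [nu0 hnu]] := riesz_circle Llin Lpos; exists nu; split=> // f uf.
pose i : C := Complex 0 1.
have ur := rcirc_re uf.
have ui : rcirc (fun z => im (f z)).
  have uif : ucirc (fun z => (- i) * f z) by apply: ucircM => //; exact: ucirc_cst.
  apply: ucirc_ext (rcirc_re uif) => z _; congr (_%:C%C).
  by rewrite reM /=; ring.
have real v : rcirc v -> inner (fcT (fun z => (v z)%:C%C) g) g = (\int[nu]_(z in S1) v z)%:C%C.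
  move=> rv; rewrite hnu//; apply: cplxP => //.
  have Lv := TL rv Lg.
  have h : inner (fcT (fun z => (v z)%:C%C) g) g = inner g (fcT (fun z => (v z)%:C%C) g).
    apply: (fcalc_adj inv Lg Lg rv (TP rv Lg)); apply: fcalc_eq (TP rv Lg) => z _.
    by apply: cplxP; rewrite ?reJ ?imJ /= ?oppr0.
  have := congr1 (@complex.Im R) h; rewrite (innerJ Lv Lg) imJ => e.
  have -> : im (inner (fcT (fun z => (v z)%:C%C) g) g) = 0 by move: e; set c := im _; lra.
  by [].
have -> : f = fun z => i * (im (f z))%:C%C + (re (f z))%:C%C.
  by apply/funext => z; apply: cplxP; rewrite !reimE /=; ring.
rewrite fcT_lin// !real//; apply: cplxP; rewrite !reimE /=.
  have -> : (fun z => 0 * im (f z) - 1 * 0 + re (f z)) = fun z => re (f z) by apply/funext => z; ring.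
  by ring.
have -> : (fun z => 0 * 0 + 1 * im (f z) + 0) = fun z => im (f z) by apply/funext => z; ring.
by ring.
Qed.

End spectral_measures.

(** * Spectral types and eigenvectors *)

Section spectral_types.
Context (R : realType) (X : pmetricType R) (phi : tds X) (mu : probability (borel X) R).
Hypothesis inv : invariant_measure phi mu.
Local Notation C := (R[i]).
Local Notation L2 := (L2 mu).
Local Notation fcT := (fcT phi mu).
Local Notation smeas := (smeas phi mu).
Local Notation S1 := (@circle R : set (borel C^o)).
Local Notation finmeas := {finite_measure set (borel C^o) -> \bar R}.
Implicit Types (g u : X -> C) (a z w : C) (f h : C -> C) (v : C -> R) (nu : finmeas).

Let TP f g : ucirc f -> L2 g -> fcalc phi mu f g (fcT f g). Proof. exact: fcTP. Qed.
Let TL f g : ucirc f -> L2 g -> L2 (fcT f g). Proof. exact: fcT_L2. Qed.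

Lemma smeas_total nu g : L2 g -> smeas g nu -> L2N mu g = fine (nu S1).
Proof.
move=> Lg [_ /(_ _ (ucirc_cst 1))]; rewrite fcT_cst_inner// mul1r => /(congr1 (@complex.Re R)) /= ->.
by rewrite fint_cst ?mul1r//; exact: meas_circle.
Qed.

Lemma fcT_ae f g g' : ucirc f -> L2 g -> L2 g' -> eqL2 mu g g' -> eqL2 mu (fcT f g) (fcT f g').
Proof.
move=> uf Lg Lg' gg; have L1 := TL uf Lg; have Lt := TL uf Lg'.
refine (fcalc_uniq inv uf Lg' _ (TP uf Lg')).
exact: fcalc_ae Lg Lg' L1 gg (eqL2_refl _ _) (TP uf Lg).
Qed.

Lemma smeas_ae nu g g' : L2 g -> L2 g' -> eqL2 mu g g' -> smeas g nu -> smeas g' nu.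
Proof.
move=> Lg Lg' gg [n0 h]; split=> // f uf; rewrite -h//.
have L1 := TL uf Lg; have Lt := TL uf Lg'.
have e := fcT_ae uf Lg Lg' gg.
exact: inner_ae (L2_meas Lt) (L2_meas L1) (L2_meas Lg') (L2_meas Lg) (eqL2_sym e) (eqL2_sym gg).
Qed.

Lemma smeas_fcT nu g h : ucirc h -> L2 g -> smeas g nu -> exists rho : finmeas,
  smeas (fcT h g) rho /\ forall A, measurable A -> nu A = 0%E -> rho A = 0%E.
Proof.
move=> uh Lg [n0 hnu]; have mS := @meas_circle R.
have mr := ucirc_meas_re uh; have mi := ucirc_meas_im uh.
(* Extended by 0 off the circle, where nothing is known about [h]. *)
pose q : borel C^o -> R := (fun z => csqnorm (h z)) \_ S1.
have mq : measurable_fun setT q.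
  apply/(measurable_restrictT _ mS); apply: (@measurable_funD _ _ _ S1 (fun z => re (h z) ^+ 2)).
    exact: measurable_funX.
  exact: measurable_funX.
have q0 z : 0 <= q z by rewrite /q patchE; case: ifP; rewrite ?csq_ge0.
have [K K0 hK] := ucirc_bounded uh.
have qK z : q z <= K by rewrite /q patchE; case: ifP => // /set_mem /hK.
have [rho [rhoE rhoI]] := density_measure nu mq q0 qK.
have rho0 A : measurable A -> nu A = 0%E -> rho A = 0%E.
  move=> mA A0; rewrite rhoE//; apply: null_set_integral => //.
  by apply/measurable_EFinP; exact: measurable_funTS.
exists rho; split; last exact: rho0.
split=> [|f uf]; first by apply: rho0 => //; exact: measurableC.
rewrite fcT_inner_mul// hnu; last first.
  apply: ucircM => //; have := ucircM uh (ucirc_conj uh).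
  by apply: ucirc_ext => z _; rewrite mulJ_csq.
have [L L0 hL] := ucirc_bounded uf.
have dens (P : C -> R) : (forall z, `|P z| ^+ 2 <= csqnorm z) ->
    (forall (c : R) z, P (z * c%:C%C) = P z * c) ->
    measurable_fun S1 (fun z : borel C^o => P (f z)) ->
    \int[nu]_(z in S1) P (f z * (csqnorm (h z))%:C%C) = \int[rho]_(z in S1) P (f z).
  move=> P1 PM mP; rewrite Rintegral_mkcond [RHS]Rintegral_mkcond rhoI.
    by apply: eq_Rintegral => z _; rewrite /q !patchE; case: ifP => _; rewrite ?mul0r// PM.
  split; first exact/(measurable_restrictT _ mS).
  exists (Num.sqrt L) => z _; rewrite patchE; case: ifP => [/set_mem cz|]; last by rewrite normr0 sqrtr_ge0.
  apply: ler_sqr_le; first exact: sqrtr_ge0.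
  by rewrite sqr_sqrtr//; apply: le_trans (P1 _) (hL z cz).
rewrite /cintegral; congr Complex; apply: dens; try exact: ucirc_meas_re; try exact: ucirc_meas_im.
- by move=> z; rewrite real_normK ?num_real// lerDl sqr_ge0.
- by move=> c z; rewrite reM /=; ring.
- by move=> z; rewrite real_normK ?num_real// lerDr sqr_ge0.
- by move=> c z; rewrite imM /=; ring.
Qed.

Lemma meas_cpoint w : measurable ([set w] : set (borel C^o)).
Proof.
have -> : [set w] = (fun z : borel C^o => csqnorm (z - w)) @^-1` [set 0].
  apply/seteqP; split=> z /=; first by move=> ->; rewrite subrr csq0.
  by move=> /csq_eq0/eqP; rewrite subr_eq0 => /eqP.
rewrite -[X in measurable X]setTI; apply: (cont_borelR (u := fun z : C^o => csqnorm (z - w))) => //.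
move=> z; apply: (@continuous_comp _ _ _ (fun z : C^o => z - w) (fun z : C^o => csqnorm z)).
  by apply: continuousB => //; exact: cst_continuous.
apply: continuousD; apply: continuousM; (exact: continuous_re || exact: continuous_im).
Qed.

Definition eigenvec w g := L2 g /\ eqL2 mu (koopman phi g) (fun x => w * g x).

Lemma eigenvec_circle w g : eigenvec w g -> 0 < L2N mu g -> circle w.
Proof.
move=> [Lg e] g0; have := L2N_mpres (mpres_tds inv) Lg.
have -> : L2N mu (g \o phi) = csqnorm w * L2N mu g.
  by rewrite -L2NZ//; apply: L2N_ae e; [exact: L2_meas (koopman_L2 inv Lg)|exact: L2_meas (L2Z w Lg)].
by move=> /eqP; rewrite -subr_eq0 -[X in _ - X]mul1r -mulrBl mulf_eq0 (gt_eqF g0) orbF subr_eq0 => /eqP.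
Qed.

Lemma eigenvec_sub w a g : eigenvec w g -> eigenvec w (fun x => koopman phi g x - a * g x).
Proof.
move=> [Lg e]; have LU := koopman_L2 inv Lg; split; first by apply: L2B => //; exact: L2Z.
have e2 := eqL2_mpres (mpres_tds inv) e.
by apply: (aeS2 _ e e2) => x /=; rewrite /koopman /= => -> ->; ring.
Qed.

Lemma eigenvec_norm w a g : eigenvec w g ->
  L2N mu (fun x => koopman phi g x - a * g x) = csqnorm (w - a) * L2N mu g.
Proof.
move=> [Lg e]; rewrite -L2NZ//; apply: L2N_ae; [|exact: L2_meas (L2Z _ Lg)|].
  exact: (L2_meas (L2B (koopman_L2 inv Lg) (L2Z a Lg))).
by apply: aeS e => x ->; rewrite mulrBl.
Qed.

(** The integral of [|z - w|^2] is the squared norm of [U g - w g], which vanishes. *)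
Lemma smeas_eigenvec w g nu : circle w -> eigenvec w g -> smeas g nu -> nu (~` [set w]) = 0%E.
Proof.
move=> cw [Lg e] [n0 hnu]; have mS := @meas_circle R.
pose f z := z - w; have uf : ucirc f by apply: ucircD (@ucirc_id R) (ucirc_cst _).
have T0 : L2N mu (fcT f g) = 0.
  have Ld : L2 (fun x => koopman phi g x - w * g x) by apply: L2B; [exact: koopman_L2|exact: L2Z].
  rewrite (L2N_ae (L2_meas (TL uf Lg)) (L2_meas Ld)); last first.
    exact: (fcalc_uniq inv uf Lg (TP uf Lg) (fcalc_XsubC inv w Lg)).
  by rewrite (@eigenvec_norm w)// subrr csq0 mul0r.
have uq : ucirc (fun z => (csqnorm (f z))%:C%C).
  by have := ucircM uf (ucirc_conj uf); apply: ucirc_ext => z _; rewrite mulJ_csq.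
have := fcT_sqr inv uf Lg; rewrite hnu// T0 => /(congr1 (@complex.Re R)) /=; rewrite /Rintegral.
have mq : measurable_fun S1 (fun z => csqnorm (f z)) by have := ucirc_meas_re uq.
have [K K0 hK] := ucirc_bounded uf.
have bq : bmeas S1 (fun z => csqnorm (f z)).
  by split=> //; exists K => z cz; rewrite ger0_norm ?csq_ge0// hK.
have iq := bmeas_integrable nu mS bq.
move=> /eqP; rewrite fine_eq0; last exact: integrable_fin_num.
move=> /eqP q0.
have : (\int[nu]_(z in S1) `|(csqnorm (f z))%:E| = 0)%E.
  by rewrite -[RHS]q0; apply: eq_integral => z _; rewrite gee0_abs// lee_fin csq_ge0.
have mEq : measurable_fun S1 (EFin \o (fun z : borel C^o => csqnorm (f z))) by exact/measurable_EFinP.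
move=> /(ae_eq_integral_abs nu mS mEq) qae.
have mw : measurable (~` [set w] : set (borel C^o)) by apply: measurableC; exact: meas_cpoint.
apply: (measure_negligible mw).
have -> : ~` [set w] = ~` S1 `|` (S1 `&` ~` [set w]).
  apply/seteqP; split=> z /=; first by case: (pselect (circle z)) => cz zw; [right|left].
  by case=> [cz zw|[]//]; apply: cz; rewrite zw.
apply: negligibleU; first by apply/negligibleP; [exact: measurableC|].
apply: negligibleS qae => z [cz zw] /= /(_ cz) [] /csq_eq0 /eqP; rewrite subr_eq0 => /eqP.
exact: zw.
Qed.

(** An eigenvector for an eigenvalue near [z] is an approximate eigenvector at [z], so density of
    the eigenvalues fills the circle. *)
Lemma spectrum_on_dense V : V `<=` L2 -> (forall f g, ucirc f -> V g -> V (fcT f g)) ->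
  (forall w g, eigenvec w g -> V g) ->
  (forall z, circle z -> forall e : R, 0 < e -> exists w g,
     [/\ csqnorm (w - z) <= e, eigenvec w g & 0 < L2N mu g]) ->
  spectrum_on mu V (koopman phi) = @circle R.
Proof.
move=> VL Vf Ve dens; apply/seteqP; split=> [z|z cz].
  by apply: (spectrum_on_circle inv VL Vf).
apply: (approximate_eigenvector VL) => e e0.
have [w [g [wz eg g0]]] := dens z cz e e0; exists g; split=> //; first exact: Ve eg.
  exact: (Ve w _ (eigenvec_sub z eg)).
by rewrite (eigenvec_norm _ eg) ler_wpM2r// L2N_ge0.
Qed.

Section on_circle.
Hypothesis spec : dynamical_spectrum phi mu = @circle R.

Lemma spectral_measureP g nu : L2 g -> is_spectral_measure phi mu g nu <-> smeas g nu.
Proof.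
move=> Lg; rewrite /is_spectral_measure spec; split=> -[n0 h]; split.
- by apply: measure_negligible n0; apply: measurableC; exact: meas_circle.
- move=> f uf; have [T [fT <-]] := h f (ucirc_within_continuous uf).
  have LT : L2 (T g) by case: fT => h1 _; exact: h1.
  apply: inner_aeL => //; first exact: TL.
  exact: (fcalc_uniq inv uf Lg (TP uf Lg) (is_functional_calculus_fcalc inv spec fT Lg)).
- by apply/negligibleP => //; apply: measurableC; exact: meas_circle.
- move=> f /within_continuous_ucirc uf; exists (fcT f); split; last exact: h.
  exact: fcT_is_functional_calculus.
Qed.

Lemma L2pp_fcT f g : ucirc f -> L2pp phi mu g -> L2pp phi mu (fcT f g).
Proof.
move=> uf [Lg [nu [/(spectral_measureP _ Lg) sm [D cD nD]]]]; have Lf := TL uf Lg.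
have [rho [srho r0]] := smeas_fcT uf Lg sm; split=> //; exists rho.
split; first exact/(spectral_measureP _ Lf).
by exists D => //; case: nD => N [mN N0 sN]; exists N; split=> //; exact: r0.
Qed.

Lemma L2sc_fcT f g : ucirc f -> L2sc phi mu g -> L2sc phi mu (fcT f g).
Proof.
move=> uf [Lg [nu [/(spectral_measureP _ Lg) sm [n0 [A [mA A0 [N [mN N0 sN]]]]]]]].
have [rho [srho r0]] := smeas_fcT uf Lg sm; have Lf := TL uf Lg; split=> //; exists rho.
split; first exact/(spectral_measureP _ Lf).
split; first by move=> z; apply: r0 => //; exact: meas_cpoint.
by exists A; split=> //; exists N; split=> //; exact: r0.
Qed.

Lemma eigenvec_L2pp w g : eigenvec w g -> L2pp phi mu g.
Proof.
move=> eg; have Lg := eg.1; split=> //; have [nu snu] := smeas_exists inv Lg.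
exists nu; split; first exact/(spectral_measureP _ Lg).
(* The zero vector satisfies [eigenvec] for every [w]; its spectral measure is zero. *)
have [g0|g0] := eqVneq (L2N mu g) 0.
  exists set0 => //; have n0 : nu [set: borel C^o] = 0%E.
    have mS := @meas_circle R; have [h0 _] := snu; have e := smeas_total Lg snu.
    apply: measure_negligible => //; rewrite -(setUv S1); apply: negligibleU; apply/negligibleP => //.
      by rewrite -[LHS]fineK -?e ?g0//; exact: fin_num_measure.
    exact: measurableC.
  by exists setT; split=> //.
have gp : 0 < L2N mu g by rewrite lt_def g0 L2N_ge0.
have cw := eigenvec_circle eg gp.
exists [set w] => //; have h := smeas_eigenvec cw eg snu.
exists (~` [set w]); split=> //; apply: measurableC; exact: meas_cpoint.
Qed.

End on_circle.

Lemma dynamical_spectrum_dense :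
  (forall z, circle z -> forall e : R, 0 < e -> exists w g,
     [/\ csqnorm (w - z) <= e, eigenvec w g & 0 < L2N mu g]) ->
  dynamical_spectrum phi mu = @circle R.
Proof.
by move=> dens; apply: spectrum_on_dense => // w g [].
Qed.

Lemma spectrum_pp_dense :
  (forall z, circle z -> forall e : R, 0 < e -> exists w g,
     [/\ csqnorm (w - z) <= e, eigenvec w g & 0 < L2N mu g]) ->
  spectrum_pp phi mu = @circle R.
Proof.
move=> dens; have spec := dynamical_spectrum_dense dens.
apply: spectrum_on_dense => //; [by move=> g []|by move=> f g; exact: L2pp_fcT|].
by move=> w g; exact: eigenvec_L2pp.
Qed.

End spectral_types.

(** * Lebesgue measure and characters on the circle *)

Section torus_measure.
Context (R : realType).
Local Notation C := (R[i]).
Local Notation lamT := (@torus1_lebesgue R).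
Implicit Types (s t : torus1 R) (x y : R).

Lemma lebesgue_shift (a : R) (A : set (measurableTypeR R)) : measurable A ->
  lebesgue_measure ((fun x => x + a) @^-1` A) = lebesgue_measure A.
Proof.
pose f : measurableTypeR R -> measurableTypeR R := fun x => x + a.
have mf : measurable_fun setT f by apply: measurable_funD => //; exact: measurable_cst.
pose ff : {mfun measurableTypeR R >-> measurableTypeR R} := HB.pack f (isMeasurableFun.Build _ _ _ _ f mf).
pose nu : {measure set (measurableTypeR R) -> \bar R} := pushforward lebesgue_measure ff.
move=> mA; rewrite [RHS](lebesgue_measure_unique (mu := nu mf))// => _ [[p q] _ <-] /=.
rewrite /nu /= /pushforward.
have -> : ff @^-1` `]p, q]%classic = `](p - a), (q - a)]%classic.
  by apply/seteqP; split=> x /=; rewrite !in_itv /= /f ltrBlDr lerBrDr.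
rewrite !lebesgue_measure_itv /= !lte_fin ltrD2r; case: ifP => // _.
by rewrite -!EFinB; congr (_%:E); ring.
Qed.

Lemma measurable_toT : measurable_fun setT (toT : measurableTypeR R -> borel (torus1 R)).
Proof.
apply: (measurability (@open (torus1 R) : set (set (borel (torus1 R))))) => //.
move=> _ [B oB <-]; rewrite setTI.
by apply: measurable_realfun.open_measurable; apply: open_comp => // x _; exact: continuous_toT.
Qed.
Lemma measurable_toT_pre (A : set (borel (torus1 R))) : measurable A ->
  measurable (toT @^-1` A : set (measurableTypeR R)).
Proof. by move=> mA; rewrite -[_ @^-1` _]setTI; exact: measurable_toT. Qed.

(** The translated fundamental domain [[a, 1 + a[] is cut at 1, and its second piece is moved back
    by 1 using the periodicity of the preimage. *)
Lemma torus1_lebesgue_shift t (A : set (borel (torus1 R))) : measurable A ->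
  lamT ((fun s => s + t) @^-1` A) = lamT A.
Proof.
move=> mA; have [y yt] := toT_surj t.
pose a := y - (Num.floor y)%:~R.
have at_ : toT a = t by rewrite /a -mulrNz toT_int yt.
have /andP[a0 a1] : 0 <= a < 1 by have := floor_itv y; rewrite intrD1 /a => /andP[]; lra.
pose B : set (measurableTypeR R) := toT @^-1` A.
have mB : measurable B by exact: measurable_toT_pre.
have Bper x : B (x + 1) = B x by rewrite /B /preimage /= -[1]/(1%:~R) toT_int.
have mI (u v : R) : measurable (`[u, v[%classic : set (measurableTypeR R)) by exact: measurable_itv.
rewrite /torus1_lebesgue.
have -> : (`[0, 1[%classic : set R) `&` toT @^-1` ((fun s => s + t) @^-1` A) =
    (fun x => x + a) @^-1` (`[a, 1 + a[%classic `&` B).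
  apply/seteqP; split=> x /=; rewrite !in_itv /= /B /= toTD at_ ltrD2r lerDr;
  by move=> [/andP[-> ->]].
rewrite [LHS]lebesgue_shift; last exact: measurableI.
have split_ (u v w : R) : u <= v -> v <= w -> lebesgue_measure (`[u, w[%classic `&` B) =
    (lebesgue_measure (`[u, v[%classic `&` B) + lebesgue_measure (`[v, w[%classic `&` B))%E.
  move=> uv vw; rewrite -measureU; [|exact: measurableI|exact: measurableI|].
    congr lebesgue_measure; rewrite -setIUl; congr (_ `&` _); apply/seteqP; split=> x /=; rewrite !in_itv /=.
      by move=> /andP[ux xw]; case: (ltP x v) => h; [left; rewrite ux|right; rewrite xw].
    by case=> /andP[h1 h2]; apply/andP; split=> //; [exact: lt_le_trans h2 vw|exact: le_trans uv h1].
  apply/seteqP; split=> // x [[/=]]; rewrite !in_itv /= => /andP[_ h1] _ [/andP[h2 _] _].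
  by move: (lt_le_trans h1 h2); rewrite ltxx.
rewrite (split_ a 1 (1 + a)); [|lra|lra].
rewrite [RHS](split_ 0 a 1); [|lra|lra].
rewrite addeC; congr (_ + _)%E.
rewrite -(@lebesgue_shift 1); last exact: measurableI.
congr lebesgue_measure; apply/seteqP; split=> x /=; rewrite !in_itv /= Bper.
  by move=> [/andP[h1 h2] h3]; split=> //; apply/andP; split; lra.
by move=> [/andP[h1 h2] h3]; split=> //; apply/andP; split; lra.
Qed.
Lemma rot_invariant t : invariant_measure (rotation t) lamT.
Proof. by move=> A mA; exact: torus1_lebesgue_shift. Qed.

Definition echar t : C := ec (repr t).

Lemma echar_toT x : echar (toT x) = ec x.
Proof. by rewrite /echar; have [z ->] := toT_repr x; rewrite ecD ec_int mulr1. Qed.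
Lemma echarD s t : echar (s + t) = echar s * echar t.
Proof. by rewrite -(reprT s) -(reprT t) -toTD !echar_toT ecD. Qed.

Lemma circle_echar t : circle (echar t). Proof. exact: circle_ec. Qed.

Lemma echar_lip s t : dC (echar s) (echar t) <= 4 * pi * mdist s t.
Proof.
have p0 : 0 < 4 * pi :> R by rewrite mulr_gt0// pi_gt0.
rewrite mulrC -ler_pdivrMr// leNgt; apply/negP => h.
have [y yt sy] := @toT_near R (repr s) t _ ltac:(rewrite reprT; exact: h).
move: sy; rewrite ltr_pdivlMr// mulrC => sy; have := dC_ec (repr s) y.
by rewrite -[ec y]echar_toT yt leNgt sy.
Qed.

Lemma re_dC (z w : C) : `|re z - re w| <= dC z w.
Proof.
apply: ler_sqr_le; first exact: dC_ge0.
by rewrite dC_sqr real_normK ?num_real// -reB lerDl sqr_ge0.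
Qed.

Lemma im_dC (z w : C) : `|im z - im w| <= dC z w.
Proof.
apply: ler_sqr_le; first exact: dC_ge0.
by rewrite dC_sqr real_normK ?num_real// -imB lerDr sqr_ge0.
Qed.

Lemma ccont_echar : ccont echar.
Proof.
split; apply: (@lipschitz_continuous _ _ _ (4 * pi)) => s t; apply: le_trans (echar_lip s t).
  exact: re_dC.
exact: im_dC.
Qed.

Lemma ccontX (X : pmetricType R) (f : X -> C) n : ccont f -> ccont (fun p : X => f p ^+ n).
Proof.
move=> cf; elim: n => [|n IH]; first by under eq_fun do rewrite expr0; exact: ccont_cst.
by under eq_fun do rewrite exprS; exact: ccontM.
Qed.
Lemma echarX_L2 n : L2 lamT (fun t => echar t ^+ n).
Proof. by apply: (ccont_L2 (@compact_torus1 R)); apply: ccontX; exact: ccont_echar. Qed.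

(** Translation by half a period of the character of degree [k - l] preserves the inner product and
    also multiplies it by [- 1]. *)
Lemma echar_orthogonal k l : k <> l ->
  L2inner lamT (fun t => echar t ^+ k) (fun t => echar t ^+ l) = 0.
Proof.
wlog lk : k l / (l < k)%N => [hw kl|_].
  have [lk|kl'|/esym//] := ltngtP l k; first exact: hw.
  rewrite (innerJ (echarX_L2 l) (echarX_L2 k)) hw ?(rmorph0 (@conjc R))//.
  by apply/eqP; rewrite gtn_eqF.
pose t0 := toT (1 / (2 * (k - l)%:R)) : torus1 R.
have d0 : 0 < (k - l)%:R :> R by rewrite ltr0n subn_gt0.
have mp := mpres_tds (rot_invariant t0).
have := inner_mpres mp (echarX_L2 k) (echarX_L2 l).
have E n : (fun t => echar t ^+ n) \o rotation t0 = fun t => echar t0 ^+ n * echar t ^+ n.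
  by apply/funext => t /=; rewrite echarD exprMn mulrC.
rewrite !E innerZl ?innerZr//; [|exact: echarX_L2..|apply: L2Z; exact: echarX_L2].
have -> : (echar t0 ^+ l)^*%C = echar t0 ^- l.
  by rewrite -circleV// /circle /= csqX circle_echar expr1n.
rewrite mulrA; have -> : echar t0 ^+ k * echar t0 ^- l = -1.
  have e0 := circle_neq0 (circle_echar t0).
  rewrite -(subnK (ltnW lk)) exprD mulfK ?expf_neq0// echar_toT -ec_mulrn.
  have -> : 1 / (2 * (k - l)%:R) *+ (k - l) = 2^-1 :> R.
    by rewrite -mulr_natr; field; rewrite gt_eqF.
  apply: cplxP; rewrite /= mulrAC divff ?mul1r ?cospi ?sinpi ?oppr0//.
by move=> h; apply: cplxP; move: (congr1 (@complex.Re R) h) (congr1 (@complex.Im R) h); rewrite mulN1r /=; lra.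
Qed.

(** On [E] all these characters have real part at least [1 / 2], so the inner product of the
    indicator with each has real part at least [c / 2]. Adding [n] orthonormal characters and using
    the Cauchy-Schwarz inequality gives [n c <= 4]. *)
Lemma echar_rigid_null (r : nat -> nat) (E : set (borel (torus1 R))) : injective r ->
  measurable E -> (forall t, E t -> forall i, csqnorm (echar t ^+ r i - 1) < 1) -> lamT E = 0%E.
Proof.
move=> ri mE hE; pose f : torus1 R -> C := fun t => (\1_E t)%:C%C.
have mf : cmeas f by split; [exact: measurable_indic|exact: measurable_cst].
have f1 t : csqnorm (f t) = \1_E t.
  by rewrite csq_real indicE; case: (_ \in _); rewrite ?expr1n ?expr0n.
have Lf : L2 lamT f.
  by apply: (@L2_bounded _ _ lamT f 1 mf) => t; rewrite f1 indicE; case: (_ \in _); rewrite ?ler01.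
pose c := fine (lamT E).
have cE : lamT E = c%:E by rewrite fineK// fin_num_measure.
have c0 : 0 <= c by rewrite /c fine_ge0// measure_ge0.
have fc : L2N lamT f = c.
  rewrite /L2N /Rintegral; under eq_integral do rewrite f1.
  by rewrite integral_indic// setIT.
pose e i t : C := echar t ^+ r i.
have Le i : L2 lamT (e i) := echarX_L2 (r i).
have half i : c / 2 <= re (L2inner lamT f (e i)).
  rewrite re_inner -fc /L2N mulrC -(RintZ 2^-1 (L2_intg Lf)).
  apply: Rint_le; [exact: intgZ (L2_intg Lf)|by have [] := intg_inner Lf (Le i)|].
  move=> t; rewrite f1 /f reM reJ imJ /= mul0r subr0.
  have e01 : (\1_E t : R) = (t \in E)%:R by rewrite indicE.
  rewrite !e01; have := hE t; case: (boolP (t \in E)) => [/set_mem Et /(_ Et i)|_ _] /=; last by lra.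
  have : csqnorm (echar t ^+ r i) = 1 by rewrite csqX circle_echar expr1n.
  by rewrite /e /csqnorm reB imB /=; move: (re _) (im _) => a b; rewrite subr0 sqrrB expr1n mulr1; lra.
have bessel n : n%:R * c <= 4.
  pose S t := \sum_(i < n) e i t.
  have LS : L2 lamT S by exact: L2_sum.
  have nS : L2N lamT S = n%:R.
    have : L2inner lamT S S = n%:R.
      rewrite {1}/S inner_suml//; under eq_bigr => i _.
        rewrite /S inner_sumr// (bigD1 i)//= big1 ?addr0; last first.
          by move=> j ji; apply: echar_orthogonal => /ri/val_inj ij; rewrite ij eqxx in ji.
        rewrite inner_sqr (_ : L2N lamT (e i) = 1); last first.
          rewrite /L2N -[RHS](Rint_cst lamT 1); apply: eq_Rintegral => t _.
          by rewrite csqX circle_echar expr1n.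
        over.
      by rewrite sumr_const card_ord.
    by rewrite inner_sqr -(rmorph_nat (real_complex R)) => /(congr1 (@complex.Re R)).
  have ge : n%:R * (c / 2) <= re (L2inner lamT f S).
    rewrite /S inner_sumr// (raddf_sum (@complex.Re R)).
    by rewrite mulr_natl -[n in _ *+ n]card_ord -sumr_const; apply: ler_sum => i _; exact: half.
  have cs := cauchy_schwarz Lf LS; rewrite fc nS in cs.
  have : (n%:R * (c / 2)) ^+ 2 <= c * n%:R.
    apply: le_trans cs; rewrite /csqnorm; apply: (@le_trans _ _ (re (L2inner lamT f S) ^+ 2)).
      by rewrite lerXn2r ?nnegrE// ?mulr_ge0 ?divr_ge0// (le_trans _ ge)// mulr_ge0// divr_ge0.
    by rewrite lerDl sqr_ge0.
  have -> : n%:R * (c / 2) = n%:R * c / 2 by rewrite mulrA.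
  rewrite (mulrC c); move: (n%:R * c) => w h.
  rewrite leNgt; apply/negP => w4; have : 0 < (w - 4) * w by apply: mulr_gt0; lra.
  by move: h; rewrite (_ : (w / 2) ^+ 2 = w * w / 4); [lra|field].
rewrite cE; congr (_%:E); apply/eqP; rewrite eq_le c0 andbT leNgt; apply/negP => cp.
have := bessel (Num.bound (4 / c)).+1; apply/negP; rewrite -ltNge -ltr_pdivrMr//.
by apply: lt_trans (archi_boundP _) _; rewrite ?ltr_nat// divr_ge0.
Qed.

End torus_measure.

(** * Rigidity, weak limits and spectral types *)

Section rigidity_and_mixing.
Context (R : realType) (X : pmetricType R) (phi : tds X) (mu : probability (borel X) R).
Hypothesis inv : invariant_measure phi mu.
Local Notation C := (R[i]).
Local Notation L2 := (L2 mu).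
Local Notation inner := (L2inner mu).
Local Notation fcT := (fcT phi mu).
Local Notation smeas := (smeas phi mu).
Local Notation S1 := (@circle R : set (borel C^o)).
Local Notation finmeas := {finite_measure set (borel C^o) -> \bar R}.
Implicit Types (g u : X -> C) (a z w : C) (f h : C -> C) (v : C -> R) (nu : finmeas).

Let TP f g : ucirc f -> L2 g -> fcalc phi mu f g (fcT f g). Proof. exact: fcTP. Qed.
Let TL f g : ucirc f -> L2 g -> L2 (fcT f g). Proof. exact: fcT_L2. Qed.
Let mS : measurable S1. Proof. exact: meas_circle. Qed.

Lemma ucircX n : ucirc (fun z : C => z ^+ n).
Proof.
elim: n => [|n IH]; first by apply: ucirc_ext (ucirc_cst 1) => z _; rewrite expr0.
by apply: ucirc_ext (ucircM (@ucirc_id R) IH) => z _; rewrite exprS.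
Qed.

Lemma fcalcX n g : L2 g -> fcalc phi mu (fun z => z ^+ n) g (fun x => g (iter n phi x)).
Proof.
move=> Lg; have -> : (fun x => g (iter n phi x)) = lop phi 0 'X^n g.
  by apply/funext => x; rewrite /lop /= kpolyXn.
by apply: fcalc_eq (fcalc_laurent inv 0 'X^n Lg) => z _; rewrite /laurent hornerXn expr0 divr1.
Qed.

Lemma fint_le_measure nu v (A : set (borel C^o)) : bmeas S1 v -> (forall z, 0 <= v z) ->
  measurable A -> (forall z, A z -> S1 z /\ 1 <= v z) -> fine (nu A) <= \int[nu]_(z in S1) v z.
Proof.
move=> bv v0 mA hA; have -> : fine (nu A) = \int[nu]_(z in S1) (\1_A z : R).
  rewrite /Rintegral integral_indic//; congr (fine (nu _)).
  by apply/seteqP; split=> z => [Az|[]//]; split=> //; case: (hA z Az).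
apply: fint_le => //; last by move=> z _; rewrite indicE; case: (boolP (z \in A)) => [/set_mem/hA[]|].
exact: bmeas_indic.
Qed.

Lemma bmeas_csq f : ucirc f -> bmeas S1 (fun z => csqnorm (f z)).
Proof.
move=> uf; have [K K0 hK] := ucirc_bounded uf; split.
  apply: (@measurable_funD _ _ _ S1 (fun z => re (f z) ^+ 2)); apply: measurable_funX.
    exact: ucirc_meas_re.
  exact: ucirc_meas_im.
by exists K => z cz; rewrite ger0_norm ?csq_ge0// hK.
Qed.

Lemma smeas_sqr nu f g : ucirc f -> L2 g -> smeas g nu ->
  L2N mu (fcT f g) = \int[nu]_(z in S1) csqnorm (f z).
Proof.
move=> uf Lg [_ hnu]; have := fcT_sqr inv uf Lg; rewrite hnu; last first.
  by have := ucircM uf (ucirc_conj uf); apply: ucirc_ext => z _; rewrite mulJ_csq.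
by move=> /(congr1 (@complex.Re R)) /= <-.
Qed.

Section rigid.
Hypothesis rig : forall g, L2 g -> forall (e : R) N, 0 < e ->
  exists2 n, (N <= n)%N & L2N mu (fun x => g (iter n phi x) - g x) <= e.

(** The integral of [|z^r - 1|^2] is the squared norm of [U^r g - g]. Along fast rigidity times
    almost every [z] eventually satisfies [|z^r - 1| < 1], whereas the points that do so for all
    late times form a Lebesgue null set by [echar_rigid_null]. *)
Lemma smeas_singular nu g : L2 g -> smeas g nu -> exists A : set (borel C^o),
  [/\ measurable A, circle_lebesgue A = 0%E & nu (~` A) = 0%E].
Proof.
move=> Lg snu.
have /choice[F hF] (p : nat * nat) : exists n, (p.1 <= n)%N /\
    L2N mu (fun x => g (iter n phi x) - g x) <= 2^-1 ^+ p.2.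
  have h2 : 0 < 2^-1 :> R by lra.
  by have [n n1 n2] := rig Lg p.1 (exprn_gt0 p.2 h2); exists n.
(* The times increase strictly, so they are pairwise different, as orthogonality of the characters
   requires. *)
pose r := fix r i := if i is j.+1 then F ((r j).+1, j.+1) else F (0%N, 0%N).
have r_small i : L2N mu (fun x => g (iter (r i) phi x) - g x) <= 2^-1 ^+ i.
  by case: i => [|i]; exact: (hF _).2.
have r_lt : {homo r : i j / (i < j)%N}.
  by apply: homo_ltn => [? ? ?|i]; [exact: ltn_trans|exact: (hF ((r i).+1, i.+1)).1].
pose f i z : C := z ^+ r i - 1.
have uf i : ucirc (f i) by apply: ucircD (ucircX _) (ucirc_cst _).
pose A i : set (borel C^o) := [set z | S1 z /\ 1 <= csqnorm (f i z)].
have mA i : measurable (A i).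
  have [mf _] := bmeas_csq (uf i).
  by have := mf mS `[1, +oo[%classic (measurable_itv _); congr measurable; apply/seteqP;
    split=> z /=; rewrite in_itv /= andbT.
have hA i : (nu (A i) <= (1 * 2^-1 ^+ i)%:E)%E.
  rewrite -[leLHS]fineK ?lee_fin; last exact: fin_num_measure.
  rewrite mul1r; apply: le_trans (fint_le_measure nu (bmeas_csq (uf i)) _ (mA i) _) _ => [z|z []//|].
    exact: csq_ge0.
  rewrite -(smeas_sqr (uf i) Lg snu); apply: le_trans (r_small i).
  rewrite (@L2N_ae _ _ mu _ (fun x => g (iter (r i) phi x) - g x))//.
  - exact: L2_meas (TL (uf i) Lg).
  - exact: (L2_meas (L2B (fcalcX (r i) Lg).1 Lg)).
  apply: (fcalc_uniq inv (uf i) Lg (TP (uf i) Lg)).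
  have := fcalc_lin inv (-1) Lg (ucirc_cst 1) (ucircX (r i)) (fcalc1 inv Lg) (fcalcX (r i) Lg).
  under [X in fcalc _ _ _ _ X]eq_fun do rewrite mulN1r addrC.
  by apply: fcalc_eq => z _; rewrite mulN1r addrC.
have [N [mN N0 sN]] := borel_cantelli (ltac:(lra) : 0 <= 2^-1 < 1) mA hA.
pose B i : set (borel C^o) := \bigcap_(j in [set j | (i <= j)%N]) (S1 `\` A j).
have mB i : measurable (B i) by apply: bigcap_measurable => [|j _]; [exists i => /=|exact: measurableD].
have B0 i : circle_lebesgue (B i) = 0%E.
  rewrite /circle_lebesgue.
  pose E : set (borel (torus1 R)) :=
    \bigcap_j ((fun t => csqnorm (echar t ^+ r (i + j)%N - 1)) @^-1` `]-oo, 1[%classic).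
  have mE : measurable E.
    apply: bigcap_measurable => [|j _]; first by exists 0%N.
    have cc : ccont (fun t : torus1 R => echar t ^+ r (i + j)%N - 1).
      by apply: ccontB; [apply: ccontX; exact: ccont_echar|exact: ccont_cst].
    rewrite -[X in measurable X]setTI.
    by apply: (cmeas_csq (L2_meas (@ccont_L2 _ _ (@compact_torus1 R) (@torus1_lebesgue R) _ cc))).
  have ri : injective (fun j => r (i + j)%N).
    move=> j k; case: (ltngtP j k) => // jk e.
      by have := r_lt _ _ (ltac:(by rewrite ltn_add2l) : (i + j < i + k)%N); rewrite e ltnn.
    by have := r_lt _ _ (ltac:(by rewrite ltn_add2l) : (i + k < i + j)%N); rewrite e ltnn.
  have E0 : torus1_lebesgue E = 0%E.
    by apply: (echar_rigid_null ri mE) => t Et j; have := Et j I; rewrite /= in_itv.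
  rewrite -[RHS]E0; congr lebesgue_measure; congr (_ `&` _); apply/seteqP; split=> t /= Bt.
    move=> j _ /=; rewrite in_itv /= echar_toT ltNge; apply/negP => h.
    by have [_] := Bt (i + j)%N (leq_addr _ _); apply; split=> //; exact: circle_ec.
  move=> j /= ij; split; first exact: circle_ec.
  by move=> [_]; have := Bt (j - i)%N I; rewrite /= in_itv /= echar_toT subnKC// /f leNgt => ->.
have mU : measurable (\bigcup_i B i) by exact: bigcup_measurable.
exists (\bigcup_i B i); split => //.
  have mp (V : set (borel C^o)) : measurable V ->
      measurable ((`[0, 1[%classic : set (measurableTypeR R)) `&` [set t | V (ec t)]).
    move=> mV; apply: measurableI => //.
    rewrite -[X in measurable X]setTI.
    by apply: (measurable_ec (@measurable_id _ (measurableTypeR R) setT)).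
  rewrite /circle_lebesgue; apply: (measure_negligible (mp _ mU)).
  have := @negligible_bigcup _ _ _ lebesgue_measure (fun i => `[0, 1[%classic `&` [set t | B i (ec t)]).
  rewrite -setI_bigcupr; apply=> i.
  by exists (`[0, 1[%classic `&` [set t | B i (ec t)]); split; [exact: mp (mB i)|exact: B0|].
apply: (measure_negligible (measurableC mU)).
have nU : nu.-negligible (~` S1 `|` N).
  by apply: negligibleU; apply/negligibleP => //; [exact: measurableC|case: snu].
apply: negligibleS nU => z nz; have [Sz|Sz] := pselect (S1 z); [right|by left].
apply: sN => hz; apply: nz; have [i hi] := hz; exists i => // j /= ij; split=> //; exact: hi.
Qed.

Lemma smeas_rigid nu g : L2 g -> smeas g nu -> absolutely_continuous nu -> L2N mu g = 0.
Proof.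
move=> Lg snu ac; have [A [mA A0 nA]] := smeas_singular Lg snu.
rewrite (smeas_total inv Lg snu) (_ : nu S1 = 0%E)//; apply: (measure_negligible mS).
have nU : nu.-negligible (A `|` ~` A).
  by apply: negligibleU; apply/negligibleP => //; [exact: ac|exact: measurableC].
by apply: negligibleS nU => z _; rewrite setUv.
Qed.

Lemma L2ac_rigid (spec : dynamical_spectrum phi mu = @circle R) g : L2ac phi mu g -> eqL2 mu g (fun=> 0).
Proof.
move=> [Lg [nu [/(spectral_measureP inv spec _ Lg) snu ac]]].
by apply: L2N_ae0 => //; exact: smeas_rigid snu ac.
Qed.

(** The subspace contains only null functions, and on these the identity inverts [U - z] for every
    [z]. *)
Lemma spectrum_ac_rigid : dynamical_spectrum phi mu = @circle R -> spectrum_ac phi mu = set0.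
Proof.
move=> spec; apply/seteqP; split=> // z; apply; exists id; split.
  split=> // [a f g _ _|]; first exact: eqL2_refl.
  by exists 1 => f _; rewrite mul1r.
move=> f Lf; have f0 := L2ac_rigid spec Lf.
have fU := eqL2_mpres (mpres_tds inv) f0.
by split; apply: (aeS2 _ f0 fU) => x /= fx; rewrite /koopman /= fx => ->; rewrite mulr0 subr0.
Qed.

End rigid.

Definition bump a (k : nat) z : R := Num.max 0 (1 - k.+1%:R * dC z a).

Lemma bump01 a k z : 0 <= bump a k z <= 1.
Proof. by rewrite /bump le_max lexx ge_max ler01 /= gerBl mulr_ge0// dC_ge0. Qed.
Lemma bump_center a k : bump a k a = 1.
Proof. by rewrite /bump dCxx mulr0 subr0 (max_idPr ler01). Qed.

Lemma bump_supp a k z : k.+1%:R^-1 <= dC z a -> bump a k z = 0.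
Proof.
by rewrite -div1r ler_pdivrMr ?ltr0n// mulrC => h; rewrite /bump (max_idPl _)// subr_le0.
Qed.

Lemma rcirc_bump a k : rcirc (bump a k).
Proof.
apply: (@rcirc_lipschitz _ _ k.+1%:R) => z w.
have k0 : 0 <= k.+1%:R :> R by [].
have t1 : dC z a <= dC z w + dC w a := dC_triangle _ _ _.
have t2 : dC w a <= dC z w + dC z a by rewrite [dC z w]dCC; exact: dC_triangle.
have m1 := ler_wpM2l k0 t1; have m2 := ler_wpM2l k0 t2; rewrite !mulrDr in m1 m2.
have d0 : 0 <= k.+1%:R * dC z w by rewrite mulr_ge0// dC_ge0.
move: m1 m2 d0; rewrite /bump; move: (k.+1%:R * dC z a) (k.+1%:R * dC w a) (_ * dC z w) => x y d m1 m2 d0.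
by case: (leP 0 (1 - x)) => hx; case: (leP 0 (1 - y)) => hy; rewrite ler_norml; apply/andP; split; lra.
Qed.

Definition cball a (r : R) : set (borel C^o) := [set z | S1 z /\ dC z a < r].

Lemma meas_cball a (r : R) : 0 < r -> measurable (cball a r).
Proof.
move=> r0; have ua : ucirc (fun z => z - a) by apply: ucircD (@ucirc_id R) (ucirc_cst _).
have [mf _] := bmeas_csq ua.
have := mf mS `]-oo, r ^+ 2[%classic (measurable_itv _); congr measurable; apply/seteqP.
by split=> z /=; rewrite in_itv /= -dC_sqr ltr_pXn2r ?nnegrE ?dC_ge0// ltW.
Qed.

Lemma fint_dist_indic nu v v' (A : set (borel C^o)) : bmeas S1 v -> bmeas S1 v' -> measurable A ->
  (forall z, S1 z -> ~ A z -> v z = v' z) -> (forall z, S1 z -> A z -> `|v z - v' z| <= 1) ->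
  `|\int[nu]_(z in S1) v z - \int[nu]_(z in S1) v' z| <= fine (nu (A `&` S1)).
Proof.
move=> bv bv' mA out inn; have bA : bmeas S1 (\1_A : borel C^o -> R).
  exact: bmeas_indic.
have -> : fine (nu (A `&` S1)) = \int[nu]_(z in S1) (\1_A z : R).
  by rewrite /Rintegral integral_indic.
have h z : S1 z -> `|v z - v' z| <= \1_A z.
  move=> Sz; rewrite indicE; case: (boolP (z \in A)) => [/set_mem|/negP nA]; first exact: inn.
  by rewrite out ?subrr ?normr0// => Az; apply: nA; exact: mem_set.
rewrite -fintB// ler_norml -mulN1r -fintZ//; apply/andP; split; apply: fint_le => //;
  try exact: bmeasB; try exact: bmeasZ; move=> z Sz; have := h z Sz; rewrite ler_norml; lra.
Qed.

(** Let [a] be a point of mass [c], and [v] a narrow bump at [a]. The inner product of [U^n v(U) g]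
    and [g] is nearly [a^n c], of modulus [c] for every [n]. For suitable [n] it is also nearly
    [theta] times a number close to [c]. As [|theta| < 1], this forces [c = 0]. *)
Lemma smeas_nonatomic nu g (theta : C) : L2 g -> smeas g nu -> csqnorm theta < 1 ->
  (forall f, ucirc f -> forall e : R, 0 < e -> exists n,
    csqnorm (inner (fun x => fcT f g (iter n phi x)) g - theta * inner (fcT f g) g) <= e) ->
  forall a, nu [set a] = 0%E.
Proof.
move=> Lg [n0 hnu] th1 mix a; have ma := meas_cpoint a.
have [ca|nca] := pselect (circle a); last first.
  apply: (measure_negligible ma); exists (~` S1); split=> //; first exact: measurableC.
  by move=> z /= ->.
pose c := fine (nu [set a]).
have c0 : 0 <= c by rewrite fine_ge0// measure_ge0.
rewrite -[LHS]fineK ?fin_num_measure//; congr (_%:E).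
pose q := Num.sqrt (csqnorm theta).
have q0 : 0 <= q := sqrtr_ge0 _.
have q1 : q < 1.
  by rewrite -(@ltr_pXn2r _ 2) ?nnegrE// sqr_sqrtr ?csq_ge0// expr1n.
apply/eqP; rewrite eq_le c0 andbT -(pmulr_lle0 _ (ltac:(lra) : 0 < 1 - q)).
(* Of the four [eta], two come from [h1], one from [h2], and one from the excess mass of the bump in
   [h3]. *)
apply: (@eps_le _ _ _ 4) => // eta eta0; rewrite add0r.
have [k hk] : exists k, fine (nu (cball a k.+1%:R^-1 `\ a)) <= eta.
  have mF k : measurable (cball a k.+1%:R^-1 `\ a) by apply: measurableD => //; apply: meas_cball; rewrite invr_gt0.
  have F0 : \bigcap_k (cball a k.+1%:R^-1 `\ a) = set0.
    apply/seteqP; split=> // z hz; have [[_ _] za] := hz 0%N I.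
    have dz : 0 < dC z a.
      rewrite lt_def dC_ge0 andbT; apply/eqP => d0; apply: za; apply/eqP; rewrite -subr_eq0.
      by apply/eqP/csq_eq0; rewrite -dC_sqr d0 expr0n.
    have [k hk] := inv_nat_small dz; have [[_ h] _] := hz k I.
    by move: (lt_trans h hk); rewrite ltxx.
  have : (nu \o (fun k => cball a k.+1%:R^-1 `\ a)) k @[k --> \oo] --> 0%E.
    rewrite -(measure0 nu) -F0; apply: nonincreasing_cvg_mu => //.
    - by rewrite ltey_eq fin_num_measure.
    - by rewrite F0; exact: measurable0.
    move=> i j ij; apply/subsetPset => z [[Sz dz] za]; split=> //; split=> //.
    by apply: lt_le_trans dz _; rewrite lef_pV2 ?posrE// ler_nat.
  move=> /fine_cvgP[_ /cvgr0Pnorm_le/(_ eta eta0)[k _ /(_ k (leqnn k))] /= hk]; exists k.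
  exact: le_trans (ler_norm _) hk.
pose v := bump a k; have rv : rcirc v := rcirc_bump a k.
have v01 z : `|v z| <= 1 by have /andP[v0 v1] := bump01 a k z; rewrite ger0_norm.
have vsupp z : S1 z -> ~ cball a k.+1%:R^-1 z -> v z = 0.
  by move=> Sz nz; apply: bump_supp; rewrite leNgt; apply/negP => h; exact: nz.
have mF : measurable (cball a k.+1%:R^-1 `\ a) by apply: measurableD => //; apply: meas_cball; rewrite invr_gt0.
have b1 : bmeas S1 (\1_[set a] : borel C^o -> R).
  exact: bmeas_indic.
have near (P : C -> R) : (forall z, circle z -> `|P z| <= 1) -> measurable_fun S1 (P : borel C^o -> R) ->
    `|\int[nu]_(z in S1) (P z * v z) - P a * c| <= eta.
  move=> P1 mP; have bP : bmeas S1 (P : borel C^o -> R) by split=> //; exists 1.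
  have bv : bmeas S1 (v : borel C^o -> R).
    by split; [exact: ucirc_meas_re rv|exists 1 => z _; exact: v01].
  have -> : P a * c = \int[nu]_(z in S1) (P a * \1_[set a] z : R).
    rewrite fintZ//; congr (_ * _); rewrite /Rintegral integral_indic//; congr (fine (nu _)).
    by apply/seteqP; split=> z => [/= ->|[]].
  apply: (@le_trans _ _ (fine (nu ((cball a k.+1%:R^-1 `\ a) `&` S1)))); last first.
    apply: le_trans hk; apply: fine_le; rewrite ?fin_num_measure//; [exact: measurableI|].
    by apply: le_measure; rewrite ?inE; [exact: measurableI|exact: mF|move=> z []].
  apply: fint_dist_indic => //; [exact: bmeasM|exact: bmeasZ| |].
    move=> z Sz nz; have [->|za] := eqVneq z a.
      by rewrite /v bump_center indicE mem_set//.
    rewrite indicE memNset//; last exact/eqP.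
    by rewrite mulr0 vsupp ?mulr0// => cz; apply: nz; split=> //; exact/eqP.
  move=> z Sz [_ za]; rewrite indicE memNset// mulr0 subr0 normrM.
  by rewrite -[leRHS]mulr1 ler_pM// P1.
have [n hn] := mix _ rv (eta ^+ 2) (exprn_gt0 2 eta0).
pose J := cintegral nu S1 (fun z => z ^+ n * (v z)%:C%C).
pose I0 := \int[nu]_(z in S1) v z.
have circle1 (z : C) : circle z -> `|re z| <= 1 /\ `|im z| <= 1.
  move=> cz; have := cz; rewrite /circle /csqnorm /= => e.
  by split; apply: ler_sqr_le => //; rewrite real_normK ?num_real// expr1n;
    have := sqr_ge0 (re z); have := sqr_ge0 (im z); lra.
have cX (z : C) : circle z -> circle (z ^+ n) by rewrite /circle /= csqX => ->; rewrite expr1n.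
have uX := ucircX n.
have h1 : dC (a ^+ n * c%:C%C) J <= 2 * eta.
  have hr := near (fun z => re (z ^+ n)) (fun z cz => (circle1 _ (cX z cz)).1) (ucirc_meas_re uX).
  have hi := near (fun z => im (z ^+ n)) (fun z cz => (circle1 _ (cX z cz)).2) (ucirc_meas_im uX).
  have e0 : 0 <= 2 * eta by lra.
  have er : re J = \int[nu]_(z in S1) (re (z ^+ n) * v z).
    by apply: eq_Rintegral => z _; rewrite reM /=; ring.
  have ei : im J = \int[nu]_(z in S1) (im (z ^+ n) * v z).
    by apply: eq_Rintegral => z _; rewrite imM /=; ring.
  have ra : re (a ^+ n * c%:C%C) = re (a ^+ n) * c by rewrite reM /=; ring.
  have ia : im (a ^+ n * c%:C%C) = im (a ^+ n) * c by rewrite imM /=; ring.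
  have sq (x y : R) : `|x - y| <= eta -> (x - y) ^+ 2 <= eta ^+ 2.
    by move=> h; rewrite -(real_normK (num_real (x - y))) ler_pXn2r ?nnegrE//; exact: ltW.
  rewrite dCC dC_le// /csqnorm reB imB er ei ra ia; move: (sq _ _ hr) (sq _ _ hi).
  by have := sqr_ge0 eta; rewrite exprMn; lra.
have h2 : dC J (theta * I0%:C%C) <= eta.
  rewrite dC_le; last exact: ltW.
  apply: le_trans hn; rewrite le_eqVlt; apply/orP; left; apply/eqP; congr (csqnorm (_ - _ * _)).
    rewrite /J -hnu; last exact: ucircM.
    apply: inner_aeL => //; [exact: TL (ucircM uX rv) Lg|exact: (fcalcX n (TL rv Lg)).1|].
    refine (fcalc_uniq inv (ucircM uX rv) Lg (TP (ucircM uX rv) Lg) _).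
    exact: (fcalc_mul inv Lg rv uX (TP rv Lg) (fcalcX n (TL rv Lg))).
  rewrite hnu// /cintegral /I0; apply: cplxP => //=.
  by rewrite fint_cst// mul0r.
have h3 : I0 <= c + eta.
  have := near (fun=> 1) (fun z cz => ltac:(by rewrite normr1)) (measurable_cst _).
  rewrite mul1r (_ : (fun z => 1 * v z) = v); last by apply/funext => z; rewrite mul1r.
  by rewrite -/I0 ler_norml => /andP[_]; lra.
have I00 : 0 <= I0 by apply: Rintegral_ge0 => z _; case/andP: (bump01 a k z).
have h4 : dC (theta * I0%:C%C) 0 = q * I0.
  by rewrite /dC subr0 csqM csq_real sqrtrM ?csq_ge0// sqrtr_sqr ger0_norm.
have h5 : c = dC (a ^+ n * c%:C%C) 0.
  by rewrite /dC subr0 csqM cX// mul1r csq_real sqrtr_sqr ger0_norm.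
have t1 := dC_triangle (a ^+ n * c%:C%C) J 0; have t2 := dC_triangle J (theta * I0%:C%C) 0.
have h6 := ler_wpM2l q0 h3; rewrite -h5 in t1; rewrite h4 in t2.
have h7 : q * eta <= eta by rewrite ger_pMl// ltW.
by rewrite -/c mulrBr mulr1 (mulrC c); move: h1 h2 t1 t2 h6 h7; rewrite mulrDr; lra.
Qed.

(** Otherwise every point has a null neighbourhood, and countably many null balls with centres at
    rational angles would cover the circle. *)
Lemma support_point nu : nu S1 != 0%E ->
  exists2 a, circle a & forall r : R, 0 < r -> nu (cball a r) != 0%E.
Proof.
move=> nz; apply: contrapT => hno.
have null a : circle a -> exists2 r : R, 0 < r & nu.-negligible (cball a r).
  move=> ca; apply: contrapT => h; apply: hno; exists a => // r r0; apply/eqP => e.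
  by apply: h; exists r => //; apply/negligibleP => //; exact: meas_cball.
have p0 : 0 < 4 * pi :> R by rewrite mulr_gt0// pi_gt0.
(* The radius is twice the distance [4 pi / k.+1] within which some centre of level [k] is found, so
   the ball contains the given point and stays in its null neighbourhood for large [k]. *)
pose B k i := cball (ec (i%:R / k.+1%:R)) (8 * pi / k.+1%:R).
pose N k i := if `[< nu.-negligible (B k i) >] then B k i else set0.
have nN : nu.-negligible (\bigcup_k \bigcup_i N k i).
  apply: negligible_bigcup => k; apply: negligible_bigcup => i; rewrite /N; case: asboolP => // _.
  exact: negligible_set0.
move: nz; apply/negP/negPn/eqP/(measure_negligible mS); apply: negligibleS nN => z cz.
have [t [t0 t1 tz]] := circle_ecP cz; have [r r0 nr] := null z cz.
have [k] := inv_nat_small (divr_gt0 r0 (mulr_gt0 (ltr0n _ 3) p0)).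
rewrite ltr_pdivlMr; last exact: (mulr_gt0 (ltr0n _ 3) p0).
move=> hk; have k0 : 0 < k.+1%:R^-1 :> R by rewrite invr_gt0.
have /andP[i1 i2] := truncn_itv (mulr_ge0 t0 (ler0n R k.+1)); set i := Num.truncn _ in i1 i2.
have near : dC (ec t) (ec (i%:R / k.+1%:R)) <= 4 * pi / k.+1%:R.
  apply: le_trans (dC_ec _ _) _; rewrite ler_wpM2l ?(ltW p0)// ger0_norm ?subr_ge0 ?ler_pdivrMr//.
  by rewrite lerBlDr -[X in X + _]mul1r -mulrDl ler_pdivlMr// addrC natr1 ltW.
exists k => //; exists i => //; rewrite /N asboolT; last first.
  apply: negligibleS nr => x [cx dx]; split=> //; apply: le_lt_trans (dC_triangle _ (ec (i%:R / k.+1%:R)) _) _.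
  by rewrite -tz [X in _ + X]dCC; apply: lt_le_trans (ltr_leD dx near) _; rewrite (_ : _ + _ = k.+1%:R^-1 * (3 * (4 * pi))) ?(ltW hk)//; ring.
by split=> //; rewrite -tz; apply: le_lt_trans near _; rewrite ltr_pM2r//; lra.
Qed.

(** At a point [a] of the support, [bump(U) g] is nonzero and its spectral measure lives within
    [1 / k.+1] of [a]; hence it is an approximate eigenvector, and it stays in the singular
    continuous subspace. *)
Lemma spectrum_sc_nonempty g : dynamical_spectrum phi mu = @circle R ->
  L2sc phi mu g -> 0 < L2N mu g -> spectrum_sc phi mu !=set0.
Proof.
move=> spec scg g0; have [Lg [nu [/(spectral_measureP inv spec _ Lg) snu _]]] := scg.
have nz : nu S1 != 0%E.
  by apply/eqP => e; move: g0; rewrite (smeas_total inv Lg snu) e ltxx.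
have [a ca supp] := support_point nz.
exists a; apply: approximate_eigenvector; first by move=> h [].
move=> e e0.
have [k ke] : exists k : nat, (k.+1%:R^-1 : R) ^+ 2 <= e.
  have [|k hk] := @inv_nat_small R (Num.sqrt e); first by rewrite sqrtr_gt0.
  by exists k; rewrite -[leRHS](sqr_sqrtr (ltW e0)) lerXn2r ?nnegrE ?sqrtr_ge0 ?invr_ge0// ltW.
have rb := rcirc_bump a k; set h := fun z => (bump a k z)%:C%C.
pose u := fcT h g; have Lu : L2 u := TL rb Lg.
have scu : L2sc phi mu u by exact: L2sc_fcT.
have uz : ucirc (fun z => z - a) by apply: ucircD (@ucirc_id R) (ucirc_cst _).
pose u' := fun x => koopman phi u x - a * u x.
have Lu' : L2 u' by apply: L2B; [exact: koopman_L2|exact: L2Z].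
have eu : eqL2 mu (fcT (fun z => z - a) u) u' by refine (fcalc_uniq inv uz Lu (TP uz Lu) (fcalc_XsubC inv a Lu)).
have nu' : L2N mu u' = \int[nu]_(z in S1) csqnorm ((z - a) * h z).
  rewrite -(L2N_ae (L2_meas (TL uz Lu)) (L2_meas Lu') eu).
  rewrite -(smeas_sqr (ucircM uz rb) Lg snu).
  by apply: L2N_ae (fcT_mul inv rb uz Lg); apply: L2_meas; apply: TL => //; exact: ucircM.
exists u; split=> //.
- have [Lw [nu1 [/(spectral_measureP inv spec _ Lw) s1 sc1]]] := L2sc_fcT inv spec uz scu.
  split=> //; exists nu1; split=> //; apply/(spectral_measureP inv spec _ Lu').
  exact: smeas_ae Lw Lu' eu s1.
- rewrite (smeas_sqr rb Lg snu).
  have r2 : 0 < (2 * k.+1%:R)^-1 :> R by rewrite invr_gt0 mulr_gt0.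
  have k0 : 0 < k.+1%:R :> R by [].
  have bh := bmeas_csq rb.
  have le : fine (nu (cball a (2 * k.+1%:R)^-1)) <= \int[nu]_(z in S1) (4 * csqnorm (h z)).
    apply: fint_le_measure => [|z||z [cz dz]]; [exact: bmeasZ|by rewrite mulr_ge0 ?csq_ge0|exact: meas_cball|].
    split=> //; rewrite csq_real.
    have : 2^-1 <= bump a k z.
      rewrite /bump le_max; apply/orP; right.
      by move: dz; rewrite -div1r ltr_pdivlMr ?mulr_gt0// => dz; lra.
    by move=> b2; nra.
  rewrite fintZ// in le; rewrite -(pmulr_rgt0 _ (ltac:(lra) : 0 < 4)); apply: lt_le_trans le.
  rewrite lt_def fine_ge0 ?measure_ge0// andbT fine_eq0; first exact: supp.
  by rewrite fin_num_measure//; exact: meas_cball.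
- rewrite nu' (smeas_sqr rb Lg snu) -fintZ//; last exact: bmeas_csq.
  apply: fint_le => //; [exact: bmeas_csq (ucircM uz rb)|by apply: bmeasZ; exact: bmeas_csq|].
  move=> z cz; rewrite csqM; have [dk|dk] := leP (k.+1%:R^-1) (dC z a).
    by rewrite /h bump_supp// csq0 !mulr0.
  rewrite ler_wpM2r ?csq_ge0//; apply: le_trans ke; rewrite -dC_sqr.
  by rewrite ler_pXn2r ?nnegrE ?dC_ge0// ltW.
Qed.

End rigidity_and_mixing.

(** * Rigidity in L2, and uniqueness of invariant measures *)

Section uniform_continuity.
Context (R : realType) (X : pmetricType R).
Hypothesis cX : compact [set: X].
Local Notation C := (R[i]).

Lemma ccont_unif (f : X -> C) : ccont f -> forall e : R, 0 < e ->
  exists2 d : R, 0 < d & forall x y, mdist x y < d -> csqnorm (f x - f y) <= e.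
Proof.
move=> [cr ci] e e0; have s0 : 0 < Num.sqrt (e / 2) by rewrite sqrtr_gt0 divr_gt0.
have [d d0 hd] := compact_unif_continuous cX cr s0; have [d' d'0 hd'] := compact_unif_continuous cX ci s0.
exists (Num.min d d'); first by rewrite lt_min d0.
move=> x y; rewrite lt_min => /andP[/hd h /hd' h'].
have sq (r : R) : `|r| < Num.sqrt (e / 2) -> r ^+ 2 <= e / 2.
  move=> rs; rewrite -(real_normK (num_real r)) -[leRHS](sqr_sqrtr (ltac:(lra) : 0 <= e / 2)).
  by rewrite ler_pXn2r ?nnegrE// ltW.
by rewrite /csqnorm reB imB; have := sq _ h; have := sq _ h'; lra.
Qed.

Lemma near_identity_L2 (mu : probability (borel X) R) (g : X -> C) (e : R) : L2 mu g -> 0 < e ->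
  exists2 d : R, 0 < d & forall T : X -> X, mpres mu mu T -> (forall z, mdist (T z) z < d) ->
    L2N mu (fun z => g (T z) - g z) <= e.
Proof.
move=> Lg e0; have e16 : 0 < e / 16 by rewrite divr_gt0.
have [_ /(_ _ e16)[f cf gf]] := cdense_L2 cX Lg.
have [d d0 hd] := ccont_unif cf e16; exists d => // T mT hT.
have Lf := ccont_L2 cX mu cf; have LgT := L2_mpres mT Lg; have LfT := L2_mpres mT Lf.
have h1 : L2N mu (fun z => g (T z) - f (T z)) <= e / 16.
  apply: le_trans gf; rewrite -(L2N_mpres mT (L2B Lg Lf)) //.
have h2 : L2N mu (fun z => f (T z) - f z) <= e / 16.
  by apply: L2N_bounded; [exact: L2B LfT Lf|move=> z; exact: hd].
have h3 := gf; rewrite L2N_sym in h3.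
have := L2N_tri LgT LfT Lg; have := L2N_tri LfT Lf Lg; rewrite /comp /=; lra.
Qed.

Lemma rigid_L2 (psi : tds X) (mu : probability (borel X) R) : invariant_measure psi mu ->
  (forall (e : R) N, 0 < e -> exists2 n, (N <= n)%N & forall z, mdist (iter n psi z) z < e) ->
  forall g, L2 mu g -> forall (e : R) N, 0 < e ->
  exists2 n, (N <= n)%N & L2N mu (fun x => g (iter n psi x) - g x) <= e.
Proof.
move=> inv rig g Lg e N e0; have [d d0 hd] := near_identity_L2 Lg e0.
have [n Nn hn] := rig d N d0; exists n => //.
by apply: hd => //; apply: mpres_iter; exact: mpres_tds.
Qed.

(** A cyclic permutation of the sampling times does not change the average of a continuous function
    along them, so these averages hardly depend on the starting point. Every invariant measure has
    to integrate the function to this common value. *)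
Lemma orbit_averages_unique (psi : tds X) (mu nu : probability (borel X) R) :
  (forall e : R, 0 < e -> exists l q, (0 < l)%N /\ forall z z', exists k0, forall k, (k < l)%N ->
     mdist (iter (q * k) psi z) (iter (q * ((k + k0) %% l)) psi z') < e) ->
  invariant_measure psi mu -> invariant_measure psi nu ->
  forall A : set (borel X), measurable A -> mu A = nu A.
Proof.
move=> H imu inu; apply: measure_continuous_eq => u cu.
apply/eqP; rewrite -subr_eq0 -normr_le0; apply: (@eps_le _ _ _ 2) => // e e0; rewrite add0r.
have [d d0 hd] := compact_unif_continuous cX cu e0; have [l [q [l0 hl]]] := H d d0.
have lR : 0 < l%:R :> R by rewrite ltr0n.
have [K hK] := continuous_bounded cX cu.
pose z0 : X := point; pose v k x : R := u (iter (q * k) psi x).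
pose A x : R := l%:R^-1 * \sum_(k < l) v k x.
have Az x : `|A x - A z0| <= e.
  have [k0 hk] := hl x z0.
  pose s (k : 'I_l) : 'I_l := Ordinal (ltn_pmod (k + k0) l0).
  have si : injective s.
    move=> j k /(congr1 val) /= /eqP; rewrite eqn_modDr !modn_small// => /eqP; exact: val_inj.
  rewrite /A (reindex_inj si (F := fun k : 'I_l => v k z0)) -mulrBr -sumrB normrM.
  rewrite (ger0_norm (ltW (ltac:(by rewrite invr_gt0) : 0 < l%:R^-1 :> R))) mulrC ler_pdivrMr//; apply: le_trans (ler_norm_sum _ _ _) _.
  rewrite mulr_natr -[l in e *+ l]card_ord -sumr_const; apply: ler_sum => k _.
  by apply: ltW; apply: hd; exact: hk.
have main (rho : probability (borel X) R) : invariant_measure psi rho -> `|\int[rho]_x u x - A z0| <= e.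
  move=> irho; have iu : intg rho u.
    by apply: (intg_le (cont_borelR cu) hK); exact: intg_cst.
  have iv k : intg rho (v k) /\ \int[rho]_x v k x = \int[rho]_x u x.
    by apply: (Rint_mpres _ iu); apply: mpres_iter; exact: mpres_tds.
  have [iS eS] := Rint_sum (index_enum 'I_l) (fun k => (iv (k : nat)).1).
  have eA : \int[rho]_x A x = \int[rho]_x u x.
    rewrite RintZ// eS; under eq_bigr do rewrite (iv _).2.
    by rewrite sumr_const card_ord -[X in _ * X = _]mulr_natl mulrA mulVf ?mul1r// gt_eqF.
  have iA : intg rho A by exact: intgZ.
  rewrite -eA ler_norml -(Rint_cst rho (A z0)) -RintB//; last exact: intg_cst.
  rewrite -[X in X <= _ <= _](Rint_cst rho) -[X in _ <= _ <= X](Rint_cst rho); apply/andP.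
  by split; apply: Rint_le; rewrite ?intg_cst//; try (apply: intgB => //; exact: intg_cst);
    move=> x; have := Az x; rewrite ler_norml => /andP[].
have := main _ imu; have := main _ inu; rewrite !ler_norml => /andP[h1 h2] /andP[h3 h4].
by apply/andP; split; lra.
Qed.

End uniform_continuity.

(** * Unique ergodicity of [phi] and of the base rotation *)

Section rotation_ergodicity.
Context (R : realType) (m : nat) (m0 : (0 < m)%N).
Local Notation al := (alpha R m).
Local Notation phi := (@phi R m m0).
Local Notation rot := (rotation (toT al)).
Local Notation lamT := (@torus1_lebesgue R).

Lemma phi_invariant_unique s (mu nu : probability (borel (torus2 R)) R) : (0 < s)%N ->
  invariant_measure (tds_iter phi s) mu -> invariant_measure (tds_iter phi s) nu ->
  forall A : set (borel (torus2 R)), measurable A -> mu A = nu A.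
Proof.
move=> s0; apply: (orbit_averages_unique (tds_compact phi)) => e e0.
have [n h] := @half_pow_lt R (5 * s%:R) e (mulr_ge0 (ler0n _ 5) (ler0n _ s)) e0.
exists (ell m n), (qn m n); split=> [|z z']; first exact: ell_gt0.
have [k0 hk] := orbit_shift m0 n z z' s0; exists k0 => k kl.
have E j w : iter j (tds_iter phi s) w = iter (s * j) phi w by have := iterz_tds_iter phi s j w.
by rewrite !E !mulnA; apply: le_lt_trans (hk k kl) h.
Qed.

(** Orbits of the rotation are first coordinates of orbits of [phi], so [orbit_shift] projects to
    the base. *)
Lemma rot_invariant_unique (mu nu : probability (borel (torus1 R)) R) :
  invariant_measure rot mu -> invariant_measure rot nu ->
  forall A : set (borel (torus1 R)), measurable A -> mu A = nu A.
Proof.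
apply: (orbit_averages_unique (@compact_torus1 R)) => e e0.
have [n h] := @half_pow_lt R (5 * 1%:R) e (mulr_ge0 (ler0n _ 5) (ler0n _ 1)) e0.
exists (ell m n), (qn m n); split=> [|t t']; first exact: ell_gt0.
have [k0 hk] := orbit_shift m0 n (t, 0) (t', 0) (ltn0Sn 0); exists k0 => k kl.
have E j s : iter j rot s = (iter j phi (s, 0)).1.
  by elim: j => //= j ->.
have := hk k kl; rewrite !mul1n !E mdist_prodE ge_max => /andP[h1 _].
exact: le_lt_trans h1 h.
Qed.

Definition mulT N (t : torus1 R) : torus1 R := t *+ N.

Lemma metric_lipschitz_continuous (M N : metricType R) (K : R) (f : M -> N) : 0 <= K ->
  (forall x y, mdist (f x) (f y) <= K * mdist x y) -> continuous f.
Proof.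
move=> K0 fK t; apply/cvg_ballP => e e0; have K1 : 0 < K + 1 by rewrite ltr_wpDl.
apply/nbhs_ballP; exists (e / (K + 1)) => /=; first by rewrite divr_gt0.
move=> s; rewrite !ballEmdist /= ltr_pdivlMr// => h; apply: le_lt_trans (fK _ _) _.
by apply: le_lt_trans h; rewrite mulrC ler_wpM2l ?mdist_ge0// lerDl.
Qed.

Lemma mulT_lip N s t : mdist (mulT N s) (mulT N t) <= N%:R * mdist s t.
Proof.
elim: N => [|N IH]; first by rewrite /mulT !mulr0n mdistxx mul0r.
apply: le_trans (metric_triangle _ (s + mulT N t) _) _.
rewrite [_ + mdist _ _]addrC -[N.+1%:R]natr1 mulrDl mul1r addrC /mulT !mulrS; apply: lerD.
  by rewrite ![s + _]addrC mdistT_translate.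
by rewrite mdistT_translate.
Qed.
Lemma toT_mulrn x n : mulT n (toT x) = toT (x *+ n).
Proof. by rewrite /mulT; elim: n => [|n IH]; rewrite ?mulr0n ?toT0// !mulrS toTD IH. Qed.
Lemma continuous_mulT N : continuous (mulT N).
Proof. by apply: (@metric_lipschitz_continuous _ _ N%:R) => //; exact: mulT_lip. Qed.

(** The image measure is invariant under the rotation by [alpha], because translating by [alpha / N]
    beforehand has the same effect. Unique ergodicity identifies it with Lebesgue measure. *)
Lemma mpres_mulT N : (0 < N)%N -> mpres lamT lamT (mulT N).
Proof.
move=> N0; pose f : borel (torus1 R) -> borel (torus1 R) := mulT N.
have mf : measurable_fun setT f by apply: cont_borel; exact: continuous_mulT.
pose ff : {mfun borel (torus1 R) >-> borel (torus1 R)} := HB.pack f (isMeasurableFun.Build _ _ _ _ f mf).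
have p1 : pushforward lamT ff setT = 1%E by rewrite /pushforward preimage_setT probability_setT.
pose H := Measure_isProbability.Build _ _ _ (pushforward lamT ff) p1.
pose nu : probability (borel (torus1 R)) R := HB.pack (pushforward lamT ff) (H mf).
split=> // A mA; have nuE B : nu mf B = lamT (f @^-1` B) by [].
transitivity (nu mf A) => //; apply: rot_invariant_unique mA; last exact: rot_invariant.
move=> B mB; rewrite !nuE; pose b := toT (al / N%:R) : torus1 R.
have mfB : measurable (f @^-1` B) by rewrite -[_ @^-1` _]setTI; exact: (mf measurableT).
rewrite -[RHS](rot_invariant b mfB); congr lamT; apply/funext => t.
have NR : N%:R != 0 :> R by rewrite pnatr_eq0 -lt0n.
rewrite /preimage /= /f {2}/mulT mulrnDl; congr (B (_ + _)).
by rewrite -[b *+ N]/(mulT N b) toT_mulrn -[_ *+ N]mulr_natr divfK.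
Qed.

End rotation_ergodicity.

(** * A measurable section of the circle *)

Section fundamental_domain.
Context (R : realType).
Local Notation lamT := (@torus1_lebesgue R).
Implicit Types (t : torus1 R) (x y : R).

Definition frac x : R := x - (Num.floor x)%:~R.

Lemma frac_itv x : 0 <= frac x < 1.
Proof. by have := floor_itv x; rewrite intrD1 /frac => /andP[]; lra. Qed.
Lemma frac_id x : 0 <= x < 1 -> frac x = x.
Proof. by move=> h; rewrite /frac (@floor_def _ x 0) ?subr0. Qed.
Lemma toT_frac x : toT (frac x) = toT x.
Proof. by rewrite /frac -mulrNz toT_int. Qed.
Lemma frac_int x (z : int) : frac (x + z%:~R) = frac x.
Proof. by rewrite /frac floorDrz ?intr_int// intrKfloor intrD; ring. Qed.

(** The representative [repr] is an arbitrary choice; its fractional part is canonical and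
    measurable. *)
Definition sec t : R := frac (repr t).

Lemma sec_itv t : 0 <= sec t < 1. Proof. exact: frac_itv. Qed.
Lemma toT_sec t : toT (sec t) = t. Proof. by rewrite toT_frac reprT. Qed.
Lemma sec_toT x : sec (toT x) = frac x.
Proof. by rewrite /sec; have [z ->] := toT_repr x; rewrite frac_int. Qed.

(** The only discontinuity is the drop from 1 to 0 at the origin, so the superlevel sets for
    [r >= 0] are open. *)
Lemma measurable_sec : measurable_fun setT (sec : borel (torus1 R) -> measurableTypeR R).
Proof.
apply: (measurability _ (RGenOInfty.measurableE R)) => //.
move=> _ [_ [r ->] <-]; rewrite setTI.
have [r0|r0] := ltP r 0.
  have -> : sec @^-1` `]r, +oo[%classic = setT; last exact: measurableT.
  apply/seteqP; split=> // t _ /=; rewrite in_itv /= andbT.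
  by apply: lt_le_trans r0 _; case/andP: (sec_itv t).
apply: sub_sigma_algebra; rewrite openE => t /=; rewrite in_itv /= andbT => rt.
have /andP[t0 t1] := sec_itv t.
apply/nbhs_ballP; exists (Num.min (sec t - r) (1 - sec t)); first by rewrite /= lt_min !subr_gt0 rt.
move=> s; rewrite ballEmdist /= -{1}(toT_sec t) => /toT_near[y <-]; rewrite lt_min !ltr_norml.
move=> /andP[/andP[h1 h2] /andP[h3 h4]]; rewrite in_itv /= andbT sec_toT frac_id; first by lra.
by apply/andP; split; lra.
Qed.

Lemma torus1_lebesgue_sec (I : set (measurableTypeR R)) :
  lamT (sec @^-1` I) = lebesgue_measure ((`[0, 1[%classic : set R) `&` I).
Proof.
congr lebesgue_measure; apply/seteqP; split=> x [x01] /=; rewrite sec_toT frac_id//;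
by move: x01; rewrite /= in_itv.
Qed.

Lemma measurable_floor : measurable_fun setT (fun x : measurableTypeR R => (Num.floor x)%:~R : R).
Proof.
by apply: nondecreasing_measurable => // x y xy; rewrite ler_int le_floor.
Qed.
Lemma measurable_frac : measurable_fun setT (frac : measurableTypeR R -> R).
Proof. by apply: measurable_funB => //; exact: measurable_floor. Qed.

(** The representative of [x] modulo 1 in [[-1/2, 1/2[], hence of least modulus. *)
Definition rd x : R := frac (x + 2^-1) - 2^-1.

Lemma measurable_rd : measurable_fun setT (rd : measurableTypeR R -> R).
Proof.
apply: measurable_funB; last exact: measurable_cst.
have ma : measurable_fun setT (fun x : measurableTypeR R => x + 2^-1).
  by apply: measurable_funD => //; exact: measurable_cst.
exact: (measurableT_comp measurable_frac ma).
Qed.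
Lemma rd_int x : exists z : int, rd x = x + z%:~R.
Proof. by exists (- Num.floor (x + 2^-1)); rewrite /rd /frac mulrNz; ring. Qed.

Lemma rd_le x (z : int) : `|rd x| <= `|x - z%:~R|.
Proof.
have -> : rd x = rd (x - z%:~R) by rewrite /rd [X in _ = frac X - _]addrAC -mulrNz frac_int.
move: (x - _) => y; have [y2|y2] := ltP `|y| 2^-1; last first.
  by apply: le_trans y2; have := frac_itv (y + 2^-1); rewrite /rd ler_norml; lra.
by rewrite /rd frac_id ?addrK//; move: y2; rewrite ltr_norml; lra.
Qed.

End fundamental_domain.

(** * The invariant multigraph *)

Section invariant_graph.
Context (R : realType) (m : nat) (m0 : (0 < m)%N).
Local Notation q n := ((qn m n)%:R : R).
Local Notation S n := ((Sn m n)%:R : R).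
Local Notation L n := ((Lam m n)%:R : R).
Local Notation al := (alpha R m).
Local Notation phi := (@phi R m m0).
Local Notation lamT := (@torus1_lebesgue R).
Local Notation mR := (m%:R : R).
Implicit Types (s t : torus1 R) (x y u : R).

Let mm : 0 < mR := mR_gt0 R m0.

(* Outside the bad set, the contraction defining kap at step n maps the base
   point of the fibre close to a multiple of 1/m. *)
Definition bad n : set (borel (torus1 R)) :=
  [set t | `|sec (mulT (m * qn m n) t) - 2^-1| < mR / S n].
Definition good N : set (borel (torus1 R)) := \bigcap_(n in [set n | (N <= n)%N]) ~` bad n.
Definition Good : set (borel (torus1 R)) := \bigcup_N good N.

Lemma mS_bound n : mR / S n = 2^-1 ^+ n / (4 * L n ^+ 3).
Proof.
rewrite /Sn /contr_nat natrM natrM !natrX exprVn; have L0 := L_gt0 R m0 n; rewrite exprS exprS.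
by field; rewrite !gt_eqF ?exprn_gt0.
Qed.

Lemma measurable_near_half (d : R) : measurable [set s : borel (torus1 R) | `|sec s - 2^-1| < d].
Proof.
have mf : measurable_fun setT (fun s : borel (torus1 R) => `|sec s - 2^-1|).
  by apply: measurableT_comp => //; apply: measurable_funB; [exact: measurable_sec|exact: measurable_cst].
have := mf measurableT `]-oo, d[%classic (measurable_itv _); rewrite setTI; congr measurable.
Qed.

Lemma meas_bad n : measurable (bad n).
Proof.
have := cont_borel (@continuous_mulT R (m * qn m n)) measurableT (measurable_near_half (mR / S n)).
by rewrite setTI.
Qed.

Lemma bad_measure n : (lamT (bad n) <= (2^-1 ^+ n)%:E)%E.
Proof.
have N0 : (0 < m * qn m n)%N by rewrite muln_gt0 m0 qn_gt0.
have [_ hN] := mpres_mulT R m0 N0.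
pose d := mR / S n; have -> : bad n = mulT (m * qn m n) @^-1` [set s | `|sec s - 2^-1| < d] by [].
rewrite hN; last exact: measurable_near_half.
have d0 : 0 < d by rewrite divr_gt0// S_gt0.
have dle : 2 * d <= 2^-1 ^+ n.
  have L1 := L_ge1 R m0 n; have L3 : 1 <= L n ^+ 3 by rewrite exprn_ege1.
  rewrite /d mS_bound mulrCA ger_pMr ?exprn_gt0// ler_pdivrMr ?mulr_gt0//; lra.
rewrite (_ : [set s | _] = @sec R @^-1` `](2^-1 - d), (2^-1 + d)[%classic); last first.
  apply/seteqP; split=> s /=; rewrite in_itv /= ltr_norml => /andP[h1 h2]; apply/andP; split; lra.
rewrite [X in (X <= _)%E](torus1_lebesgue_sec _); apply: (@le_trans _ _ (lebesgue_measure (`](2^-1 - d), (2^-1 + d)[%classic : set R))).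
  by apply: le_measure; rewrite ?inE//; exact: measurableI.
rewrite lebesgue_measure_itv /= lte_fin; case: ifP => _; last by rewrite lee_fin exprn_ge0.
by rewrite -EFinB lee_fin; lra.
Qed.

Lemma good_ae : {ae lamT, forall t, Good t}.
Proof.
have h2 : 0 <= (2^-1 : R) < 1 by apply/andP; split; lra.
have hb n : (lamT (bad n) <= (1 * 2^-1 ^+ n)%:E)%E by rewrite mul1r; exact: bad_measure.
have := borel_cantelli h2 meas_bad hb.
by apply: aeS => t [N hN]; exists N.
Qed.

Lemma measurable_good N : measurable (good N).
Proof.
by apply: bigcap_measurable => [|n _]; [exists N => /=|apply: measurableC; exact: meas_bad].
Qed.
Lemma measurable_Good : measurable Good.
Proof. by apply: bigcup_measurable => N _; exact: measurable_good. Qed.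

Lemma good_measure N : (lamT (~` good N) <= (2 * 2^-1 ^+ N)%:E)%E.
Proof.
have -> : ~` good N = \bigcup_k bad (N + k).
  apply/seteqP; split=> t.
    move=> /existsNP[n /not_implyP[/= Nn /contrapT bn]]; exists (n - N)%N => //.
    by rewrite subnKC.
  by move=> [k _ bk] /(_ (N + k)%N (leq_addr _ _)).
apply: (@le_trans _ _ (\sum_(k <oo) lamT (bad (N + k)))%E); first apply: measure_sigma_subadditive => //.
- by move=> k; exact: meas_bad.
- by apply: bigcup_measurable => k _; exact: meas_bad.
apply: lime_le; first exact: is_cvg_nneseries.
near=> n; apply: (@le_trans _ _ (\sum_(0 <= k < n) (2^-1 ^+ (N + k))%:E)%E).
  by apply: lee_sum => k _; exact: bad_measure.
rewrite sumEFin lee_fin big_mkord; under eq_bigr do rewrite exprD.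
rewrite -mulr_sumr mulrC ler_wpM2r ?exprn_ge0//.
have e : 2^-1 - 1 = - 2^-1 :> R by lra.
have := subrX1 (2^-1 : R) n; rewrite e; have := exprn_ge0 n (ltac:(lra) : 0 <= 2^-1 :> R); lra.
Unshelve. all: by end_near. Qed.

(** As [kap n] commutes with translations by [1 / m], the [m] points over [t] are encoded by one
    number modulo 1, namely [m] times any of them. *)
Definition base n t : R := mR * kap m n (sec t) 0.

(** Off the bad set the argument [- q n * x] of the contraction lies in the flat part around some
    [z / m], so the contraction replaces it by [z / m] up to [1 / S n]. The translation by [z / m]
    becomes the integer [z] after multiplication by [m]. *)
Lemma base_step n t : ~ bad n t -> exists z : int,
  `|base n.+1 t - base n t - z%:~R| <= 2^-1 ^+ n / (4 * L n ^+ 2).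
Proof.
move=> /negP; rewrite -leNgt; have S0 := S_gt0 R m0 n; have S1 := S_ge1 R m0 n.
have L0 := L_gt0 R m0 n.
pose x := sec t; rewrite -{1}(toT_sec t) toT_mulrn sec_toT -/x => far.
pose s := frac (x *+ (m * qn m n)); have /andP[s0 s1] := frac_itv (x *+ (m * qn m n)).
pose w := Num.floor (x *+ (m * qn m n)).
have xE : q n * x = (s + w%:~R) / mR.
  by rewrite /s /frac subrK -[x *+ _]mulr_natl natrM; field; rewrite gt_eqF.
rewrite -/s in far s0 s1.
have [z hz] : exists z : int, `|0 - q n * x - z%:~R / mR| <= 1 / (2 * mR) - 1 / S n.
  have E (z : int) (a : R) : s + w%:~R + z%:~R = a -> `|a| <= 2^-1 - mR / S n ->
      `|0 - q n * x - z%:~R / mR| <= 1 / (2 * mR) - 1 / S n.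
    move=> aE ha; rewrite xE (_ : _ - _ - _ = - (a / mR)); last by rewrite -aE; field; rewrite gt_eqF.
    rewrite normrN normrM normfV (gtr0_norm mm) ler_pdivrMr// mulrBl.
    have e1 : 1 / (2 * mR) * mR = 2^-1 by rewrite div1r invfM -mulrA mulVf ?mulr1// gt_eqF.
    have e2 : 1 / S n * mR = mR / S n by rewrite div1r mulrC.
    by rewrite e1 e2.
  (* Depending on the half of the period in which the phase lies, the nearest attracting point is at
     its beginning or at its end. *)
  move: far; case: (leP s 2^-1) => h.
    rewrite ler0_norm ?subr_le0// opprB => far; exists (- w); apply: (E _ s); last by rewrite ger0_norm//; lra.
    by rewrite mulrNz; ring.
  rewrite gtr0_norm ?subr_gt0// => far; exists (- w - 1); apply: (E _ (s - 1)).
    by rewrite intrB mulrNz; ring.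
  by rewrite ler0_norm; lra.
exists z; rewrite /base /= -/x.
have cf := contr_flat m0 S1 hz.
have := kap_lip m0 n x x (contr m (S n) (0 - q n * x)) (z%:~R / mR).
have ks := kap_shift m0 n x 0 z; rewrite [0 + z%:~R / _]add0r in ks.
rewrite ks subrr normr0 [0 + `|_|]add0r => kl.
have -> : mR * kap m n x (contr m (S n) (0 - q n * x)) - mR * kap m n x 0 - z%:~R =
  mR * (kap m n x (contr m (S n) (0 - q n * x)) - (kap m n x 0 + z%:~R / mR)).
  by field; rewrite gt_eqF.
rewrite normrM (gtr0_norm mm).
apply: (@le_trans _ _ (mR * (L n * (1 / S n)))).
  apply: ler_wpM2l; first exact: ltW mm.
  by apply: le_trans kl _; apply: ler_wpM2l; [exact: ltW|exact: cf].
rewrite (_ : mR * (L n * (1 / S n)) = L n * (mR / S n)); last by ring.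
by rewrite mS_bound le_eqVlt; apply/orP; left; apply/eqP; field; rewrite gt_eqF.
Qed.

(** Real lifts of [base n], chosen successively with the smallest possible jump, so that convergence
    modulo 1 becomes convergence of real numbers. *)
Fixpoint lifted n t : R := if n is k.+1 then lifted k t + rd (base k.+1 t - lifted k t) else 0.

Lemma lifted_base n t : exists z : int, lifted n t = base n t + z%:~R.
Proof.
case: n => [|n]; first by exists 0; rewrite /base /= mulr0 addr0.
by rewrite [lifted _ _]/=; have [z ->] := rd_int (base n.+1 t - lifted n t); exists z; ring.
Qed.

Lemma lifted_step n t : ~ bad n t ->
  `|lifted n.+1 t - lifted n t| <= 2^-1 ^+ n / (4 * L n ^+ 2).
Proof.
move=> /base_step[z hz]; have [w e] := lifted_base n t.
rewrite [lifted n.+1 t]/= addrAC subrr add0r; apply: le_trans (rd_le _ (z - w)) _.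
by apply: le_trans hz; rewrite e intrB le_eqVlt; apply/orP; left; apply/eqP; congr `|_|; ring.
Qed.

Lemma lifted_cvg N t : good N t -> lifted ^~ t @ \oo --> limn (lifted ^~ t) /\
  forall n, (N <= n)%N -> `|limn (lifted ^~ t) - lifted n t| <= 2^-1 ^+ n / (2 * L n ^+ 2).
Proof.
move=> gt; have step k n : (N <= k)%N -> (k <= n)%N ->
    4 * L k ^+ 2 * `|lifted n.+1 t - lifted n t| <= 2^-1 ^+ n.
  move=> Nk kn; have Ln : L k <= L n by rewrite ler_nat Lam_homo.
  have [Lk0 Ln0] := (L_gt0 R m0 k, L_gt0 R m0 n).
  have h := lifted_step (gt n (leq_trans Nk kn)).
  apply: (@le_trans _ _ (4 * L n ^+ 2 * (2^-1 ^+ n / (4 * L n ^+ 2)))).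
    apply: ler_pM; [by rewrite mulr_ge0// exprn_ge0// ltW|by []| |exact: h].
    by rewrite ler_wpM2l// ler_pXn2r ?nnegrE// ltW.
  by rewrite mulrC divfK// gt_eqF// mulr_gt0// exprn_gt0.
have c k : (N <= k)%N -> lifted ^~ t @ \oo --> limn (lifted ^~ t) /\
    `|limn (lifted ^~ t) - lifted k t| <= 2^-1 ^+ k / (2 * L k ^+ 2).
  move=> Nk; have Lk0 : 0 < 4 * L k ^+ 2 by rewrite mulr_gt0// exprn_gt0// L_gt0.
  (* Rescaling by [4 * L k ^+ 2] turns the weighted increments from the index [k] on into plainly
     geometric ones. *)
  pose u n := 4 * L k ^+ 2 * lifted n t.
  have [cu hu] := @geometric_cvg R u k (fun n kn => ltac:(rewrite /u -mulrBr normrM (gtr0_norm Lk0); exact: step)).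
  have cl : lifted ^~ t @ \oo --> (4 * L k ^+ 2)^-1 * limn u.
    have -> : lifted ^~ t = fun n => (4 * L k ^+ 2)^-1 * u n.
      by apply/funext => n; rewrite /u mulrA mulVf ?mul1r// gt_eqF.
    by apply: cvgM => //; exact: cvg_cst.
  have le := cvg_lim (@Rhausdorff R) cl; split; first by rewrite le.
  have := hu k (leqnn k); rewrite le.
  have -> : limn u - u k = 4 * L k ^+ 2 * ((4 * L k ^+ 2)^-1 * limn u - lifted k t).
    by rewrite mulrBr mulVKf// gt_eqF.
  rewrite normrM (gtr0_norm Lk0) mulrC -ler_pdivlMr// => /le_trans; apply.
  by rewrite le_eqVlt; apply/orP; left; apply/eqP; field; rewrite gt_eqF// L_gt0.
by split=> [|n Nn]; [case: (c N (leqnn N))|case: (c n Nn)].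
Qed.

Definition height t : R := if `[< Good t >] then limn (lifted ^~ t) else 0.

Lemma height_good N n t : good N t -> (N <= n)%N ->
  exists z : int, `|height t - base n t - z%:~R| <= 2^-1 ^+ n / (2 * L n ^+ 2).
Proof.
move=> gN Nn; have Gt : Good t by exists N.
have [_ /(_ n Nn)] := lifted_cvg gN; have [z ->] := lifted_base n t.
by rewrite /height asboolT// opprD addrA => h; exists z.
Qed.

Lemma measurable_base n : measurable_fun setT (base n : borel (torus1 R) -> R).
Proof.
apply: measurable_funM; first exact: measurable_cst.
apply: (@measurableT_comp _ _ _ _ _ _ (fun x : measurableTypeR R => kap m n x 0)); last exact: measurable_sec.
apply: continuous_measurable_fun => x; apply/cvgrPdist_le => e e0.
have L0 := L_gt0 R m0 n; apply/nbhs_ballP; exists (e / L n) => /=; first by rewrite divr_gt0.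
move=> y; rewrite /ball /= ltr_pdivlMr// => h; apply: le_trans (kap_lip m0 n x y 0 0) _.
by rewrite subrr normr0 addr0 mulrC ltW.
Qed.

Lemma measurable_lifted n : measurable_fun setT (lifted n : borel (torus1 R) -> R).
Proof.
elim: n => [|n IH]; first exact: measurable_cst.
have mr : measurable_fun setT (fun t : borel (torus1 R) => base n.+1 t - lifted n t).
  by apply: measurable_funB => //; exact: measurable_base.
exact: measurable_funD IH (measurableT_comp (@measurable_rd R) mr).
Qed.

Lemma measurable_height : measurable_fun setT (height : borel (torus1 R) -> R).
Proof.
apply: (measurable_fun_cvg (h := fun n (t : borel (torus1 R)) => lifted n t * \1_Good t)).
  by move=> n; apply: measurable_funM; [exact: measurable_lifted|exact: measurable_indic measurable_Good].
move=> t _; rewrite /height indicE; case: asboolP => Gt.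
  rewrite mem_set//; under eq_fun do rewrite mulr1.
  by have [N _ gN] := Gt; case: (lifted_cvg gN).
by rewrite memNset//; under eq_fun do rewrite mulr0; exact: cvg_cst.
Qed.

(** Multiplication by [m] merges the graphs [gam j] into this single one, and the multigraph is its
    full preimage ([mulT_gam], [gam_onto]). *)
Definition crv t : torus1 R := toT (height t).
Definition gam (j : nat) t : torus1 R := toT ((height t + j%:R) / mR).

Lemma measurable_crv : measurable_fun setT (crv : borel (torus1 R) -> borel (torus1 R)).
Proof. exact: (measurableT_comp (@measurable_toT R) measurable_height). Qed.

Lemma measurable_gam j : measurable_fun setT (gam j : borel (torus1 R) -> borel (torus1 R)).
Proof.
have mh : measurable_fun setT (fun t : borel (torus1 R) => (height t + j%:R) / mR).
  apply: measurable_funM; last exact: measurable_cst.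
  by apply: measurable_funD; [exact: measurable_height|exact: measurable_cst].
exact: (measurableT_comp (@measurable_toT R) mh).
Qed.

Lemma toT_nat x n : toT (x + n%:R) = toT x. Proof. exact: (toT_int x (Posz n)). Qed.

Lemma mulT_gam j t : mulT m (gam j t) = crv t.
Proof.
by rewrite /gam toT_mulrn -[_ *+ m]mulr_natr divfK ?gt_eqF// toT_nat.
Qed.

Lemma gam_inj t i j : (i < m)%N -> (j < m)%N -> gam i t = gam j t -> i = j.
Proof.
move=> im jm /toT_eqP[z e].
have : (Posz j)%:~R = (Posz i)%:~R + z%:~R * mR :> R.
  have : mR * ((height t + j%:R) / mR) = mR * ((height t + i%:R) / mR + z%:~R) by rewrite e.
  by rewrite mulrDr !(mulrC mR (_ / mR)) !divfK ?gt_eqF// -!pmulrn; lra.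
rewrite -[mR]/((Posz m)%:~R) -intrM -intrD => /eqP; rewrite eqr_int => /eqP h.
have [z1|[z1|z1]] : z <= -1 \/ z = 0 \/ 1 <= z by lia.
- have zm : z * Posz m <= - Posz m by nia.
  by lia.
- by move: h; rewrite z1 mul0r addr0 => -[].
- have zm : Posz m <= z * Posz m by nia.
  by lia.
Qed.

Lemma gam_onto t (y : torus1 R) : mulT m y = crv t -> exists2 j, (j < m)%N & y = gam j t.
Proof.
rewrite -(reprT y) toT_mulrn => /toT_eqP[z e].
exists `|(- z %% Posz m)%Z|%N; first by rewrite -ltz_nat gez0_abs ?ltz_pmod ?modz_ge0//; lia.
apply/eqP; rewrite toT_eq; apply/intrP; exists (- z %/ Posz m)%Z.
have h : (Posz `|(- z %% Posz m)%Z|%N)%:~R = (- z)%:~R - (- z %/ Posz m)%Z%:~R * mR :> R.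
  rewrite gez0_abs ?modz_ge0//; last by lia.
  by rewrite -[mR]/((Posz m)%:~R) -intrM -intrB {2}(divz_eq (- z) (Posz m)) addrC addKr.
rewrite -[(`|_|%N)%:R]/((Posz `|(- z %% Posz m)%Z|%N)%:~R) h e -[_ *+ m]mulr_natr mulrNz.
by field; rewrite gt_eqF.
Qed.

(** In the coordinates of step [n] the multigraph over a good point is near the multiples of
    [1 / m]. One factor [L n] is lost in [iot n] and another is kept in the conclusion for a later
    use of [kap n]; this explains the square in [height_good]. *)
Lemma coord N n t (y : torus1 R) : good N t -> (N <= n)%N -> mulT m y = crv t ->
  exists u (i : int), (t, y) = Kt m n (sec t) u /\ L n * `|u - i%:~R / mR| <= 2^-1 ^+ n / (2 * mR).
Proof.
move=> gt Nn; have [z hz] := height_good gt Nn; have L0 := L_gt0 R m0 n.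
rewrite -(reprT y) toT_mulrn => /toT_eqP[w e]; set Y := repr y; set x := sec t.
exists (iot m n x Y), (z - w); rewrite /Kt kapK// toT_sec; split=> //.
have ks := kap_shift m0 n x 0 (z - w); rewrite add0r in ks.
have := iot_lip m0 n x Y (kap m n x ((z - w)%:~R / mR)); rewrite iotK// => il.
have d : `|Y - kap m n x ((z - w)%:~R / mR)| <= 2^-1 ^+ n / (2 * L n ^+ 2) / mR.
  rewrite ler_pdivlMr// -{2}(gtr0_norm mm) -normrM; apply: le_trans hz.
  rewrite le_eqVlt; apply/orP; left; apply/eqP; congr `|_|.
  by rewrite e ks /base -/x -[_ *+ m]mulr_natr intrB -/Y; field; rewrite gt_eqF.
apply: (@le_trans _ _ (L n * (L n * (2^-1 ^+ n / (2 * L n ^+ 2) / mR)))).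
  rewrite ler_wpM2l ?(ltW L0)//; apply: le_trans il _; by rewrite ler_wpM2l ?(ltW L0).
by rewrite le_eqVlt; apply/orP; left; apply/eqP; field; rewrite !gt_eqF.
Qed.

Lemma curve_near N n x (i : int) : good N (toT x) -> (N <= n)%N ->
  mdist (mulT m (toT (kap m n x (i%:~R / mR)))) (crv (toT x)) <= 2^-1 ^+ n.
Proof.
move=> gt Nn; have [z hz] := height_good gt Nn; have L0 := L_gt0 R m0 n.
have [w xw] : exists w : int, x = sec (toT x) + w%:~R.
  by apply: toT_eqP; rewrite toT_sec.
have ks := kap_shift m0 n x 0 i; rewrite add0r in ks.
rewrite ks toT_mulrn {1}xw kap_base// -[_ *+ m]mulr_natr.
set W := (w * _)%R.
have -> : (kap m n (sec (toT x)) 0 - W%:~R + i%:~R / mR) * mR =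
    base n (toT x) + z%:~R + (i - W * m - z)%:~R.
  by rewrite /base !intrB intrM -pmulrn; field; rewrite gt_eqF.
rewrite toT_int; apply: le_trans (mdist_toT_le _ _) _; rewrite distrC opprD addrA.
apply: le_trans hz _; rewrite ler_pdivrMr ?mulr_gt0 ?exprn_gt0//.
rewrite ler_pMr ?exprn_gt0//.
by have := exprn_ege1 2 (L_ge1 R m0 n); lra.
Qed.

(** For large [n] the point has a coordinate near some [i / m]. One step of [phi] nearly keeps this
    coordinate by [shadow], and over [t + alpha] the points with coordinate [i / m] are near the
    multigraph by [curve_near]. *)
Lemma graph_invariant t (y : torus1 R) : Good t -> Good (t + toT al) -> mulT m y = crv t ->
  mulT m (phi (t, y)).2 = crv (t + toT al).
Proof.
move=> [N _ gN] [N' _ gN'] yt; apply: mdist_positivity; apply/eqP.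
rewrite eq_le mdist_ge0 andbT; apply: (@eps_le _ _ _ 1) => // e e0; rewrite add0r mulr1.
have c0 : 0 < 2 * mR + 1 by rewrite ltr_wpDl// mulr_ge0// ltW.
have [M /(_ (M + N + N')%N) hM] := half_pow_small (divr_gt0 e0 c0).
set n := (M + N + N')%N in hM; have {}hM : 2^-1 ^+ n <= e / (2 * mR + 1).
  have := hM ltac:(by rewrite /n -addnA leq_addr); have := exprn_ge0 n (ltac:(lra) : 0 <= (2^-1 : R)); lra.
have Nn : (N <= n)%N by rewrite /n; lia.
have N'n : (N' <= n)%N by rewrite /n; lia.
have [u [i [E Lu]]] := coord gN Nn yt; set x := sec t in E.
have q1 : (1 <= 1 * qn m n)%N by rewrite mul1n qn_gt0.
have sh := shadow m0 x u q1; rewrite /= -E !mul1r in sh.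
have kl := Kt_lip m0 n (x + al) (x + al) u (i%:~R / mR); rewrite subrr normr0 add0r in kl.
have {}kl : mdist (Kt m n (x + al) u) (Kt m n (x + al) (i%:~R / mR)) <= 2^-1 ^+ n.
  apply: le_trans kl _; apply: le_trans Lu _; rewrite ler_pdivrMr ?mulr_gt0// ler_pMr ?exprn_gt0//.
  by have := mR_ge1 R m0; lra.
have d2 : mdist (phi (t, y)).2 (toT (kap m n (x + al) (i%:~R / mR))) <= 2 * 2^-1 ^+ n.
  have : mdist (phi (t, y)) (Kt m n (x + al) (i%:~R / mR)) <= 2 * 2^-1 ^+ n.
    by apply: le_trans (metric_triangle _ _ _) _; apply: le_trans (lerD sh kl) _; lra.
  by rewrite mdist_prodE ge_max => /andP[].
have tx : toT (x + al) = t + toT al by rewrite toTD toT_sec.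
have cn := @curve_near N' n (x + al) i ltac:(by rewrite tx) N'n; rewrite tx in cn.
apply: le_trans (metric_triangle _ _ _) _; apply: le_trans (lerD (mulT_lip m _ _) cn) _.
have := ler_wpM2l (ltW mm) d2; move: hM; rewrite ler_pdivlMr//; lra.
Qed.

End invariant_graph.

(** * Borel measurability of pairs *)

Section borel_pairs.
Context (R : realType) (X Y : pmetricType R).

(** Compact metric spaces are second countable, so an open set of the product is a countable union
    of open rectangles, whose preimages are measurable. *)
Lemma measurable_pair_borel d (T : measurableType d) (f : T -> borel X) (g : T -> borel Y) :
  compact [set: X] -> compact [set: Y] -> measurable_fun setT f -> measurable_fun setT g ->
  measurable_fun setT (fun t => (f t, g t) : borel (X * Y)%type).
Proof.
move=> cX cY mf mg.
have [B /pcard_surjP[b hb] [oB bB]] := compact_second_countable cX.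
have [B' /pcard_surjP[b' hb'] [oB' bB']] := compact_second_countable cY.
apply: (measurability (@open (X * Y)%type : set (set (borel (X * Y)%type)))) => //.
move=> _ [W oW <-]; rewrite setTI.
pose P (n k : nat) := [/\ open (b n), open (b' k) & b n `*` b' k `<=` W].
pose F n k : set T := if `[< P n k >] then f @^-1` (b n) `&` g @^-1` (b' k) else set0.
have -> : (fun t => (f t, g t)) @^-1` W = \bigcup_n \bigcup_k F n k.
  apply/seteqP; split=> [t /= Wt|t [n _ [k _]]]; last first.
    by rewrite /F; case: asboolP => // -[_ _ sub] [bn bk]; apply: sub.
  have : nbhs (f t, g t) W by exact: (open_nbhs_nbhs (conj oW Wt)).
  move=> [[U V] /= [Uf Vg] sub].
  have [U' [BU Ut] UU] := bB _ _ Uf; have [V' [BV Vt] VV] := bB' _ _ Vg.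
  have [n _ nU] := hb _ BU; have [k _ kV] := hb' _ BV.
  exists n => //; exists k => //; rewrite /F asboolT ?nU ?kV//.
  split; rewrite ?nU ?kV; [exact: oB|exact: oB'|].
  by move=> [x y] [/= Ux Vy]; apply: sub; split=> /=; [exact: UU|exact: VV].
apply: bigcup_measurable => n _; apply: bigcup_measurable => k _.
rewrite /F; case: asboolP => [[on ok _]|_]; last exact: measurable0.
apply: measurableI.
  by rewrite -[_ @^-1` _]setTI; apply: mf => //; exact: sub_sigma_algebra.
by rewrite -[_ @^-1` _]setTI; apply: mg => //; exact: sub_sigma_algebra.
Qed.

End borel_pairs.

(** * The measure carried by the multigraph, its invariance and uniqueness *)

Section graph_measures.
Context (R : realType) (m : nat) (m0 : (0 < m)%N).
Local Notation al := (alpha R m).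
Local Notation phi := (@phi R m m0).
Local Notation lamT := (@torus1_lebesgue R).
Local Notation mR := (m%:R : R).
Implicit Types (t : torus1 R) (z : torus2 R).

Let mm : 0 < mR := mR_gt0 R m0.

Definition Gam (j : nat) t : torus2 R := (t, gam m j t).

Lemma meas_Gam j : measurable_fun setT (Gam j : borel (torus1 R) -> borel (torus2 R)).
Proof.
have mg : measurable_fun setT (gam m j : borel (torus1 R) -> borel (torus1 R)) by exact: measurable_gam.
by apply: (measurable_pair_borel (@compact_torus1 R) (@compact_torus1 R) _ mg); exact: measurable_id.
Qed.

Lemma graph_measure : exists mu : probability (borel (torus2 R)) R,
  (forall A, measurable A -> mu A = ((mR^-1)%:E * \sum_(j < m) lamT (Gam j @^-1` A))%E) /\
  forall F : borel (torus2 R) -> \bar R, measurable_fun setT F -> (forall z, 0 <= F z)%E ->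
    (\int[mu]_z F z = (mR^-1)%:E * \sum_(j < m) \int[lamT]_t F (Gam j t))%E.
Proof.
pose ff j : {mfun borel (torus1 R) >-> borel (torus2 R)} :=
  HB.pack (Gam j) (isMeasurableFun.Build _ _ _ _ (Gam j : borel (torus1 R) -> borel (torus2 R)) (meas_Gam j)).
pose nu0 j : {measure set (borel (torus2 R)) -> \bar R} := pushforward lamT (ff j).
pose nu := nu0 meas_Gam.
have im0 : 0 <= mR^-1 by rewrite invr_ge0 ltW.
pose rho : {measure set (borel (torus2 R)) -> \bar R} := mscale (NngNum im0) (msum nu m).
have rhoE A : rho A = ((mR^-1)%:E * \sum_(j < m) lamT (Gam j @^-1` A))%E.
  by rewrite /rho /mscale /= /msum.
have rho1 : rho setT = 1%E.
  rewrite rhoE; under eq_bigr do rewrite preimage_setT probability_setT.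
  by rewrite sumEFin sumr_const card_ord -EFinM mulVf// gt_eqF.
pose rho0 := mscale (NngNum im0) (msum nu m).
pose H := Measure_isProbability.Build _ _ _ rho0 rho1.
pose mu : probability (borel (torus2 R)) R := HB.pack rho0 H.
exists mu; split=> [A _|F mF F0]; first exact: rhoE.
transitivity (\int[rho]_z F z)%E => //; rewrite /rho ge0_integral_mscale//=; congr (_ * _)%E.
rewrite ge0_integral_measure_sum//; apply: eq_bigr => j _.
transitivity (\int[pushforward lamT (Gam j : borel (torus1 R) -> borel (torus2 R))]_z F z)%E => //.
by rewrite ge0_integral_pushforward//= ?preimage_setT//; exact: meas_Gam.
Qed.

Variable mu : probability (borel (torus2 R)) R.
Hypothesis muE : forall A, measurable A -> mu A = ((mR^-1)%:E * \sum_(j < m) lamT (Gam j @^-1` A))%E.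
Hypothesis muI : forall F : borel (torus2 R) -> \bar R, measurable_fun setT F -> (forall z, 0 <= F z)%E ->
    (\int[mu]_z F z = (mR^-1)%:E * \sum_(j < m) \int[lamT]_t F (Gam j t))%E.

Lemma Rint_graph (u : torus2 R -> R) (K : R) : measurable_fun setT (u : borel (torus2 R) -> R) ->
  (forall z, `|u z| <= K) ->
  \int[mu]_z u z = \int[lamT]_t (mR^-1 * \sum_(j < m) u (Gam j t)).
Proof.
move=> mu_ uK; have iu := intg_bounded mu mu_ uK.
have muG j : measurable_fun setT (fun t : borel (torus1 R) => u (Gam j t)).
  exact: (measurableT_comp mu_ (meas_Gam j)).
have iuG j : intg lamT (fun t => u (Gam j t)) by apply: (intg_bounded lamT (muG j)) => t; exact: uK.
have [iS eS] := Rint_sum (index_enum 'I_m) (fun j : 'I_m => iuG j).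
rewrite RintZ// eS.
have K0 : 0 <= K := le_trans (normr_ge0 _) (uK point).
(* The formula is given for nonnegative functions; the bound [K] is added here and cancelled
   afterwards. *)
have pos : \int[mu]_z (u z + K) = mR^-1 * \sum_(j < m) \int[lamT]_t (u (Gam j t) + K).
  rewrite /Rintegral muI; last 2 first.
  - by apply/measurable_EFinP; apply: measurable_funD => //; exact: measurable_cst.
  - by move=> z; rewrite lee_fin; have := uK z; rewrite ler_norml; lra.
  have fin (j : 'I_m) : (\int[lamT]_t (u (Gam j t) + K)%:E)%E \is a fin_num.
    by apply: integrable_fin_num => //; exact: (intgD (iuG j) (intg_cst lamT K)).
  by rewrite fineM ?sum_fine//; apply/sum_fin_numP => j _ _; exact: fin.
move: pos; rewrite RintD//; last exact: intg_cst.
have -> : \sum_(j < m) \int[lamT]_t (u (Gam j t) + K) = \sum_(j < m) (\int[lamT]_t u (Gam j t) + K).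
  by apply: eq_bigr => j _; rewrite RintD ?Rint_cst//; exact: intg_cst.
rewrite Rint_cst big_split /= sumr_const card_ord mulrDr -[K *+ m]mulr_natl mulrA mulVf ?mul1r ?gt_eqF//.
exact: addIr.
Qed.

(** Over almost every [t], the injective map [T] sends the [m] graph points to graph points over
    [t + b], hence bijectively. The average over the fibre is therefore transported by the
    translation by [b]. *)
Lemma mpres_graph (T : torus2 R -> torus2 R) (b : torus1 R) : continuous T -> injective T ->
  (forall z, (T z).1 = z.1 + b) ->
  {ae lamT, forall t, forall y : torus1 R, mulT m y = crv m t -> mulT m (T (t, y)).2 = crv m (t + b)} ->
  mpres mu mu T.
Proof.
move=> cT iT T1 Tae; have mT := cont_borel cT; split=> // A mA.
have mTA : measurable (T @^-1` A : set (borel (torus2 R))) by rewrite -[_ @^-1` _]setTI; exact: mT.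
suff : fine (mu (T @^-1` A)) = fine (mu A).
  move=> e; rewrite -[LHS]fineK ?fin_num_measure// -[RHS]fineK ?fin_num_measure//.
  by rewrite e.
pose u : torus2 R -> R := \1_A.
have mu_ : measurable_fun setT (u : borel (torus2 R) -> R) by exact: measurable_indic.
have u1 z : `|u z| <= 1 by rewrite /u indicE; case: (_ \in _); rewrite ?normr1 ?normr0.
have indE (B : set (borel (torus2 R))) : measurable B -> fine (mu B) = \int[mu]_z (\1_B z : R).
  by move=> mB; rewrite /Rintegral integral_indic// setIT.
have muT : measurable_fun setT (u \o T : borel (torus2 R) -> R) by exact: (measurableT_comp mu_ mT).
rewrite !indE// [RHS](Rint_graph mu_ u1).
have -> : \int[mu]_z (\1_(T @^-1` A) z : R) = \int[mu]_z (u \o T) z by [].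
rewrite (Rint_graph muT (fun z => u1 (T z))).
pose v t : R := mR^-1 * \sum_(j < m) u (Gam j t).
have muG j : measurable_fun setT (fun t : borel (torus1 R) => u (Gam j t)).
  exact: (measurableT_comp mu_ (meas_Gam j)).
have mv : measurable_fun setT (v : borel (torus1 R) -> R).
  by apply: measurable_funM; [exact: measurable_cst|exact: measurable_sum].
have vK t : `|v t| <= mR^-1 * mR.
  rewrite /v normrM (ger0_norm (ltac:(by rewrite invr_ge0 ltW) : 0 <= mR^-1)) ler_wpM2l ?invr_ge0 ?(ltW mm)//.
  apply: le_trans (ler_norm_sum _ _ _) _; apply: (@le_trans _ _ (\sum_(j < m) (1 : R))).
    by apply: ler_sum => j _; exact: u1.
  by rewrite sumr_const card_ord.
have [_ ev] := Rint_mpres (mpres_tds (rot_invariant b)) (intg_bounded lamT mv vK).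
rewrite -[RHS]/(\int[lamT]_t v t) -ev; apply: ae_Rint.
- apply: measurable_funM; [exact: measurable_cst|apply: measurable_sum => j].
  exact: (measurableT_comp muT (meas_Gam j)).
- exact: (measurableT_comp mv (mpres_tds (rot_invariant b)).1).
apply: aeS Tae => t ht; rewrite /v; congr (_ * _).
have /choice[s hs] (j : 'I_m) : exists k : 'I_m, T (Gam j t) = Gam k (t + b).
  have := ht _ (mulT_gam m0 j t) => /(gam_onto m0)[k km e].
  exists (Ordinal km); rewrite [LHS]surjective_pairing T1 /Gam /=; congr pair; exact: e.
have si : injective s.
  move=> j k jk; apply: val_inj; apply: (gam_inj m0 (ltn_ord j) (ltn_ord k) (t := t)).
  have : T (Gam j t) = T (Gam k t) by rewrite !hs jk.
  by move=> /iT[].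
rewrite [RHS](reindex_inj si); apply: eq_bigr => j _ /=.
by rewrite /u /comp hs.
Qed.

Definition tau (z : torus2 R) : torus2 R := (z.1, z.2 + toT (- mR^-1)).

Lemma mulT_m_inv : mulT m (toT (- mR^-1) : torus1 R) = 0.
Proof.
rewrite toT_mulrn -[_ *+ m]mulr_natl mulrN divff ?gt_eqF// -(toT_nat _ 1) mulr1n addNr.
exact: toT0.
Qed.
Lemma mulTD n (s t : torus1 R) : mulT n (s + t) = mulT n s + mulT n t.
Proof. by rewrite /mulT mulrnDl. Qed.

Lemma continuous_tau : continuous tau.
Proof.
apply: continuous_nonexpansive => z w; rewrite !mdist_prodE /tau /=.
by rewrite mdistT_translate.
Qed.

Lemma mpres_tau : mpres mu mu tau.
Proof.
apply: (@mpres_graph tau 0); first exact: continuous_tau.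
- by move=> [x y] [x' y'] [-> /addIr ->].
- by move=> z; rewrite addr0.
by apply: aeW => t y yt; rewrite /tau /= mulTD mulT_m_inv !addr0.
Qed.

Lemma mu_invariant : invariant_measure phi mu.
Proof.
have [_ h] : mpres mu mu phi; last exact: h.
apply: (@mpres_graph phi (toT al)); first exact: tds_continuous.
- exact: (can_inj (tds_mapK phi)).
- by [].
have g1 := good_ae R m0.
have [N [mN N0 sN]] := g1.
have g2 : {ae lamT, forall t, Good m (t + toT al)}.
  have mp := mpres_tds (rot_invariant (toT al)).
  exists ((rotation (toT al) : torus1 R -> torus1 R) @^-1` N); split.
  - by rewrite -[_ @^-1` _]setTI; exact: mp.1.
  - by rewrite mp.2.
  - by move=> t /= h; apply: sN.
by apply: (aeS2 _ g1 g2) => t G1 G2 y; exact: graph_invariant.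
Qed.

Lemma mu_unique s : (0 < s)%N -> unique_invariant_measure (tds_iter phi s) mu.
Proof.
move=> s0; have inv : invariant_measure (tds_iter phi s) mu.
  exact: (mpres_iter s (mpres_tds mu_invariant)).2.
by split=> // nu inu A mA; exact: phi_invariant_unique s0 inu inv A mA.
Qed.

Lemma rot_unique : unique_invariant_measure (rotation (toT al)) lamT.
Proof.
split; first exact: rot_invariant.
by move=> nu inu A mA; apply: (rot_invariant_unique m0 inu (rot_invariant _) mA).
Qed.
Lemma phi_totally_strictly_ergodic : totally_strictly_ergodic phi.
Proof. by move=> s s0; split; [exact: phi_iter_minimal|exists mu; exact: mu_unique]. Qed.

Lemma mu_unique1 : unique_invariant_measure phi mu.
Proof.
split; first exact: mu_invariant.
move=> nu inu A mA; have i1 (rho : probability (borel (torus2 R)) R) :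
    invariant_measure phi rho -> invariant_measure (tds_iter phi 1) rho by [].
exact: (mu_unique (ltn0Sn 0)).2 (i1 nu inu) A mA.
Qed.

Lemma phi_m_to_one : m_to_one_extension phi (rotation (toT al)) fst m.
Proof.
split; first exact: phi_factor.
exists mu, lamT; split; [exact: mu_unique1|exact: rot_unique|].
pose A : set (borel (torus2 R)) := [set z | mulT m z.2 = crv m z.1].
have c1 : continuous (fst : torus2 R -> torus1 R) by move=> x; exact: cvg_fst.
have c2 : continuous (snd : torus2 R -> torus1 R) by move=> x; exact: cvg_snd.
have mA : measurable A.
  have m1 : measurable_fun setT (fun z : borel (torus2 R) => crv m z.1 : borel (torus1 R)).
    have mc : measurable_fun setT (crv m : borel (torus1 R) -> borel (torus1 R)) by exact: measurable_crv.
    exact: (measurableT_comp mc (cont_borel c1)).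
  have m2 : measurable_fun setT (fun z : borel (torus2 R) => mulT m z.2 : borel (torus1 R)).
    exact: (measurableT_comp (cont_borel (@continuous_mulT R m)) (cont_borel c2)).
  have mpair := measurable_pair_borel (@compact_torus1 R) (@compact_torus1 R) m2 m1.
  pose D : set (borel (torus2 R)) := [set w | w.1 = w.2].
  have mD : measurable D.
    have cD : continuous (fun w : torus2 R => mdist w.1 w.2).
      apply: (@lipschitz_continuous _ _ _ 2) => w w'.
      have t1 := metric_triangle w.1 w'.1 w.2; have t2 := metric_triangle w'.1 w'.2 w.2.
      have t3 := metric_triangle w'.1 w.1 w'.2; have t4 := metric_triangle w.1 w.2 w'.2.
      have d1 : mdist w.1 w'.1 <= mdist w w' by rewrite [leRHS]mdist_prodE le_max lexx.
      have d2 : mdist w.2 w'.2 <= mdist w w' by rewrite [leRHS]mdist_prodE le_max lexx orbT.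
      have s1 := metric_sym w.1 w'.1; have s2 := metric_sym w.2 w'.2.
      by rewrite ler_norml; apply/andP; split; lra.
    have := cont_borelR cD measurableT (measurable_set1 0); rewrite setTI; congr measurable.
    by apply/seteqP; split=> w /= h; [exact: mdist_positivity|rewrite h mdistxx].
  have := mpair measurableT D mD; rewrite setTI; congr measurable.
(* The functions [gam j] are defined and pairwise different at every base point, so the whole base
   can be taken. *)
exists A, setT; split => //.
- rewrite muE//; have -> : \sum_(j < m) lamT (Gam j @^-1` A) = (m%:R%:E)%E.
    under eq_bigr => j _.
      rewrite (_ : Gam j @^-1` A = setT); last first.
        by apply/seteqP; split=> // t _ /=; exact: mulT_gam.
      rewrite probability_setT; over.
    by rewrite sumEFin sumr_const card_ord.
  by rewrite -EFinM mulVf// gt_eqF.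
- exact: probability_setT.
move=> t _; rewrite card_eq_sym; apply/card_set_bijP; exists (fun j => Gam j t); split.
- by move=> j /= jm; split=> //; exact: mulT_gam.
- by move=> i j; rewrite !inE /= => im jm [] /(gam_inj m0 im jm).
- move=> [x y] [/= -> /(gam_onto m0)[j jm e]]; exists j => //=.
  by rewrite /Gam -e.
Qed.

End graph_measures.

(** * Weak limits and dense sets *)

Section weak_limits.
Context (R : realType) (X : pmetricType R) (mu : probability (borel X) R).
Local Notation C := (R[i]).
Local Notation L2 := (L2 mu).
Local Notation inner := (L2inner mu).
Implicit Types (F G H c : X -> C) (e : R).

(** Applied with [c] the indicator [chi n] and [G] the translate of [F] by [tau]: if multiplication
    by [c] halves the relevant inner products, the mixture of [F] and [G] acts weakly like their
    mean. *)
Lemma halved_inner c F G E H e :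
  L2 (fun x => c x * F x) -> L2 (fun x => c x * G x) -> L2 F -> L2 G -> L2 E -> L2 H ->
  L2N mu (fun x => E x - (c x * F x + (1 - c x) * G x)) <= e ->
  csqnorm (inner (fun x => c x * F x) H - 2^-1 * inner F H) <= e ->
  csqnorm (inner (fun x => c x * G x) H - 2^-1 * inner G H) <= e ->
  csqnorm (inner (fun x => E x - 2^-1 * (F x + G x)) H) <= (2 * L2N mu H + 8) * e.
Proof.
move=> LcF LcG LF LG LE LH; pose w x := E x - (c x * F x + (1 - c x) * G x).
have wE : w = fun x => E x - (c x * F x + (G x - c x * G x)).
  by apply/funext => x; rewrite /w mulrBl mul1r.
have LD := L2D LcF (L2B LG LcG); have Lw : L2 w by rewrite wE; exact: (L2B LE LD).
have LFG := L2D LF LG; rewrite -[fun x => E x - (_ + _)]/w => h1 h2 h3.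
have -> : inner (fun x => E x - 2^-1 * (F x + G x)) H = inner w H +
    ((inner (fun x => c x * F x) H - 2^-1 * inner F H) - (inner (fun x => c x * G x) H - 2^-1 * inner G H)).
  rewrite (innerBl LE (L2Z 2^-1 LFG) LH) (innerZl _ LFG LH) (innerDl LF LG LH) wE.
  by rewrite (innerBl LE LD LH) (innerDl LcF (L2B LG LcG) LH) (innerBl LG LcG LH); field.
have cs := le_trans (cauchy_schwarz Lw LH) (ler_wpM2r (L2N_ge0 mu H) h1).
apply: le_trans (csqD_le _ _) _; apply: le_trans (lerD (lexx _) (ler_wpM2l _ (csqD_le _ _))) _ => //.
by rewrite csqN; move: cs h2 h3; lra.
Qed.

Lemma quotient_le (k a e : R) : 0 <= k -> 0 <= a -> 0 < e -> k * (e / (k * a + 1)) * a <= e.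
Proof.
move=> k0 a0 e0; have ka := mulr_ge0 k0 a0; rewrite mulrA -mulrAC ler_pdivrMr; last by lra.
have -> : k * e * a = e * (k * a) by ring.
by apply: ler_wpM2l; lra.
Qed.

(** The operators [D n] are uniformly bounded, so both arguments may be replaced by continuous
    functions at a cost that does not depend on [n]. *)
Lemma inner_small_dense (D : nat -> (X -> C) -> X -> C) : compact [set: X] ->
  (forall n F, L2 F -> L2 (D n F) /\ L2N mu (D n F) <= 4 * L2N mu F) ->
  (forall n F G, D n (fun x => F x - G x) = fun x => D n F x - D n G x) ->
  (forall F H e, ccont F -> ccont H -> 0 < e -> exists n, csqnorm (inner (D n F) H) <= e) ->
  forall F H e, L2 F -> L2 H -> 0 < e -> exists n, csqnorm (inner (D n F) H) <= e.
Proof.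
move=> cX DL DB Dc F H e LF LH e0; pose h := L2N mu H; have h0 : 0 <= h := L2N_ge0 _ _.
have e1 : 0 < e / (24 * h + 1) by rewrite divr_gt0//; lra.
have [_ /(_ _ e1)[F' cF FF]] := cdense_L2 cX LF.
have LF' := ccont_L2 cX mu cF; pose f := L2N mu F'; have f0 : 0 <= f := L2N_ge0 _ _.
have e2 : 0 < e / (48 * f + 1) by rewrite divr_gt0//; lra.
have [_ /(_ _ e2)[H' cH HH]] := cdense_L2 cX LH.
have LH' := ccont_L2 cX mu cH; have e3 : 0 < e / 12 by rewrite divr_gt0.
have [N hN] := Dc _ _ _ cF cH e3; exists N.
have LFF := L2B LF LF'; have LHH := L2B LH LH'.
have [L1 n1] := DL N _ LFF; have [L2' n2] := DL N _ LF'; have [L3 _] := DL N _ LF.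
have -> : inner (D N F) H = inner (D N (fun z => F z - F' z)) H +
    (inner (D N F') (fun z => H z - H' z) + inner (D N F') H').
  by rewrite (innerBr L2' LH LH') subrK DB (innerBl L3 L2' LH) subrK.
apply: le_trans (csqD_le _ _) _; apply: le_trans (lerD (lexx _) (ler_wpM2l _ (csqD_le _ _))) _ => //.
have b1 : L2N mu (D N (fun z => F z - F' z)) * h <= 4 * (e / (24 * h + 1)) * h.
  by apply: ler_wpM2r => //; apply: le_trans n1 _; rewrite ler_wpM2l.
have b2 : L2N mu (D N F') * L2N mu (fun z => H z - H' z) <= 4 * f * (e / (48 * f + 1)).
  by apply: ler_pM; rewrite ?L2N_ge0.
have d1 := le_trans (cauchy_schwarz L1 LH) b1; have d2 := le_trans (cauchy_schwarz L2' LHH) b2.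
have s1 : 24 * (e / (24 * h + 1)) * h <= e by exact: quotient_le.
have s2 : 48 * (e / (48 * f + 1)) * f <= e by exact: quotient_le.
by move: d1 d2 s1 s2 hN; lra.
Qed.

End weak_limits.

(** * Weak limit of the Koopman operators along the half-turn times *)

Section half_turn_mixing.
Context (R : realType) (m : nat) (m0 : (0 < m)%N).
Local Notation phi := (@phi R m m0).
Local Notation lamT := (@torus1_lebesgue R).
Local Notation mR := (m%:R : R).
Local Notation C := (R[i]).
Local Notation tn n := (tn m n).
Local Notation Gam := (@Gam R m).
Local Notation tau := (@tau R m).
Implicit Types (t : torus1 R) (z : torus2 R) (F H : torus2 R -> C).

Let mm : 0 < mR := mR_gt0 R m0.

Lemma csq_half : csqnorm (2^-1 : C) = 4^-1.
Proof. by rewrite csqV; congr _^-1; rewrite /csqnorm -[2]/(1 + 1 : C) reD imD /=; ring. Qed.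

(** The phase of the base point within one period of the contraction of step [n]; it decides how the
    graph points over [t] behave at time [tn n]. *)
Definition clock n t : R := sec (mulT (m * qn m n) t).

(** Graph points have [u] near a multiple of [1 / m], so [u - q n * x] is nearly [- clock / m]
    modulo [1 / m]. A clock value in the upper half therefore falls under [half_turn_stay], one in
    the lower half under [half_turn_move]. *)
Lemma half_turn_graph n t (y : torus1 R) : good m n.+1 t -> mulT m y = crv m t ->
  let d := 2^-1 ^+ n / 2 in
  (2^-1 + d <= clock n t <= 1 - d -> mdist (iter (tn n) phi (t, y)) (t, y) <= 5 * 2^-1 ^+ n) /\
  (d <= clock n t <= 2^-1 - d -> mdist (iter (tn n) phi (t, y)) (tau (t, y)) <= 5 * 2^-1 ^+ n).
Proof.
move=> gt yt d; have [u [i [E Lu]]] := coord m0 gt (leqnn _) yt.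
pose S := (Sn m n)%:R : R; have S0 : 0 < S := S_gt0 R m0 n.
have hp : 0 < 2^-1 ^+ n :> R by exact: exprn_gt0.
have mS : mR / S <= 2^-1 ^+ n / 4.
  rewrite mS_bound// ler_pdivrMr ?mulr_gt0 ?exprn_gt0 ?L_gt0//.
  by have := ler_wpM2l (ltW hp) (exprn_ege1 3 (L_ge1 R m0 n)); rewrite mulr1; lra.
pose rho := mR * (u - i%:~R / mR).
have rhoE : `|rho| <= 2^-1 ^+ n / 4.
  have L1 := L_ge1 R m0 n.+1; rewrite /rho normrM (gtr0_norm mm) mulrC -ler_pdivlMr//.
  apply: (@le_trans _ _ ((Lam m n.+1)%:R * `|u - i%:~R / mR|)).
    by rewrite -[leLHS]mul1r ler_wpM2r.
  by apply: le_trans Lu _; rewrite le_eqVlt exprS; apply/orP; left; apply/eqP; field; rewrite gt_eqF.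
pose x := sec t; pose w := Num.floor (x *+ (m * qn m n)).
have cE : clock n t = x *+ (m * qn m n) - w%:~R.
  by rewrite /clock -{1}(toT_sec t) toT_mulrn sec_toT.
have pE : mR * (u - (qn m n)%:R * x) = rho + i%:~R - clock n t - w%:~R.
  by rewrite cE -[x *+ _]mulr_natl natrM /rho; field; rewrite gt_eqF.
have key (j : int) (a b a' b' : R) : a' = a / mR -> b' = b / mR ->
    a + mR / S <= rho + (i - j)%:~R - clock n t - w%:~R <= b - mR / S ->
    j%:~R / mR + a' + 1 / S <= u - (qn m n)%:R * x <= j%:~R / mR + b' - 1 / S.
  move=> -> -> h; rewrite -(ler_pM2l mm) -[X in _ && X](ler_pM2l mm) pE.
  have e1 : mR * (j%:~R / mR + a / mR + 1 / S) = j%:~R + a + mR / S by field; rewrite !gt_eqF.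
  have e2 : mR * (j%:~R / mR + b / mR - 1 / S) = j%:~R + b - mR / S by field; rewrite !gt_eqF.
  by rewrite e1 e2; move: h; rewrite intrB; lra.
have jE : (i - (i - w - 1))%:~R = w%:~R + 1 :> R by rewrite !intrB; ring.
rewrite /d; split=> hc.
  rewrite E; have := @half_turn_stay R m m0 n x u (i - w - 1); apply.
  have := key (i - w - 1) 0 2^-1 0 (1 / (2 * mR)); rewrite addr0; apply; [by rewrite mul0r|by rewrite mul1r invfM|].
  by rewrite jE; move: rhoE mS hc; rewrite ler_norml; lra.
have -> : tau (t, y) = Kt m n.+1 x (u - 1 / mR).
  have ks := kap_shift m0 n.+1 x u (-1); move: E => [_ ->]; rewrite /tau /Kt toT_sec.
  congr pair; rewrite -[u - 1 / mR](_ : u + (-1)%:~R / mR = _); last by rewrite mulrNz mulNr.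
  by rewrite ks toTD mulrNz mulNr div1r.
rewrite E; have := @half_turn_move R m m0 n x u (i - w - 1); apply.
apply: (key (i - w - 1) 2^-1 1); [by rewrite mul1r invfM|by []|].
by rewrite jE; move: rhoE mS hc; rewrite ler_norml; lra.
Qed.

Lemma measurable_clock n : measurable_fun setT (clock n : borel (torus1 R) -> R).
Proof.
exact: (measurableT_comp (@measurable_sec R) (cont_borel (@continuous_mulT R (m * qn m n)))).
Qed.

Lemma clock_measure n (I : set R) : measurable (I : set (measurableTypeR R)) ->
  lamT [set t | I (clock n t)] = lebesgue_measure ((`[0, 1[%classic : set R) `&` I).
Proof.
move=> mI; have N0 : (0 < m * qn m n)%N by rewrite muln_gt0 m0 qn_gt0.
have [_ h] := mpres_mulT R m0 N0; rewrite -torus1_lebesgue_sec.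
apply: (h [set s | I (sec s)]).
by rewrite -[X in measurable X]setTI; exact: measurable_sec.
Qed.

(** Margins around the clock values 0, 1/2 and 1, where neither alternative of [half_turn_graph] is
    available. *)
Definition edge (d : R) : set R := `[0, d[%classic `|` `]2^-1 - d, 2^-1 + d[%classic `|` `]1 - d, 1]%classic.

Lemma edge_measure (d : R) n : 0 < d -> (lamT [set t | edge d (clock n t)] <= (4 * d)%:E)%E.
Proof.
move=> d0; have mE : measurable (edge d : set (measurableTypeR R)).
  by rewrite /edge; apply: measurableU; [apply: measurableU|]; exact: measurable_itv.
rewrite clock_measure//; apply: (@le_trans _ _ (lebesgue_measure (edge d))).
  by apply: le_measure; rewrite ?inE//; exact: measurableI.
rewrite /edge; apply: le_trans (measureU2 _ _ _) _; [by apply: measurableU; exact: measurable_itv|exact: measurable_itv|].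
have itv (a b : R) (k1 k2 : bool) : a <= b ->
    lebesgue_measure [set` Interval (BSide k1 a) (BSide k2 b)] = (b - a)%:E.
  by rewrite le_eqVlt lebesgue_measure_itv /= lte_fin => /orP[/eqP ->|->]; rewrite ?ltxx ?subrr// EFinB.
apply: (@le_trans _ _ ((d + 2 * d)%:E + d%:E)%E); last by rewrite -EFinD lee_fin; lra.
have itv_le (a b c : R) (k1 k2 : bool) : a <= b -> b - a <= c ->
    (lebesgue_measure [set` Interval (BSide k1 a) (BSide k2 b)] <= c%:E)%E.
  by move=> ab bc; rewrite itv.
apply: leeD; last by apply: itv_le; lra.
apply: le_trans (measureU2 _ _ _) _; [exact: measurable_itv|exact: measurable_itv|].
by rewrite EFinD; apply: leeD; apply: itv_le; lra.
Qed.

Definition chi n t : C := if (2^-1 <= clock n t)%R then 1 else 0.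

Lemma cmeas_chi n : cmeas (chi n).
Proof.
have mi : measurable_fun setT (fun t : borel (torus1 R) => (\1_`[2^-1, +oo[%classic (clock n t) : R)).
  have m1 : measurable_fun setT (\1_`[2^-1, +oo[%classic : measurableTypeR R -> R).
    by apply: measurable_indic; exact: measurable_itv.
  exact: (measurableT_comp m1 (measurable_clock n)).
have -> : chi n = fun t => (\1_`[2^-1, +oo[%classic (clock n t) : R)%:C%C.
  apply/funext => t; rewrite /chi indicE; case: ifP => h.
    by rewrite mem_set//= in_itv /= h.
  by rewrite memNset//= in_itv /= h.
by split; [exact: mi|exact: measurable_cst].
Qed.
Lemma chi01 n t : csqnorm (chi n t) <= 1 /\ csqnorm (1 - chi n t) <= 1.
Proof. by rewrite /chi; case: ifP => _; rewrite ?subrr ?subr0 csq0 csqnorm1. Qed.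

(* Rotation by half a period of the clock exchanges chi and 1 - chi. *)
Lemma chi_equidistributed (k : torus1 R -> C) (e : R) : L2 lamT k -> 0 < e -> exists N, forall n, (N <= n)%N ->
  csqnorm (L2inner lamT k (chi n) - 2^-1 * L2inner lamT k (fun=> 1)) <= e.
Proof.
move=> Lk e0; have [d d0 hd] := near_identity_L2 (@compact_torus1 R) Lk e0.
have [N hN] := half_pow_small d0; exists N => n Nn.
have N0 : (0 < m * qn m n)%N by rewrite muln_gt0 m0 qn_gt0.
have Nr : 0 < (m * qn m n)%:R :> R by rewrite ltr0n.
pose a : R := 2^-1 / (m * qn m n)%:R; pose b : torus1 R := toT a.
have mp := mpres_tds (rot_invariant b).
have Lc : L2 lamT (chi n) := @L2_bounded _ _ lamT (chi n) 1 (cmeas_chi n) (fun t => (chi01 n t).1).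
have L1 : L2 lamT (fun=> 1) by exact: L2_cst.
have bn : mdist b 0 < d.
  rewrite -toT0; apply: le_lt_trans (mdist_toT_le _ _) _; rewrite subr0 ger0_norm; last by rewrite divr_ge0// ltW.
  apply: le_lt_trans (hN n Nn); apply: le_trans (L_over_q R m0 n).
  have q0 := q_gt0 R m0 n; rewrite /a natrM ler_pdivrMr ?mulr_gt0// mulrACA -mulrA mulrCA mulVf ?gt_eqF// mulr1.
  by have := ler_pM ler01 ler01 (L_ge1 R m0 n) (mR_ge1 R m0); lra.
have flip t : chi n (t + b) = 1 - chi n t.
  have E : clock n (t + b) = frac (clock n t + 2^-1).
    rewrite /clock mulTD -{1}(toT_sec (mulT _ t)) /b toT_mulrn -toTD sec_toT -[a *+ _]mulr_natr.
    by rewrite divfK// gt_eqF.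
  rewrite /chi E; have /andP[c0 c1] : 0 <= clock n t < 1 by exact: sec_itv.
  have [h|h] := leP 2^-1 (clock n t).
    have -> : frac (clock n t + 2^-1) = clock n t - 2^-1.
      rewrite -[LHS](frac_int _ (-1)) frac_id; first by rewrite mulrNz; lra.
      by rewrite mulrNz; apply/andP; split; lra.
    by rewrite ifF ?subrr//; apply/negbTE; rewrite -ltNge; lra.
  rewrite frac_id; last by apply/andP; split; lra.
  by rewrite ifT ?subr0//; lra.
pose kb t := k (t + b); have Lkb : L2 lamT kb := L2_mpres mp Lk.
have s1 : L2inner lamT kb (fun t => chi n (t + b)) = L2inner lamT k (chi n) := inner_mpres mp Lk Lc.
have s2 : L2inner lamT kb (fun=> 1) = L2inner lamT k (fun=> 1) := inner_mpres mp Lk L1.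
rewrite (_ : (fun t => chi n (t + b)) = fun t => 1 - chi n t) in s1; last by apply/funext => t; rewrite flip.
rewrite innerBr// s2 in s1.
have -> : L2inner lamT k (chi n) - 2^-1 * L2inner lamT k (fun=> 1) =
    - (2^-1 * (L2inner lamT (fun t => kb t - k t) (chi n))).
  rewrite innerBl//; move: s1; move: (L2inner _ k _) (L2inner _ kb _) (L2inner _ k _) => p q r h.
  have -> : r = p + q by rewrite -h; ring.
  by field.
rewrite csqN csqM; have cs := cauchy_schwarz (L2B Lkb Lk) Lc.
have kk : L2N lamT (fun t => kb t - k t) <= e.
  by apply: (hd (fun t => t + b)) => // t; rewrite -{2}[t]add0r addrC mdistT_translate.
have c1 : L2N lamT (chi n) <= 1 by apply: L2N_bounded => // t; exact: (chi01 n t).1.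
have h2 : csqnorm (2^-1 : C) <= 1 by rewrite csq_half; lra.
by apply: le_trans (ler_pM (csq_ge0 _) (csq_ge0 _) h2 cs) _; rewrite mul1r;
  apply: le_trans (ler_pM (L2N_ge0 _ _) (L2N_ge0 _ _) kk c1) _; rewrite mulr1.
Qed.

Variable mu : probability (borel (torus2 R)) R.
Hypothesis muI : forall F : borel (torus2 R) -> \bar R, measurable_fun setT F -> (forall z, 0 <= F z)%E ->
    (\int[mu]_z F z = (mR^-1)%:E * \sum_(j < m) \int[lamT]_t F (Gam j t))%E.
Local Notation L2 := (L2 mu).
Local Notation inner := (L2inner mu).

Let mpt : mpres mu mu tau. Proof. exact: mpres_tau. Qed.
Let mpp n : mpres mu mu (iter n phi). Proof. by apply: mpres_iter; apply: mpres_tds; exact: mu_invariant. Qed.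
Let c1 : continuous (fst : torus2 R -> torus1 R). Proof. by move=> x; exact: cvg_fst. Qed.
Let c2T : compact [set: torus2 R] := tds_compact phi.

Lemma cmeas_fst (f : torus1 R -> C) : cmeas f -> cmeas (fun z : torus2 R => f z.1).
Proof.
by move=> [fr fi]; split; [exact: (measurableT_comp fr (cont_borel c1))
  |exact: (measurableT_comp fi (cont_borel c1))].
Qed.

Lemma cint_graph (G : torus2 R -> C) (K : R) : cmeas G -> (forall z, csqnorm (G z) <= K) ->
  cintegral mu setT G = cintegral lamT setT (fun t => (mR^-1)%:C%C * \sum_(j < m) G (Gam j t)).
Proof.
move=> [gr gi] gK; have K0 : 0 <= K := le_trans (csq_ge0 _) (gK point).
have bd (P : C -> R) : (forall c : C, P c ^+ 2 <= csqnorm c) -> forall z, `|P (G z)| <= Num.sqrt K.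
  move=> hP z; apply: ler_sqr_le; first exact: sqrtr_ge0.
  by rewrite sqr_sqrtr// real_normK ?num_real//; apply: le_trans (hP _) (gK z).
rewrite /cintegral; congr Complex.
  rewrite (Rint_graph m0 muI gr (bd _ _)); last by move=> z; rewrite lerDl sqr_ge0.
  by apply: eq_Rintegral => t _; rewrite reM /= mul0r subr0 (raddf_sum (@complex.Re R)).
rewrite (Rint_graph m0 muI gi (bd _ _)); last by move=> z; rewrite lerDr sqr_ge0.
by apply: eq_Rintegral => t _; rewrite imM /= mul0r addr0 (raddf_sum (@complex.Im R)).
Qed.

(** Averaging [F] times the conjugate of [H] over the [m] graph points moves inner products for [mu]
    to the base, where [chi_equidistributed] applies. *)
Definition fibre_kern F H t : C := (mR^-1)%:C%C * \sum_(j < m) (F (Gam j t) * (H (Gam j t))^*%C).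

Lemma cmeas_Gam F j : cmeas F -> cmeas (fun t : torus1 R => F (Gam j t)).
Proof.
have mG : measurable_fun setT (Gam j : borel (torus1 R) -> borel (torus2 R)) by exact: meas_Gam.
by move=> [fr fi]; split; [exact: (measurableT_comp fr mG)|exact: (measurableT_comp fi mG)].
Qed.

Lemma fibre_kern_L2 F H : ccont F -> ccont H -> Defs.L2 lamT (fibre_kern F H).
Proof.
move=> cF cH; have [K K0 hK] := ccont_bounded c2T cF; have [K' K'0 hK'] := ccont_bounded c2T cH.
apply: L2Z; apply: L2_sum => j; apply: (@L2_bounded _ _ lamT _ (K * K')) => [|t].
  apply: (cmeas_Gam j (F := fun z => F z * (H z)^*%C)).
  by apply: cmeasM; [|apply: cmeasJ]; exact: ccont_cmeas.
by rewrite csqM csqJ ler_pM ?csq_ge0.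
Qed.

Lemma inner_chi n F H : ccont F -> ccont H ->
  inner (fun z => chi n z.1 * F z) H = L2inner lamT (fibre_kern F H) (chi n) /\
  inner F H = L2inner lamT (fibre_kern F H) (fun=> 1).
Proof.
move=> cF cH; have [K K0 hK] := ccont_bounded c2T cF; have [K' K'0 hK'] := ccont_bounded c2T cH.
have mH := cmeasJ (ccont_cmeas cH); have mF := ccont_cmeas cF.
have bFH z : csqnorm (F z * (H z)^*%C) <= K * K' by rewrite csqM csqJ ler_pM ?csq_ge0.
have bc z : csqnorm (chi n z.1 * F z * (H z)^*%C) <= K * K'.
  rewrite -mulrA csqM; apply: le_trans (bFH z); rewrite -[leRHS]mul1r ler_wpM2r ?csq_ge0//.
  exact: (chi01 n z.1).1.
split; rewrite /L2inner.
  rewrite (cint_graph (cmeasM (cmeasM (cmeas_fst (cmeas_chi n)) mF) mH) bc).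
  congr cintegral; apply/funext => t; rewrite /fibre_kern -mulrA mulr_suml; congr (_ * _).
  apply: eq_bigr => j _ /=; rewrite [RHS]mulrC mulrA; congr (_ * _ * _).
  by rewrite /chi; case: ifP => _; rewrite ?(rmorph1 (@conjc R)) ?(rmorph0 (@conjc R)).
rewrite (cint_graph (cmeasM mF mH) bFH); congr cintegral.
by apply/funext => t; rewrite (rmorph1 (@conjc R)) mulr1.
Qed.

(** Outside the base set [Z] the two sides are close at each graph point, by uniform continuity of
    [F]. On [Z] the squared error is at most [4 K], and [Z] has measure at most [3 * 2^-1 ^+ n]. *)
Lemma half_turn_L2 F (e : R) : ccont F -> 0 < e -> exists N, forall n, (N <= n)%N ->
  L2N mu (fun z => F (iter (tn n) phi z) - (chi n z.1 * F z + (1 - chi n z.1) * F (tau z))) <= e.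
Proof.
move=> cF e0; have [K K0 hK] := ccont_bounded c2T cF.
have e2 : 0 < e / 2 by rewrite divr_gt0.
have [d d0 hd] := ccont_unif c2T cF e2.
have c0 : 0 < e / (24 * K + 1) by rewrite divr_gt0//; lra.
have d5 : 0 < Num.min (d / 5) (e / (24 * K + 1)) by rewrite lt_min c0 divr_gt0.
have [N hN] := half_pow_small d5; exists N => n Nn.
have p0 : 0 < 2^-1 ^+ n :> R by exact: exprn_gt0.
have := hN n Nn; rewrite lt_min => /andP[n1 n2].
have n5 : 5 * 2^-1 ^+ n < d by move: n1; lra.
have nK : 4 * K * (3 * 2^-1 ^+ n) <= e / 2.
  by move: n2; rewrite ltr_pdivlMr; last lra; have := mulr_ge0 K0 (ltW p0); lra.
pose w z := F (iter (tn n) phi z) - (chi n z.1 * F z + (1 - chi n z.1) * F (tau z)).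
have mF := ccont_cmeas cF.
have mw : cmeas w.
  apply: cmeasB; first exact: cmeas_mpres (mpp (tn n)) mF.
  have mc := cmeas_fst (cmeas_chi n); apply: cmeasD; first exact: cmeasM.
  by apply: cmeasM; [apply: cmeasB => //; exact: cmeas_cst|exact: cmeas_mpres mpt mF].
have wE z : w z = F (iter (tn n) phi z) - (if (2^-1 <= clock n z.1)%R then F z else F (tau z)).
  by rewrite /w /chi; case: ifP => _; rewrite ?subrr ?subr0 ?mul1r ?mul0r ?addr0 ?add0r.
have wK z : csqnorm (w z) <= 4 * K.
  rewrite wE; apply: le_trans (csqD_le _ _) _; rewrite csqN.
  by case: ifP => _; have := hK (iter (tn n) phi z); have := hK z; have := hK (tau z); lra.
pose Z : set (borel (torus1 R)) := ~` good m n.+1 `|` [set t | edge (2^-1 ^+ n / 2) (clock n t)].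
have mE : measurable [set t : borel (torus1 R) | edge (2^-1 ^+ n / 2) (clock n t)].
  rewrite -[X in measurable X]setTI; apply: measurable_clock => //.
  by rewrite /edge; apply: measurableU; [apply: measurableU|]; exact: measurable_itv.
have mg : measurable (~` good m n.+1 : set (borel (torus1 R))) by apply: measurableC; exact: measurable_good.
have mZ : measurable Z by exact: measurableU.
have lZ : fine (lamT Z) <= 3 * 2^-1 ^+ n.
  rewrite -lee_fin fineK ?fin_num_measure//; apply: le_trans (measureU2 _ mg mE) _.
  apply: (@le_trans _ _ ((2 * 2^-1 ^+ n.+1)%:E + (4 * (2^-1 ^+ n / 2))%:E)%E).
    by apply: leeD; [exact: good_measure|apply: edge_measure; rewrite divr_gt0].
  by rewrite -EFinD lee_fin exprS; lra.
have point_le t (j : nat) : csqnorm (w (Gam j t)) <= e / 2 + 4 * K * \1_Z t.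
  have [Zt|Zt] := pselect (Z t).
    by rewrite indicE mem_set// mulr1; have := wK (Gam j t); lra.
  rewrite indicE memNset// mulr0 addr0.
  have gt : good m n.+1 t by apply: contrapT => g; apply: Zt; left.
  have [h1 h2] := half_turn_graph gt (mulT_gam m0 j t).
  have ne : ~ edge (2^-1 ^+ n / 2) (clock n t) by move=> g; apply: Zt; right.
  have /andP[c0' c1'] : 0 <= clock n t < 1 by exact: sec_itv.
  rewrite wE /=; case: ifP => hc; apply: hd; apply: le_lt_trans n5.
    apply: h1; apply/andP; split; rewrite leNgt; apply/negP => h; apply: ne.
      by left; right; rewrite /= in_itv /=; apply/andP; split; lra.
    by right; rewrite /= in_itv /=; apply/andP; split; lra.
  move/negbT: hc; rewrite -ltNge => hc.
  apply: h2; apply/andP; split; rewrite leNgt; apply/negP => h; apply: ne.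
    by left; left; rewrite /= in_itv /=; apply/andP; split; lra.
  by left; right; rewrite /= in_itv /=; apply/andP; split; lra.
have mc := cmeas_csq mw.
have -> : L2N mu (fun z => F (iter (tn n) phi z) - (chi n z.1 * F z + (1 - chi n z.1) * F (tau z))) =
    \int[mu]_z csqnorm (w z) by [].
have cK z : `|csqnorm (w z)| <= 4 * K by rewrite ger0_norm ?csq_ge0.
rewrite (Rint_graph m0 muI mc cK).
have iZ : intg lamT (\1_Z : torus1 R -> R).
  have b1 t : `|\1_Z t : R| <= 1 by rewrite indicE; case: (_ \in _); rewrite ?normr1 ?normr0.
  exact: (intg_bounded lamT (measurable_indic mZ) b1).
have eZ : \int[lamT]_t (\1_Z t : R) = fine (lamT Z) by rewrite /Rintegral integral_indic// setIT.
apply: (@le_trans _ _ (\int[lamT]_t (e / 2 + 4 * K * \1_Z t))).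
  have mcG (j : nat) : measurable_fun setT (fun t : borel (torus1 R) => csqnorm (w (Gam j t))).
    by apply: cmeas_csq; exact: cmeas_Gam.
  apply: Rint_le.
  - apply: intgZ; have [h _] := Rint_sum (index_enum 'I_m) (fun j : 'I_m =>
      intg_bounded lamT (mcG j) (fun t => cK (Gam j t))); exact: h.
  - by apply: intgD; [exact: intg_cst|exact: intgZ].
  move=> t; rewrite mulrC ler_pdivrMr// mulr_natr -[m in _ *+ m]card_ord -sumr_const.
  by apply: ler_sum => j _; exact: point_le.
rewrite RintD; [|exact: intg_cst|exact: intgZ].
rewrite Rint_cst RintZ// eZ; have := ler_wpM2l (ltac:(lra) : 0 <= 4 * K) lZ; lra.
Qed.

Definition drift n F z : C := F (iter (tn n) phi z) - 2^-1 * (F z + F (tau z)).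

Lemma drift_ccont F H (e : R) : ccont F -> ccont H -> 0 < e -> exists n, csqnorm (inner (drift n F) H) <= e.
Proof.
move=> cF cH e0; have LH : L2 H := ccont_L2 c2T mu cH; have LF : L2 F := ccont_L2 c2T mu cF.
have cFt : ccont (F \o tau) := ccont_comp (@continuous_tau R m) cF.
have k0 : 0 < 2 * L2N mu H + 8 by rewrite ltr_wpDl// mulr_ge0// L2N_ge0.
have e1 := divr_gt0 e0 k0.
have [N1 H1] := half_turn_L2 cF e1.
have [N2 H2] := chi_equidistributed (fibre_kern_L2 cF cH) e1.
have [N3 H3] := chi_equidistributed (fibre_kern_L2 cFt cH) e1.
pose n := (N1 + N2 + N3)%N; exists n.
have [l1 l2 l3] : [/\ N1 <= n, N2 <= n & N3 <= n]%N by rewrite /n; clear; split; lia.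
have [i1 i2] := inner_chi n cF cH; have [j1 j2] := inner_chi n cFt cH.
have a2 := H2 n l2; have a3 := H3 n l3; rewrite -i1 -i2 in a2; rewrite -j1 -j2 in a3.
have Lchi (f : torus2 R -> C) : ccont f -> L2 (fun z => chi n z.1 * f z).
  move=> cf; have [K' K'0 hK'] := ccont_bounded c2T cf; apply: (@L2_bounded _ _ mu _ K').
    by apply: cmeasM; [exact: cmeas_fst (cmeas_chi n)|exact: ccont_cmeas].
  by move=> z; rewrite csqM -[leRHS]mul1r ler_pM ?csq_ge0//; exact: (chi01 n z.1).1.
have -> : e = (2 * L2N mu H + 8) * (e / (2 * L2N mu H + 8)) by rewrite mulrC divfK// gt_eqF.
exact: (halved_inner (Lchi F cF) (Lchi (F \o tau) cFt) LF (L2_mpres mpt LF) (L2_mpres (mpp (tn n)) LF)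
  LH (H1 n l1) a2 a3).
Qed.

Lemma drift_L2 n F : L2 F -> L2 (drift n F) /\ L2N mu (drift n F) <= 4 * L2N mu F.
Proof.
move=> LF; have LFt : L2 (F \o tau) := L2_mpres mpt LF.
have LFn : L2 (fun z => F (iter (tn n) phi z)) := L2_mpres (mpp (tn n)) LF.
have LFF := L2D LF LFt; have LZ := L2Z 2^-1 LFF; split; first exact: L2B LFn LZ.
apply: le_trans (L2NB_le LFn LZ) _; rewrite (L2NZ _ LFF) csq_half.
rewrite (_ : L2N mu (fun z => F (iter (tn n) phi z)) = L2N mu F); last exact: L2N_mpres (mpp (tn n)) LF.
have := L2ND_le LF LFt; rewrite (L2N_mpres mpt LF); lra.
Qed.

Lemma drift_small F H (e : R) : L2 F -> L2 H -> 0 < e -> exists n, csqnorm (inner (drift n F) H) <= e.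
Proof.
apply: (inner_small_dense c2T drift_L2); last exact: drift_ccont.
by move=> n G G'; apply/funext => z; rewrite /drift; ring.
Qed.

End half_turn_mixing.

(** * The spectrum of the diffeomorphism *)

Section spectrum_of_phi.
Context (R : realType) (m : nat) (m0 : (0 < m)%N).
Local Notation al := (alpha R m).
Local Notation phi := (@phi R m m0).
Local Notation rot := (rotation (toT al)).
Local Notation lamT := (@torus1_lebesgue R).
Local Notation mR := (m%:R : R).
Local Notation C := (R[i]).
Local Notation Gam := (@Gam R m).
Local Notation tau := (@tau R m).
Implicit Types (t : torus1 R) (z : torus2 R) (F : torus2 R -> C).

Let mm : 0 < mR := mR_gt0 R m0.

Lemma iter_phi_fst k z : (iter k phi z).1 = z.1 + toT al *+ k.
Proof. by elim: k => [|k IH]; rewrite ?mulr0n ?addr0// iterS mulrSr addrA -IH. Qed.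
Lemma echar_mulrn t k : echar (t *+ k) = echar t ^+ k.
Proof. by elim: k => [|k IH]; rewrite ?mulr0n -?toT0 ?echar_toT ?ec0// mulrS echarD IH exprS. Qed.

Lemma eigenvec_echar k : eigenvec rot lamT (echar (toT al) ^+ k) (fun t => echar t ^+ k).
Proof.
split; first exact: echarX_L2.
by apply: aeW => t /=; rewrite /koopman /= echarD exprMn mulrC.
Qed.

Lemma L2N_echar k : L2N lamT (fun t => echar t ^+ k) = 1.
Proof.
rewrite /L2N -[RHS](Rint_cst lamT 1); apply: eq_Rintegral => t _.
by rewrite csqX (circle_echar t : csqnorm _ = 1) expr1n.
Qed.

(** The powers are the characters of the orbit of 0 under the rotation, and [orbit_dense] makes this
    orbit dense. *)
Lemma echar_dense (a : C) : circle a -> forall e : R, 0 < e -> exists k, csqnorm (echar (toT al) ^+ k - a) <= e.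
Proof.
move=> ca e e0; have [x [_ _ xa]] := circle_ecP ca.
have p0 : 0 < 4 * pi :> R by rewrite mulr_gt0// pi_gt0.
have d0 : 0 < Num.sqrt e / (4 * pi) by rewrite divr_gt0// sqrtr_gt0.
have [k] := orbit_dense m0 (toT x, 0) (0, 0) (ltn0Sn 0) d0.
rewrite mdist_prodE gt_max => /andP[+ _]; rewrite mul1n iter_phi_fst /= add0r => hk; exists k.
rewrite -csqN opprB -dC_sqr -xa -echar_toT -echar_mulrn -[leRHS](sqr_sqrtr (ltW e0)).
rewrite ler_sqr ?nnegrE ?dC_ge0 ?sqrtr_ge0//; apply: le_trans (echar_lip _ _) _.
by rewrite mulrC -ler_pdivlMr// ltW.
Qed.

Lemma rotation_spectrum : dynamical_spectrum rot lamT = @circle R.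
Proof.
apply: dynamical_spectrum_dense => [|z cz e e0]; first exact: rot_invariant.
have [k hk] := echar_dense cz e0; exists (echar (toT al) ^+ k), (fun t => echar t ^+ k).
by split; [|exact: eigenvec_echar|rewrite L2N_echar].
Qed.

Lemma qn_ge n : (n <= qn m n)%N.
Proof.
elim: n => // n IH; rewrite qnS; apply: leq_ltn_trans IH _.
by rewrite ltn_Pmulr ?qn_gt0// ell_ge2.
Qed.

Variable mu : probability (borel (torus2 R)) R.
Hypothesis muE : forall A, measurable A -> mu A = ((mR^-1)%:E * \sum_(j < m) lamT (Gam j @^-1` A))%E.
Hypothesis muI : forall F : borel (torus2 R) -> \bar R, measurable_fun setT F -> (forall z, 0 <= F z)%E ->
    (\int[mu]_z F z = (mR^-1)%:E * \sum_(j < m) \int[lamT]_t F (Gam j t))%E.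
Local Notation L2 := (L2 mu).
Local Notation inner := (L2inner mu).

Let inv : invariant_measure phi mu. Proof. exact: mu_invariant. Qed.
Let mpt : mpres mu mu tau. Proof. exact: mpres_tau. Qed.
Let c2T : compact [set: torus2 R] := tds_compact phi.

Lemma mpres_fst : mpres mu lamT fst.
Proof.
have c1 : continuous (fst : torus2 R -> torus1 R) by move=> x; exact: cvg_fst.
have mf := cont_borel c1; split=> // A mA; have := mf measurableT A mA; rewrite setTI => mfA.
rewrite muE// (eq_bigr (fun=> lamT A))// -[lamT A]fineK ?fin_num_measure//.
by rewrite sumEFin sumr_const card_ord -EFinM -[fine _ *+ m]mulr_natl mulrA mulVf ?mul1r ?fineK ?fin_num_measure ?gt_eqF.
Qed.

Lemma phi_rigid g : L2 g -> forall (e : R) N, 0 < e ->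
  exists2 n, (N <= n)%N & L2N mu (fun x => g (iter n phi x) - g x) <= e.
Proof.
apply: (rigid_L2 c2T inv) => e N e0; have [M hM] := half_pow_small e0.
exists (qn m (M + N)); first by apply: leq_trans (leq_addl M N) (qn_ge _).
by move=> z; apply: le_lt_trans (rigid m0 _ z) (hM _ (leq_addr _ _)).
Qed.

Lemma phi_eigenvalues_dense (a : C) : circle a -> forall e : R, 0 < e -> exists w g,
  [/\ csqnorm (w - a) <= e, eigenvec phi mu w g & 0 < L2N mu g].
Proof.
move=> ca e e0; have [k hk] := echar_dense ca e0.
have [Lg eg] := eigenvec_echar k.
exists (echar (toT al) ^+ k), (fun z => echar z.1 ^+ k); split=> //; last first.
  by rewrite (L2N_mpres mpres_fst Lg) L2N_echar.
by split; [exact: L2_mpres mpres_fst Lg|exact: eqL2_mpres mpres_fst eg].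
Qed.
Lemma phi_spectrum : dynamical_spectrum phi mu = @circle R.
Proof. exact: dynamical_spectrum_dense inv phi_eigenvalues_dense. Qed.

Let mGam j (N : set (borel (torus2 R))) : measurable N -> measurable (Gam j @^-1` N : set (borel (torus1 R))).
Proof. by move=> mN; have := meas_Gam m0 j measurableT mN; rewrite setTI. Qed.

Lemma ae_graph (P : torus2 R -> Prop) : {ae mu, forall z, P z} ->
  {ae lamT, forall t, forall j, (j < m)%N -> P (Gam j t)}.
Proof.
move=> [N [mN N0 sN]]; pose B j : set (borel (torus1 R)) := if (j < m)%N then Gam j @^-1` N else set0.
suff h j : lamT.-negligible (B j).
  apply: negligibleS (negligible_bigcup h) => t /= nt; apply: contrapT => nB; apply: nt => j jm.
  by apply: contrapT => nP; apply: nB; exists j => //; rewrite /B jm; exact: sN.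
rewrite /B; case: ifP => jm; last exact: negligible_set0.
exists (Gam j @^-1` N); split; [exact: mGam| |by []].
have := muE mN; rewrite N0 => /esym/eqP; rewrite mule_eq0 gt_eqF ?lte_fin ?invr_gt0//=.
rewrite (bigD1 (Ordinal jm))//= => /eqP h; apply/eqP; rewrite eq_le measure_ge0 andbT -h leeDl//.
by apply: sume_ge0.
Qed.

Lemma graph_ae (P : set (borel (torus2 R))) : measurable P ->
  {ae lamT, forall t, forall j, (j < m)%N -> P (Gam j t)} -> {ae mu, forall z, P z}.
Proof.
move=> mP [N [mN N0 sN]]; exists (~` P); split=> //; first exact: measurableC.
rewrite muE; last exact: measurableC.
rewrite big1 ?mule0// => j _; apply: (subset_measure0 (B := N)) => //.
  by apply: mGam; exact: measurableC.
by move=> t /= nP; apply: sN => h; apply: nP; exact: h.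
Qed.

Lemma eigenvec_iter w F n : eigenvec phi mu w F -> eqL2 mu (fun z => F (iter n phi z)) (fun z => w ^+ n * F z).
Proof.
move=> [LF eF]; elim: n => [|n IH]; first by apply: aeW => z; rewrite expr0 mul1r.
have h := eqL2_mpres (mpres_iter n (mpres_tds inv)) eF.
by move: h IH; apply: aeS2 => z /=; rewrite /koopman /= => -> ->; rewrite exprS mulrA.
Qed.

(** Let [r] be the squared norm of [F] and [c] the inner product of [F \o tau] and [F]. The inner
    product of [U^n F] and [F] has modulus [r] for all [n], but along the half-turn times it comes
    close to [(r + c) / 2]. As [|c| <= r], this forces [c = r], and then [F \o tau] equals [F]. *)
Lemma eigenvec_tau w F : eigenvec phi mu w F -> 0 < L2N mu F -> eqL2 mu (F \o tau) F.
Proof.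
move=> eF n0; have LF := eF.1; have LFt : L2 (F \o tau) := L2_mpres mpt LF.
apply: eqL2_L2N => //; set r := L2N mu F in n0.
have rt : L2N mu (F \o tau) = r := L2N_mpres mpt LF.
pose c := inner (F \o tau) F; have cr : csqnorm c <= r ^+ 2.
  by have := cauchy_schwarz LFt LF; rewrite rt expr2.
suff rc : r <= re c.
  apply/eqP; rewrite eq_le L2N_ge0 andbT.
  have -> : L2N mu (fun z => (F \o tau) z - F z) = 2 * r - 2 * re c; last by lra.
  rewrite (L2ND LFt (L2opp LF)) L2N_opp rt -/r.
  rewrite (_ : inner _ (fun x => - F x) = - c); first by rewrite reN; ring.
  rewrite (_ : (fun x => - F x) = fun x => (-1) * F x); last by apply/funext => x; rewrite mulN1r.
  by rewrite (innerZr _ LFt LF) (rmorphN1 (@conjc R)) mulN1r.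
have cw := eigenvec_circle inv eF n0.
pose s : C := 2^-1 * (r%:C%C + c).
have sE : csqnorm s = 4^-1 * (r ^+ 2 + csqnorm c + 2 * r * re c).
  by rewrite csqM csq_half /csqnorm reD imD /=; ring.
have rs : r <= Num.sqrt (csqnorm s).
  apply: (@eps_le _ _ _ 1) => // e e0; rewrite mulr1.
  have [n hn] := drift_small m0 muI LF LF (exprn_gt0 2 e0).
  have LFn : L2 (fun z => F (iter (tn m n) phi z)) := L2_mpres (mpres_iter _ (mpres_tds inv)) LF.
  have E : inner (drift m0 n F) F = w ^+ tn m n * r%:C%C - s.
    rewrite /drift (innerBl LFn (L2Z _ (L2D LF LFt)) LF) (innerZl _ (L2D LF LFt) LF) (innerDl LF LFt LF).
    rewrite inner_sqr; congr (_ - _).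
    by rewrite (inner_aeL LFn (L2Z _ LF) LF (eigenvec_iter _ eF)) (innerZl _ LF LF) inner_sqr.
  have wr : dC (w ^+ tn m n * r%:C%C) 0 = r.
    rewrite /dC subr0 csqM csqX (cw : csqnorm w = 1) expr1n mul1r.
    by rewrite (_ : csqnorm _ = r ^+ 2) ?sqrtr_sqr ?gtr0_norm// /csqnorm /= expr0n addr0.
  rewrite -[leLHS]wr; apply: le_trans (dC_triangle _ s _) _; rewrite addrC /dC subr0 lerD2l.
  by rewrite -E -[leRHS]gtr0_norm// -sqrtr_sqr ler_wsqrtr.
have : r ^+ 2 <= csqnorm s.
  by rewrite -[leRHS]sqr_sqrtr ?csq_ge0// ler_sqr ?nnegrE ?sqrtr_ge0// ltW.
rewrite sE => h; rewrite -(ler_pM2l n0); move: h cr; rewrite expr2; clear; move: (re c) => x; move: (csqnorm c) (r * r) => *; lra.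
Qed.

(** By [eigenvec_tau] an eigenfunction takes a single value on the [m] graph points over almost
    every [t], so it descends to a function [f] on the base. The map [phi] sends the point of graph
    0 to some graph point over [t + alpha], where [F] again has the value of [f]. *)
Lemma eigenvalues_phi : dynamical_eigenvalues phi mu = dynamical_eigenvalues rot lamT.
Proof.
apply/seteqP; split=> w [F [LF nF eF]]; last first.
  exists (F \o fst); split; [exact: L2_mpres mpres_fst LF|move=> h; apply: nF|exact: (eqL2_mpres mpres_fst eF)].
  apply: L2N_ae0 => //; rewrite -(L2N_mpres mpres_fst LF).
  rewrite (L2N_ae (cmeas_mpres mpres_fst (L2_meas LF)) (cmeas_cst _ _) h).
  by rewrite /L2N csq0 Rint_cst.
have n0 : 0 < L2N mu F.
  by rewrite lt_neqAle L2N_ge0 andbT eq_sym; apply/eqP => h; apply: nF; exact: L2N_ae0.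
have ht := ae_graph (eigenvec_tau (conj LF eF) n0); have he := ae_graph eF.
pose f t := F (Gam 0 t).
have mf : cmeas f := cmeas_Gam m0 0 (L2_meas LF).
have flat : {ae lamT, forall t, forall j, (j < m)%N -> F (Gam j t) = f t}.
  (* Translating the point of graph [j.+1] by [- 1 / m] gives that of graph [j], so the invariance
     propagates along the index. *)
  apply: aeS ht => t ht; elim=> // j IH jm; rewrite -(IH (ltnW jm)) -(ht j.+1 jm) /=; congr F.
  rewrite /Gam /tau /= /gam -toTD; congr (_, toT _).
  by rewrite -natr1 addrA [in LHS]mulrDl div1r addrK.
have Lf : Defs.L2 lamT f.
  apply/L2P; split=> //; apply/integrableP; split.
    by apply/measurable_EFinP; exact: cmeas_csq.
  have mc := cmeas_csq (L2_meas LF).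
  have /integrableP[_] := L2_intg LF; rewrite /= muI; last 2 first.
  - by apply/measurable_EFinP; apply: measurableT_comp.
  - by move=> z; rewrite lee_fin.
  rewrite (bigD1 (Ordinal m0))//= => h.
  have : ((mR^-1)%:E * \int[lamT]_t (`|csqnorm (F (Gam 0 t))|%R)%:E < +oo)%E.
    apply: le_lt_trans h; rewrite lee_pmul2l ?lte_fin ?invr_gt0// leeDl//.
    by apply: sume_ge0 => i _; apply: integral_ge0 => t _; rewrite lee_fin.
  have : (0 <= \int[lamT]_t (`|csqnorm (f t)|%R)%:E)%E by apply: integral_ge0 => t _; rewrite lee_fin.
  rewrite -/(f _); under eq_integral do rewrite -/(f _).
  case: (\int[lamT]_t _)%E => [r _ _| _ |//]; first exact: ltry.
  by rewrite gt0_muley// lte_fin invr_gt0.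
exists f; split=> //.
  move=> f0; apply: nF; have mF := cmeas_csq (L2_meas LF).
  have mZ : measurable [set z : borel (torus2 R) | csqnorm (F z) = 0].
    by have := mF measurableT _ (measurable_set1 0); rewrite setTI.
  have := graph_ae mZ; move=> /(_ _)/aeS; apply; first by move=> z /= /csq_eq0.
  by move: flat f0; apply: aeS2 => t fl ft j jm /=; rewrite fl// ft csq0.
have [mr mpr] := mpres_tds (rot_invariant (toT al)).
have rotated (P : torus1 R -> Prop) : {ae lamT, forall t, P t} -> {ae lamT, forall t, P (t + toT al)}.
  move=> [N [mN N0 sN]]; exists ((fun t => t + toT al) @^-1` N); split; [| |by move=> t /= h; exact: sN].
    by have := mr measurableT N mN; rewrite setTI.
  by rewrite -N0; exact: (mpr N mN).
have step : {ae lamT, forall t, Good m t /\ Good m (t + toT al)}.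
  by move: (good_ae R m0) (rotated _ (good_ae R m0)); apply: aeS2.
have step2 : {ae lamT, forall t, F (phi (Gam 0 t)) = f (t + toT al)}.
  move: step (rotated _ flat); apply: aeS2 => t [g1 g2] fl.
  have [j jm e] := gam_onto m0 (graph_invariant m0 g1 g2 (mulT_gam m0 0 t)).
  rewrite -(fl j jm) /Gam -e; congr F; rewrite [LHS]surjective_pairing; congr pair.
move: step2 he; apply: aeS2 => t; rewrite /koopman /= => <- h; exact: (h 0%N m0).
Qed.

(** The fibre character satisfies [g \o tau = b g] with [b] the root of unity of angle [- 1 / m],
    different from 1 when [m > 1]. Tested against [g], the weak limit then multiplies by
    [(1 + b) / 2], of modulus below 1, so [smeas_nonatomic] excludes atoms, while rigidity makes the
    measure singular. *)
Lemma spectrum_sc_phi : (1 < m)%N -> spectrum_sc phi mu !=set0.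
Proof.
move=> m1; have cs : continuous (snd : torus2 R -> torus1 R) by move=> x; exact: cvg_snd.
pose g z : C := echar z.2.
have cg : ccont g := ccont_comp cs (@ccont_echar R).
have Lg : L2 g := ccont_L2 c2T mu cg.
have gN : L2N mu g = 1.
  rewrite /L2N -[RHS](Rint_cst mu 1); apply: eq_Rintegral => z _; exact: circle_echar.
pose b : C := ec (- mR^-1).
have gt : g \o tau = fun z => b * g z.
  by apply/funext => z; rewrite /g /tau /= echarD echar_toT mulrC.
have cb : csqnorm b = 1 by exact: circle_ec.
have b1 : b != 1.
  rewrite /b ecN; apply/negP => /eqP h; have /negP[] : ec mR^-1 != 1.
    by apply: ec_neq1; rewrite invr_gt0 mm /= invf_lt1// ltr1n.
  by apply/eqP; rewrite -[LHS]invrK h invr1.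
have theta1 : csqnorm (2^-1 * (1 + b)) < 1.
  rewrite csqM csq_half; have -> : csqnorm (1 + b) = 2 + 2 * re b.
    by move: cb; rewrite /csqnorm reD imD /=; lra.
  suff : re b < 1 by lra.
  rewrite ltNge; apply/negP => rb; move/eqP: b1; apply.
  move: cb; rewrite /csqnorm => cb'; have ib : im b = 0.
    by apply/eqP; rewrite -sqrf_eq0 eq_le sqr_ge0 andbT; nra.
  apply: cplxP; rewrite ?ib//=; apply/eqP; rewrite eq_le rb andbT.
  exact: cos_le1.
have [nu snu] := smeas_exists inv Lg.
have scg : L2sc phi mu g.
  split=> //; exists nu; split; first exact/(spectral_measureP inv phi_spectrum _ Lg).
  split; last first.
    have [A [mA A0 nA]] := smeas_singular inv phi_rigid Lg snu; exists A; split=> //.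
    by exists (~` A); split=> //; exact: measurableC.
  apply: (smeas_nonatomic inv Lg snu theta1) => f uf e e0.
  set F := fcT phi mu f g; have LF : L2 F by exact: fcT_L2.
  have [n hn] := drift_small m0 muI LF Lg e0; exists (tn m n).
  have LFt : L2 (F \o tau) := L2_mpres mpt LF.
  have LFn : L2 (fun z => F (iter (tn m n) phi z)) := L2_mpres (mpres_iter _ (mpres_tds inv)) LF.
  have bE : inner (F \o tau) g = b * inner F g.
    rewrite -(inner_mpres mpt LF Lg) gt (innerZr _ LFt Lg) mulrA mulJ_csq cb.
    by rewrite mul1r.
  move: hn; rewrite /drift (innerBl LFn (L2Z _ (L2D LF LFt)) Lg) (innerZl _ (L2D LF LFt) Lg) (innerDl LF LFt Lg) bE.
  by rewrite -mulrA [in (1 + b) * _]mulrDl mul1r.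
by apply: (spectrum_sc_nonempty inv phi_spectrum scg); rewrite gN.
Qed.

End spectrum_of_phi.

Theorem theorem1p2 (R : realType) (m : nat) (hm : (0 < m)%N) :
  exists (phi : tds (torus2 R)) (alpha : R)
         (mu : probability (borel (torus2 R)) R),
    let R_alpha := rotation (toT alpha) in
    [/\ smooth_diffeo phi /\ unique_invariant_measure phi mu,
        (* (a) *)
        irrational alpha /\ is_skew_product phi (toT alpha),
        (* (b) *)
        [/\ totally_strictly_ergodic phi,
            m_to_one_extension phi R_alpha fst m &
            is_MEF phi R_alpha fst],
        (* (c) *)
        exists gamma : 'I_m -> borel (torus1 R) -> borel (torus1 R),
          [/\ forall j, measurable_fun setT (gamma j),
              forall A : set (borel (torus2 R)), measurable A ->
                mu A = ((m%:R^-1)%:E * \sum_(j < m)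
                  torus1_lebesgue ((fun x => (x, gamma j x)) @^-1` A))%E &
              forall i j : 'I_m, i != j ->
                {ae (@torus1_lebesgue R), forall x, gamma i x <> gamma j x}] &
        (* (d) *)
        [/\ spectrum_pp phi mu = dynamical_spectrum R_alpha (@torus1_lebesgue R),
            dynamical_eigenvalues phi mu =
              dynamical_eigenvalues R_alpha (@torus1_lebesgue R),
            spectrum_ac phi mu = set0 &
            (1 < m)%N -> spectrum_sc phi mu !=set0]].
Proof.
have [mu [muE muI]] := graph_measure R hm.
have inv : invariant_measure (@phi R m hm) mu by exact: mu_invariant.
have rig := phi_rigid hm muI; have spec := phi_spectrum hm muE muI.
exists (@phi R m hm), (alpha R m), mu; split.
- by split; [exact: phi_smooth|exact: mu_unique1].
- by split; [exact: alpha_irrational|exact: phi_skew].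
- by split; [exact: (phi_totally_strictly_ergodic hm muI)|exact: (phi_m_to_one hm muE muI)|exact: phi_MEF].
- exists (fun j => gam m j); split=> [j|//|i j ij]; first exact: measurable_gam.
  by apply: aeW => t /(gam_inj hm (ltn_ord i) (ltn_ord j))/val_inj ji; rewrite ji eqxx in ij.
split; last 3 first.
- exact: eigenvalues_phi.
- exact: (spectrum_ac_rigid inv rig spec).
- exact: spectrum_sc_phi.
(* Both spectra are the full circle, because the eigenvalues are dense in it. *)
by rewrite rotation_spectrum//; apply: (spectrum_pp_dense inv); exact: phi_eigenvalues_dense.
Qed.
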